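(* Let $(E,\mathrm g)$ be a pseudo-Euclidean vector bundle of even rank over a smooth manifold $M$, let $S$ be a spinor bundle of $(E,\mathrm g)$ and let $(\nabla^E,\nabla^S)$ be a pair of compatible connections. There exists a unique isomorphism of graded commutative Poisson $\mathbb C$-algebras $$\mathfrak S_\nabla:\operatorname{gr}\mathcal D(M,S)\longrightarrow\mathcal O^{\mathbb C}(T^*[2]M\oplus E[1])$$ satisfying $$(\mathfrak S_\nabla\circ\varsigma)(f)=f,\qquad (\mathfrak S_\nabla\circ\varsigma)(\gamma(\xi))=\xi,\qquad(\mathfrak S_\nabla\circ\varsigma)(\nabla^S_X)=X$$ for all $f\in C^\infty(M)$, $\xi\in\Gamma(E)$ and $X\in\mathfrak X(M)$ (here $\varsigma$ is applied to $f\in\mathcal D_0$, $\gamma(\xi)\in\mathcal D_1$, $\nabla_X^S\in\mathcal D_2$ and takes the class in degree $0,1,2$ respectively). Moreover, the isomorphism $\mathfrak S_\nabla$ depends only on the connection $\nabla^E$.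
   Context: A pseudo-Euclidean vector bundle is a real vector bundle $E\to M$ with a nondegenerate symmetric fibre metric $\mathrm g$; $E\cong E^*$ via $\mathrm g$. The real Clifford bundle $\mathrm{Cl}(E)$ is generated by $E$ with relation $\xi\eta+\eta\xi=\mathrm g(\xi,\eta)$, and $\mathbb C\mathrm l(E)=\mathrm{Cl}(E)\otimes\mathbb C=\mathbb C\mathrm l^+(E)\oplus\mathbb C\mathrm l^-(E)$ (even/odd parts). A spinor bundle is a complex vector bundle $S\to M$ with an algebra bundle isomorphism $\operatorname{End}S\cong\mathbb C\mathrm l(E)$. The map $\gamma:\Gamma(\wedge E\otimes\mathbb C)\to\Gamma(\mathbb C\mathrm l(E))\cong\Gamma(\operatorname{End}S)$ is the linear isomorphism extending $\Gamma(E)\hookrightarrow\Gamma(\mathbb C\mathrm l(E))$ by skew-symmetrization. Connections $\nabla^E$ on $E$ and $\nabla^S$ on $S$ are compatible if $\nabla^E$ is metric ($\nabla^E\mathrm g=0$) and $[\nabla^S_X,\gamma(\eta)]=\gamma(\nabla^E_X\eta)$ for all $X\in\mathfrak X(M)$, $\eta\in\Gamma(\wedge E\otimes\mathbb C)$; $\nabla^S$ is then called a spinor connection. $\mathcal D(M,S)$ is the algebra of differential operators on $S$, with the $\mathbb Z_2$-grading $\mathcal D^\pm(M,S)$ in which spinor covariant derivatives $\nabla^S_X$ are even and $\Gamma(\mathbb C\mathrm l^{\pm}(E))$ are even/odd. $[A,B]=AB-(-1)^{|A||B|}BA$ is the graded commutator. Filtration: $\mathcal D_{-1}(M,S)=\{0\}$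 and, for $k\ge0$, $\mathcal D_k(M,S)=\{D\in\mathcal D(M,S)\mid[D,\gamma(\xi)]\in\mathcal D_{k-1}(M,S)\ \forall\xi\in\Gamma(E)\}$. One has $\mathcal D_k\mathcal D_l\subseteq\mathcal D_{k+l}$ and $[\mathcal D_k,\mathcal D_l]\subseteq\mathcal D_{k+l-2}$, so $\operatorname{gr}\mathcal D(M,S)=\bigoplus_k\mathcal D_k/\mathcal D_{k-1}$ is a graded commutative algebra, with Poisson bracket of degree $-2$ induced by $[\cdot,\cdot]:\mathcal D_k\times\mathcal D_l\to\mathcal D_{k+l-2}$. $\varsigma:\mathcal D_k\to\mathcal D_k/\mathcal D_{k-1}$ is the canonical projection. $\mathcal O(T^*[2]M\oplus E[1])=\Gamma(\operatorname{Sym}(TM)\otimes\wedge E)$, graded commutative with vector fields in degree $2$, sections of $E$ in degree $1$, functions in degree $0$; $\mathcal O^{\mathbb C}$ is its complexification. Given the metric connection $\nabla^E$, its Poisson bracket of degree $-2$ is the graded skew-symmetric biderivation determined by $\{X,f\}=X(f)$, $\{h,f\}=0$, $\{X,\xi\}=\nabla^E_X\xi$, $\{f,\xi\}=0$, $\{X,Y\}=[X,Y]+R^E(X,Y)$, $\{\xi,\eta\}=\mathrm g(\xi,\eta)$ for $f,h\in C^\infty(M)$, $\xi,\eta\in\Gamma(E)$, $X,Y\in\mathfrak X(M)$, where the curvature $R^E(X,Y)$ of $\nabla^E$ is identified with the element of $\Gamma(\wedge^2E)$ such that $\{R^E(X,Y),\xi\}=(\nabla^E_X\nabla^E_Y-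\nabla^E_Y\nabla^E_X-\nabla^E_{[X,Y]})\xi$.
   Formalization: The bundle E is assumed to have positive even rank; for rank 0 over a manifold of positive dimension every differential operator lies in D_0 and the claim fails. *)

(* Defs.v *)
From HB Require Import structures.
From mathcomp Require Import all_boot all_order all_algebra all_fingroup.
From mathcomp Require Import all_classical all_reals all_analysis.
From mathcomp Require Import complex ring generic_quotient.
Set Implicit Arguments.
Unset Strict Implicit.
Unset Printing Implicit Defensive.
Import Order.TTheory GRing.Theory Num.Theory numFieldNormedType.Exports.
Local Open Scope classical_set_scope.
Local Open Scope ring_scope.

Section smooth_functions_on_Rn.
Context {R : realType} {n : nat}.
Implicit Types (V : set 'rV[R]_n) (f g : 'rV[R]_n -> R).

Fixpoint Ck (k : nat) V f : Prop :=
  (forall x, V x -> {for x, continuous f}) /\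
  if k is k'.+1 then
    forall v, exists2 df, (forall x, V x -> is_derive x v f (df x)) & Ck k' V df
  else True.

Lemma Ck_continuous k V f x : Ck k V f -> V x -> {for x, continuous f}.
Proof. by case: k => [|k] [cf _] Vx; exact: cf. Qed.

Lemma CkS k V f : Ck k.+1 V f -> Ck k V f.
Proof.
elim: k f => [|k IH] f [cf df]; first by split.
split=> // v; have [g fg Cg] := df v; exists g => //; exact: IH.
Qed.

Lemma Ck_sub k V W f : V `<=` W -> Ck k W f -> Ck k V f.
Proof.
move=> VW; elim: k f => [|k IH] f [cf df]; (split; first by move=> x /VW; exact: cf) => //.
move=> v; have [g fg Cg] := df v; exists g; last exact: IH.
by move=> x /VW; exact: fg.
Qed.

Lemma Ck_cst k V (a : R) : Ck k V (fun=> a).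
Proof.
elim: k a => [|k IH] a; (split; first by move=> x _; exact: cst_continuous) => //.
by move=> v; exists (fun=> 0) => // x _; exact: is_derive_cst.
Qed.

Lemma CkD k V f g : Ck k V f -> Ck k V g -> Ck k V (fun x => f x + g x).
Proof.
elim: k f g => [|k IH] f g [cf df] [cg dg];
  (split; first by move=> x Vx; apply: continuousD; [exact: cf|exact: cg]) => //.
move=> v; have [f' ff' Cf'] := df v; have [g' gg' Cg'] := dg v.
exists (fun x => f' x + g' x); last exact: IH.
by move=> x Vx; apply: is_deriveD; [exact: ff'|exact: gg'].
Qed.

Lemma CkM k V f g : Ck k V f -> Ck k V g -> Ck k V (fun x => f x * g x).
Proof.
elim: k f g => [|k IH] f g Cf Cg;
  (split; first by move=> x Vx; apply: continuousM; [exact: Ck_continuous Cf Vx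
                                               |exact: Ck_continuous Cg Vx]) => //.
move=> v; have [f' ff' Cf'] := Cf.2 v; have [g' gg' Cg'] := Cg.2 v.
exists (fun x => f x * g' x + g x * f' x).
  by move=> x Vx; have := ff' x Vx; have := gg' x Vx => ? ?; exact: is_deriveM.
by apply: CkD; apply: IH => //; exact: CkS.
Qed.

End smooth_functions_on_Rn.

Record chart (R : realType) (n : nat) (M : topologicalType) := Chart {
  cdom : set M;
  cmap : M -> 'rV[R]_n;
  cinv : 'rV[R]_n -> M;
  cdom_open : open cdom;
  cimg_open : open (cmap @` cdom);
  cmapK : {in cdom, cancel cmap cinv};
  cmap_continuous : forall x, cdom x -> {for x, continuous cmap};
  cinv_continuous : forall y, (cmap @` cdom) y -> {for y, continuous cinv} }.

Record manifold (R : realType) (n : nat) := Manifold {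
  mcarrier :> topologicalType;
  atlas : set (chart R n mcarrier);
  manifold_hausdorff : hausdorff_space mcarrier;
  manifold_countable : @second_countable mcarrier;
  atlas_cover : forall x, exists2 c, atlas c & cdom c x;
  atlas_compat : forall c c', atlas c -> atlas c' -> forall i k,
    Ck k (cmap c @` (cdom c `&` cdom c')) (fun y => cmap c' (cinv c y) 0 i) }.

Section smooth_functions.
Context {R : realType} {n : nat} (M : manifold R n).

Definition smooth_on (U : set M) (f : M -> R) : Prop :=
  forall c, atlas c -> forall k, Ck k (cmap c @` (cdom c `&` U)) (f \o cinv c).

Definition csmooth_on (U : set M) (f : M -> R[i]) : Prop :=
  smooth_on U (fun x => complex.Re (f x)) /\ smooth_on U (fun x => complex.Im (f x)).

Lemma smooth_cst U a : smooth_on U (fun=> a).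
Proof. by move=> c _ k; exact: Ck_cst. Qed.

Lemma smoothD U f g : smooth_on U f -> smooth_on U g ->
  smooth_on U (fun x => f x + g x).
Proof. by move=> sf sg c Ac k; apply: CkD; [exact: sf|exact: sg]. Qed.

Lemma smoothM U f g : smooth_on U f -> smooth_on U g ->
  smooth_on U (fun x => f x * g x).
Proof. by move=> sf sg c Ac k; apply: CkM; [exact: sf|exact: sg]. Qed.

Lemma csmooth_cst U a : csmooth_on U (fun=> a).
Proof. by split; exact: smooth_cst. Qed.

Lemma csmoothD U f g : csmooth_on U f -> csmooth_on U g ->
  csmooth_on U (fun x => f x + g x).
Proof.
move=> [f1 f2] [g1 g2]; split.
- rewrite (_ : (fun _ => _) = fun x => complex.Re (f x) + complex.Re (g x)).
    exact: smoothD.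
  by apply/funext => x; case: (f x) (g x) => a b [].
- rewrite (_ : (fun _ => _) = fun x => complex.Im (f x) + complex.Im (g x)).
    exact: smoothD.
  by apply/funext => x; case: (f x) (g x) => a b [].
Qed.

Lemma csmoothM U f g : csmooth_on U f -> csmooth_on U g ->
  csmooth_on U (fun x => f x * g x).
Proof.
move=> [f1 f2] [g1 g2]; split.
- rewrite (_ : (fun _ => _) = fun x => complex.Re (f x) * complex.Re (g x) +
                            (-1) * (complex.Im (f x) * complex.Im (g x))).
    by apply: smoothD; first exact: smoothM;
       apply: smoothM; [exact: smooth_cst|exact: smoothM].
  by apply/funext => x; case: (f x) (g x) => a b [c d] /=; rewrite mulN1r.
- rewrite (_ : (fun _ => _) = fun x => complex.Re (f x) * complex.Im (g x) +
                                     complex.Im (f x) * complex.Re (g x)).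
    by apply: smoothD; exact: smoothM.
  by apply/funext => x; case: (f x) (g x) => a b [].
Qed.

Lemma csmooth_real U f : smooth_on U f -> csmooth_on U (fun x => (f x)%:C%C).
Proof. by move=> sf; split => //=; exact: smooth_cst. Qed.

End smooth_functions.

(* The two fields of scalars of vector bundles, R and R[i], treated uniformly. *)
Record scalars (R : realType) (n : nat) (M : manifold R n) := Scalars {
  sfield :> fieldType;
  semb : R -> sfield;
  ssmooth : set M -> (M -> sfield) -> Prop;
  ssmooth_cst : forall U a, ssmooth U (fun=> a);
  ssmoothD : forall U f g, ssmooth U f -> ssmooth U g ->
    ssmooth U (fun x => f x + g x);
  ssmoothM : forall U f g, ssmooth U f -> ssmooth U g ->
    ssmooth U (fun x => f x * g x);
  ssmooth_emb : forall U f, smooth_on U f -> ssmooth U (fun x => semb (f x)) }.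

Definition real_scalars {R : realType} {n : nat} (M : manifold R n) : scalars M :=
  @Scalars R n M R id (@smooth_on R n M) (@smooth_cst R n M) (@smoothD R n M)
    (@smoothM R n M) (fun U f sf => sf).

Definition complex_scalars {R : realType} {n : nat} (M : manifold R n) :
    scalars M :=
  @Scalars R n M R[i] (fun x => x%:C%C) (@csmooth_on R n M) (@csmooth_cst R n M)
    (@csmoothD R n M) (@csmoothM R n M) (@csmooth_real R n M).

Section function_algebra.
Context {R : realType} {n : nat} (M : manifold R n).

Definition Cinf_pred : {pred M -> R} := fun f => `[< smooth_on setT f >].

Record Cinf := MkCinf { Cinf_fun :> M -> R; _ : Cinf_fun \in Cinf_pred }.
HB.instance Definition _ := [isSub for Cinf_fun].
HB.instance Definition _ := [Choice of Cinf by <:].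

Lemma Cinf_subring : GRing.subring_closed Cinf_pred.
Proof.
split=> [|f g /asboolP sf /asboolP sg|f g /asboolP sf /asboolP sg];
  apply/asboolP.
- exact: smooth_cst.
- rewrite (_ : f - g = fun x => f x + (-1) * g x).
    by apply: smoothD => //; apply: smoothM => //; exact: smooth_cst.
  by apply/funext => x; rewrite mulN1r.
- exact: smoothM.
Qed.
HB.instance Definition _ := GRing.isSubringClosed.Build (M -> R) Cinf_pred
  Cinf_subring.

Lemma Cinf_submod : GRing.submod_closed Cinf_pred.
Proof.
split=> [|a f g /asboolP sf /asboolP sg]; apply/asboolP; first exact: smooth_cst.
by apply: smoothD => //; apply: smoothM => //; exact: smooth_cst.
Qed.
HB.instance Definition _ := GRing.isSubmodClosed.Build R (M -> R) Cinf_pred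
  Cinf_submod.
HB.instance Definition _ :=
  GRing.SubChoice_isSubComPzRing.Build (M -> R) Cinf_pred Cinf Cinf_subring.
HB.instance Definition _ := [SubZmodule_isSubLmodule of Cinf by <:].

Lemma CinfP (f : Cinf) : smooth_on setT f.
Proof. by case: f => f fP; apply/asboolP. Qed.
Definition mkCinf (f : M -> R) (sf : smooth_on setT f) : Cinf :=
  MkCinf (asboolT sf : f \in Cinf_pred).

End function_algebra.
Arguments Cinf_pred {R n} M.
HB.instance Definition _ {R : realType} {n : nat} (M : manifold R n) :=
  GRing.Lmodule.on (@Cinf R n M).

Section dependent_functions.
Context (K : pzRingType) (T : Type) (F : T -> lmodType K).

Definition dsec : Type := forall x, F x.
HB.instance Definition _ := Choice.copy dsec (forall x, F x).

Let dadd (s t : dsec) : dsec := fun x => s x + t x.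
Let dopp (s : dsec) : dsec := fun x => - s x.
Let dzero : dsec := fun x => 0.
Let dscale a (s : dsec) : dsec := fun x => a *: s x.

Let daddA : associative dadd.
Proof. by move=> s t u; apply/functional_extensionality_dep => x; exact: addrA. Qed.
Let daddC : commutative dadd.
Proof. by move=> s t; apply/functional_extensionality_dep => x; exact: addrC. Qed.
Let dadd0 : left_id dzero dadd.
Proof. by move=> s; apply/functional_extensionality_dep => x; exact: add0r. Qed.
Let daddN : left_inverse dzero dopp dadd.
Proof. by move=> s; apply/functional_extensionality_dep => x; exact: addNr. Qed.
HB.instance Definition _ := GRing.isZmodule.Build dsec daddA daddC dadd0 daddN.

Let dscaleA a b s : dscale a (dscale b s) = dscale (a * b) s.
Proof. by apply/functional_extensionality_dep => x; exact: scalerA. Qed.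
Let dscale1 : left_id 1 dscale.
Proof. by move=> s; apply/functional_extensionality_dep => x; exact: scale1r. Qed.
Let dscaleDr : right_distributive dscale +%R.
Proof.
by move=> a s t; apply/functional_extensionality_dep => x; exact: scalerDr.
Qed.
Let dscaleDl s : {morph dscale^~ s : a b / a + b}.
Proof.
by move=> a b; apply/functional_extensionality_dep => x; exact: scalerDl.
Qed.
HB.instance Definition _ :=
  GRing.Zmodule_isLmodule.Build K dsec dscaleA dscale1 dscaleDr dscaleDl.

End dependent_functions.

Record frame (T : Type) (K : fieldType) (r : nat) (F : T -> lmodType K) := Frame {
  fdom : set T;
  fvec : 'I_r -> forall x, F x }.

(* A vector bundle of rank r, given by its fibres and a cover by local frames *)
(* (equivalently, local trivializations) with smooth transition functions.    *)
Record vbundle (R : realType) (n : nat) (M : manifold R n) (K : scalars M)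
    (r : nat) := VBundle {
  fibre :> M -> lmodType K;
  frames : set (frame r fibre);
  frame_open : forall e, frames e -> open (fdom e);
  frame_cover : forall x, exists2 e, frames e & fdom e x;
  frame_basis : forall e x, frames e -> fdom e x ->
    forall v : fibre x, exists! c : 'I_r -> K, v = \sum_i c i *: fvec e i x;
  frame_compat : forall e e', frames e -> frames e' -> forall j,
    exists2 c : 'I_r -> M -> K,
      forall i, ssmooth (fdom e `&` fdom e') (c i) &
      forall x, fdom e x -> fdom e' x ->
        fvec e' j x = \sum_i c i x *: fvec e i x }.

Section sections.
Context {R : realType} {n : nat} {M : manifold R n} {K : scalars M} {r : nat}.
Variable E : vbundle K r.

Definition smooth_section (s : dsec E) : Prop :=
  forall e, frames e -> exists2 c : 'I_r -> M -> K,
    forall i, ssmooth (fdom e) (c i) &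
    forall x, fdom e x -> s x = \sum_i c i x *: fvec e i x.

Definition Gamma_pred : {pred dsec E} := fun s => `[< smooth_section s >].

Record Gamma := MkGamma { Gamma_val : dsec E; _ : Gamma_val \in Gamma_pred }.
HB.instance Definition _ := [isSub for Gamma_val].
HB.instance Definition _ := [Choice of Gamma by <:].

Lemma Gamma_submod : GRing.submod_closed Gamma_pred.
Proof.
split=> [|a s t /asboolP ss /asboolP st]; apply/asboolP => e Fe.
  exists (fun=> fun=> 0) => [i|x _]; first exact: ssmooth_cst.
  by rewrite big1 // => i _; rewrite scale0r.
have [c sc Ec] := ss e Fe; have [d sd Ed] := st e Fe.
exists (fun i x => a * c i x + d i x) => [i|x ex].
  by apply: ssmoothD => //; apply: ssmoothM => //; exact: ssmooth_cst.
rewrite [LHS](_ : _ = a *: s x + t x) // Ec // Ed // scaler_sumr -big_split /=.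
by apply: eq_bigr => i _; rewrite scalerDl scalerA.
Qed.
HB.instance Definition _ := GRing.isSubmodClosed.Build K (dsec E) Gamma_pred
  Gamma_submod.
HB.instance Definition _ := [SubChoice_isSubZmodule of Gamma by <:].
HB.instance Definition _ := [SubZmodule_isSubLmodule of Gamma by <:].

Definition mkGamma (s : dsec E) (ss : smooth_section s) : Gamma :=
  MkGamma (asboolT ss : s \in Gamma_pred).
Definition Gamma_at (s : Gamma) (x : M) : E x := Gamma_val s x.

Lemma GammaP (s : Gamma) : smooth_section (Gamma_val s).
Proof. by case: s => s sP; apply/asboolP. Qed.

Lemma fsmul_subproof (f : Cinf M) (s : Gamma) :
  smooth_section (fun x => semb K (f x) *: Gamma_val s x).
Proof.
move=> e Fe; have [c sc Ec] := GammaP s Fe.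
exists (fun i x => semb K (f x) * c i x) => [i|x ex].
  apply: ssmoothM => //; apply: ssmooth_emb => d Ad k.
  apply: Ck_sub (CinfP f Ad k) => _ [y [dy _] <-]; by exists y.
by rewrite Ec // scaler_sumr; apply: eq_bigr => i _; rewrite scalerA.
Qed.
Definition fsmul f s : Gamma := mkGamma (fsmul_subproof f s).

End sections.
Arguments Gamma_pred {R n M K r} E.

Section vector_fields.
Context {R : realType} {n : nat} (M : manifold R n).

Definition TM_pred (x : M) : {pred Cinf M -> R} := fun v =>
  `[< (forall a f g, v (a *: f + g) = a * v f + v g) /\
      (forall f g, v (f * g) = v f * g x + f x * v g) >].

Record TM (x : M) := MkTM { TM_fun :> Cinf M -> R; _ : TM_fun \in TM_pred x }.
HB.instance Definition _ x := [isSub for @TM_fun x].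
HB.instance Definition _ x := [Choice of TM x by <:].

Lemma TM_submod x : @GRing.submod_closed R (Cinf M -> R) (TM_pred x).
Proof.
split=> [|a v w /asboolP[v1 v2] /asboolP[w1 w2]]; apply/asboolP; split.
- by move=> a f g; change ((0 : R) = a * 0 + 0); rewrite mulr0 addr0.
- by move=> f g; change ((0 : R) = 0 * g x + f x * 0); rewrite mul0r mulr0 addr0.
- move=> b f g.
  change (a * v (b *: f + g) + w (b *: f + g) =
          b * (a * v f + w f) + (a * v g + w g)).
  by rewrite v1 w1; ring.
- move=> f g.
  change (a * v (f * g) + w (f * g) =
          (a * v f + w f) * g x + f x * (a * v g + w g)).
  by rewrite v2 w2; ring.
Qed.
HB.instance Definition _ x := GRing.isSubmodClosed.Build R (Cinf M -> R)
  (TM_pred x) (TM_submod x).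
HB.instance Definition _ x := [SubChoice_isSubZmodule of TM x by <:].
HB.instance Definition _ x := [SubZmodule_isSubLmodule of TM x by <:].

Definition derivation (X : Cinf M -> Cinf M) : Prop :=
  (forall (a : R) f g, X (a *: f + g) = a *: X f + X g) /\
  (forall f g, X (f * g) = X f * g + f * X g).

Record vfield := MkVfield {
  vfun :> Cinf M -> Cinf M;
  vfieldP : derivation vfun }.

Lemma vadd_subproof (X Y : vfield) : derivation (fun f => X f + Y f).
Proof.
case: X Y => X [X1 X2] [Y [Y1 Y2]]; split=> [a f g|f g] /=.
  by rewrite X1 Y1 scalerDr addrACA.
by rewrite X2 Y2; ring.
Qed.
Definition vadd X Y := MkVfield (vadd_subproof X Y).

Lemma vscale_subproof (h : Cinf M) (X : vfield) : derivation (fun f => h * X f).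
Proof.
case: X => X [X1 X2]; split=> [a f g|f g] /=; last by rewrite X2; ring.
apply/val_inj/funext => x; rewrite X1.
change (h x * (a * X f x + X g x) = a * (h x * X f x) + h x * X g x).
by ring.
Qed.
Definition vscale h X := MkVfield (vscale_subproof h X).

Lemma vlie_subproof (X Y : vfield) : derivation (fun f => X (Y f) - Y (X f)).
Proof.
case: X Y => X [X1 X2] [Y [Y1 Y2]].
have XD f g : X (f + g) = X f + X g.
  by have := X1 1 f g; rewrite !scale1r.
have YD f g : Y (f + g) = Y f + Y g.
  by have := Y1 1 f g; rewrite !scale1r.
split=> [a f g|f g] /=.
  by rewrite Y1 X1 X1 Y1 opprD addrACA scalerBr.
by rewrite Y2 X2 XD YD !X2 !Y2; ring.
Qed.
Definition vlie X Y := MkVfield (vlie_subproof X Y).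

Lemma vfield_at_subproof (X : vfield) (x : M) : (fun f => X f x) \in TM_pred x.
Proof.
case: X => X [X1 X2]; apply/asboolP; split=> [a f g|f g] /=.
  by rewrite X1.
by rewrite X2.
Qed.
Definition vfield_at X x : TM x := MkTM (vfield_at_subproof X x).

End vector_fields.

(* The K-algebra presented by a type G of generators and relations prel: the   *)
(* quotient of the terms over G by the congruence generated by prel and   *)
(* the axioms of unital associative K-algebras.                                *)
Section presented_algebra.
Local Open Scope quotient_scope.
Context {K : comPzRingType} {G : Type}.

Inductive pterm :=
  | pscal of K | pgen of G | padd of pterm & pterm | pmul of pterm & pterm.
HB.instance Definition _ := gen_eqMixin pterm.
HB.instance Definition _ := gen_choiceMixin pterm.

Variable prel : pterm -> pterm -> Prop.

Inductive pcong : pterm -> pterm -> Prop :=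
  | pc_rel s t : prel s t -> pcong s t
  | pc_refl t : pcong t t
  | pc_sym s t : pcong s t -> pcong t s
  | pc_trans s t u : pcong s t -> pcong t u -> pcong s u
  | pc_add s s' t t' : pcong s s' -> pcong t t' -> pcong (padd s t) (padd s' t')
  | pc_mul s s' t t' : pcong s s' -> pcong t t' -> pcong (pmul s t) (pmul s' t')
  | pc_addA s t u : pcong (padd s (padd t u)) (padd (padd s t) u)
  | pc_addC s t : pcong (padd s t) (padd t s)
  | pc_add0 t : pcong (padd (pscal 0) t) t
  | pc_addN t : pcong (padd (pmul (pscal (-1)) t) t) (pscal 0)
  | pc_mulA s t u : pcong (pmul s (pmul t u)) (pmul (pmul s t) u)
  | pc_mul1 t : pcong (pmul (pscal 1) t) t
  | pc_mulDl s t u : pcong (pmul (padd s t) u) (padd (pmul s u) (pmul t u))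
  | pc_mulDr s t u : pcong (pmul s (padd t u)) (padd (pmul s t) (pmul s u))
  | pc_scalD a b : pcong (pscal (a + b)) (padd (pscal a) (pscal b))
  | pc_scalM a b : pcong (pscal (a * b)) (pmul (pscal a) (pscal b))
  | pc_scalC a t : pcong (pmul (pscal a) t) (pmul t (pscal a)).

Let pcongb : rel pterm := fun s t => `[< pcong s t >].
Let pcongb_refl : reflexive pcongb.
Proof. by move=> t; apply/asboolP; exact: pc_refl. Qed.
Let pcongb_sym : symmetric pcongb.
Proof. by move=> s t; apply/asboolP/asboolP; exact: pc_sym. Qed.
Let pcongb_trans : transitive pcongb.
Proof. by move=> t s u /asboolP st /asboolP tu; apply/asboolP; exact: pc_trans tu. Qed.
Definition pcong_equiv := EquivRel pcongb pcongb_refl pcongb_sym pcongb_trans.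

Definition palg : Type := {eq_quot pcong_equiv}.
HB.instance Definition _ := Choice.on palg.

Definition pclass (t : pterm) : palg := \pi_{eq_quot pcong_equiv} t.
Let prep (a : palg) : pterm := @repr _ {eq_quot pcong_equiv} a.

Lemma pclassP s t : pclass s = pclass t <-> pcong s t.
Proof.
split=> [/eqmodP/asboolP //|st].
by apply/eqmodP/asboolP.
Qed.

Lemma prepK a : pclass (prep a) = a. Proof. exact: reprK. Qed.

Lemma prep_cong t : pcong (prep (pclass t)) t.
Proof. by apply/pclassP; rewrite prepK. Qed.

Let aadd a b := pclass (padd (prep a) (prep b)).
Let amul a b := pclass (pmul (prep a) (prep b)).
Let ascal c := pclass (pscal c).

Lemma aaddE s t : aadd (pclass s) (pclass t) = pclass (padd s t).
Proof. by apply/pclassP/pc_add; exact: prep_cong. Qed.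
Lemma amulE s t : amul (pclass s) (pclass t) = pclass (pmul s t).
Proof. by apply/pclassP/pc_mul; exact: prep_cong. Qed.

Let aaddA : associative aadd.
Proof.
move=> a b c; rewrite -(prepK a) -(prepK b) -(prepK c) !aaddE.
exact/pclassP/pc_addA.
Qed.
Let aaddC : commutative aadd.
Proof. by move=> a b; exact/pclassP/pc_addC. Qed.
Let aadd0 : left_id (ascal 0) aadd.
Proof. by move=> a; rewrite -(prepK a) aaddE; exact/pclassP/pc_add0. Qed.
Let aaddN : left_inverse (ascal 0) (amul (ascal (-1))) aadd.
Proof. by move=> a; rewrite -(prepK a) amulE aaddE; exact/pclassP/pc_addN. Qed.
Let amulA : associative amul.
Proof.
move=> a b c; rewrite -(prepK a) -(prepK b) -(prepK c) !amulE.
exact/pclassP/pc_mulA.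
Qed.
Let amul1 : left_id (ascal 1) amul.
Proof. by move=> a; rewrite -(prepK a) amulE; exact/pclassP/pc_mul1. Qed.
Let amul1r : right_id (ascal 1) amul.
Proof.
move=> a; rewrite -(prepK a) amulE; apply/pclassP.
by apply: pc_trans (pc_mul1 _); apply/pc_sym/pc_scalC.
Qed.
Let amulDl : left_distributive amul aadd.
Proof.
move=> a b c; rewrite -(prepK a) -(prepK b) -(prepK c) !(amulE, aaddE).
exact/pclassP/pc_mulDl.
Qed.
Let amulDr : right_distributive amul aadd.
Proof.
move=> a b c; rewrite -(prepK a) -(prepK b) -(prepK c) !(amulE, aaddE).
exact/pclassP/pc_mulDr.
Qed.
HB.instance Definition _ := GRing.isPzRing.Build palg
  aaddA aaddC aadd0 aaddN amulA amul1 amul1r amulDl amulDr.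

Let ascalD c d : ascal (c + d) = ascal c + ascal d.
Proof. by rewrite [RHS]aaddE; exact/pclassP/pc_scalD. Qed.
Let ascalM c d : ascal (c * d) = ascal c * ascal d.
Proof. by rewrite [RHS]amulE; exact/pclassP/pc_scalM. Qed.

Let ascale c a : palg := ascal c * a.
Let ascaleA c d a : ascale c (ascale d a) = ascale (c * d) a.
Proof. by rewrite /ascale ascalM mulrA. Qed.
Let ascale1 : left_id 1 ascale.
Proof. exact: mul1r. Qed.
Let ascaleDr : right_distributive ascale +%R.
Proof. by move=> c a b; rewrite /ascale mulrDr. Qed.
Let ascaleDl a : {morph ascale^~ a : c d / c + d}.
Proof. by move=> c d; rewrite /ascale ascalD mulrDl. Qed.
HB.instance Definition _ :=
  GRing.Zmodule_isLmodule.Build K palg ascaleA ascale1 ascaleDr ascaleDl.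

Lemma palg_scaleE c (a : palg) : c *: a = (c *: (1 : palg)) * a.
Proof. by rewrite -[RHS]mulrA mul1r. Qed.

Definition agen (u : G) : palg := pclass (pgen u).

(* The elements of a given degree, for the degrees wt of the generators. *)
Inductive homog (D : nmodType) (wt : G -> D) : D -> palg -> Prop :=
  | homog_scal c : homog wt 0 (c *: (1 : palg))
  | homog_gen u : homog wt (wt u) (agen u)
  | homog_add d a b : homog wt d a -> homog wt d b -> homog wt d (a + b)
  | homog_mul d e a b : homog wt d a -> homog wt e b -> homog wt (d + e) (a * b)
  | homog_0 d : homog wt d 0.

End presented_algebra.
Arguments palg {K G} prel.
Arguments agen {K G prel} u.
Arguments pterm : clear implicits.

(* Smooth sections of a bundle of presented algebras over M: those which are   *)
(* locally given by smooth functions and the smooth generating sections gens.  *)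
Section smooth_algebra_sections.
Context {R : realType} {n : nat} {M : manifold R n}.
Context {G : M -> Type} {rel : forall x, pterm R[i] (G x) -> pterm R[i] (G x) -> Prop}.
Variable gens : set (forall x, G x).

Inductive smooth_alg : (forall x, palg (@rel x)) -> Prop :=
  | smooth_alg_fun f : csmooth_on setT f -> smooth_alg (fun x => f x *: (1 : palg (@rel x)))
  | smooth_alg_gen u : gens u -> smooth_alg (fun x => agen (u x))
  | smooth_alg_add a b : smooth_alg a -> smooth_alg b ->
      smooth_alg (fun x => a x + b x)
  | smooth_alg_mul a b : smooth_alg a -> smooth_alg b ->
      smooth_alg (fun x => a x * b x)
  | smooth_alg_local a (b : M -> forall x, palg (@rel x)) :
      (forall x, smooth_alg (b x)) ->
      (forall x, \forall y \near x, a y = b x y) -> smooth_alg a.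

End smooth_algebra_sections.

Record metric (R : realType) (n : nat) (M : manifold R n) (r : nat)
    (E : vbundle (real_scalars M) r) := Metric {
  metric_at :> forall x, E x -> E x -> R;
  metric_sym : forall x (u v : E x), metric_at u v = metric_at v u;
  metric_linear : forall x a (u v w : E x),
    metric_at (a *: u + v) w = a * metric_at u w + metric_at v w;
  metric_nondegenerate : forall x (u : E x),
    (forall v, metric_at u v = 0) -> u = 0;
  metric_smooth : forall xi eta : Gamma E,
    smooth_on setT (fun x => metric_at (Gamma_at xi x) (Gamma_at eta x)) }.

Section clifford_bundle.
Context {R : realType} {n : nat} {M : manifold R n} {r : nat}.
Context {E : vbundle (real_scalars M) r} (g : metric E).

Definition metric_fun (xi eta : Gamma E) : Cinf M :=
  mkCinf (metric_smooth g xi eta).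

Inductive clifford_rel (x : M) : pterm R[i] (E x) -> pterm R[i] (E x) -> Prop :=
  | clifford_linear a u v : clifford_rel (pgen (a *: u + v))
      (padd (pmul (pscal a%:C%C) (pgen u)) (pgen v))
  | clifford_metric u v : clifford_rel
      (padd (pmul (pgen u) (pgen v)) (pmul (pgen v) (pgen u)))
      (pscal (g x u v)%:C%C).

Definition Cl (x : M) := palg (@clifford_rel x).

(* Even (b = false) and odd (b = true) elements; the addition of the nmodType  *)
(* bool is addb.                                                               *)
Definition Cl_parity (b : bool) (x : M) (a : Cl x) : Prop :=
  homog (fun=> true) b a.

Definition smooth_Cl (a : forall x, Cl x) : Prop :=
  smooth_alg [set u | smooth_section u] a.

End clifford_bundle.

(* A complex vector bundle S with an isomorphism of algebra bundles from the   *)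
(* complex Clifford bundle to End S.                                           *)
Record spinor_bundle (R : realType) (n : nat) (M : manifold R n) (r : nat)
    (E : vbundle (real_scalars M) r) (g : metric E) := SpinorBundle {
  spinor_rank : nat;
  spinor_vbundle :> vbundle (complex_scalars M) spinor_rank;
  cliff : forall x, Cl g x -> spinor_vbundle x -> spinor_vbundle x;
  cliff_linear : forall x (a : Cl g x) (c : R[i]) s t,
    cliff a (c *: s + t) = c *: cliff a s + cliff a t;
  cliffD : forall x (c : R[i]) (a b : Cl g x) s,
    cliff (c *: a + b) s = c *: cliff a s + cliff b s;
  cliff1 : forall x s, cliff (1 : Cl g x) s = s;
  cliffM : forall x (a b : Cl g x) s, cliff (a * b) s = cliff a (cliff b s);
  cliff_inj : forall x (a : Cl g x), (forall s, cliff a s = 0) -> a = 0;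
  cliff_surj : forall x (T : spinor_vbundle x -> spinor_vbundle x),
    (forall (c : R[i]) s t, T (c *: s + t) = c *: T s + T t) ->
    exists a : Cl g x, forall s, cliff a s = T s;
  cliff_smooth : forall (a : forall x, Cl g x) (s : Gamma spinor_vbundle),
    smooth_Cl a -> smooth_section (fun x => cliff (a x) (Gamma_at s x)) }.

Arguments cliff {R n M r E g} S {x} a s : rename.

Record connection (R : realType) (n : nat) (M : manifold R n) (K : scalars M)
    (r : nat) (F : vbundle K r) := Connection {
  nabla :> vfield M -> Gamma F -> Gamma F;
  nabla_vadd : forall X Y s, nabla (vadd X Y) s = nabla X s + nabla Y s;
  nabla_vscale : forall f X s, nabla (vscale f X) s = fsmul f (nabla X s);
  nabla_linear : forall X (c : K) s t,
    nabla X (c *: s + t) = c *: nabla X s + nabla X t;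
  nabla_leibniz : forall X f s,
    nabla X (fsmul f s) = fsmul (X f) s + fsmul f (nabla X s) }.

Section differential_operators.
Context {R : realType} {n : nat} {M : manifold R n} {r : nat}.
Context {E : vbundle (real_scalars M) r} {g : metric E} (S : spinor_bundle g).

Definition operator : Type := Gamma S -> Gamma S.
HB.instance Definition _ := GRing.Lmodule.on operator.

Definition cl_op (a : forall x, Cl g x) (sa : smooth_Cl a) : operator :=
  fun s => mkGamma (cliff_smooth s sa).

Definition gamma (xi : Gamma E) : operator :=
  cl_op (smooth_alg_gen (gens := [set u | smooth_section u]) (GammaP xi)).

(* gamma (xi_0 /\ ... /\ xi_(k-1)) *)
Definition gamma_wedge (k : nat) (xi : 'I_k -> Gamma E) : operator :=
  (k`!%:R^-1 : R[i]) *: \sum_(w : 'S_k)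
    ((-1) ^+ w : R[i]) *: (\big[comp/idfun]_(i < k) gamma (xi (w i)) : operator).

Definition mul_op (f : Cinf M) : operator := fsmul f.

(* The sections of /\ E (x) C are sums of sections f xi_0 /\ ... /\ xi_(k-1)   *)
(* with f complex-valued; as nS satisfies the Leibniz rule, the condition on   *)
(* such sections amounts to the one for f = 1.                                 *)
Definition compatible (nE : connection E) (nS : connection S) : Prop :=
  (forall X xi eta, (X : vfield M) (metric_fun g xi eta) =
     metric_fun g (nE X xi) eta + metric_fun g xi (nE X eta)) /\
  (forall X (k : nat) (xi : 'I_k -> Gamma E),
     (nS X \o gamma_wedge xi) - (gamma_wedge xi \o nS X) =
     \sum_(i < k) gamma_wedge (fun j => if j == i then nE X (xi j) else xi j)).

Definition linear_op (D : operator) : Prop :=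
  forall (c : complex_scalars M) s t, D (c *: s + t) = c *: D s + D t.

(* diffop_lt k D: D is a differential operator of order less than k *)
Fixpoint diffop_lt (k : nat) (D : operator) : Prop :=
  if k is k'.+1 then linear_op D /\
    forall f, diffop_lt k' ((D \o mul_op f) - (mul_op f \o D))
  else D = 0.

Definition diffop (D : operator) : Prop := exists k, diffop_lt k D.

Inductive diffop_parity : bool -> operator -> Prop :=
  | parity_nabla nE nS X : compatible nE nS -> diffop_parity false (nS X)
  | parity_cl b a (sa : smooth_Cl a) : (forall x, Cl_parity b (a x)) ->
      diffop_parity b (cl_op sa)
  | parity_add b A B : diffop_parity b A -> diffop_parity b B ->
      diffop_parity b (A + B)
  | parity_mul b c A B : diffop_parity b A -> diffop_parity c B ->
      diffop_parity (b (+) c) (A \o B).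

(* P = (P_+, P_-) are the even and odd components of D *)
Definition parity_components (D : operator) (P : operator * operator) : Prop :=
  [/\ diffop_parity false P.1, diffop_parity true P.2 & D = P.1 + P.2].

(* The graded commutator of operators with components P and Q. *)
Definition gcomm (P Q : operator * operator) : operator :=
  ((P.1 \o Q.1) - (Q.1 \o P.1)) + ((P.1 \o Q.2) - (Q.2 \o P.1)) +
  ((P.2 \o Q.1) - (Q.1 \o P.2)) + ((P.2 \o Q.2) + (Q.2 \o P.2)).

(* diffop_filt k.+1 is D_k and diffop_filt 0 is D_{-1} *)
Fixpoint diffop_filt (k : nat) (D : operator) : Prop :=
  if k is k'.+1 then diffop D /\
    exists2 P, parity_components D P &
      forall xi, diffop_filt k' (gcomm P (0, gamma xi))
  else D = 0.

End differential_operators.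
Arguments cl_op {R n M r E g} S {a} sa s.
Arguments gamma {R n M r E g} S xi s.
Arguments gamma_wedge {R n M r E g} S {k} xi s.
Arguments mul_op {R n M r E g} S f s.

Section filtration.
Context {R : realType} {n : nat} {M : manifold R n} {r : nat}.
Context {E : vbundle (real_scalars M) r} {g : metric E} (S : spinor_bundle g).
Local Notation K := (complex_scalars M).
Implicit Types (A B D : operator S) (c : K).

Lemma diffop_ltS k D : diffop_lt k D -> diffop_lt k.+1 D.
Proof.
elim: k D => [|k IH] D /=.
  move=> ->; split=> [c s t|f].
    by change (0 = c *: 0 + 0 :> Gamma S); rewrite scaler0 addr0.
  apply/funext => s; change (0 - fsmul f 0 = 0 :> Gamma S).
  by apply/val_inj/functional_extensionality_dep => x;
     change (0 - semb K (f x) *: 0 = 0 :> S x); rewrite scaler0 subr0.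
by move=> [lD DD]; split=> // f; apply: IH; exact: DD.
Qed.

Lemma diffop_lt_leq j k D : (j <= k)%N -> diffop_lt j D -> diffop_lt k D.
Proof.
move=> /subnK <-; elim: (k - j)%N => // i IH jD.
by rewrite addSn; apply: diffop_ltS; exact: IH.
Qed.

Lemma diffop_lt_linear k c A B :
  diffop_lt k A -> diffop_lt k B -> diffop_lt k (c *: A + B).
Proof.
elim: k A B => [|k IH] A B /=; first by move=> -> ->; rewrite scaler0 addr0.
move=> [lA cA] [lB cB]; split=> [d s t|f].
  change (c *: A (d *: s + t) + B (d *: s + t) =
          d *: (c *: A s + B s) + (c *: A t + B t)).
  rewrite lA lB !scalerDr !scalerA (mulrC c d) -!addrA; congr (_ + _).
  by rewrite addrCA.
rewrite [X in diffop_lt _ X](_ : _ =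
  c *: ((A \o mul_op S f) - (mul_op S f \o A)) + ((B \o mul_op S f) - (mul_op S f \o B))).
  exact: IH.
apply/funext => s.
change (c *: A (fsmul f s) + B (fsmul f s) - fsmul f (c *: A s + B s) =
  c *: (A (fsmul f s) - fsmul f (A s)) + (B (fsmul f s) - fsmul f (B s))).
rewrite (_ : fsmul f (c *: A s + B s) = c *: fsmul f (A s) + fsmul f (B s)).
  by rewrite scalerBr opprD addrACA.
apply/val_inj/functional_extensionality_dep => x.
change (semb K (f x) *: (c *: Gamma_at (A s) x + Gamma_at (B s) x) =
  c *: (semb K (f x) *: Gamma_at (A s) x) + semb K (f x) *: Gamma_at (B s) x).
by rewrite scalerDr !scalerA mulrC.
Qed.

Lemma diffop0 : diffop (0 : operator S).
Proof. by exists 0%N. Qed.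

Lemma diffop_linear c A B : diffop A -> diffop B -> diffop (c *: A + B).
Proof.
move=> [j jA] [k kB]; exists (maxn j k); apply: diffop_lt_linear.
  exact: diffop_lt_leq (leq_maxl _ _) jA.
exact: diffop_lt_leq (leq_maxr _ _) kB.
Qed.

Lemma cliff0 x s : cliff S (0 : Cl g x) s = 0.
Proof.
have := @cliffD _ _ _ _ _ _ S x 1 0 0 s; rewrite !scale1r addr0 => h.
by apply: (addIr (cliff S (0 : Cl g x) s)); rewrite add0r -h.
Qed.

Lemma diffop_parity_scale b c A :
  diffop_parity b A -> diffop_parity b (c *: A).
Proof.
move=> bA; have sc : smooth_Cl (g := g) (fun x => (c : R[i]) *: (1 : Cl g x)).
  exact: (smooth_alg_fun _ (csmooth_cst setT (c : R[i]))).
rewrite (_ : c *: A = cl_op S sc \o A).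
  rewrite -(addFb b); apply: parity_mul => //; apply: parity_cl => x.
  exact: homog_scal.
apply/funext => s; apply/val_inj/functional_extensionality_dep => x.
change (c *: Gamma_at (A s) x =
  cliff S ((c : R[i]) *: (1 : Cl g x)) (Gamma_at (A s) x)).
by rewrite -[X in cliff S X]addr0 cliffD cliff1 cliff0 addr0.
Qed.

Lemma diffop_parity0 b : diffop_parity b (0 : operator S).
Proof.
have s0 : smooth_Cl (g := g) (fun x => (0 : R[i]) *: (1 : Cl g x)).
  exact: (smooth_alg_fun _ (csmooth_cst setT (0 : R[i]))).
rewrite -(scale0r (cl_op S s0)); apply: diffop_parity_scale; apply: parity_cl.
by move=> x; rewrite scale0r; exact: homog_0.
Qed.

Lemma diffop_filt_linear k c A B :
  diffop_filt k A -> diffop_filt k B -> diffop_filt k (c *: A + B).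
Proof.
elim: k A B => [|k IH] A B /=; first by move=> -> ->; rewrite scaler0 addr0.
move=> [dA [P [P1 P2 AP] fP]] [dB [Q [Q1 Q2 BQ] fQ]].
split; first exact: diffop_linear.
exists (c *: P.1 + Q.1, c *: P.2 + Q.2); first split=> /=.
- by apply: parity_add => //; exact: diffop_parity_scale.
- by apply: parity_add => //; exact: diffop_parity_scale.
- by rewrite AP BQ scalerDr addrACA.
move=> xi; rewrite [X in diffop_filt _ X](_ : _ =
  c *: gcomm P (0, gamma S xi) + gcomm Q (0, gamma S xi)); first exact: IH.
have gl s t : gamma S xi (c *: s + t) = c *: gamma S xi s + gamma S xi t.
  apply/val_inj/functional_extensionality_dep => x.
  exact: cliff_linear.
apply/funext => s.
change ((c *: P.1 0 + Q.1 0 - 0) +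
  (c *: P.1 (gamma S xi s) + Q.1 (gamma S xi s) - gamma S xi (c *: P.1 s + Q.1 s))
  + (c *: P.2 0 + Q.2 0 - 0) +
  (c *: P.2 (gamma S xi s) + Q.2 (gamma S xi s) + gamma S xi (c *: P.2 s + Q.2 s))
  = c *: ((P.1 0 - 0) + (P.1 (gamma S xi s) - gamma S xi (P.1 s)) +
          (P.2 0 - 0) + (P.2 (gamma S xi s) + gamma S xi (P.2 s))) +
    ((Q.1 0 - 0) + (Q.1 (gamma S xi s) - gamma S xi (Q.1 s)) +
          (Q.2 0 - 0) + (Q.2 (gamma S xi s) + gamma S xi (Q.2 s)))).
rewrite !gl !subr0.
rewrite [c *: (_ + _ + _ + _)]scalerDr [RHS]addrACA; congr (_ + _); last first.
  by rewrite scalerDr addrACA.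
rewrite [c *: (_ + _ + _)]scalerDr [RHS]addrACA; congr (_ + _).
rewrite [c *: (_ + _)]scalerDr [RHS]addrACA; congr (_ + _).
by rewrite scalerBr opprD addrACA.
Qed.

Lemma diffop_filt0 k : diffop_filt k (0 : operator S).
Proof.
elim: k => [|k IH] //=; split; first exact: diffop0.
exists (0, 0); first by split=> /=; rewrite ?addr0 //; exact: diffop_parity0.
move=> xi; rewrite [X in diffop_filt _ X](_ : _ = 0) //.
apply/funext => s; apply/val_inj/functional_extensionality_dep => x.
change (0 - 0 + (0 - cliff S (agen (Gamma_at xi x)) 0) + (0 - 0) +
  (0 + cliff S (agen (Gamma_at xi x)) 0) = 0 :> S x).
by rewrite !subr0 !add0r addr0 addNr.
Qed.

Definition filt_pred (k : nat) : {pred operator S} :=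
  fun D => `[< diffop_filt k.+1 D >].

Lemma filt_submod k : @GRing.submod_closed K (operator S) (filt_pred k).
Proof.
split=> [|c A B /asboolP fA /asboolP fB]; apply/asboolP; first exact: diffop_filt0.
exact: diffop_filt_linear.
Qed.
HB.instance Definition _ k := GRing.isSubmodClosed.Build K (operator S)
  (filt_pred k) (filt_submod k).

Record filt (k : nat) := MkFilt {
  filt_op :> operator S;
  _ : filt_op \in filt_pred k }.
HB.instance Definition _ k := [isSub for @filt_op k].
HB.instance Definition _ k := [Choice of filt k by <:].
HB.instance Definition _ k := [SubChoice_isSubZmodule of filt k by <:].
HB.instance Definition _ k := [SubZmodule_isSubLmodule of filt k by <:].

Definition filt_low (k : nat) : {pred filt k} :=
  fun D : filt k => `[< diffop_filt k (filt_op D) >].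

Lemma filt_low_submod k : @GRing.submod_closed K (filt k) (@filt_low k).
Proof.
split=> [|c A B /asboolP fA /asboolP fB]; apply/asboolP; first exact: diffop_filt0.
exact: diffop_filt_linear.
Qed.

End filtration.

Section quotient_module.
Local Open Scope quotient_scope.
Context {K : pzRingType} {V : lmodType K} {P : {pred V}}.
Variable PS : GRing.submod_closed P.

Let PZ c u : u \in P -> c *: u \in P.
Proof. by move=> Pu; rewrite -[c *: u]addr0 PS.2 // PS.1. Qed.
Let PN u : u \in P -> - u \in P.
Proof. by rewrite -scaleN1r; exact: PZ. Qed.
Let PD u v : u \in P -> v \in P -> u + v \in P.
Proof. by move=> Pu Pv; rewrite -[u]scale1r PS.2. Qed.


Let qequiv : rel V := fun u v => u - v \in P.
Let qequiv_refl : reflexive qequiv.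
Proof. by move=> u; rewrite /qequiv subrr PS.1. Qed.
Let qequiv_sym : symmetric qequiv.
Proof.
by move=> u v; apply/idP/idP; rewrite /qequiv -[X in _ -> X \in P]opprB; exact: PN.
Qed.
Let qequiv_trans : transitive qequiv.
Proof.
by move=> v u w uv vw; rewrite /qequiv -(subrKA v) PD.
Qed.
Definition qequiv_rel := EquivRel qequiv qequiv_refl qequiv_sym qequiv_trans.

Definition qmod : Type := {eq_quot qequiv_rel}.
HB.instance Definition _ := Choice.on qmod.

Definition qclass (v : V) : qmod := \pi_{eq_quot qequiv_rel} v.
Definition qrepr (a : qmod) : V := @repr _ {eq_quot qequiv_rel} a.

Lemma qreprK a : qclass (qrepr a) = a. Proof. exact: reprK. Qed.

Lemma qclassP u v : qclass u = qclass v <-> u - v \in P.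
Proof. by split=> [/eqmodP|uv] //; apply/eqmodP. Qed.

Lemma qrepr_class v : qrepr (qclass v) - v \in P.
Proof. by apply/qclassP; rewrite qreprK. Qed.

Let qadd a b := qclass (qrepr a + qrepr b).
Let qopp a := qclass (- qrepr a).
Let qscale c a := qclass (c *: qrepr a).

Lemma qaddE u v : qadd (qclass u) (qclass v) = qclass (u + v).
Proof. by apply/qclassP; rewrite opprD addrACA PD ?qrepr_class. Qed.
Lemma qoppE u : qopp (qclass u) = qclass (- u).
Proof. by apply/qclassP; rewrite -opprD PN ?qrepr_class. Qed.
Lemma qscaleE c u : qscale c (qclass u) = qclass (c *: u).
Proof. by apply/qclassP; rewrite -scalerBr PZ ?qrepr_class. Qed.

Let qaddA : associative qadd.
Proof.
by move=> a b c; rewrite -(qreprK a) -(qreprK b) -(qreprK c) !qaddE addrA.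
Qed.
Let qaddC : commutative qadd.
Proof. by move=> a b; rewrite /qadd addrC. Qed.
Let qadd0 : left_id (qclass 0) qadd.
Proof. by move=> a; rewrite -(qreprK a) qaddE add0r. Qed.
Let qaddN : left_inverse (qclass 0) qopp qadd.
Proof. by move=> a; rewrite -(qreprK a) qoppE qaddE addNr. Qed.
HB.instance Definition _ := GRing.isZmodule.Build qmod qaddA qaddC qadd0 qaddN.

Let qscaleA c d a : qscale c (qscale d a) = qscale (c * d) a.
Proof. by rewrite -(qreprK a) !qscaleE scalerA. Qed.
Let qscale1 : left_id 1 qscale.
Proof. by move=> a; rewrite -(qreprK a) qscaleE scale1r. Qed.
Let qscaleDr : right_distributive qscale +%R.
Proof.
move=> c a b; rewrite -(qreprK a) -(qreprK b).
have -> : qclass (qrepr a) + qclass (qrepr b) = qclass (qrepr a + qrepr b).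
  exact: qaddE.
by rewrite !qscaleE scalerDr; exact/esym/qaddE.
Qed.
Let qscaleDl a : {morph qscale^~ a : c d / c + d}.
Proof.
by move=> c d; rewrite -(qreprK a) !qscaleE [RHS]qaddE scalerDl.
Qed.
HB.instance Definition _ :=
  GRing.Zmodule_isLmodule.Build K qmod qscaleA qscale1 qscaleDr qscaleDl.

End quotient_module.

(* The bare operations of a graded Poisson algebra with a bracket of degree -2. *)
(* In degrees k + l < 2, where k + l - 2 is truncated, the brackets below       *)
(* vanish.                                                                      *)
Record graded_poisson (K : pzRingType) := GradedPoisson {
  gpiece :> nat -> lmodType K;
  gone : gpiece 0;
  gmul : forall k l, gpiece k -> gpiece l -> gpiece (k + l);
  gbracket : forall k l, gpiece k -> gpiece l -> gpiece (k + l - 2) }.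
Arguments gmul {K} g {k l} a b.
Arguments gbracket {K} g {k l} a b.

Definition graded_poisson_iso (K : pzRingType) (A B : graded_poisson K)
    (phi : forall k, A k -> B k) : Prop :=
  [/\ (forall k (c : K) a b, phi k (c *: a + b) = c *: phi k a + phi k b) /\
      (forall k, bijective (phi k)),
      phi 0%N (gone A) = gone B,
      forall k l (a : A k) (b : A l),
        phi (k + l)%N (gmul A a b) = gmul B (phi k a) (phi l b) &
      forall k l (a : A k) (b : A l),
        phi (k + l - 2)%N (gbracket A a b) = gbracket B (phi k a) (phi l b)].

Section graded_differential_operators.
Context {R : realType} {n : nat} {M : manifold R n} {r : nat}.
Context {E : vbundle (real_scalars M) r} {g : metric E} (S : spinor_bundle g).

Definition gr_piece (k : nat) := qmod (@filt_low_submod R n M r E g S k).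

(* The class of D in D_k / D_{k-1}; it is 0 by default for D outside of D_k,   *)
(* which does not occur below as D_k D_l is included in D_{k+l} and [D_k, D_l] *)
(* in D_{k+l-2}.                                                               *)
Definition symbol (k : nat) (D : operator S) : gr_piece k :=
  qclass _ (insubd (0 : filt S k) D).

Definition gr_repr (k : nat) (a : gr_piece k) : operator S := filt_op (qrepr a).

(* Since D^+ and D^- are in direct sum, the components are unique. *)
Definition parity_split (D : operator S) : operator S * operator S :=
  xget (0, 0) [set P | parity_components D P].

Definition gr : graded_poisson R[i] := @GradedPoisson R[i] gr_piece
  (symbol 0 idfun)
  (fun k l a b => symbol (k + l) (gr_repr a \o gr_repr b))
  (fun k l a b => symbol (k + l - 2)
     (gcomm (parity_split (gr_repr a)) (parity_split (gr_repr b)))).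

End graded_differential_operators.

Section graded_functions.
Context {R : realType} {n : nat} {M : manifold R n} {r : nat}.
Context {E : vbundle (real_scalars M) r} (g : metric E).
Local Notation generator x := (TM x + E x)%type.

(* The relations of Sym(T_x M) (x) /\ E_x. *)
Inductive symext_rel (x : M) :
    pterm R[i] (generator x) -> pterm R[i] (generator x) -> Prop :=
  | symext_linearT a (v w : TM x) : symext_rel (pgen (inl (a *: v + w)))
      (padd (pmul (pscal a%:C%C) (pgen (inl v))) (pgen (inl w)))
  | symext_linearE a (u w : E x) : symext_rel (pgen (inr (a *: u + w)))
      (padd (pmul (pscal a%:C%C) (pgen (inr u))) (pgen (inr w)))
  | symext_TT (v w : TM x) : symext_rel (pmul (pgen (inl v)) (pgen (inl w)))
      (pmul (pgen (inl w)) (pgen (inl v)))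
  | symext_TE (v : TM x) (u : E x) :
      symext_rel (pmul (pgen (inl v)) (pgen (inr u)))
        (pmul (pgen (inr u)) (pgen (inl v)))
  | symext_EE (u : E x) :
      symext_rel (pmul (pgen (inr u)) (pgen (inr u))) (pscal 0).

Definition symext (x : M) : lmodType R[i] := palg (@symext_rel x).

Definition total_degree (x : M) (u : generator x) : nat :=
  if u is inl _ then 2 else 1.
Definition sym_degree (x : M) (u : generator x) : nat :=
  if u is inl _ then 1 else 0.

Definition smooth_generators : set (forall x : M, generator x) :=
  [set u | (exists X : vfield M, u = fun x => inl (vfield_at X x)) \/
           (exists xi : Gamma E, u = fun x => inr (Gamma_at xi x))].

Definition O_pred (k : nat) : {pred dsec symext} := fun a =>
  `[< smooth_alg smooth_generators a /\
      forall x, homog (@total_degree x) k (a x) >].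

Record OC (k : nat) := MkOC { O_val :> dsec symext; _ : O_val \in O_pred k }.
HB.instance Definition _ k := [isSub for @O_val k].
HB.instance Definition _ k := [Choice of OC k by <:].

Lemma O_submod k : GRing.submod_closed (O_pred k).
Proof.
split=> [|c a b /asboolP[sa ka] /asboolP[sb kb]]; apply/asboolP.
  split=> [|x]; last exact: homog_0.
  suff -> : (0 : dsec symext) = (fun x => (0 : R[i]) *: (1 : palg (@symext_rel x))).
    exact: (smooth_alg_fun _ (csmooth_cst setT 0)).
  by apply/functional_extensionality_dep => x; rewrite scale0r.
split=> [|x].
  apply: smooth_alg_add => //.
  change (smooth_alg smooth_generators (c *: a : dsec symext)).
  suff -> : (c *: a : dsec symext) = (fun x => (c *: (1 : palg (@symext_rel x))) * a x).
    by apply: smooth_alg_mul => //; exact: (smooth_alg_fun _ (csmooth_cst setT c)).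
  by apply/functional_extensionality_dep => x; exact: palg_scaleE.
apply: homog_add => //.
change (homog (@total_degree x) k (c *: (a x : palg (@symext_rel x)))).
by have := homog_mul (homog_scal _ _ c) (ka x); rewrite add0r -palg_scaleE.
Qed.
HB.instance Definition _ k := GRing.isSubmodClosed.Build R[i] (dsec symext)
  (O_pred k) (O_submod k).
HB.instance Definition _ k := [SubChoice_isSubZmodule of OC k by <:].
HB.instance Definition _ k := [SubZmodule_isSubLmodule of OC k by <:].

Definition O_at (k : nat) (a : OC k) (x : M) : palg (@symext_rel x) := O_val a x.

Lemma OP (k : nat) (a : OC k) :
  smooth_alg smooth_generators (O_at a) /\
  forall x, homog (@total_degree x) k (O_at a x).
Proof. by case: a => a aP; apply/asboolP. Qed.

Definition mkO (k : nat) (a : dsec symext)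
    (sa : smooth_alg smooth_generators a)
    (ka : forall x, homog (@total_degree x) k (a x)) : OC k :=
  MkOC (asboolT (conj sa ka) : a \in O_pred k).

Definition O_fun (f : Cinf M) : OC 0 :=
  @mkO 0 _ (smooth_alg_fun _ (csmooth_real (CinfP f))) (fun x => homog_scal _ _ _).
Definition O_one : OC 0 := O_fun 1.
Definition O_E (xi : Gamma E) : OC 1 :=
  @mkO 1 _ (smooth_alg_gen (or_intror (ex_intro _ xi erefl)))
    (fun x => homog_gen _ (@total_degree x) (inr (Gamma_at xi x))).
Definition O_TM (X : vfield M) : OC 2 :=
  @mkO 2 _ (smooth_alg_gen (or_introl (ex_intro _ X erefl)))
    (fun x => homog_gen _ (@total_degree x) (inl (vfield_at X x))).
Definition O_mul (k l : nat) (a : OC k) (b : OC l) : OC (k + l) :=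
  @mkO (k + l) _ (smooth_alg_mul (OP a).1 (OP b).1)
    (fun x => homog_mul ((OP a).2 x) ((OP b).2 x)).

Definition bracket_type := forall k l, OC k -> OC l -> OC (k + l - 2).

(* The brackets of elements in different, but equal, degrees are compared     *)
(* pointwise. The element rho is R^E(X, Y), of degree 0 in TM.                *)
Definition is_poisson_bracket (nE : connection E) (B : bracket_type) : Prop :=
  [/\ forall k l (a : OC k) (c : R[i]) (b b' : OC l),
        B _ _ a (c *: b + b') = c *: B _ _ a b + B _ _ a b',
      forall k l (a : OC k) (b : OC l) x,
        O_at (B _ _ a b) x = - ((-1) ^+ (k * l) *: O_at (B _ _ b a) x),
      forall k l m (a : OC k) (b : OC l) (c : OC m) x,
        O_at (B _ _ a (O_mul b c)) x = O_at (B _ _ a b) x * O_at c x +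
          (-1) ^+ (k * l) *: (O_at b x * O_at (B _ _ a c) x) &
      [/\ forall h f, B _ _ (O_fun h) (O_fun f) = 0,
          forall f xi, B _ _ (O_fun f) (O_E xi) = 0,
          forall X f, B _ _ (O_TM X) (O_fun f) = O_fun (X f),
          forall X xi, B _ _ (O_TM X) (O_E xi) = O_E (nE X xi) &
          (forall xi eta, B _ _ (O_E xi) (O_E eta) = O_fun (metric_fun g xi eta)) /\
          forall X Y, exists rho : OC 2,
            [/\ forall x, homog (@sym_degree x) 0%N (O_at rho x),
                forall xi, B _ _ rho (O_E xi) =
                  O_E (nE X (nE Y xi) - nE Y (nE X xi) - nE (vlie X Y) xi) &
                B _ _ (O_TM X) (O_TM Y) = O_TM (vlie X Y) + rho]]].

Definition O_bracket (nE : connection E) : bracket_type :=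
  if pselect (exists B, is_poisson_bracket nE B) is left h then sval (cid h)
  else fun k l _ _ => 0.

Definition O_poisson (nE : connection E) : graded_poisson R[i] :=
  @GradedPoisson R[i] OC (O_one) O_mul (O_bracket nE).

End graded_functions.

Section symbol_isomorphism.
Context {R : realType} {n : nat} {M : manifold R n} {r : nat}.
Context {E : vbundle (real_scalars M) r} {g : metric E} (S : spinor_bundle g).

Definition symbol_iso (nE : connection E) (nS : connection S)
    (phi : forall k, gr S k -> O_poisson g nE k) : Prop :=
  [/\ graded_poisson_iso phi,
      forall f, phi 0%N (symbol 0 (mul_op S f)) = O_fun f,
      forall xi, phi 1%N (symbol 1 (gamma S xi)) = O_E xi &
      forall X, phi 2 (symbol 2 (nS X)) = O_TM X].

End symbol_isomorphism.
Arguments symbol_iso {R n M r E g S} nE nS phi.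

(* Main.v *)
From HB Require Import structures.
From mathcomp Require Import all_boot all_order all_algebra all_fingroup.
From mathcomp Require Import all_classical all_reals all_analysis.
From mathcomp Require Import complex ring lra zify generic_quotient.
Require Import Defs.
Set Implicit Arguments.
Unset Strict Implicit.
Unset Printing Implicit Defensive.
Import Order.TTheory GRing.Theory Num.Theory numFieldNormedType.Exports.
Local Open Scope classical_set_scope.
Local Open Scope ring_scope.

(** The symbol of an operator is read off from its expansions in functions, Clifford generators γ(ξ)
    and covariant derivatives ∇_X, counted in degrees 0, 1 and 2. The relation [Span m b D a] says
    that D has such an expansion of parity b and degree at most m, with leading part a in Γ(Sym(TM)
    ⊗ ∧E) ⊗ C. Commuting D with a function f lowers the degree by 2 and acts on a as {-, f}. The
    graded commutator with γ(ξ) lowers it by 1 and acts as {-, ξ} ([Span_comm_f], [Span_comm_g]).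

    An Euler identity turns everything into inductions on the degree. There are finitely many
    functions h_j, vector fields X_j and sections e_i, e'_i with v = Σ v(h_j) X_j and ξ = Σ g(ξ,
    e_i) e'_i ([tangent_frame], [metric_frame]). A symbol a of degree m then satisfies m a = Σ_j {a,
    h_j} (2 X_j - Σ_i (∇_{X_j} e_i) e'_i) + Σ_i {a, e_i} e'_i ([symext_euler]), and the same
    combination of commutators of an operator D is m D up to lower degree ([op_euler_Span]). Hence
    an operator determines its symbol ([Span_uniq]), an operator with zero symbol has lower degree
    ([Span_lower]), and every smooth symbol lifts to an operator ([Span_surj]).

    The finite frames come from [finite_spanning]. Over a compact set a number of generators
    depending only on the dimension and the rank is enough, by a counting argument that takes the
    place of Sard's theorem. As this number is uniform, generators over the shells of an exhaustion
    can be glued.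

    To compare with the filtration, every operator with a parity is shown to have an expansion
    ([parity_Span]). Clifford sections are expanded by an Euler identity in the Clifford algebra.
    Two spinor connections differ by an operator inducing a skew endomorphism of E, hence by a
    quadratic Clifford element plus a scalar ([derivation_quad]), because an operator commuting with
    functions and with Cl(E) is a scalar ([central_scalar]). Even and odd operators meet only in 0
    ([Span_even_odd]). As the rank is positive, a symbol of positive degree killed by all {-, ξ}
    vanishes ([osym_nondegenerate]), so the commutator condition defining D_k bounds the degree by k
    ([filt_SpE]). Thus D_k / D_{k-1} is the space of symbols of degree k.

    Products of operators give products of symbols. Graded commutators induce a bracket [br] on
    symbols. The commutators of the generators, in particular [∇_X, ∇_Y] = ∇_{[X,Y]} + γ(R) + scalar
    ([curvature_op]), show that [br] satisfies the defining identities of the Poisson bracket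
    ([br_poisson]), and these determine it ([poisson_bracket_uniq]). The isomorphism is unique
    because functions, sections and vector fields generate. Two spinor connections compatible with
    the same ∇^E differ by scalars, which vanish in degree 2 ([symbol_nabla]), so the isomorphism
    depends only on ∇^E. *)

(** * Calculus on R^n: mean values, chain rule, composition of C^k functions *)

Section directional_derivatives.
Context {R : realType} {n : nat}.
Implicit Types (f : 'rV[R]_n -> R) (x v z : 'rV[R]_n).

Lemma le_coord_norm x i : `|x 0 i| <= `|x|.
Proof.
rewrite {2}/Num.Def.normr /= mx_normrE; exact: (le_bigmax _ (fun ij => `|x ij.1 ij.2|) (0, i)).
Qed.

Lemma norm_le_coord x (e : R) : 0 <= e -> (forall i, `|x 0 i| <= e) -> `|x| <= e.
Proof.
move=> e0 xe; rewrite /Num.Def.normr /= mx_normrE bigmax_le // => -[a b] _ /=.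
by rewrite ord1.
Qed.

Lemma derive_line0 f x v : 'D_v f x = 'D_1 (fun h : R => f (h *: v + x)) 0.
Proof.
rewrite /derive; set g1 := fun t => t^-1 *: _; set g2 := fun t => t^-1 *: _.
suff -> : g1 = g2 by [].
by rewrite funeqE /g1 /g2 => t /=; rewrite addr0 scale0r add0r [_%:A]mulr1.
Qed.

Lemma is_derive_scale f x v (c d : R) : is_derive x v f d ->
  is_derive x (c *: v) f (c * d).
Proof.
move=> [/derivable1P dg gd].
have gd' : is_derive (0 : R) (1 : R) (fun h : R => f (h *: v + x)) d.
  by apply: DeriveDef => //; rewrite -gd derive_line0.
have lc : is_derive (0 : R) (1 : R) (fun h : R => h * c) c.
  have := @is_deriveM R R^o id (cst c) 0 1 1 0 (is_derive_id _ _) (is_derive_cst _ _ _).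
  by rewrite scaler0 add0r [_ *: _]mulr1.
have g0 : is_derive (0 * c : R) (1 : R) (fun h : R => f (h *: v + x)) d by rewrite mul0r.
have [ex dE] := @is_derive1_comp R (fun t : R => f (t *: v + x)) (fun t : R => t * c) 0 d c g0 lc.
have E : (fun h : R => f (h *: v + x)) \o (fun h => h * c) =
   fun h : R => f (h *: (c *: v) + x).
  by apply/funext => h /=; rewrite scalerA.
rewrite E in ex dE; apply: DeriveDef; first exact/derivable1P.
by rewrite mulrC -dE derive_line0.
Qed.

Lemma is_derive_line f x v (t d : R) : is_derive (t *: v + x) v f d ->
  is_derive t 1 (fun s : R => f (s *: v + x)) d.
Proof.
move=> [ex dE]; have E : (fun h : R => h^-1 *:
    (((fun s : R => f (s *: v + x)) \o shift t) (h *: 1) - f (t *: v + x))) =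
  fun h => h^-1 *: ((f \o shift (t *: v + x)) (h *: v) - f (t *: v + x)).
  by apply/funext => h /=; rewrite [_%:A]mulr1 scalerDl addrA.
by apply: DeriveDef; rewrite /derivable /derive E.
Qed.

Lemma mvt_line f x v : (forall t : R, 0 <= t <= 1 -> derivable f (t *: v + x) v) ->
  exists2 t : R, 0 <= t <= 1 & f (v + x) - f x = 'D_v f (t *: v + x).
Proof.
move=> df; pose phi := fun s : R => f (s *: v + x).
have dphi (t : R) : 0 <= t <= 1 -> is_derive t 1 phi ('D_v f (t *: v + x)).
  by move=> t01; apply/is_derive_line/derivableP/df.
have [|||t tin E] := @MVT_segment R phi (fun t => 'D_v f (t *: v + x)) 0 1.
- exact: ler01.
- by move=> t tin; apply: dphi; move: tin; rewrite in_itv /= => /andP[/ltW-> /ltW->].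
- apply: derivable_within_continuous => t; rewrite in_itv /= => tin.
  by have [] := dphi _ tin.
exists t; first by move: tin; rewrite in_itv.
by move: E; rewrite /phi scale1r scale0r add0r subr0 mulr1.
Qed.

Definition unit_vec (i : 'I_n) : 'rV[R]_n := delta_mx 0 i.

(** The segment from x to h + x is replaced by a path of n legs parallel to the axes, [p k] keeping
    the first k coordinates of h. The mean value theorem is applied on each leg. The legs stay
    within [|h|] of x because the norm is the sup norm. *)
Lemma tele_mvt f x (h : 'rV[R]_n) : (forall z i, `|z - x| <= `|h| -> derivable f z (unit_vec i)) ->
  exists2 xi : 'I_n -> 'rV[R]_n, forall i, `|xi i - x| <= `|h| &
    f (h + x) - f x = \sum_i h 0 i * 'D_(unit_vec i) f (xi i).
Proof.
move=> df; pose p (k : nat) : 'rV[R]_n := \row_i (if (i < k)%N then h 0 i else 0).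
have pn : p n = h by apply/rowP => i; rewrite mxE ltn_ord.
have p0 : p 0%N = 0 by apply/rowP => i; rewrite !mxE.
have pS (i : 'I_n) : p i.+1 = h 0 i *: unit_vec i + p i.
  apply/rowP => j; rewrite !mxE eqxx /= ltnS leq_eqVlt.
  have [->|ij] := eqVneq j i; first by rewrite eqxx ltnn mulr1 addr0.
  have -> : (nat_of_ord j == i) = false.
    by apply/negbTE; apply: contraNneq ij => /val_inj->.
  by rewrite mulr0 add0r.
have step (i : 'I_n) : exists z, `|z - x| <= `|h| /\
    f (p i.+1 + x) - f (p i + x) = h 0 i * 'D_(unit_vec i) f z.
  have near_p (t : R) : 0 <= t <= 1 ->
      `|t *: (h 0 i *: unit_vec i) + (p i + x) - x| <= `|h|.
    move=> /andP[t0 t1]; rewrite addrA addrK; apply: norm_le_coord => // j.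
    rewrite !mxE eqxx /=; have [->|ij] := eqVneq j i.
      rewrite ltnn addr0 mulr1 normrM (ger0_norm t0).
      by rewrite (le_trans _ (le_coord_norm h i))// ler_piMl.
    rewrite !mulr0 add0r; case: ifP => _; last by rewrite normr0.
    exact: le_coord_norm.
  have dd (t : R) : 0 <= t <= 1 -> is_derive (t *: (h 0 i *: unit_vec i) + (p i + x))
      (h 0 i *: unit_vec i) f
      (h 0 i * 'D_(unit_vec i) f (t *: (h 0 i *: unit_vec i) + (p i + x))).
    by move=> t01; apply/is_derive_scale/derivableP/df/near_p.
  have [|t t01 E] := @mvt_line f (p i + x) (h 0 i *: unit_vec i).
    by move=> t t01; have [] := dd t t01.
  exists (t *: (h 0 i *: unit_vec i) + (p i + x)); split; first exact: near_p.
  by rewrite pS -addrA E; have [_ ->] := dd t t01.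
have [xi xiP] := choice step.
exists xi => [i|]; first by have [] := xiP i.
rewrite -(eq_bigr _ (fun i _ => (xiP i).2)).
rewrite -(big_mkord xpredT (fun i => f (p i.+1 + x) - f (p i + x))).
by rewrite telescope_sumr // pn p0 add0r.
Qed.

End directional_derivatives.

Section chain_rule.
Context {R : realType} {m n : nat}.
Implicit Types (f : 'rV[R]_m -> R) (G : 'rV[R]_n -> 'rV[R]_m).

Lemma derivable_line_continuous (g : 'rV[R]_n -> R) y v : derivable g y v ->
  (fun t : R => g (t *: v + y)) @ 0 --> g y.
Proof.
move=> /derivable1P dg; have h := differentiable_continuous ((derivable1_diffP _ _).1 dg).
have : (fun t : R => g (t *: v + y)) @ 0 --> g (0 *: v + y) := h.
by rewrite scale0r add0r.
Qed.

(** [tele_mvt] expresses the increment of f along G through partial derivatives at points squeezed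
    towards G y, where these are continuous. Of G only the derivative along the one line through y
    is used, which also gives the continuity of G along that line. *)
Lemma is_derive_comp_C1 f G (U : set 'rV[R]_m) y v : open U -> U (G y) ->
  (forall z i, U z -> derivable f z (unit_vec i)) ->
  (forall i, {for G y, continuous ('D_(unit_vec i) f)}) ->
  (forall i, derivable (fun z => G z 0 i) y v) ->
  is_derive y v (f \o G)
    (\sum_i 'D_v (fun z => G z 0 i) y * 'D_(unit_vec i) f (G y)).
Proof.
move=> oU Uy df cdf dG.
have cG : (fun t : R => G (t *: v + y)) @ 0 --> G y.
  apply/cvgrPdist_lt => e e0; near=> t.
  have te i : `|(G y - G (t *: v + y)) 0 i| <= e / 2.
    rewrite !mxE; move: i; near: t; apply: filter_forall => i.
    have := derivable_line_continuous (dG i) => /cvgrPdist_le; apply.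
    by rewrite divr_gt0.
  rewrite (@le_lt_trans _ _ (e / 2))//; last by rewrite gtr_pMr// invf_lt1// ltr1n.
  by apply: norm_le_coord => //; rewrite divr_ge0// ltW.
have /nbhs_ballP[e /= e0 eU] : nbhs (G y) U by exact: open_nbhs_nbhs.
(* The intermediate points are chosen for all t at once, with the default 0 when G has left the ball
   on which f has partial derivatives. *)
have [xi xiP] : exists xi : R -> 'I_m -> 'rV[R]_m, forall t : R,
    `|G (t *: v + y) - G y| < e -> (forall i, `|xi t i - G y| <= `|G (t *: v + y) - G y|) /\
    f (G (t *: v + y)) - f (G y) =
      \sum_i (G (t *: v + y) - G y) 0 i * 'D_(unit_vec i) f (xi t i).
  suff /choice[xi xiP] : forall t : R, exists xi : 'I_m -> 'rV[R]_m,
    `|G (t *: v + y) - G y| < e -> (forall i, `|xi i - G y| <= `|G (t *: v + y) - G y|) /\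
    f (G (t *: v + y)) - f (G y) =
      \sum_i (G (t *: v + y) - G y) 0 i * 'D_(unit_vec i) f (xi i) by exists xi.
  move=> t; have [te|] := ltP `|G (t *: v + y) - G y| e; last by exists (fun=> 0).
  have [|xi xi1 xi2] := @tele_mvt R m f (G y) (G (t *: v + y) - G y).
    move=> z i zG; apply/df/eU; rewrite -ball_normE /= distrC.
    exact: le_lt_trans te.
  by exists xi => _; split => //; move: xi2; rewrite subrK.
have near_e : \forall t \near (0 : R)^', `|G (t *: v + y) - G y| < e.
  apply: nbhs_dnbhs; move/cvgrPdist_lt: cG => /(_ e e0).
  by apply: filterS => t; rewrite distrC.
have lims : (fun h : R => h^-1 *: (((f \o G) \o shift y) (h *: v) - (f \o G) y)) @ 0^' -->
    \sum_i 'D_v (fun z => G z 0 i) y * 'D_(unit_vec i) f (G y).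
  pose g (h : R) := \sum_i (h^-1 *: (((fun z => G z 0 i) \o shift y) (h *: v) - G y 0 i)) *
      'D_(unit_vec i) f (xi h i).
  apply: (@cvg_trans _ (g @ 0^')).
    apply: near_eq_cvg; apply: filterS near_e => t te.
    rewrite /g /= (xiP t te).2 scaler_sumr; apply: eq_bigr => i _.
    by rewrite !mxE scalerAl.
  rewrite /g; apply: cvg_big => [|i _]; first exact: add_continuous.
  apply: cvgM; first exact: dG.
  apply: (@cvg_comp _ _ _ (fun h => xi h i) ('D_(unit_vec i) f) _ (nbhs (G y))); last exact: cdf.
  apply/cvgrPdist_lt => d d0; near=> t; rewrite distrC.
  apply: (@le_lt_trans _ _ `|G (t *: v + y) - G y|).
    by apply: (xiP t _).1; near: t.
  near: t; apply: nbhs_dnbhs; move/cvgrPdist_lt: cG => /(_ d d0).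
  by apply: filterS => t; rewrite distrC.
by apply: DeriveDef; [apply/cvg_ex; eexists; exact: lims | exact/cvg_lim].
Unshelve. all: by end_near.
Qed.

End chain_rule.

Section near_open.
Context {T : topologicalType} {U : Type}.
Implicit Types (f g : T -> U) (V : set T).

Lemma near_open V f g x : open V -> V x -> (forall y, V y -> f y = g y) ->
  {near x, f =1 g}.
Proof.
move=> oV Vx fg; have : nbhs x V by exact: open_nbhs_nbhs.
by apply: filterS => y /fg.
Qed.

End near_open.

Lemma continuous_open_ext (T U : topologicalType) (f g : T -> U) (V : set T) x :
  open V -> V x -> (forall y, V y -> f y = g y) ->
  {for x, continuous f} -> {for x, continuous g}.
Proof.
move=> oV Vx fg; rewrite /prop_for /continuous_at -(fg x Vx) => cf.
apply: cvg_trans cf; apply: near_eq_cvg; exact: near_open oV Vx fg.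
Qed.

Section Ck_theory.
Context {R : realType} {n : nat}.
Implicit Types (f g : 'rV[R]_n -> R) (V W : set 'rV[R]_n).

Lemma Ck_ext k V f g : open V -> (forall y, V y -> f y = g y) -> Ck k V f -> Ck k V g.
Proof.
move=> oV; elim: k f g => [|k IH] f g fg [cf df].
  by split=> // x Vx; exact: continuous_open_ext oV Vx fg (cf x Vx).
split=> [x Vx|v]; first exact: continuous_open_ext oV Vx fg (cf x Vx).
have [f' ff' Cf'] := df v; exists f' => // x Vx.
by apply: near_eq_is_derive (ff' x Vx); exact: near_open oV Vx fg.
Qed.

Lemma CkSP k V f : open V -> Ck k.+1 V f <->
  (forall x, V x -> {for x, continuous f}) /\
  forall v, (forall x, V x -> derivable f x v) /\ Ck k V ('D_v f).
Proof.
move=> oV; split=> -[cf df]; split=> // v.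
  have [f' ff' Cf'] := df v; split=> [x Vx|]; first by have [] := ff' x Vx.
  by apply: Ck_ext Cf' => // x Vx; have [_ ->] := ff' x Vx.
by have [df1 df2] := df v; exists ('D_v f) => // x Vx; exact/derivableP/df1.
Qed.

Lemma Ck_local k V f :
  (forall x, V x -> exists W, [/\ open W, W x & Ck k W f]) -> Ck k V f.
Proof.
elim: k f => [|k IH] f Vf; split=> //.
- by move=> x /Vf[W [_ Wx /Ck_continuous]]; apply.
- by move=> x /Vf[W [_ Wx /Ck_continuous]]; apply.
move=> v; exists ('D_v f) => [x /Vf[W [oW Wx /CkSP -/(_ oW)[_ /(_ v)[df _]]]]|].
  exact/derivableP/df.
apply: IH => x /Vf[W [oW Wx /CkSP -/(_ oW)[_ /(_ v)[_ Cf]]]].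
by exists W.
Qed.

Lemma Ck_leq j k V f : (j <= k)%N -> Ck k V f -> Ck j V f.
Proof. by move=> /subnK <-; elim: (k - j)%N => // i IH /CkS. Qed.

Lemma Ck_sum k V (I : Type) (r : seq I) (P : pred I) (F : I -> 'rV[R]_n -> R) :
  (forall i, P i -> Ck k V (F i)) -> Ck k V (fun x => \sum_(i <- r | P i) F i x).
Proof.
move=> CF; elim: r => [|i r IH].
  have -> : (fun x => \sum_(j <- [::] | P j) F j x) = (fun=> 0).
    by apply/funext => x; rewrite big_nil.
  exact: Ck_cst.
have -> : (fun x => \sum_(j <- i :: r | P j) F j x) =
    (fun x => if P i then F i x + \sum_(j <- r | P j) F j x else \sum_(j <- r | P j) F j x).
  by apply/funext => x; rewrite big_cons.
case: (boolP (P i)) => // Pi; apply: CkD => //; exact: CF.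
Qed.

Lemma Ck_prod k V (I : Type) (r : seq I) (P : pred I) (F : I -> 'rV[R]_n -> R) :
  (forall i, P i -> Ck k V (F i)) -> Ck k V (fun x => \prod_(i <- r | P i) F i x).
Proof.
move=> CF; elim: r => [|i r IH].
  have -> : (fun x => \prod_(j <- [::] | P j) F j x) = (fun=> 1).
    by apply/funext => x; rewrite big_nil.
  exact: Ck_cst.
have -> : (fun x => \prod_(j <- i :: r | P j) F j x) =
    (fun x => if P i then F i x * \prod_(j <- r | P j) F j x else \prod_(j <- r | P j) F j x).
  by apply/funext => x; rewrite big_cons.
case: (boolP (P i)) => // Pi; apply: CkM => //; exact: CF.
Qed.

Lemma is_derive_coord (i : 'I_n) (x v : 'rV[R]_n) :
  is_derive x v (fun y : 'rV[R]_n => y 0 i) (v 0 i).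
Proof.
have lims : (fun h : R => h^-1 *: (((fun y : 'rV[R]_n => y 0 i) \o shift x) (h *: v) - x 0 i))
    @ 0^' --> v 0 i.
  apply: (@cvg_trans _ ((cst (v 0 i) : R -> R) @ 0^')); last exact: cvg_cst.
  apply: near_eq_cvg; near=> h.
  rewrite /= !mxE addrK scalerA mulVf ?scale1r //.
  by near: h; exact: nbhs_dnbhs_neq.
by apply: DeriveDef; [apply/cvg_ex; eexists; exact: lims | exact/cvg_lim].
Unshelve. all: by end_near.
Qed.

Lemma Ck_coord k V i : Ck k V (fun y : 'rV[R]_n => y 0 i).
Proof.
case: k => [|k]; split=> //; try by move=> x _; exact: coord_continuous.
move=> v; exists (fun=> v 0 i); last exact: Ck_cst.
by move=> x _; exact: is_derive_coord.
Qed.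

Lemma Ck_inv k V g : (forall x, V x -> g x != 0) -> Ck k V g ->
  Ck k V (fun x => (g x)^-1).
Proof.
move=> g0; elim: k g g0 => [|k IH] g g0 Cg;
  (split; first by move=> x Vx; apply: continuousV;
     [exact: g0 | exact: Ck_continuous Cg Vx]) => //.
move=> v; have [g' gg' Cg'] := Cg.2 v.
exists (fun x => - 1 * ((g x)^-1 * (g x)^-1) * g' x).
  move=> x Vx; have [dg <-] := gg' x Vx.
  apply: DeriveDef; first by apply: derivableV => //; exact: g0.
  rewrite deriveV //; last exact: g0.
  by rewrite mulN1r -invfM -expr2.
by apply: CkM => //; apply: CkM; [exact: Ck_cst|apply: CkM; apply: IH => //; exact: CkS].
Qed.

End Ck_theory.

Lemma cvg_coords {R : realType} {m : nat} {T : Type} {F : set_system T} {FF : Filter F}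
    (G : T -> 'rV[R]_m) (l : 'rV[R]_m) :
  (forall i, (fun z => G z 0 i) @ F --> l 0 i) -> G @ F --> l.
Proof.
move=> cG; apply/cvgrPdist_lt => e e0; near=> z.
rewrite (@le_lt_trans _ _ (e / 2))//; last by rewrite gtr_pMr// invf_lt1// ltr1n.
apply: norm_le_coord => [|i]; first by rewrite divr_ge0// ltW.
rewrite !mxE; move: i; near: z; apply: filter_forall => i.
have /cvgrPdist_le := cG i; apply; by rewrite divr_gt0.
Unshelve. all: by end_near.
Qed.

Section Ck_composition.
Context {R : realType} {m n : nat}.

Lemma continuous_coords {T : topologicalType} (G : T -> 'rV[R]_m) y :
  (forall i, {for y, continuous (fun z => G z 0 i)}) -> {for y, continuous G}.
Proof. by move=> cG; apply: cvg_coords => i; exact: cG. Qed.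

(** Induction on k for all f together: a derivative of f ∘ G is a sum of products of derivatives of
    the components of G with partial derivatives of f composed with G. *)
Lemma Ck_comp k (U : set 'rV[R]_m) (W : set 'rV[R]_n) (f : 'rV[R]_m -> R)
    (G : 'rV[R]_n -> 'rV[R]_m) : open U -> open W -> (forall y, W y -> U (G y)) ->
  Ck k U f -> (forall i, Ck k W (fun y => G y 0 i)) -> Ck k W (f \o G).
Proof.
move=> oU oW WU; elim: k f => [|k IH] f Cf CG.
  split=> // y Wy; apply: continuous_comp; last exact: Ck_continuous Cf (WU y Wy).
  by apply: continuous_coords => i; exact: Ck_continuous (CG i) Wy.
split=> [y Wy|v].
  apply: continuous_comp; last exact: Ck_continuous Cf (WU y Wy).
  by apply: continuous_coords => i; exact: Ck_continuous (CG i) Wy.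
have [cf df] := (CkSP k f oU).1 Cf.
have dG i := ((CkSP k _ oW).1 (CG i)).2 v.
exists (fun y => \sum_i 'D_v (fun z => G z 0 i) y * 'D_(unit_vec i) f (G y)).
  move=> y Wy; apply: (is_derive_comp_C1 oU (WU y Wy)) => [z i Uz|i|i].
  - by have [+ _] := df (unit_vec i); apply.
  - by have [_ C] := df (unit_vec i); exact: Ck_continuous C (WU y Wy).
  - by have [+ _] := dG i; apply.
apply: Ck_sum => i _; apply: CkM; first by have [] := dG i.
have [_ C] := df (unit_vec i); apply: (IH _ C) => j; exact/CkS.
Qed.

Lemma derive_sum_coord (f : 'rV[R]_n -> R) (U : set 'rV[R]_n) y v : open U -> Ck 1 U f ->
  U y -> 'D_v f y = \sum_i v 0 i * 'D_(unit_vec i) f y.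
Proof.
move=> oU Cf Uy; have [cf df] := (CkSP 0 f oU).1 Cf.
have [||i|_ ->] := @is_derive_comp_C1 R n n f id U y v oU Uy.
- by move=> z i Uz; have [+ _] := df (unit_vec i); apply.
- by move=> i; have [_ C] := df (unit_vec i); exact: Ck_continuous C Uy.
- by have [] := @is_derive_coord R n i y v.
by apply: eq_bigr => i _; have [_ ->] := @is_derive_coord R n i y v.
Qed.

End Ck_composition.

(** * A smooth step function and local Lipschitz bounds *)

Section flat_function.
Context {R : realType}.

(* [x^-k * exp (-1/x)] for [0 < x]: its derivative is a combination of the   *)
(* same functions for [k + 1] and [k + 2], including at [0].                  *)
Definition flat (k : nat) (x : R) : R :=
  if x <= 0 then 0 else x^-1 ^+ k * expR (- x^-1).

Lemma flat_ge0 k x : 0 <= flat k x.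
Proof.
rewrite /flat; have [//|x0] := leP x 0.
by rewrite mulr_ge0 ?exprn_ge0 ?invr_ge0 ?expR_ge0 // ltW.
Qed.

Lemma flat_gt0 k x : 0 < x -> 0 < flat k x.
Proof. by move=> x0; rewrite /flat (leNgt x 0) x0 /= mulr_gt0 ?exprn_gt0 ?invr_gt0 ?expR_gt0. Qed.

Lemma flat_eq0 k x : x <= 0 -> flat k x = 0.
Proof. by rewrite /flat => ->. Qed.

(** With y = 1/x this is y^(k+1) / (k+1)! <= exp y, one term of the exponential series. It makes all
    the functions [flat k] tend to 0 at 0. *)
Lemma flat_le k x : `|flat k x| <= (k.+1)`!%:R * `|x|.
Proof.
have [x0|x0] := leP x 0; first by rewrite flat_eq0 // normr0 mulr_ge0.
rewrite ger0_norm ?flat_ge0 // (gtr0_norm x0) /flat (leNgt x 0) x0 /=.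
set y := x^-1; have y0 : 0 < y by rewrite invr_gt0.
rewrite expRN -[x]invrK -/y ler_pdivrMr ?expR_gt0 //.
have := @expR_ge1Dxn R y k (ltW y0) => H.
have : y ^+ k.+1 / (k.+1)`!%:R <= expR y by apply: le_trans H; rewrite lerDr.
rewrite ler_pdivrMr ?ltr0n ?fact_gt0 // exprSr => {}H.
rewrite -(ler_pM2r y0) (le_trans H) // le_eqVlt; apply/orP; left; apply/eqP.
by field; rewrite gt_eqF.
Qed.

Lemma is_derive_flat k (x : R) : is_derive x (1 : R) (flat k : R -> R) (flat k.+2 x - k%:R * flat k.+1 x).
Proof.
have [x0|x0|->] := ltgtP x 0.
- rewrite !flat_eq0 ?ltW // mulr0 subr0.
  apply: (@near_eq_is_derive R R R (cst (0 : R))).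
  by near=> y; rewrite flat_eq0 //= ltW //; near: y; exact: lt_nbhsl.
- have xN0 : x != 0 by rewrite gt_eqF.
  pose q (y : R) := y ^+ k * expR (- y).
  apply: (@near_eq_is_derive R R R (q \o (fun y => y^-1))).
    near=> y; rewrite /flat (leNgt y 0) (_ : 0 < y) //; near: y; exact: lt_nbhsr.
  have dq (y : R) : is_derive y 1 q (k%:R * y ^+ k.-1 * expR (- y) - q y).
    have d1 : is_derive y 1 (fun z : R => z ^+ k) (k%:R * y ^+ k.-1).
      apply: DeriveDef; first exact: exprn_derivable.
      by rewrite exp_derive [_ *: _]mulr1.
    have dN : is_derive y 1 (-%R : R -> R) (-1) by exact: (is_deriveN (is_derive_id y 1)).
    have d2 := @is_derive1_comp R expR -%R y _ _ (is_derive_expR (- y)) dN.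
    have := is_deriveM d1 d2; rewrite /q; set u := expR (- y).
    set w := (X in is_derive _ _ _ X -> _); suff -> : w = k%:R * y ^+ k.-1 * u - y ^+ k * u by [].
    rewrite /w; change (y ^+ k * (u * -1) + u * (k%:R * y ^+ k.-1) = k%:R * y ^+ k.-1 * u - y ^+ k * u).
    by ring.
  have dv : is_derive x 1 (fun y : R => y^-1) (- x ^- 2).
    have := @is_deriveV R id x 1 1 xN0 (is_derive_id _ _).
    by rewrite [_ *: _]mulr1.
  have := @is_derive1_comp R q _ x _ _ (dq x^-1) dv.
  rewrite /flat (leNgt x 0) x0 /= /q; set u := expR _.
  suff -> : (k%:R * x^-1 ^+ k.-1 * u - x^-1 ^+ k * u) * - x ^- 2 =
    x^-1 ^+ k.+2 * u - k%:R * (x^-1 ^+ k.+1 * u) by [].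
  rewrite -exprVn; clearbody u; clear dq q; case: k => [|k]; first by rewrite !mul0r expr0; ring.
  by rewrite /= !exprS; ring.
rewrite !flat_eq0 // mulr0 subr0.
(* At 0 the difference quotient of [flat k] is [flat k.+1], which tends to 0 by [flat_le]. *)
have lims : (fun h : R => h^-1 *: ((flat k \o shift 0) (h *: 1) - flat k 0)) @ 0^' --> (0 : R).
  apply: (@cvg_trans _ (flat k.+1 @ 0^')).
    apply: near_eq_cvg; near=> h.
    have h0 : h != 0 by near: h; exact: nbhs_dnbhs_neq.
    rewrite /= [_%:A]mulr1 addr0 (flat_eq0 k (lexx 0)) subr0.
    have [hle|hgt] := leP h 0; first by rewrite !flat_eq0 // scaler0.
    by rewrite /flat (leNgt h 0) hgt /= exprS -mulrA.
  apply/cvgrPdist_le => e e0; near=> h; rewrite sub0r normrN.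
  apply: (le_trans (flat_le _ _)).
  rewrite -ler_pdivlMl ?ltr0n ?fact_gt0 // mulrC.
  near: h; apply: dnbhs0_le; by rewrite divr_gt0 // ltr0n fact_gt0.
by apply: DeriveDef; [apply/cvg_ex; eexists; exact: lims | exact/cvg_lim].
Unshelve. all: by end_near.
Qed.

Lemma is_derive_comp1 n (phi : R -> R) (g : 'rV[R]_n -> R) x v (d d' : R) :
  is_derive x v g d -> is_derive (g x) 1 phi d' -> is_derive x v (phi \o g) (d' * d).
Proof.
move=> dg dphi; have g0 : is_derive (0 *: v + x) v g d by rewrite scale0r add0r.
have := is_derive_line g0 => dl.
have dphi' : is_derive (g (0 *: v + x)) 1 phi d' by rewrite scale0r add0r.
have [ex dE] := @is_derive1_comp R phi (fun s : R => g (s *: v + x)) 0 d' d dphi' dl.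
by apply: DeriveDef; [exact/derivable1P | rewrite derive_line0].
Qed.

Lemma Ck_flat n k j (V : set 'rV[R]_n) (g : 'rV[R]_n -> R) :
  Ck k V g -> Ck k V (fun x => flat j (g x)).
Proof.
have cont (j' : nat) x : Ck 0 V g -> V x -> {for x, continuous (fun x => flat j' (g x))}.
  move=> Cg Vx; apply: continuous_comp; first exact: Ck_continuous Cg Vx.
  by apply/differentiable_continuous/derivable1_diffP; have [] := is_derive_flat j' (g x).
elim: k j => [|k IH] j Cg; first by split=> // x; exact: cont.
split=> [x|v]; first by apply: cont; apply: Ck_leq Cg.
have [g' gg' Cg'] := Cg.2 v.
exists (fun x => (flat j.+2 (g x) + (- j%:R) * flat j.+1 (g x)) * g' x).
  move=> x Vx; rewrite mulNr; apply: is_derive_comp1; first exact: gg'.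
  exact: is_derive_flat.
by apply: CkM => //; apply: CkD; [|apply: CkM; first exact: Ck_cst]; apply/IH/CkS.
Qed.

Definition step (t : R) : R := flat 0 t * (flat 0 t + flat 0 (1 - t))^-1.

Lemma step_den t : 0 < flat 0 t + flat 0 (1 - t).
Proof.
have [t0|t0] := leP t 0.
  by rewrite flat_eq0 // add0r flat_gt0 // subr_gt0 (le_lt_trans t0).
by rewrite ltr_wpDr ?flat_ge0 ?flat_gt0.
Qed.

Lemma step_eq0 t : t <= 0 -> step t = 0.
Proof. by move=> t0; rewrite /step flat_eq0 // mul0r. Qed.

Lemma step_eq1 t : 1 <= t -> step t = 1.
Proof.
move=> t1; rewrite /step; have := step_den t.
by rewrite [flat 0 (1 - t)]flat_eq0 ?subr_le0 // addr0 => /lt0r_neq0/divff.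
Qed.

Lemma step_ge0 t : 0 <= step t.
Proof. by rewrite mulr_ge0 ?flat_ge0 // invr_ge0 ltW ?step_den. Qed.

Lemma step_le1 t : step t <= 1.
Proof. by rewrite ler_pdivrMr ?step_den // mul1r lerDl flat_ge0. Qed.

Lemma Ck_step n k (V : set 'rV[R]_n) (g : 'rV[R]_n -> R) :
  Ck k V g -> Ck k V (fun x => step (g x)).
Proof.
move=> Cg; have C1 := Ck_flat 0 Cg.
have C2 : Ck k V (fun x => flat 0 (1 - g x)).
  apply: Ck_flat; rewrite (_ : (fun x => 1 - g x) = fun x => 1 + -1 * g x).
    by apply: CkD; [exact: Ck_cst|apply: CkM => //; exact: Ck_cst].
  by apply/funext => x; rewrite mulN1r.
apply: CkM => //; apply: Ck_inv; last exact: CkD.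
by move=> x _; rewrite gt_eqF // step_den.
Qed.

End flat_function.

Lemma C1_lipschitz {R : realType} {n : nat} (U : set 'rV[R]_n) (f : 'rV[R]_n -> R) x :
  open U -> U x -> Ck 1 U f ->
  exists2 L : R, 0 <= L &
    exists2 e : R, 0 < e & forall y z, `|y - x| < e -> `|z - x| < e ->
      `|f y - f z| <= L * `|y - z|.
Proof.
move=> oU Ux /CkSP-/(_ oU)[_ df].
pose D i := 'D_(unit_vec i) f.
have cD i : {for x, continuous (D i)}.
  by have [_ C] := df (unit_vec i); exact: Ck_continuous C Ux.
have [e e0 eP] : exists2 e : R, 0 < e & forall y, `|y - x| < e -> U y /\
    forall i, `|D i y| <= `|D i x| + 1.
  have nD : \forall y \near nbhs x, forall i, `|D i y| <= `|D i x| + 1.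
    apply: filter_forall => i.
    have /cvgrPdist_le/(_ 1 ltr01) := cD i; apply: filterS => y Dy.
    rewrite -[D i y](subrK (D i x)) addrC (le_trans (ler_normD _ _)) // lerD2l.
    by rewrite distrC.
  have : nbhs x U by exact: open_nbhs_nbhs.
  move=> /filterI/(_ nD).
  move=> /nbhs_ballP[e /= e0 eP]; exists e => // y ye; apply: eP.
  by rewrite -ball_normE /= distrC.
exists (\sum_i (`|D i x| + 1)); first by apply: sumr_ge0 => i _; rewrite addr_ge0.
(* The intermediate points of [tele_mvt] lie within |y - z| < 2e/3 of z, hence within e of x, where
   the partial derivatives are bounded. *)
exists (e / 3); first by rewrite divr_gt0.
move=> y z ye ze; have yz : `|y - z| < e / 3 + e / 3.
  by rewrite -(subrKA x) (le_lt_trans (ler_normD _ _)) // ltrD // distrC.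
have in_ball w : `|w - z| <= `|y - z| -> `|w - x| < e.
  move=> wz; rewrite -(subrKA z) (le_lt_trans (ler_normD _ _)) //.
  have : `|w - z| + `|z - x| < (e / 3 + e / 3) + e / 3.
    by rewrite ltrD // (le_lt_trans wz).
  by move/lt_le_trans; apply; lra.
have [w i wz|xi xi1] := @tele_mvt R n f z (y - z).
  by have [+ _] := df (unit_vec i); apply; have [] := eP w (in_ball w wz).
rewrite subrK => ->; rewrite mulr_suml (le_trans (ler_norm_sum _ _ _)) //.
apply: ler_sum => i _; rewrite normrM mulrC ler_pM //; last exact: le_coord_norm.
by have [_ ] := eP _ (in_ball _ (xi1 i)); apply.
Qed.

(** * Integrals over [0, 1] and Hadamard's lemma *)

Section unit_integral.
Context {R : realType}.
Local Notation mu := (@lebesgue_measure R).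
Implicit Types f g : R -> R.

Definition int01 f : R := (\int[mu]_(t in `[0%R, 1%R]) f t)%R.

Definition cont01 f := forall t, 0 <= t <= 1 -> {for t, continuous f}.

Let mI : measurable (`[0%R, 1%R]%classic : set R). Proof. exact: measurable_itv. Qed.

Let cont01_within f : cont01 f -> {within `[0, 1], continuous f}.
Proof.
move=> cf; apply/continuous_in_subspaceT => t; rewrite inE /= in_itv /=; exact: cf.
Qed.

Let int_f f : cont01 f -> mu.-integrable `[0%R, 1%R] (EFin \o f).
Proof.
move=> /cont01_within; apply: continuous_compact_integrable; exact: segment_compact.
Qed.

Lemma int01B f g : cont01 f -> cont01 g -> int01 (fun t => f t - g t) = int01 f - int01 g.
Proof. by move=> cf cg; rewrite /int01 RintegralB //; exact: int_f. Qed.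

Lemma int01D f g : cont01 f -> cont01 g -> int01 (fun t => f t + g t) = int01 f + int01 g.
Proof. by move=> cf cg; rewrite /int01 RintegralD //; exact: int_f. Qed.

Lemma int01Z f c : cont01 f -> int01 (fun t => c * f t) = c * int01 f.
Proof. by move=> cf; rewrite /int01 RintegralZl //; exact: int_f. Qed.

Lemma eq_int01 f g : (forall t, 0 <= t <= 1 -> f t = g t) -> int01 f = int01 g.
Proof.
by move=> fg; apply: eq_Rintegral => t; rewrite inE /= in_itv /=; exact: fg.
Qed.

Lemma int01_ftc f g : cont01 f -> (forall t : R, 0 <= t <= 1 -> is_derive t (1 : R) g (f t)) ->
  int01 f = g 1 - g 0.
Proof.
move=> cf dg; rewrite /int01 /Rintegral (@continuous_FTC2 _ f g) //.
- exact: cont01_within.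
- have cg t : 0 <= t <= 1 -> {for t, continuous g}.
    by move=> /dg[d _]; exact/differentiable_continuous/derivable1_diffP.
  split.
  + by move=> t; rewrite in_itv /= => /andP[t0 t1]; have [] := dg t; rewrite ?(ltW t0) ?ltW.
  + by apply: cvg_at_right_filter; apply: cg; rewrite lexx ler01.
  + by apply: cvg_at_left_filter; apply: cg; rewrite lexx ler01.
- move=> t; rewrite in_itv /= => /andP[t0 t1]; rewrite derive1E.
  have t01 : 0 <= t <= 1 by rewrite (ltW t0) ltW.
  by have [_ ->] := dg t t01.
Qed.

Lemma int01_cst (c : R) : int01 (fun=> c) = c.
Proof.
have dc (t : R) : 0 <= t <= 1 -> is_derive t (1 : R) ( *%R c) c.
  move=> _; have := @is_deriveZ R R R id c t 1 1 (is_derive_id _ _).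
  by rewrite [_ *: _]mulr1.
rewrite (int01_ftc _ dc); first by rewrite mulr1 mulr0 subr0.
by move=> t _; exact: cst_continuous.
Qed.

Lemma int01_le f e : cont01 f -> (forall t, 0 <= t <= 1 -> `|f t| <= e) -> `|int01 f| <= e.
Proof.
move=> cf fe; rewrite -[leRHS]int01_cst /int01; apply: le_trans.
  by apply: le_normr_Rintegral; [exact: mI|exact: int_f].
apply: le_Rintegral => //.
- apply: int_f => t t01; apply: continuous_comp; [exact: cf|exact: norm_continuous].
- by apply: (int_f (f := fun=> e)) => t _; exact: cst_continuous.
Qed.

End unit_integral.

Lemma continuous_near {R : realType} {T : topologicalType} (f : T -> R) (y : T) :
  (forall d, 0 < d -> \forall y' \near y, `|f y - f y'| <= d) -> {for y, continuous f}.
Proof. by move=> fy; apply/cvgrPdist_le. Qed.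

Section hadamard.
Context {R : realType} {n : nat} (a : 'rV[R]_n) (e : R).
Let U : set 'rV[R]_n := [set y | `|y - a| < e].
Implicit Types (F : 'rV[R]_n -> R).

Let oU : open U.
Proof.
have [e0|e0] := ltP 0 e.
  have -> : U = ball a e by apply/seteqP; split=> y; rewrite -ball_normE /= /U /= distrC.
  exact: ball_open.
rewrite (_ : U = set0); first exact: open0.
apply/seteqP; split=> // y /=; apply/negP; rewrite -leNgt (le_trans e0) //.
Qed.

Definition ray (t : R) (y : 'rV[R]_n) := t *: (y - a) + a.

Lemma ray_in t y : 0 <= t <= 1 -> U y -> U (ray t y).
Proof.
move=> /andP[t0 t1] Uy; rewrite /U /= /ray addrK normrZ (ger0_norm t0).
by rewrite (le_lt_trans _ Uy) // ler_piMl.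
Qed.

Lemma ray_cvg t y : (fun p : R * 'rV[R]_n => ray p.1 p.2) @ (t, y) --> ray t y.
Proof.
apply: cvgD; last exact: cvg_cst.
apply: cvgZ; first exact: cvg_fst.
by apply: cvgB; [exact: cvg_snd | exact: cvg_cst].
Qed.

(** Compactness of [0, 1] makes the continuity of F along the rays uniform in t. It serves both the
    continuity of the ray integrals and the differentiation under the integral sign. *)
Lemma ray_unif F y (d : R) : (forall z, U z -> {for z, continuous F}) -> U y -> 0 < d ->
  \forall y' \near y, forall t, 0 <= t <= 1 -> `|F (ray t y') - F (ray t y)| <= d.
Proof.
move=> cF Uy d0.
have /compact_near_coveringP : compact (`[0, 1]%classic : set R) by exact: segment_compact.
move=> /(_ _ (nbhs y) (fun y' t => `|F (ray t y') - F (ray t y)| <= d) _) C.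
have {}C : \forall y' \near y,
    `[0, 1] `<=` [set t : R | `|F (ray t y') - F (ray t y)| <= d].
  apply: C => t; rewrite /= in_itv /= => t01.
  have cR : (fun p : R * 'rV[R]_n => F (ray p.1 p.2)) @ (t, y) --> F (ray t y).
    apply: (@cvg_comp _ _ _ (fun p : R * 'rV[R]_n => ray p.1 p.2) F _ (nbhs (ray t y))).
      exact: ray_cvg.
    by apply: cF; exact: ray_in.
  have d20 : 0 < d / 2 by rewrite divr_gt0.
  have /cvgrPdist_le/(_ _ d20) := cR.
  case=> -[A B] /= [At By] AB; exists (A, B) => // -[t' y'] /= [At' By'].
  have h1 := AB (t', y') (conj At' By').
  have h2 := AB (t', y) (conj At' (nbhs_singleton By)).
  rewrite /= in h1 h2; rewrite -(subrKA (F (ray t y))) (splitr d).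
  by rewrite (le_trans (ler_normD _ _)) // lerD // distrC.
by apply: filterS C => y' C t t01; apply: C; rewrite /= in_itv.
Qed.

Let cont01_ray F j y : (forall z, U z -> {for z, continuous F}) -> U y ->
  cont01 (fun t => t ^+ j * F (ray t y)).
Proof.
move=> cF Uy t t01; apply: continuousM; first exact: exprn_continuous.
apply: (@continuous_comp _ _ _ (fun t => ray t y)); last exact/cF/ray_in.
apply: continuousD; last exact: cst_continuous.
by apply: continuousZr_tmp => //; exact: cvg_id.
Qed.

Lemma int_ray_continuous F j y : (forall z, U z -> {for z, continuous F}) -> U y ->
  {for y, continuous (fun y => int01 (fun t => t ^+ j * F (ray t y)))}.
Proof.
move=> cF Uy; apply: continuous_near => d d0.
have nU : \forall y' \near y, U y' by exact: open_nbhs_nbhs.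
have nR := ray_unif cF Uy d0.
apply: filterS2 nU nR => y' Uy' nR.
rewrite -int01B; [|exact: cont01_ray..].
apply: int01_le => [t t01|t t01].
  by apply: continuousB; exact: cont01_ray.
rewrite -mulrBr normrM distrC normrX -[d]mul1r ler_pM //.
  by rewrite exprn_ile1 // ger0_norm; case/andP: t01.
exact: nR.
Qed.

(** Differentiation under the integral sign. The derivative of F(a + t(y - a)) in y produces a
    factor t, so the weight t^j in the statement is what lets the induction on k close. *)
Lemma Ck_int_ray k j F : (forall k, Ck k U F) ->
  Ck k U (fun y => int01 (fun t => t ^+ j * F (ray t y))).
Proof.
elim: k j F => [|k IH] j F CF.
  by split=> // y; apply: int_ray_continuous => z; exact: Ck_continuous (CF 0%N).
have cF z : U z -> {for z, continuous F} by exact: Ck_continuous (CF 0%N).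
split=> [y|v]; first exact: int_ray_continuous.
have dF z : U z -> derivable F z v.
  by have [_ /(_ v)[+ _]] := (CkSP 0 F oU).1 (CF 1%N); apply.
have CDF k' : Ck k' U ('D_v F).
  by have [_ /(_ v)[_ +]] := (CkSP k' F oU).1 (CF k'.+1).
have cD z : U z -> {for z, continuous ('D_v F)} by exact: Ck_continuous (CDF 0%N).
exists (fun y => int01 (fun t => t ^+ j.+1 * 'D_v F (ray t y))); last exact: (IH j.+1 ('D_v F)).
move=> y Uy; set l := int01 _.
have lims : (fun h : R => h^-1 *: (((fun y => int01 (fun t => t ^+ j * F (ray t y))) \o shift y)
    (h *: v) - int01 (fun t => t ^+ j * F (ray t y)))) @ 0^' --> l.
  have cline : (fun h : R => h *: v + y) @ 0 --> y.
    have : (fun h : R => h *: v + y) @ 0 --> 0 *: v + y.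
      by apply: cvgD; [apply: cvgZr_tmp; exact: cvg_id|exact: cvg_cst].
    by rewrite scale0r add0r.
  apply/cvgrPdist_le => d d0.
  have : \forall h \near (0 : R), U (h *: v + y) /\ forall t, 0 <= t <= 1 ->
      `|'D_v F (ray t (h *: v + y)) - 'D_v F (ray t y)| <= d.
    have : nbhs y (U `&` [set y' | forall t, 0 <= t <= 1 ->
      `|'D_v F (ray t y') - 'D_v F (ray t y)| <= d]).
      apply: filterI; first exact: open_nbhs_nbhs.
      exact: (@ray_unif ('D_v F) y d cD Uy d0).
    by move/cline.
  move=> /nbhs_ballP[r /= r0 rP].
  near=> h.
  have h0 : h != 0 by near: h; exact: nbhs_dnbhs_neq.
  have hr : `|h| < r by near: h; exact: dnbhs0_lt.
  have shr (s : R) : 0 <= s <= 1 -> ball (0 : R) r (s * h).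
    move=> /andP[s0 s1]; rewrite -ball_normE /= sub0r normrN normrM (ger0_norm s0).
    by rewrite (le_lt_trans _ hr) // ler_piMl.
  have Uh : U (h *: v + y) by have [] := rP (1 * h) (shr 1 _); rewrite ?ler01 ?lexx // mul1r.
  have rayE t s : s *: ((t * h) *: v) + ray t y = ray t ((s * h) *: v + y).
    by rewrite /ray addrA -[(s * h) *: v + y - a]addrA [in RHS]scalerDr !scalerA (mulrCA s t h).
  rewrite /= -int01B; [|exact: cont01_ray..].
  have cc (t : R) : 0 <= t <= 1 -> {for t, continuous (fun t : R => t ^+ j * F (ray t (h *: v + y)) -
      t ^+ j * F (ray t y))}.
    by move=> t01; apply: continuousB; exact: cont01_ray.
  have ZE : h^-1 *: int01 (fun t => t ^+ j * F (ray t (h *: v + y)) - t ^+ j * F (ray t y)) =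
      int01 (fun t => h^-1 * (t ^+ j * F (ray t (h *: v + y)) - t ^+ j * F (ray t y))).
    by rewrite int01Z.
  rewrite ZE /l -int01B; first last.
  - by move=> t t01; apply: continuousM; [exact: cst_continuous|exact: cc].
  - exact: (@cont01_ray ('D_v F)).
  apply: int01_le => [t t01|t t01].
    apply: continuousB; first exact: (@cont01_ray ('D_v F)).
    by apply: continuousM; [exact: cst_continuous|exact: cc].
  have ds (s : R) : 0 <= s <= 1 -> is_derive (s *: ((t * h) *: v) + ray t y) ((t * h) *: v) F
      (t * h * 'D_v F (ray t ((s * h) *: v + y))).
    move=> s01; rewrite rayE; apply/is_derive_scale/derivableP/dF/ray_in => //.
    by have [] := rP _ (shr s s01).
  have [|s s01] := @mvt_line _ _ F (ray t y) ((t * h) *: v).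
    by move=> s s01; have [] := ds s s01.
  have := rayE t 1; rewrite scale1r mul1r => ->; have [_ ->] := ds s s01.
  rewrite -mulrBr => ->; rewrite [X in _ - X](_ : _ =
      t ^+ j.+1 * 'D_v F (ray t ((s * h) *: v + y))); last by rewrite exprSr; field.
  rewrite -mulrBr normrM distrC normrX -[d]mul1r ler_pM //.
    by rewrite exprn_ile1 // ger0_norm; case/andP: t01.
  by have [_] := rP _ (shr s s01); apply.
by apply: DeriveDef; [apply/cvg_ex; eexists; exact: lims | exact/cvg_lim].
Unshelve. all: by end_near.
Qed.

(** F y - F a is the integral over [0, 1] of the derivative of t ↦ F(a + t(y - a)), which is Σ (y_i
    - a_i) ∂_i F at the ray point. The integrals of the partial derivatives are the G_i. *)
Lemma hadamard F : (forall k, Ck k U F) -> exists G : 'I_n -> 'rV[R]_n -> R,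
  (forall i k, Ck k U (G i)) /\
  forall y, U y -> F y - F a = \sum_i (y 0 i - a 0 i) * G i y.
Proof.
move=> CF; pose D i := 'D_(unit_vec i) F.
have CD i k : Ck k U (D i).
  by have [_ /(_ (unit_vec i))[_ +]] := (CkSP k F oU).1 (CF k.+1).
exists (fun i y => int01 (fun t => t ^+ 0 * D i (ray t y))); split=> [i k|y Uy].
  exact: Ck_int_ray.
have cc i : cont01 (fun t => t ^+ 0 * D i (ray t y)).
  by apply: cont01_ray => // z; exact: Ck_continuous (CD i 0%N).
have cs (r : seq 'I_n) : cont01 (fun t => \sum_(i <- r) (y - a) 0 i * (t ^+ 0 * D i (ray t y))) /\
    int01 (fun t => \sum_(i <- r) (y - a) 0 i * (t ^+ 0 * D i (ray t y))) =
    \sum_(i <- r) (y 0 i - a 0 i) * int01 (fun t => t ^+ 0 * D i (ray t y)).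
  elim: r => [|i r [IH1 IH2]].
    rewrite (_ : (fun t => _) = fun=> 0); last by apply/funext => t; rewrite big_nil.
    by rewrite int01_cst big_nil; split => // t _; exact: cst_continuous.
  have c1 : cont01 (fun t => (y - a) 0 i * (t ^+ 0 * D i (ray t y))).
    by move=> t t01; apply: continuousM; [exact: cst_continuous|exact: cc].
  rewrite (_ : (fun t => _) = fun t => (y - a) 0 i * (t ^+ 0 * D i (ray t y)) +
    \sum_(i <- r) (y - a) 0 i * (t ^+ 0 * D i (ray t y))); last first.
    by apply/funext => t; rewrite big_cons.
  split; first by move=> t t01; apply: continuousD; [exact: c1|exact: IH1].
  by rewrite int01D // IH2 int01Z // big_cons !mxE.
have [c1 <-] := cs (index_enum 'I_n).
have dray (t : R) : 0 <= t <= 1 -> is_derive t (1 : R) (fun t : R => F (t *: (y - a) + a))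
    (\sum_i (y - a) 0 i * (t ^+ 0 * D i (ray t y))).
  move=> t01; apply: is_derive_line.
  have Ur : U (t *: (y - a) + a) by exact: ray_in.
  have dF : derivable F (t *: (y - a) + a) (y - a).
    by have [_ /(_ (y - a))[+ _]] := (CkSP 0 F oU).1 (CF 1%N); apply.
  apply: DeriveDef => //; rewrite (derive_sum_coord (y - a) oU (CF 1%N) Ur).
  by apply: eq_bigr => i _; rewrite expr0 mul1r.
by rewrite (int01_ftc c1 dray) scale1r scale0r add0r subrK.
Qed.

End hadamard.

Lemma open_of_nbhs {T : topologicalType} (A : set T) :
  (forall x, A x -> nbhs x A) -> open A.
Proof. by rewrite openE. Qed.

(** * Smooth functions in charts, bump functions, a proper function *)

Section charts.
Context {R : realType} {n : nat} {M : manifold R n}.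
Implicit Types (c : chart R n M) (U V W : set M) (f g : M -> R) (x : M).

Lemma chartK c x : cdom c x -> cinv c (cmap c x) = x.
Proof. by move=> cx; apply: cmapK; rewrite inE. Qed.

Lemma open_chart_image c W : open W -> open (cmap c @` (cdom c `&` W)).
Proof.
move=> oW; apply: open_of_nbhs => _ [x [cx Wx] <-].
have n1 : nbhs (cmap c x) (cmap c @` cdom c).
  by apply: open_nbhs_nbhs; split; [exact: cimg_open | exists x].
have n2 : nbhs (cmap c x) (cinv c @^-1` W).
  apply: cinv_continuous; first by exists x.
  by rewrite chartK //; exact: open_nbhs_nbhs.
apply: filterS2 n1 n2 => _ [x' cx' <-]; rewrite /= chartK // => Wx'.
by exists x'.
Qed.

Lemma near_chart c x (V : set 'rV[R]_n) : cdom c x -> nbhs (cmap c x) V ->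
  \forall y \near x, cdom c y /\ V (cmap c y).
Proof.
move=> cx Vx; apply: filterI.
  by apply: open_nbhs_nbhs; split => //; exact: cdom_open.
exact: cmap_continuous cx _ Vx.
Qed.

Lemma smooth_on_sub U V f : V `<=` U -> smooth_on U f -> smooth_on V f.
Proof.
by move=> VU sf c Ac k; apply: Ck_sub (sf c Ac k) => _ [x [cx /VU Ux] <-]; exists x.
Qed.

Lemma smooth_on_local U f : (forall x, U x -> exists W, [/\ open W, W x & smooth_on W f]) ->
  smooth_on U f.
Proof.
move=> Uf c Ac k; apply: Ck_local => _ [x [cx Ux] <-].
have [W [oW Wx sf]] := Uf x Ux.
by exists (cmap c @` (cdom c `&` W)); split; [exact: open_chart_image | exists x | exact: sf].
Qed.

Lemma smooth_on_ext U f g : open U -> (forall x, U x -> f x = g x) ->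
  smooth_on U f -> smooth_on U g.
Proof.
move=> oU fg sf c Ac k; apply: Ck_ext (sf c Ac k); first exact: open_chart_image.
by move=> _ [x [cx Ux] <-]; rewrite /= chartK // fg.
Qed.

(** Smoothness may be tested in a single chart, since the transition maps to the other charts are
    smooth and [Ck_comp] applies. *)
Lemma smooth_on_chart c W f : atlas c -> open W -> W `<=` cdom c ->
  (forall k, Ck k (cmap c @` W) (f \o cinv c)) -> smooth_on W f.
Proof.
move=> Ac oW Wc Cf c' Ac' k.
have oc'W : open (cmap c' @` (cdom c' `&` W)) by exact: open_chart_image.
have ocW : open (cmap c @` W).
  rewrite -[W](setIidr Wc); exact: open_chart_image.
apply: (@Ck_ext _ _ _ _ ((f \o cinv c) \o (cmap c \o cinv c'))) => //.
  by move=> _ [x [c'x Wx] <-] /=; rewrite !chartK //; exact: Wc.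
apply: (Ck_comp ocW oc'W) => //.
  by move=> _ [x [c'x Wx] <-] /=; rewrite chartK //; exists x.
move=> i; apply: Ck_sub (@atlas_compat _ _ M c' c Ac' Ac i k).
by move=> _ [x [c'x Wx] <-]; exists x => //; split => //; exact: Wc.
Qed.

Lemma smooth_on_coord c i : atlas c -> smooth_on (cdom c) (fun x => cmap c x 0 i).
Proof. by move=> Ac c' Ac' k; exact: atlas_compat. Qed.

Lemma smooth_on_sum U (I : Type) (r : seq I) (P : pred I) (F : I -> M -> R) :
  (forall i, P i -> smooth_on U (F i)) -> smooth_on U (fun x => \sum_(i <- r | P i) F i x).
Proof. by move=> sF c Ac k; apply: Ck_sum => i Pi; exact: sF. Qed.

Lemma smooth_on_prod U (I : Type) (r : seq I) (P : pred I) (F : I -> M -> R) :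
  (forall i, P i -> smooth_on U (F i)) -> smooth_on U (fun x => \prod_(i <- r | P i) F i x).
Proof. by move=> sF c Ac k; apply: Ck_prod => i Pi; exact: sF. Qed.

Lemma smooth_on_step U f : smooth_on U f -> smooth_on U (fun x => step (f x)).
Proof. by move=> sf c Ac k; apply: Ck_step; exact: sf. Qed.

Lemma smooth_on_inv U f : (forall x, U x -> f x != 0) -> smooth_on U f ->
  smooth_on U (fun x => (f x)^-1).
Proof.
move=> f0 sf c Ac k; apply: Ck_inv; last exact: sf.
by move=> _ [x [cx Ux] <-]; rewrite /= chartK // f0.
Qed.

Lemma smooth_onB U f g : smooth_on U f -> smooth_on U g -> smooth_on U (fun x => f x - g x).
Proof.
move=> sf sg; rewrite (_ : (fun _ => _) = fun x => f x + -1 * g x).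
  by apply: smoothD => //; apply: smoothM => //; exact: smooth_cst.
by apply/funext => x; rewrite mulN1r.
Qed.

Lemma smooth_on_continuous U f x : open U -> U x -> smooth_on U f -> {for x, continuous f}.
Proof.
move=> oU Ux sf; have [c Ac cx] := atlas_cover x.
have oW : open (cdom c `&` U) by apply: openI => //; exact: cdom_open.
apply: (@continuous_open_ext _ _ ((f \o cinv c) \o cmap c) f (cdom c `&` U) x oW) => //.
  by move=> y [cy Uy]; rewrite /= chartK.
apply: continuous_comp; first exact: cmap_continuous.
by apply: Ck_continuous (sf c Ac 0%N) _; exists x.
Qed.

Lemma Cinf_continuous (f : Cinf M) : continuous f.
Proof. by move=> x; exact: smooth_on_continuous openT I (CinfP f). Qed.

End charts.

Section bump_functions.
Context {R : realType} {n : nat} {M : manifold R n}.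
Implicit Types (x : M).

Definition bump_in (O : set M) (chi : Cinf M) : Prop :=
  (forall x, 0 <= chi x <= 1) /\
  exists2 K : set M, compact K /\ K `<=` O & forall x, ~ K x -> chi x = 0.

Lemma bump_exists (O : set M) x : open O -> O x ->
  exists2 chi : Cinf M, bump_in O chi & \forall y \near x, chi y = 1.
Proof.
move=> oO Ox; have [c Ac cx] := atlas_cover x.
pose a := cmap c x; pose q (y : 'rV[R]_n) := \sum_i (y 0 i - a 0 i) * (y 0 i - a 0 i).
have q_ge (y : 'rV[R]_n) i : (y 0 i - a 0 i) ^+ 2 <= q y.
  by rewrite /q (bigD1 i) //= expr2 lerDl sumr_ge0 // => j _; rewrite -expr2 sqr_ge0.
have /nbhs_ballP[e /= e0 eO] : nbhs a (cmap c @` (cdom c `&` O)).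
  by apply: open_nbhs_nbhs; split; [exact: open_chart_image | exists x].
pose d := (e / 2) ^+ 2; have d0 : 0 < d by rewrite exprn_gt0 // divr_gt0.
have e20 : 0 <= e / 2 by rewrite divr_ge0 // ltW.
have q_ball y : q y <= d -> `|y - a| <= e / 2.
  move=> qd; apply: norm_le_coord => [|i]; first by rewrite divr_ge0 // ltW.
  rewrite !mxE -(@ler_pXn2r _ 2) ?nnegrE ?normr_ge0 ?e20 //.
  by rewrite real_normK ?num_real //; apply: le_trans qd; exact: q_ge.
have qC k V : Ck k V q.
  by apply: Ck_sum => i _; apply: CkM; apply: (CkD (Ck_coord _ _ i) (Ck_cst _ _ (- a 0 i))).
have qc : continuous q by move=> y; apply: Ck_continuous (qC 0%N setT) _.
pose B := [set y | q y <= d].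
have B_img y : B y -> (cmap c @` (cdom c `&` O)) y.
  move=> By; apply: eO; rewrite -ball_normE /= distrC (le_lt_trans (q_ball _ By)) //.
  by rewrite gtr_pMr // invf_lt1 // ltr1n.
have cB : compact B.
  apply: bounded_closed_compact.
    exists (`|a| + e / 2); split; first exact: num_real.
    move=> r lr y By; apply: (@le_trans _ _ (`|a| + e / 2)); last exact: ltW.
    by rewrite -[y](subrK a) addrC (le_trans (ler_normD _ _)) // lerD2l q_ball.
  rewrite (_ : B = q @^-1` [set t | t <= d]) //.
  by apply: closed_comp => //; exact: closed_le.
pose K := cinv c @` B.
have cK : compact K.
  apply: continuous_compact => //; apply/continuous_in_subspaceT => y; rewrite inE => By.
  by apply: cinv_continuous; have [z [cz _] <-] := B_img y By; exists z.
have KO : K `<=` cdom c `&` O.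
  by move=> _ [y By <-]; have [z [cz Oz] <-] := B_img y By; rewrite chartK.
(* The argument 2 - (2/d) q is at least 1 for q <= d/2 and at most 0 for q >= d, so the function is
   1 near x and extends by 0 outside the compact, hence closed, set K. *)
pose chi y := if pselect (K y) then step (2 - 2 / d * q (cmap c y)) else 0.
have chi_out y : ~ K y -> chi y = 0 by rewrite /chi; case: pselect.
have chi_c y : cdom c y -> chi y = step (2 - 2 / d * q (cmap c y)).
  move=> cy; rewrite /chi; case: pselect => // nK; rewrite step_eq0 // subr_le0.
  have : ~ B (cmap c y) by move=> By; apply: nK; exists (cmap c y) => //; rewrite chartK.
  move=> /negP; rewrite -ltNge => /ltW dq.
  by rewrite -[leLHS](divfK (lt0r_neq0 d0)) ler_wpM2l // divr_ge0 // ltW.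
have schi : smooth_on setT chi.
  apply: smooth_on_local => y _; have [Ky|nKy] := pselect (K y).
    exists (cdom c); split; [exact: cdom_open| by have [] := KO y Ky|].
    apply: (@smooth_on_ext _ _ _ _ (fun z => step (2 - 2 / d * q (cmap c z)))).
    - exact: cdom_open.
    - by move=> z cz; rewrite chi_c.
    apply/smooth_on_step/smooth_onB; first exact: smooth_cst.
    apply: smoothM; first exact: smooth_cst.
    apply: smooth_on_sum => i _; apply: smoothM;
      by apply: smooth_onB; [exact: smooth_on_coord|exact: smooth_cst].
  have oK : open (~` K) by apply: closed_openC; apply: compact_closed => //; exact: manifold_hausdorff.
  exists (~` K); split => //; apply: (@smooth_on_ext _ _ _ _ (fun=> 0)) => //.
    by move=> z /chi_out.
  exact: smooth_cst.
exists (mkCinf schi); first split => [y|].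
- have [/KO[cy _]|nK] := pselect (K y); rewrite /=; last by rewrite chi_out // lexx ler01.
  by rewrite chi_c // step_ge0 step_le1.
- exists K; [by split => // y /KO[] | exact: chi_out].
have qa : q a = 0 by apply: big1 => i _; rewrite subrr mul0r.
have : \forall y \near a, q y <= d / 2.
  have /cvgrPdist_le/(_ (d / 2)) := qc a; rewrite qa => H.
  have {}H := H _; apply: filterS (H _); last by rewrite divr_gt0.
  by move=> y; rewrite sub0r normrN ger0_norm // sumr_ge0 // => i _; rewrite -expr2 sqr_ge0.
move=> /(near_chart cx); apply: filterS => y [cy qy].
rewrite /= chi_c // step_eq1 // lerBrDr -lerBrDl.
have -> : (2 - 1 : R) = 2 / d * (d / 2) by field; rewrite gt_eqF.
by rewrite ler_wpM2l // divr_ge0 // ltW.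
Qed.

End bump_functions.

Lemma finite_union_compact {T : topologicalType} (K : nat -> set T) (m : nat) :
  (forall i, compact (K i)) -> compact [set x | exists2 i, (i < m)%N & K i x].
Proof.
move=> cK; elim: m => [|m IH].
  rewrite (_ : [set x | _] = set0); first exact: compact0.
  by apply/seteqP; split=> [x []|x []].
rewrite (_ : [set x | _] = [set x | exists2 i, (i < m)%N & K i x] `|` K m).
  exact: compactU.
apply/seteqP; split=> x.
  move=> [ i ]; rewrite ltnS leq_eqVlt => /predU1P[->|im] Kx; [by right|by left; exists i].
by move=> [[i im Kx]|Kx]; [exists i => //; rewrite ltnW | exists m].
Qed.

Section exhaustion.
Context {R : realType} {n : nat} (M : manifold R n).

Lemma countable_bumps : exists chi : nat -> Cinf M,
  (forall i, bump_in setT (chi i)) /\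
  forall x : M, exists i, \forall y \near x, chi i y = 1.
Proof.
have [B cB [Bo Bx]] := @manifold_countable _ _ M.
have [f finj] : exists f : set M -> nat, {in B &, injective f}.
  by apply/countable_injP.
pose good b (c : Cinf M) := [/\ B b, bump_in setT c & forall y, b y -> c y = 1].
have /choice[chi chiP] : forall i, exists chi : Cinf M, bump_in setT chi /\
    forall b c, good b c -> f b = i -> forall y, b y -> chi y = 1.
  move=> i.
  have [[b [c [bc fb]]]|no] := pselect (exists b c, good b c /\ f b = i).
    exists c; have [Bb bumpc c1] := bc; split => // b' c' [Bb' _ _] fb'.
    by have -> : b' = b by apply: finj; rewrite ?inE ?fb.
  exists 0; split.
    by split=> [x|]; [rewrite lexx ler01 | exists set0 => //; split => //; exact: compact0].
  by move=> b c bc fb; exfalso; apply: no; exists b, c.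
exists chi; split=> [i|x]; first by have [] := chiP i.
have [c bc c1] := bump_exists openT (I : [set: M] x).
have [b [Bb bx] bc1] := Bx x _ c1.
exists (f b); have : nbhs x b by apply: open_nbhs_nbhs; split => //; exact: Bo.
apply: filterS => y yb; have [_ H] := chiP (f b).
by apply: (H b c) => //; split => // z /bc1.
Qed.

(** The function is τ = Σ_i Π_{j <= i} (1 - χ_j). Where χ_j = 1 all terms of index at least j
    vanish, so the sum is locally finite and smooth. At a point outside the supports of χ_0, ...,
    χ_m the first m + 1 terms equal 1, so τ > m there. Hence {τ <= m} is closed in a finite union of
    compact sets. *)
Lemma exhaustion : exists tau : Cinf M, (forall x, 0 <= tau x) /\
  forall m : nat, compact [set x | tau x <= m%:R].
Proof.
have [chi [bchi chi1]] := countable_bumps.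
have chi01 i x : 0 <= 1 - chi i x by have [/(_ x)/andP[_ h] _] := bchi i; rewrite subr_ge0.
pose P i x := \prod_(j < i.+1) (1 - chi j x).
have P0 i x : 0 <= P i x by apply: prodr_ge0.
have Pz j i x : chi j x = 1 -> (j <= i)%N -> P i x = 0.
  move=> cj ji; rewrite /P (bigD1 (Ordinal (ji : (j < i.+1)%N))) //=.
  by rewrite cj subrr mul0r.
have /choice[J JP] : forall x : M, exists j, chi j x = 1.
  by move=> x; have [i /nbhs_singleton] := chi1 x; exists i.
pose tau x := \sum_(i < J x) P i x.
have tauE j x : chi j x = 1 -> tau x = \sum_(i < j) P i x.
  move=> cj; have ext j1 j2 : chi j1 x = 1 -> (j1 <= j2)%N ->
      \sum_(i < j1) P i x = \sum_(i < j2) P i x.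
    move=> c1 j12; rewrite -!(big_mkord xpredT (fun i => P i x)) [RHS](@big_cat_nat _ _ _ j1) //=.
    rewrite [X in _ + X]big_nat_cond [X in _ + X]big1 ?addr0 // => i /andP[/andP[ji _] _].
    exact: Pz c1 ji.
  by rewrite /tau; have [h|h] := leqP (J x) j; [|apply/esym]; apply: ext => //; exact: ltnW.
have stau : smooth_on setT tau.
  apply: smooth_on_local => x _; have [j cj] := chi1 x.
  have : nbhs x [set y | chi j y = 1] := cj.
  rewrite nbhsE => -[W [oW Wx] Wc]; exists W; split => //.
  apply: (@smooth_on_ext _ _ _ _ (fun y => \sum_(i < j) P i y)) => //.
    by move=> y Wy; rewrite (tauE j) //; exact: Wc.
  apply: smooth_on_sum => i _; apply: smooth_on_prod => k _.
  apply: smooth_onB; first exact: smooth_cst.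
  exact: smooth_on_sub (CinfP (chi k)).
have tau_ge0 x : 0 <= tau x by apply: sumr_ge0.
exists (mkCinf stau); split => // m.
have /choice[K KP] : forall i, exists K : set M, compact K /\
    forall x, ~ K x -> chi i x = 0.
  move=> i; by have [_ [K [cK _] K0]] := bchi i; exists K.
have cU := finite_union_compact (m := m.+1) (fun i => (KP i).1).
apply: subclosed_compact cU _.
  apply: (@closed_comp _ _ (mkCinf stau : M -> R) [set t | t <= m%:R]); last exact: closed_le.
  by move=> x _; exact: Cinf_continuous.
move=> x /= taux; apply: contrapT => nK.
have c0 i : (i < m.+1)%N -> chi i x = 0.
  by move=> im; apply: (KP i).2 => Kx; apply: nK; exists i.
have mJ : (m < J x)%N.
  rewrite ltnNge; apply/negP => Jm; have := JP x; rewrite c0 //.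
  by move/eqP; rewrite eq_sym oner_eq0.
move: taux; rewrite leNgt => /negP; apply.
rewrite /tau -(big_mkord xpredT (fun i => P i x)) (@big_cat_nat _ _ _ m.+1) //=.
rewrite (@lt_le_trans _ _ (\sum_(0 <= i < m.+1) P i x)) //; last first.
  by rewrite lerDl sumr_ge0.
rewrite big_mkord (eq_bigr (fun=> 1)) => [|i _].
  by rewrite sumr_const card_ord ltr_nat.
rewrite /P big1 // => j _; rewrite c0 ?subr0 //.
exact: leq_trans (ltn_ord j) (ltn_ord i).
Qed.

End exhaustion.

(** * Finite spanning families by general position *)

Section pigeonhole.
Context {R : realType}.

(** Finitely many families with d parameters, on each of which w is a Lipschitz function of the
    parameter, cannot reach all k^m grid points when m > d. The parameters of size at most Dk fall
    into a number of small cells of order k^d, and two grid points in one cell would be closer than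
    1. This replaces Sard's theorem in [general_position]. *)
Lemma grid_pigeonhole (p d m : nat) (D : R) (T : forall k, ('I_m -> 'I_k) -> 'I_p -> ('I_d -> R) -> Prop) :
  (d < m)%N -> 0 <= D ->
  (forall k w, exists j zeta, T k w j zeta /\ forall i, `|zeta i| <= D * k%:R) ->
  (forall k w w' j zeta zeta' (e : R), 0 <= e -> T k w j zeta -> T k w' j zeta' ->
     (forall i, `|zeta i - zeta' i| <= e) ->
     forall i, `|(w i : nat)%:R - (w' i : nat)%:R| <= D * e) -> False.
Proof.
move=> dm D0 exT lipT.
pose Q : nat := (Num.truncn D).+1.
have DQ : D < Q%:R by have /andP[] := truncn_itv D0.
have Q0 : 0 < Q%:R :> R by rewrite ltr0n.
(* The shifted coordinates Q(ζ + Qk) lie in [0, 2Q²k], so their integer parts take fewer than N k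
   values. The next choice of k makes k^(d+1) exceed p (N k)^d. *)
pose N : nat := (2 * (Q * Q)).+1.
pose k : nat := (p * N ^ d).+1.
have /choice[F FP] : forall w : 'I_m -> 'I_k, exists F : 'I_p * ('I_d -> R),
    T k w F.1 F.2 /\ forall i, `|F.2 i| <= D * k%:R.
  by move=> w; have [j [zeta H]] := exT k w; exists (j, zeta).
pose v (w : 'I_m -> 'I_k) i : R := Q%:R * ((F w).2 i + Q%:R * k%:R).
have v0 w i : 0 <= v w i.
  rewrite mulr_ge0 // -lerBlDr sub0r.
  have [_ /(_ i)] := FP w; rewrite ler_norml => /andP[h _].
  by apply: le_trans h; rewrite lerN2 ler_wpM2r // ltW.
have vk w i : v w i < (N * k)%:R.
  have [_ /(_ i)] := FP w; rewrite ler_norml => /andP[_ h].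
  have h' : (F w).2 i <= Q%:R * k%:R by apply: (le_trans h); rewrite ler_wpM2r // ltW.
  rewrite /v (@le_lt_trans _ _ (Q%:R * (Q%:R * k%:R + Q%:R * k%:R))) //.
    by rewrite ler_wpM2l // lerD2r.
  rewrite -!natrM -natrD -natrM ltr_nat /N mulSn mulnDr addnn -mul2n !mulnA.
  by rewrite addnC -[X in (X < _)%N]addn0 ltn_add2l.
have cell w i : (Num.truncn (v w i) < N * k)%N.
  rewrite -(ltr_nat R) (le_lt_trans _ (vk w i)) //.
  by have /andP[] := truncn_itv (v0 w i).
pose G (w : {ffun 'I_m -> 'I_k}) : 'I_p * {ffun 'I_d -> 'I_(N * k)} :=
  ((F w).1, [ffun i => Ordinal (cell w i)]).
have Ginj : injective G.
  move=> w w' [Fw /ffunP Gw]; apply/ffunP => i; apply/val_inj/eqP.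
  have close l : `|(F w).2 l - (F w').2 l| <= Q%:R^-1.
    have := Gw l; rewrite !ffunE => -[tt].
    have /andP[a1 a2] := truncn_itv (v0 w l).
    have /andP[b1 b2] := truncn_itv (v0 w' l).
    rewrite tt in a1 a2.
    have : `|v w l - v w' l| <= 1.
      move: b1 b2 a1 a2; rewrite -!natr1; set u := _%:R => b1 b2 a1 a2.
      by rewrite ler_norml; apply/andP; split; lra.
    rewrite /v -mulrBr opprD addrACA subrr addr0 normrM (gtr0_norm Q0).
    by rewrite -ler_pdivlMl // mulr1.
  have [T1 _] := FP w; have [T2 _] := FP w'; rewrite -Fw in T2.
  have Qi : 0 <= Q%:R^-1 :> R by rewrite invr_ge0 ltW.
  have := lipT k w w' _ _ _ _ Qi T1 T2 close i.
  move/le_lt_trans => /(_ 1); rewrite ltr_pdivrMr // mul1r => /(_ DQ).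
  rewrite ltr_norml => /andP[h1 h2].
  rewrite eqn_leq; apply/andP; split; rewrite -ltnS -(ltr_nat R) -natr1; lra.
have := leq_card _ Ginj; rewrite card_prod !card_ffun !card_ord => H.
have k0 : (0 < k)%N by [].
have : (k ^ d.+1 <= p * (N * k) ^ d)%N by apply: leq_trans H; rewrite leq_pexp2l.
by rewrite expnMn mulnA expnS leq_pmul2r ?expn_gt0 // ltnn.
Qed.

End pigeonhole.

Section matrix_norm.
Context {R : realType}.

Lemma le_entry_norm m n (A : 'M[R]_(m, n)) i j : `|A i j| <= `|A|.
Proof.
rewrite {2}/Num.Def.normr /= mx_normrE.
exact: (le_bigmax _ (fun ij => `|A ij.1 ij.2|) (i, j)).
Qed.

Lemma norm_le_entry m n (A : 'M[R]_(m, n)) (e : R) : 0 <= e ->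
  (forall i j, `|A i j| <= e) -> `|A| <= e.
Proof. by move=> e0 Ae; rewrite /Num.Def.normr /= mx_normrE bigmax_le // => -[a b] _ /=. Qed.

Lemma norm_mulmx m n (u : 'rV[R]_m) (A : 'M[R]_(m, n)) : `|u *m A| <= m%:R * `|u| * `|A|.
Proof.
apply: norm_le_entry => [|i j]; first by rewrite !mulr_ge0.
rewrite mxE (le_trans (ler_norm_sum _ _ _)) //.
rewrite (@le_trans _ _ (\sum_(k < m) `|u| * `|A|)) //; last first.
  by rewrite sumr_const card_ord -mulrA mulr_natl.
by apply: ler_sum => k _; rewrite normrM ler_pM // le_entry_norm.
Qed.

End matrix_norm.

Lemma finite_subcover {T : topologicalType} (K : set T) (U : T -> set T) :
  compact K -> (forall x, K x -> nbhs x (U x)) ->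
  exists2 D : seq T, forall x, x \in D -> K x & forall y, K y -> exists2 x, x \in D & U x y.
Proof.
move=> /compact_near_coveringP cK Ux.
(* This filter expresses that a property holds for all sufficiently large finite sequences of
   points. Near-covering compactness applied to it yields the finite subcover. *)
pose F : set_system (seq T) := [set P | exists D0 : seq T, forall D : seq T, {subset D0 <= D} -> P D].
have FF : Filter F.
  split; first by exists [::].
    move=> P Q [D1 D1P] [D2 D2Q]; exists (D1 ++ D2) => D DD; split.
      by apply: D1P => x xD; apply: DD; rewrite mem_cat xD.
    by apply: D2Q => x xD; apply: DD; rewrite mem_cat xD orbT.
  by move=> P Q PQ [D0 D0P]; exists D0 => D /D0P/PQ.
have [|D DK] := cK _ F (fun (D : seq T) y => exists x, [/\ x \in D, K x & U x y]) FF.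
  move=> x Kx; exists (U x, [set D : seq T | x \in D]).
    by split; [exact: Ux | exists [:: x] => D; apply; rewrite mem_head].
  by move=> [y D] /= [Uxy xD]; exists x.
exists [seq x <- D | `[< K x >]]; first by move=> x; rewrite mem_filter => /andP[/asboolP].
move=> y Ky; have [x [xD Kx Uxy]] := DK D (fun x h => h) y Ky.
by exists x => //; rewrite mem_filter xD andbT; apply/asboolP.
Qed.

Section spanning.
Context {R : realType} {n : nat} (M : manifold R n) (L : lmodType R).
Variables (Lam : M -> (L -> R) -> Prop) (r : nat).

(** With [Lam x] the tangent vectors at x, this says that the differentials of the functions s_i
    span the cotangent space. With [Lam x] the functionals on sections that factor through the
    fibre, it says that the s_i span the fibre. *)
Definition spans_at (x : M) (m : nat) (s : 'I_m -> L) : Prop :=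
  forall l, Lam x l -> (forall i, l (s i) = 0) -> forall t, l t = 0.

Hypothesis Lam_linear : forall x l, Lam x l -> forall a s t, l (a *: s + t) = a * l s + l t.
Hypothesis LamZ : forall x l a, Lam x l -> Lam x (fun s => a * l s).

(** A chart map together with coordinate functionals [mu]. They generate the functionals near x, are
    independent at x, and vary in a Lipschitz way with respect to the chart, which is the regularity
    that the counting argument consumes. *)
Definition local_basis (x : M) (kappa : M -> 'rV[R]_n) (mu : 'I_r -> M -> L -> R) : Prop :=
  [/\ {for x, continuous kappa},
      \forall y \near x, forall l, Lam y l ->
        exists v : 'rV[R]_r, forall s, l s = \sum_k v 0 k * mu k y s,
      forall v : 'rV[R]_r, Lam x (fun s => \sum_k v 0 k * mu k x s),
      forall v : 'rV[R]_r, (forall s, \sum_k v 0 k * mu k x s = 0) -> v = 0 &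
      forall s k, exists2 c : R, 0 <= c & exists2 U : set M, nbhs x U &
        forall y z, U y -> U z -> `|mu k y s - mu k z s| <= c * `|kappa y - kappa z| ].

Hypothesis local_basis_exists : forall x, exists kappa mu, local_basis x kappa mu.

Section general_position.
Context {m : nat} (s : 'I_m -> L).

(** On a piece the values (l(s_i))_i have the form v A(y), with A Lipschitz in the chart and v
    controlled by v A(y) with one constant. Spanning at a single point provides a piece around
    it. *)
Let piece (U : set M) (kappa : M -> 'rV[R]_n) (A : M -> 'M[R]_(r, m)) (C : R) : Prop :=
  [/\ forall y l, U y -> Lam y l -> exists v : 'rV[R]_r, forall i, l (s i) = (v *m A y) 0 i,
      forall y (v : 'rV[R]_r), U y -> `|v| <= C * `|v *m A y|,
      forall y z, U y -> U z -> `|A y - A z| <= C * `|kappa y - kappa z| &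
      forall y, U y -> `|kappa y| <= C /\ `|A y| <= C].

Let piece_exists x : spans_at x s -> exists U kappa A C,
  [/\ open U, U x, 0 <= C & piece U kappa A C].
Proof.
move=> spx; have [kappa [mu [ck near_sp Lx indep lip]]] := local_basis_exists x.
pose A y : 'M[R]_(r, m) := \matrix_(k, i) mu k y (s i).
have [B AB] : exists B, A x *m B = 1%:M.
  apply/row_freeP; rewrite -kermx_eq0; apply/rowV0P => v.
  rewrite sub_kermx => /eqP vA; apply: indep; apply: spx (Lx v) _ => i.
  by have /rowP/(_ i) := vA; rewrite !mxE => E; rewrite -[RHS]E; apply: eq_bigr => k _; rewrite mxE.
have [c c0 [U1 U1x lipA]] : exists2 c : R, 0 <= c & exists2 U : set M, nbhs x U &
    forall y z, U y -> U z -> `|A y - A z| <= c * `|kappa y - kappa z|.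
  have /choice[f fP] : forall ki : 'I_r * 'I_m, exists c : R, 0 <= c /\
      exists2 U : set M, nbhs x U & forall y z, U y -> U z ->
      `|mu ki.1 y (s ki.2) - mu ki.1 z (s ki.2)| <= c * `|kappa y - kappa z|.
    by move=> [k i]; have [c c0 H] := lip (s i) k; exists c.
  have /choice[g gP] : forall ki : 'I_r * 'I_m, exists U : set M, nbhs x U /\
      forall y z, U y -> U z ->
      `|mu ki.1 y (s ki.2) - mu ki.1 z (s ki.2)| <= f ki * `|kappa y - kappa z|.
    by move=> ki; have [_ [U Ux H]] := fP ki; exists U.
  have f0 ki : 0 <= f ki by have [] := fP ki.
  exists (\sum_ki f ki); first exact: sumr_ge0.
  exists [set y | forall ki, g ki y].
    by apply: filter_forall => ki; have [] := gP ki.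
  move=> y z gy gz; apply: norm_le_entry => [|k i]; first by rewrite mulr_ge0 ?sumr_ge0.
  rewrite !mxE; have [_ H] := gP (k, i).
  apply: (le_trans (H y z (gy _) (gz _))); rewrite ler_wpM2r //.
  by rewrite (bigD1 (k, i)) //= lerDl sumr_ge0.
(* With this radius, replacing A x by A y costs at most |v|/2 in the estimate |v| <= m |v A(x)| |B|,
   and this half is absorbed on the left. *)
pose eta : R := (2 * (1 + m%:R * r%:R * `|B| * c))^-1.
have den0 : 0 < 1 + m%:R * r%:R * `|B| * c by rewrite ltr_wpDr // !mulr_ge0.
have eta0 : 0 < eta by rewrite invr_gt0 mulr_gt0.
have nk : \forall y \near x, `|kappa x - kappa y| <= eta by have /cvgrPdist_le := ck; apply.
have : nbhs x (U1 `&` [set y | `|kappa x - kappa y| <= eta] `&`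
    [set y | forall l, Lam y l -> exists v : 'rV[R]_r, forall s, l s = \sum_k v 0 k * mu k y s]).
  by apply: filterI => //; exact: filterI.
rewrite nbhsE => -[U [oU Ux] UP].
have U1U y : U y -> U1 y by move=> /UP[[]].
have Ueta y : U y -> `|kappa x - kappa y| <= eta by move=> /UP[[]].
have U1x' : U1 x by exact: U1U.
exists U, kappa, A, (2 * m%:R * `|B| + c + (`|kappa x| + eta) + (`|A x| + c * eta)).
have e1 : 0 <= 2 * m%:R * `|B| by rewrite !mulr_ge0.
have e2 : 0 <= `|kappa x| + eta by rewrite addr_ge0 // ltW.
have e3 : 0 <= `|A x| + c * eta by rewrite addr_ge0 // mulr_ge0 // ltW.
split => //; first by do 3![apply: addr_ge0 => //].
split.
- move=> y l Uy Ll; have [_ H] := UP y Uy; have [v vP] := H l Ll.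
  by exists v => i; rewrite vP mxE; apply: eq_bigr => k _; rewrite mxE.
- move=> y v Uy.
  have vE : v = v *m A y *m B + v *m (A x - A y) *m B.
    by rewrite -mulmxDl -mulmxDr addrC subrK -mulmxA AB mulmx1.
  have h : `|v| <= m%:R * `|v *m A y| * `|B| + `|v| / 2.
    rewrite {1}vE (le_trans (ler_normD _ _)) // lerD ?norm_mulmx //.
    apply: (le_trans (norm_mulmx _ _)).
    have a1 : `|v *m (A x - A y)| <= r%:R * `|v| * (c * eta).
      apply: (le_trans (norm_mulmx _ _)); rewrite ler_wpM2l ?mulr_ge0 //.
      by rewrite (le_trans (lipA x y U1x' (U1U _ Uy))) // ler_wpM2l // Ueta.
    apply: (@le_trans _ _ (m%:R * (r%:R * `|v| * (c * eta)) * `|B|)).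
      by rewrite ler_wpM2r // ler_wpM2l.
    have -> : m%:R * (r%:R * `|v| * (c * eta)) * `|B| = `|v| * ((m%:R * r%:R * `|B| * c) * eta).
      by ring.
    rewrite ler_wpM2l // /eta invfM mulrCA -[leRHS]mulr1 ler_wpM2l ?invr_ge0 //.
    by rewrite ler_pdivrMr // mul1r lerDr ler01.
  apply: (@le_trans _ _ (2 * m%:R * `|B| * `|v *m A y|)).
    have : `|v| / 2 <= m%:R * `|v *m A y| * `|B| by lra.
    by rewrite ler_pdivrMr // => /le_trans; apply; rewrite le_eqVlt; apply/orP; left; apply/eqP; ring.
  rewrite ler_wpM2r //; move: e2 e3 c0; lra.
- move=> y z Uy Uz; apply: (le_trans (lipA y z (U1U _ Uy) (U1U _ Uz))).
  rewrite ler_wpM2r //; lra.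
- move=> y Uy; split.
    have : `|kappa y| <= `|kappa x| + eta.
      rewrite -[kappa y](subrK (kappa x)) addrC (le_trans (ler_normD _ _)) // lerD2l distrC.
      exact: Ueta.
    lra.
  have : `|A y| <= `|A x| + c * eta.
    rewrite -[A y](subrK (A x)) addrC (le_trans (ler_normD _ _)) // lerD2l distrC.
    by rewrite (le_trans (lipA x y U1x' (U1U _ Uy))) // ler_wpM2l // Ueta.
  lra.
Qed.

(** The vectors (l(s_i))_i arising over K depend on n + r parameters, the chart coordinates of the
    point and the coefficients of l. If they reached every positive w they would reach all the grid
    points w + 1, contradicting [grid_pigeonhole] as n + r < m. *)
Lemma general_position (K : set M) : compact K -> (n + r < m)%N ->
  (forall x, K x -> spans_at x s) ->
  exists2 w : 'I_m -> R, forall i, 0 < w i &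
    forall x l, K x -> Lam x l -> ~ forall i, l (s i) = w i.
Proof.
move=> cK nrm spK; apply: contrapT => noW.
have hit (w : 'I_m -> R) : (forall i, 0 < w i) -> exists x l, [/\ K x, Lam x l & forall i, l (s i) = w i].
  move=> w0; apply: contrapT => no; apply: noW; exists w => // x l Kx Lx lw.
  by apply: no; exists x, l.
have /choice[U UP] : forall x, exists U : set M, [/\ open U, K x -> U x &
    K x -> exists kappa A C, 0 <= C /\ piece U kappa A C].
  move=> x; have [Kx|nKx] := pselect (K x); last first.
    by exists setT; split => //; exact: openT.
  by have [U [ka [A [C [oU Ux C0 pc]]]]] := piece_exists (spK x Kx); exists U; split => // _; exists ka, A, C.
have [x Kx|D DK Kcov] := finite_subcover cK (U := U).
  by apply: open_nbhs_nbhs; have [oU /(_ Kx) Ux _] := UP x.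
pose p := size D.
have /choice[Z ZP] : forall j : 'I_p, exists Z : (M -> 'rV[R]_n) * (M -> 'M[R]_(r, m)) * R,
    0 <= Z.2 /\ piece (U (tnth (in_tuple D) j)) Z.1.1 Z.1.2 Z.2.
  move=> j; set x := tnth _ _.
  have Kx : K x by apply: DK; exact: mem_tnth.
  by have [_ _ /(_ Kx)[ka [A [C H]]]] := UP x; exists (ka, A, C).
pose C := \sum_j (Z j).2.
have CZ j : (Z j).2 <= C.
  by rewrite /C (bigD1 j) //= lerDl sumr_ge0 // => i _; have [] := ZP i.
have C0 : 0 <= C by apply: sumr_ge0 => j _; have [] := ZP j.
pose V j := U (tnth (in_tuple D) j).
pose ka j := (Z j).1.1; pose A j := (Z j).1.2.
have A_inj j y (v : 'rV[R]_r) : V j y -> `|v| <= C * `|v *m A j y|.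
  have [_ [_ H _ _]] := ZP j; move=> Vy; apply: (le_trans (H y v Vy)).
  by rewrite ler_wpM2r.
have A_lip j y z : V j y -> V j z -> `|A j y - A j z| <= C * `|ka j y - ka j z|.
  have [_ [_ _ H _]] := ZP j; move=> Vy Vz; apply: (le_trans (H y z Vy Vz)).
  by rewrite ler_wpM2r.
have kaC j y : V j y -> `|ka j y| <= C.
  by have [_ [_ _ _ H]] := ZP j; move=> /H[h _]; exact: le_trans (CZ j).
have AC j y : V j y -> `|A j y| <= C.
  by have [_ [_ _ _ H]] := ZP j; move=> /H[_ h]; exact: le_trans (CZ j).
(* The point of M is recorded at scale k, because v may be as large as C k and multiplies the
   variation of A with the point. *)
pose T (k : nat) (w : 'I_m -> 'I_k) (j : 'I_p) (zeta : 'I_(n + r) -> R) :=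
  exists y (v : 'rV[R]_r), [/\ V j y, `|v| <= C * k%:R,
    forall i, (w i : nat)%:R + 1 = (v *m A j y) 0 i &
    forall i, zeta i = row_mx (k%:R *: ka j y) v 0 i].
apply: (@grid_pigeonhole R p (n + r) m (C + r%:R * C + r%:R * (C * C)) T) => //.
- by rewrite !addr_ge0 // !mulr_ge0.
- move=> k w; have [|x [l [Kx Ll lw]]] := hit (fun i => (w i : nat)%:R + 1).
    by move=> i; rewrite ltr_wpDl.
  have [x' Dx' Ux] := Kcov x Kx.
  have pD : (index x' D < p)%N by rewrite index_mem.
  pose j := Ordinal pD.
  have Vx : V j x by rewrite /V (tnth_nth x') /= nth_index.
  have [_ [Hv _ _ _]] := ZP j; have [v vP] := Hv x l Vx Ll.
  have vk : `|v| <= C * k%:R.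
    apply: (le_trans (A_inj j x v Vx)); rewrite ler_wpM2l //.
    apply: norm_le_entry => // a b; rewrite ord1 -vP lw ger0_norm ?addr_ge0 //.
    by rewrite natr1 ler_nat.
  exists j, (fun i => row_mx (k%:R *: ka j x) v 0 i); split.
    by exists x, v; split => // i; rewrite -vP lw.
  have Ck0 : 0 <= C * k%:R by rewrite mulr_ge0.
  move=> i; apply: (@le_trans _ _ (C * k%:R)); last first.
    by rewrite ler_wpM2r // -addrA lerDl addr_ge0 // !mulr_ge0.
  rewrite mxE; case: (fintype.split i) => i'.
    rewrite mxE normrM normr_nat mulrC ler_wpM2r //.
    exact: le_trans (le_entry_norm _ _ _) (kaC j x Vx).
  exact: le_trans (le_entry_norm _ _ _) vk.
move=> k w w' j zeta zeta' e e0 [y [v [Vy vk wv zv]]] [y' [v' [Vy' vk' wv' zv']]] close i.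
have -> : (w i : nat)%:R - (w' i : nat)%:R = (v *m A j y) 0 i - (v' *m A j y') 0 i.
  by rewrite -wv -wv' opprD addrACA subrr addr0.
have k_gt0 : 0 < k%:R :> R by rewrite ltr0n (leq_ltn_trans _ (ltn_ord (w i))).
have vv : `|v - v'| <= e.
  apply: norm_le_entry => // a b; rewrite ord1.
  by have := close (rshift n b); rewrite zv zv' !row_mxEr !mxE.
have kk : k%:R * `|ka j y - ka j y'| <= e.
  rewrite -[X in X * _]ger0_norm // -normrZ; apply: norm_le_entry => // a b; rewrite ord1.
  have := close (lshift r b); rewrite zv zv' !row_mxEl !mxE.
  by rewrite mulrBr.
have -> : (v *m A j y) 0 i - (v' *m A j y') 0 i =
    ((v - v') *m A j y + v' *m (A j y - A j y')) 0 i.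
  by rewrite mulmxBl mulmxBr addrA subrK !mxE.
apply: (le_trans (le_entry_norm _ _ _)); apply: (le_trans (ler_normD _ _)).
have b1 : `|(v - v') *m A j y| <= r%:R * C * e.
  apply: (le_trans (norm_mulmx _ _)).
  by rewrite -!mulrA ler_wpM2l // mulrC ler_pM // AC.
have b2 : `|v' *m (A j y - A j y')| <= r%:R * (C * C) * e.
  apply: (le_trans (norm_mulmx _ _)).
  apply: (@le_trans _ _ (r%:R * (C * k%:R) * (C * `|ka j y - ka j y'|))).
    rewrite -!mulrA ler_wpM2l // [leRHS]mulrA ler_pM //.
    exact: A_lip.
  have -> : r%:R * (C * k%:R) * (C * `|ka j y - ka j y'|) = r%:R * (C * C) * (k%:R * `|ka j y - ka j y'|).
    by ring.
  by rewrite ler_wpM2l // !mulr_ge0.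
have b3 : 0 <= C * e by rewrite mulr_ge0.
lra.
Qed.

End general_position.

(** Project along a direction w in general position, replacing s_i by s_i - (w_i / w_m) s_m. A
    functional killing the new family has values proportional to w on the old one. By the choice of
    w the factor is 0, so it kills the old family as well. *)
Lemma spans_reduce (m : nat) (s : 'I_m.+1 -> L) (K : set M) : compact K -> (n + r < m.+1)%N ->
  (forall x, K x -> spans_at x s) ->
  exists s' : 'I_m -> L, forall x, K x -> spans_at x s'.
Proof.
move=> cK nrm spK; have [w w0 wP] := general_position cK nrm spK.
exists (fun i => - (w (lift ord_max i) / w ord_max) *: s ord_max + s (lift ord_max i)).
move=> x Kx l Ll l0.
have wm0 : w ord_max != 0 by rewrite gt_eqF.
have E i : l (s i) = l (s ord_max) / w ord_max * w i.
  have [j ->|->] := unliftP ord_max i; last by rewrite divfK.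
  have := l0 j; rewrite (Lam_linear Ll) => /eqP; rewrite mulNr addrC subr_eq0 => /eqP->.
  by rewrite mulrAC mulrC; ring.
have [t0|t0] := eqVneq (l (s ord_max) / w ord_max) 0.
  by apply: (spK x Kx l Ll) => i; rewrite (E i) t0 mul0r.
exfalso; apply: (wP x _ Kx (LamZ (l (s ord_max) / w ord_max)^-1 Ll)) => i.
by rewrite (E i) mulrA mulVf // mul1r.
Qed.

Hypothesis local_span : forall x : M, exists s : 'I_r -> L, \forall y \near x, spans_at y s.

(** A finite subcover by local spanning families gives some spanning family, which [spans_reduce]
    shortens to n + r members. The point is that this number does not depend on K. *)
Lemma spans_compact (K : set M) : compact K ->
  exists s : 'I_(n + r) -> L, forall x, K x -> spans_at x s.
Proof.
move=> cK.
have /choice[f fP] : forall x : M, exists f : 'I_r -> L, \forall y \near x, spans_at y f.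
  exact: local_span.
have [x Kx|D DK Kcov] := finite_subcover cK (U := fun x => [set y | spans_at y (f x)]).
  exact: fP.
have [m [s sP]] : exists m (s : 'I_m -> L), forall x, K x -> spans_at x s.
  exists #|{: 'I_(size D) * 'I_r}|.
  exists (fun i => let ji := enum_val i in f (tnth (in_tuple D) ji.1) ji.2).
  move=> x Kx l Ll l0; have [x' Dx' spx] := Kcov x Kx.
  apply: (spx l Ll) => k.
  have pD : (index x' D < size D)%N by rewrite index_mem.
  have := l0 (enum_rank (Ordinal pD, k)).
  by rewrite enum_rankK /= (tnth_nth x') /= nth_index.
elim: m s sP => [|m IH] s sP.
  exists (fun=> 0) => x Kx l Ll _; apply: (sP x Kx l Ll); by case.
have [nrm|mnr] := ltnP (n + r) m.+1.
  by have [s' /IH] := spans_reduce cK nrm sP.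
exists (fun i => oapp s 0 (insub (i : nat))) => x Kx l Ll l0.
apply: (sP x Kx l Ll) => i; have := l0 (widen_ord mnr i).
rewrite /= insubT; first exact: ltn_ord.
move=> im /=; suff -> : Sub (i : nat) im = i by [].
exact: val_inj.
Qed.

Hypothesis glue : forall (sigma : Cinf M) (u : nat -> L), (forall x, 0 <= sigma x) ->
  exists S : L, forall (k : nat) x l, Lam x l -> `|sigma x - k%:R| <= 1 / 4 -> l S = l (u k).

(** All sublevel sets of τ have spanning families of the same size d = n + r, so their members can
    be glued index by index. Two gluings, governed by τ/2 and by (τ + 1)/2, take care of the shells
    around even and around odd values of τ, and 2d elements suffice. *)
Lemma finite_spanning : exists N (s : 'I_N -> L), forall x, spans_at x s.
Proof.
have [tau [tau0 ctau]] := exhaustion M.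
pose d := (n + r)%N.
have /choice[u uP] : forall m : nat, exists u : 'I_d -> L, forall x, tau x <= m%:R -> spans_at x u.
  by move=> m; have [s sP] := spans_compact (ctau m); exists s.
have [sig0 E0] : exists sig : Cinf M, forall x, sig x = tau x / 2.
  by exists (2^-1 *: tau) => x; rewrite mulrC.
have [sig1 E1] : exists sig : Cinf M, forall x, sig x = (tau x + 1) / 2.
  by exists (2^-1 *: (tau + 1)) => x; rewrite mulrC.
have /choice[S0 S0P] : forall i : 'I_d, exists S : L, forall (k : nat) x l, Lam x l ->
    `|sig0 x - k%:R| <= 1 / 4 -> l S = l (u (2 * k + 2)%N i).
  by move=> i; apply: (glue (fun k => u (2 * k + 2)%N i)) => x; rewrite E0 divr_ge0.
have /choice[S1 S1P] : forall i : 'I_d, exists S : L, forall (k : nat) x l, Lam x l ->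
    `|sig1 x - k%:R| <= 1 / 4 -> l S = l (u (2 * k + 2)%N i).
  by move=> i; apply: (glue (fun k => u (2 * k + 2)%N i)) => x; rewrite E1 divr_ge0 // addr_ge0.
exists (d + d)%N, (fun i => match fintype.split i with inl j => S0 j | inr j => S1 j end).
move=> x l Ll l0.
have l00 j : l (S0 j) = 0 by have := l0 (lshift d j); rewrite (unsplitK (inl j)).
have l01 j : l (S1 j) = 0 by have := l0 (rshift d j); rewrite (unsplitK (inr j)).
have t0 : 0 <= tau x + 2^-1 by rewrite addr_ge0.
(* b is a nearest integer to τ x. According to its parity, τ x / 2 or (τ x + 1) / 2 is within 1/4 of
   an integer k, and τ x <= 2k + 2. *)
pose b := Num.truncn (tau x + 2^-1).
have /andP[b1 b2] : b%:R <= tau x + 2^-1 < b.+1%:R := truncn_itv t0.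
rewrite -[b.+1%:R]natr1 in b2.
have bE : b%:R = (odd b)%:R + 2 * (b./2)%:R :> R.
  by rewrite -[in LHS](odd_double_half b) natrD -mul2n natrM.
case ob : (odd b) in bE.
  have {}bE : b%:R = 1 + 2 * (b./2)%:R :> R by rewrite bE.
  have cl : `|sig1 x - (b./2.+1)%:R| <= 1 / 4.
    rewrite E1 -[(b./2).+1%:R]natr1 ler_norml; apply/andP; split; lra.
  apply: (uP (2 * (b./2).+1 + 2)%N x _ l Ll) => [|i]; last by rewrite -(S1P i _ x l Ll cl).
  rewrite natrD natrM -[(b./2).+1%:R]natr1; lra.
have {}bE : b%:R = 2 * (b./2)%:R :> R by rewrite bE add0r.
have cl : `|sig0 x - (b./2)%:R| <= 1 / 4.
  rewrite E0 ler_norml; apply/andP; split; lra.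
apply: (uP (2 * b./2 + 2)%N x _ l Ll) => [|i]; last by rewrite -(S0P i _ x l Ll cl).
rewrite natrD natrM; lra.
Qed.

End spanning.

(** * Tangent vectors as derivations at a point *)

Section tangent_vectors.
Context {R : realType} {n : nat} {M : manifold R n}.
Implicit Types (c : chart R n M) (W : set M) (x : M) (f g : Cinf M).

Lemma CinfE_add f g x : (f + g) x = f x + g x. Proof. by []. Qed.
Lemma CinfE_mul f g x : (f * g) x = f x * g x. Proof. by []. Qed.
Lemma CinfE_sub f g x : (f - g) x = f x - g x. Proof. by []. Qed.
Lemma CinfE_scale a f x : (a *: f) x = a * f x. Proof. by []. Qed.

Lemma Cinf_ext f g : (forall x, f x = g x) -> f = g.
Proof. by move=> fg; apply/val_inj/funext. Qed.

Lemma smooth_extend (g : M -> R) W x : open W -> W x -> smooth_on W g ->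
  exists2 G : Cinf M, \forall y \near x, G y = g y & forall y, ~ W y -> G y = 0.
Proof.
move=> oW Wx sg; have [chi [_ [K [cK KW] chi0]] chi1] := bump_exists oW Wx.
pose G y := if pselect (W y) then chi y * g y else 0.
have GW y : W y -> G y = chi y * g y by rewrite /G; case: pselect.
have GnW y : ~ W y -> G y = 0 by rewrite /G; case: pselect.
have sG : smooth_on setT G.
  apply: smooth_on_local => y _; have [Wy|nWy] := pselect (W y).
    exists W; split => //; apply: (@smooth_on_ext _ _ _ _ (fun z => chi z * g z)) => //.
      by move=> z Wz; rewrite GW.
    by apply: smoothM => //; exact: smooth_on_sub (CinfP chi).
  have oK : open (~` K).
    by apply: closed_openC; apply: compact_closed => //; exact: manifold_hausdorff.
  exists (~` K); split => //; first by move=> Ky; apply/nWy/KW.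
  apply: (@smooth_on_ext _ _ _ _ (fun=> 0)) => //; last exact: smooth_cst.
  move=> z nKz; have [Wz|nWz] := pselect (W z); last by rewrite GnW.
  by rewrite GW // chi0 // mul0r.
exists (mkCinf sG); last by move=> y nWy; rewrite /= GnW.
have nW : \forall y \near x, W y by exact: open_nbhs_nbhs.
by apply: filterS2 chi1 nW => y cy Wy; rewrite /= GW // cy mul1r.
Qed.

Section pointwise_derivations.
Variables (x : M) (v : Cinf M -> R).
Hypothesis vP : v \in TM_pred x.

Lemma TM_linear a f g : v (a *: f + g) = a * v f + v g.
Proof. by have /asboolP[+ _] := vP; apply. Qed.

Lemma TM_leibniz f g : v (f * g) = v f * g x + f x * v g.
Proof. by have /asboolP[_] := vP; apply. Qed.

Lemma TMD f g : v (f + g) = v f + v g.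
Proof. by have := TM_linear 1 f g; rewrite scale1r mul1r. Qed.

Lemma TM0 : v 0 = 0.
Proof. by have := TMD 0 0; rewrite addr0 => /eqP; rewrite -subr_eq subrr eq_sym => /eqP. Qed.

Lemma TMZ a f : v (a *: f) = a * v f.
Proof. by have := TM_linear a f 0; rewrite !addr0 TM0 addr0. Qed.

Lemma TMB f g : v (f - g) = v f - v g.
Proof. by rewrite -scaleN1r TMD TMZ mulN1r. Qed.

Lemma TM_sum (I : Type) (r : seq I) (F : I -> Cinf M) :
  v (\sum_(i <- r) F i) = \sum_(i <- r) v (F i).
Proof. by elim: r => [|i r IH]; rewrite ?big_nil ?TM0 // !big_cons TMD IH. Qed.

Lemma TM_one : v 1 = 0.
Proof.
have one : Cinf_fun (1 : Cinf M) x = 1 by [].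
have := TM_leibniz 1 1; rewrite mulr1 one mulr1 mul1r => /eqP.
by rewrite -subr_eq subrr eq_sym => /eqP.
Qed.

(** If χ is 1 at x and supported where f = g, then χ (f - g) = 0. Applying the Leibniz rule to this
    product gives v(f - g) = 0. *)
Lemma TM_near f g : (\forall y \near x, f y = g y) -> v f = v g.
Proof.
move=> fg; have : nbhs x [set y | f y = g y] := fg.
rewrite nbhsE => -[W [oW Wx] Wfg].
have [chi [_ [K [_ KW] chi0]] chi1] := bump_exists oW Wx.
have E : chi * (f - g) = 0.
  apply: Cinf_ext => y; rewrite CinfE_mul.
  have [/KW/Wfg e|nK] := pselect (K y); last by rewrite chi0 // mul0r.
  by rewrite CinfE_sub e subrr mulr0.
have := TM_leibniz chi (f - g); rewrite E TM0 TMB.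
rewrite CinfE_sub (nbhs_singleton fg) subrr mulr0 add0r.
by rewrite (nbhs_singleton chi1) mul1r => /esym/eqP; rewrite subr_eq0 => /eqP.
Qed.

End pointwise_derivations.

Definition pd c (k : 'I_n) x f : R := 'D_(unit_vec k) (f \o cinv c) (cmap c x).

Lemma Ck_chart c f k : atlas c -> Ck k (cmap c @` cdom c) (f \o cinv c).
Proof. by move=> Ac; have := CinfP f Ac k; rewrite setIT. Qed.

Lemma derivable_chart c f x v : atlas c -> cdom c x -> derivable (f \o cinv c) (cmap c x) v.
Proof.
move=> Ac cx; have [_ /(_ v)[+ _]] := (CkSP 0 _ (@cimg_open _ _ _ c)).1 (@Ck_chart c f 1 Ac).
by apply; exists x.
Qed.

Lemma pd_TM c k x : atlas c -> cdom c x -> pd c k x \in TM_pred x.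
Proof.
move=> Ac cx; have D f := @derivable_chart c f x (unit_vec k) Ac cx.
apply/asboolP; split=> [a f g|f g].
  rewrite /pd; have -> : ((a *: f + g : Cinf M) \o cinv c) = a *: (f \o cinv c) + (g \o cinv c) by [].
  by rewrite deriveD ?deriveZ //; exact: derivableZ.
rewrite /pd; have -> : ((f * g : Cinf M) \o cinv c) = (f \o cinv c) * (g \o cinv c) by [].
rewrite deriveM // /= chartK // addrC; congr (_ + _); exact: mulrC.
Qed.

Lemma pd_near c k x f (F : 'rV[R]_n -> R) : cdom c x ->
  (\forall y \near x, cdom c y -> f y = F (cmap c y)) -> pd c k x f = 'D_(unit_vec k) F (cmap c x).
Proof.
move=> cx fF; have : nbhs x [set y | cdom c y -> f y = F (cmap c y)] := fF.
rewrite nbhsE => -[W [oW Wx] WF].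
have Vx : (cmap c @` (cdom c `&` W)) (cmap c x) by exists x.
have fg y : (cmap c @` (cdom c `&` W)) y -> (f \o cinv c) y = F y.
  by move=> [z [cz Wz] <-] /=; rewrite chartK // WF.
have H := near_open (@open_chart_image _ _ _ c W oW) Vx fg.
exact: (near_eq_derive (unit_vec k) H).
Qed.

Lemma coord_extend c x : atlas c -> cdom c x -> exists2 y : 'I_n -> Cinf M,
  (forall i, \forall z \near x, y i z = cmap c z 0 i) &
  \forall z \near x, forall i k, pd c k z (y i) = (i == k)%:R.
Proof.
move=> Ac cx.
have /choice[y yP] : forall i, exists y : Cinf M, \forall z \near x, y z = cmap c z 0 i.
  move=> i; have [y yx _] := smooth_extend (@cdom_open _ _ _ c) cx (smooth_on_coord i Ac).
  by exists y.
exists y => //.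
have all : \forall z \near x, forall i, y i z = cmap c z 0 i by exact: filter_forall.
have cnear : \forall z \near x, cdom c z by apply: open_nbhs_nbhs; split => //; exact: cdom_open.
have : nbhs x ([set z | forall i, y i z = cmap c z 0 i] `&` cdom c) by exact: filterI.
rewrite nbhsE => -[W [oW Wx] WP].
have : nbhs x W by exact: open_nbhs_nbhs.
apply: filterS => z Wz i k; have [_ cz] := WP z Wz.
rewrite (@pd_near c k z (y i) (fun u : 'rV[R]_n => u 0 i)) //.
  by have [_ ->] := is_derive_coord i (cmap c z) (unit_vec k); rewrite mxE eqxx.
have : nbhs z W by exact: open_nbhs_nbhs.
by apply: filterS => t /WP[H _] _; exact: H.
Qed.

(* By Hadamard's lemma, [f] is, near [x], its value at [x] plus a combination  *)
(* of the coordinates with smooth coefficients.                                *)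
Lemma TM_basis c x : atlas c -> cdom c x -> forall v : Cinf M -> R, v \in TM_pred x ->
  exists a : 'rV[R]_n, forall f, v f = \sum_k a 0 k * pd c k x f.
Proof.
move=> Ac cx; have [y yx pdy] := coord_extend Ac cx.
pose a := cmap c x.
have yxx i : y i x = a 0 i by exact: nbhs_singleton (yx i).
(* The functions g_i do not depend on v. Comparing v with the partial derivatives at x identifies
   g_i(x) as the i-th partial derivative of f. *)
have main f : exists g : 'I_n -> Cinf M, forall v, v \in TM_pred x ->
    v f = \sum_i v (y i) * g i x.
  have : nbhs a (cmap c @` cdom c).
    by apply: open_nbhs_nbhs; split; [exact: cimg_open | exists x].
  move=> /nbhs_ballP[e /= e0 eimg].
  pose U : set 'rV[R]_n := [set z | `|z - a| < e].
  have Uimg : U `<=` cmap c @` cdom c by move=> z Uz; apply: eimg; rewrite -ball_normE /= distrC.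
  have [G [CG GE]] := hadamard (a := a) (e := e)
    (fun k => Ck_sub Uimg (@Ck_chart c f k Ac)).
  pose W := cdom c `&` [set z | U (cmap c z)].
  have nUa : nbhs a U by apply/nbhs_ballP; exists e => //= z; rewrite -ball_normE /= distrC.
  have oU : open U.
    have -> : U = ball a e by apply/seteqP; split=> z; rewrite -ball_normE /= /U /= distrC.
    exact: ball_open.
  have oW : open W.
    apply: open_of_nbhs => z [cz Uz]; apply: (near_chart cz).
    exact: open_nbhs_nbhs.
  have Wx : W x by split => //; rewrite /U /= subrr normr0.
  have /choice[g gP] : forall i, exists g : Cinf M, \forall z \near x, g z = G i (cmap c z).
    move=> i; have sG : smooth_on W (G i \o cmap c).
      apply: (smooth_on_chart Ac oW) => [z []//|k].
      have oWi : open (cmap c @` W).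
        rewrite (_ : W = cdom c `&` W); first exact: open_chart_image.
        by apply/seteqP; split=> z [cz Uz].
      apply: (@Ck_ext _ _ _ _ (G i)) => //.
        by move=> _ [z [cz Uz] <-] /=; rewrite chartK.
      by apply: Ck_sub (CG i k) => _ [z [cz Uz] <-].
    by have [g gx _] := smooth_extend oW Wx sG; exists g.
  exists g => v vP.
  have near_f : \forall z \near x, f z = (f x *: (1 : Cinf M) + \sum_i (y i - a 0 i *: (1 : Cinf M)) * g i) z.
    have y_all : \forall z \near x, forall i, y i z = cmap c z 0 i by exact: filter_forall.
    have g_all : \forall z \near x, forall i, g i z = G i (cmap c z) by exact: filter_forall.
    have nW : \forall z \near x, W z by exact: open_nbhs_nbhs.
    apply: filterS3 y_all g_all nW => z yz gz [cz Uz].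
    have -> : (f x *: (1 : Cinf M) + \sum_i (y i - a 0 i *: (1 : Cinf M)) * g i) z =
        f x + \sum_i (y i z - a 0 i) * g i z.
      rewrite CinfE_add; congr (_ + _); first by rewrite CinfE_scale mulr1.
      have sumE (r : seq 'I_n) : (\sum_(i <- r) (y i - a 0 i *: (1 : Cinf M)) * g i) z =
          \sum_(i <- r) (y i z - a 0 i) * g i z.
        elim: r => [|i r IH]; first by rewrite !big_nil.
        rewrite !big_cons CinfE_add IH; congr (_ + _).
        by rewrite CinfE_mul CinfE_sub CinfE_scale mulr1.
      exact: sumE.
    have := GE (cmap c z) Uz; rewrite /= !chartK // => E.
    rewrite -[LHS](subrK (f x)) E addrC; congr (_ + _).
    by apply: eq_bigr => i _; rewrite yz gz.
  rewrite (TM_near vP near_f) (TMD vP) (TMZ vP) (TM_one vP) mulr0 add0r (TM_sum vP).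
  apply: eq_bigr => i _; rewrite (TM_leibniz vP) (TMB vP) (TMZ vP) (TM_one vP) mulr0 subr0.
  by rewrite CinfE_sub CinfE_scale mulr1 yxx subrr mul0r addr0.
move=> v vP; exists (\row_i v (y i)) => f.
have [g gP] := main f; rewrite (gP v vP); apply: eq_bigr => k _; rewrite mxE; congr (_ * _).
rewrite (gP _ (pd_TM k Ac cx)) (bigD1 k) //= big1 => [|i ik].
  by rewrite (nbhs_singleton pdy) eqxx mul1r addr0.
by rewrite (nbhs_singleton pdy) (negPf ik) mul0r.
Qed.

End tangent_vectors.

(** * Sections of vector bundles, extension and gluing *)

(** The sheaf properties of smooth scalars, which allow the lemmas on sections to be proved once for
    the real bundle E and the complex bundle S. *)
Record local_scalars (R : realType) (n : nat) (M : manifold R n) (K : scalars M) : Prop :=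
  LocalScalars {
  ssmooth_local : forall (U : set M) (f : M -> K),
    (forall x, U x -> exists W, [/\ open W, W x & ssmooth W f]) -> ssmooth U f;
  ssmooth_ext : forall (U : set M) (f g : M -> K), open U ->
    (forall x, U x -> f x = g x) -> ssmooth U f -> ssmooth U g;
  ssmooth_sub : forall (U V : set M) (f : M -> K), V `<=` U -> ssmooth U f -> ssmooth V f;
  semb0 : semb K 0 = 0;
  semb1 : semb K 1 = 1 }.

Lemma local_real_scalars (R : realType) (n : nat) (M : manifold R n) :
  local_scalars (real_scalars M).
Proof.
split=> //; [exact: smooth_on_local | exact: smooth_on_ext | exact: smooth_on_sub].
Qed.

Lemma local_complex_scalars (R : realType) (n : nat) (M : manifold R n) :
  local_scalars (complex_scalars M).
Proof.
split=> //.
- move=> U f Uf; split; apply: smooth_on_local => x /Uf[W [oW Wx [s1 s2]]];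
    by exists W.
- move=> U f g oU fg [s1 s2]; split; [apply: smooth_on_ext s1|apply: smooth_on_ext s2] => //;
    by move=> x Ux; rewrite (fg x Ux).
- by move=> U V f VU [s1 s2]; split; exact: smooth_on_sub VU _.
Qed.

Section bundle_sections.
Context {R : realType} {n : nat} {M : manifold R n} {K : scalars M} {r : nat}.
Variables (locK : local_scalars K) (E : vbundle K r).
Implicit Types (s t : Gamma E) (x y : M) (W : set M) (e : frame r E).

Lemma Gamma_ext s t : (forall x, Gamma_at s x = Gamma_at t x) -> s = t.
Proof. by move=> st; apply/val_inj/functional_extensionality_dep. Qed.

Lemma Gamma_atD s t x : Gamma_at (s + t) x = Gamma_at s x + Gamma_at t x. Proof. by []. Qed.
Lemma Gamma_atB s t x : Gamma_at (s - t) x = Gamma_at s x - Gamma_at t x. Proof. by []. Qed.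
Lemma Gamma_atZ (a : K) s x : Gamma_at (a *: s) x = a *: Gamma_at s x. Proof. by []. Qed.
Lemma Gamma_at0 x : Gamma_at (0 : Gamma E) x = 0. Proof. by []. Qed.
Lemma Gamma_at_fsmul f s x : Gamma_at (fsmul f s) x = semb K (f x) *: Gamma_at s x.
Proof. by []. Qed.
Lemma Gamma_at_sum (I : Type) (q : seq I) (F : I -> Gamma E) x :
  Gamma_at (\sum_(i <- q) F i) x = \sum_(i <- q) Gamma_at (F i) x.
Proof. by elim: q => [|i q IH]; rewrite ?big_nil // !big_cons Gamma_atD IH. Qed.

Definition fcoef e x (v : E x) : 'I_r -> K :=
  xget (fun=> 0) [set c : 'I_r -> K | v = \sum_i c i *: fvec e i x].

Lemma fcoefP e x (v : E x) : frames e -> fdom e x -> v = \sum_i fcoef e v i *: fvec e i x.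
Proof.
move=> Fe ex; have [c [cE _]] := frame_basis Fe ex v.
by have := @xgetI _ (fun=> 0) [set c : 'I_r -> K | v = \sum_i c i *: fvec e i x] c cE.
Qed.

Lemma fcoef_uniq e x (v : E x) c : frames e -> fdom e x ->
  v = \sum_i c i *: fvec e i x -> fcoef e v = c.
Proof.
move=> Fe ex vc; have [d [_ dU]] := frame_basis Fe ex v.
by rewrite -(dU c vc); apply/esym/dU/fcoefP.
Qed.

Lemma fcoef_linear e x (a : K) (v w : E x) i : frames e -> fdom e x ->
  fcoef e (a *: v + w) i = a * fcoef e v i + fcoef e w i.
Proof.
move=> Fe ex; rewrite (@fcoef_uniq e x _ (fun i => a * fcoef e v i + fcoef e w i)) //.
rewrite {1}(fcoefP v Fe ex) {1}(fcoefP w Fe ex) scaler_sumr -big_split /=.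
by apply: eq_bigr => j _; rewrite scalerDl scalerA.
Qed.

Lemma fcoef_fvec e x i j : frames e -> fdom e x -> fcoef e (fvec e j x) i = (i == j)%:R.
Proof.
move=> Fe ex; rewrite (@fcoef_uniq e x _ (fun i => (i == j)%:R)) // (bigD1 j) //= eqxx scale1r.
by rewrite big1 ?addr0 // => k /negPf->; rewrite scale0r.
Qed.

Lemma smooth_sum W (I : Type) (q : seq I) (F : I -> M -> K) :
  (forall i, ssmooth W (F i)) -> ssmooth W (fun x => \sum_(i <- q) F i x).
Proof.
move=> sF; elim: q => [|i q IH].
  have -> : (fun x => \sum_(i <- [::]) F i x) = (fun=> 0) by apply/funext => x; rewrite big_nil.
  exact: ssmooth_cst.
have -> : (fun x => \sum_(j <- i :: q) F j x) = (fun x => F i x + \sum_(j <- q) F j x).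
  by apply/funext => x; rewrite big_cons.
exact: ssmoothD.
Qed.

Lemma fcoef_smooth s e i : frames e -> ssmooth (fdom e) (fun y => fcoef e (Gamma_at s y) i).
Proof.
move=> Fe; have [c sc sE] := GammaP s Fe.
apply: (ssmooth_ext locK (f := c i)) => //; first exact: frame_open.
by move=> x ex; rewrite (fcoef_uniq Fe ex (sE x ex)).
Qed.

(** Around each point one frame is enough, since the coefficients in any other frame are obtained by
    a smooth transition matrix and smoothness is local. *)
Lemma smooth_section_coef (s : dsec E) :
  (forall x, exists e W, [/\ frames e, open W, W x, W `<=` fdom e &
    forall i, ssmooth W (fun y => fcoef e (s y) i)]) -> smooth_section s.
Proof.
move=> Hs e' Fe'; exists (fun i y => fcoef e' (s y) i) => [i|x e'x]; last exact: fcoefP.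
apply: (ssmooth_local locK) => x e'x; have [e [W [Fe oW Wx We sW]]] := Hs x.
exists (W `&` fdom e'); split => //; first by apply: openI => //; exact: frame_open.
have /choice[c cP] : forall j, exists c : 'I_r -> M -> K,
    (forall i, ssmooth (fdom e' `&` fdom e) (c i)) /\
    forall x, fdom e' x -> fdom e x -> fvec e j x = \sum_i c i x *: fvec e' i x.
  by move=> j; have [c c1 c2] := frame_compat Fe' Fe j; exists c.
apply: (ssmooth_ext locK (f := fun y => \sum_j fcoef e (s y) j * c j i y)).
- by apply: openI => //; exact: frame_open.
- move=> y [Wy e'y]; have ey := We y Wy.
  rewrite (@fcoef_uniq e' y (s y) (fun i => \sum_j fcoef e (s y) j * c j i y)) //.
  rewrite {1}(fcoefP (s y) Fe ey).
  under [RHS]eq_bigr do rewrite scaler_suml.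
  rewrite exchange_big /=; apply: eq_bigr => j _.
  have [_ H] := cP j; rewrite (H y e'y ey) scaler_sumr.
  by apply: eq_bigr => k _; rewrite scalerA.
- apply: smooth_sum => j; apply: ssmoothM.
    by apply: (ssmooth_sub locK) (sW j) => y [].
  have [H _] := cP j; apply: (ssmooth_sub locK) (H i) => y [Wy e'y]; split => //.
  exact: We.
Qed.

Lemma smooth_section_local (s : dsec E) :
  (forall x, exists t, \forall y \near x, s y = Gamma_at t y) -> smooth_section s.
Proof.
move=> Hs; apply: smooth_section_coef => x; have [t st] := Hs x.
have [e Fe ex] := frame_cover E x.
have : nbhs x ([set y | s y = Gamma_at t y] `&` fdom e).
  by apply: filterI => //; apply: open_nbhs_nbhs; split => //; exact: frame_open.
rewrite nbhsE => -[W [oW Wx] WP]; exists e, W; split => //.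
  by move=> y /WP[].
move=> i; apply: (ssmooth_ext locK (f := fun y => fcoef e (Gamma_at t y) i)) => //.
  by move=> y /WP[/= -> _].
by apply: (ssmooth_sub locK) (fcoef_smooth t i Fe) => y /WP[].
Qed.

(* Multiplying by [chi] supported in [W] makes the local section [s] global. *)
Lemma section_cutoff (s : dsec E) e W (chi : Cinf M) : frames e -> open W ->
  W `<=` fdom e -> (forall i, ssmooth W (fun y => fcoef e (s y) i)) -> bump_in W chi ->
  exists t, (forall y, W y -> Gamma_at t y = semb K (chi y) *: s y) /\
    forall y, ~ W y -> Gamma_at t y = 0.
Proof.
move=> Fe oW We ss [_ [C [cC CW] chi0]].
pose t y : E y := if pselect (W y) then semb K (chi y) *: s y else 0.
have tW y : W y -> t y = semb K (chi y) *: s y by rewrite /t; case: pselect.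
have tnW y : ~ W y -> t y = 0 by rewrite /t; case: pselect.
have st : smooth_section t.
  apply: smooth_section_coef => x; have [Wx|nWx] := pselect (W x).
    exists e, W; split => // i.
    apply: (ssmooth_ext locK (f := fun y => semb K (chi y) * fcoef e (s y) i)) => //.
      move=> y Wy; rewrite (tW y Wy) -[_ *: s y]addr0 fcoef_linear //; last exact: We.
      suff -> : fcoef e (0 : E y) i = 0 by rewrite addr0.
      rewrite (@fcoef_uniq e y 0 (fun=> 0)) //; first exact: We.
      by rewrite big1 // => k _; rewrite scale0r.
    apply: ssmoothM => //; apply: ssmooth_emb.
    exact: smooth_on_sub (CinfP chi).
  have [e' Fe' e'x] := frame_cover E x.
  have oC : open (~` C).
    by apply: closed_openC; apply: compact_closed => //; exact: manifold_hausdorff.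
  exists e', (fdom e' `&` ~` C); split => //.
  - by apply: openI => //; exact: frame_open.
  - by split => // /CW.
  move=> i; apply: (ssmooth_ext locK (f := fun=> 0)); last exact: ssmooth_cst.
    by apply: openI => //; exact: frame_open.
  move=> y [e'y nCy]; rewrite (@fcoef_uniq e' y (t y) (fun=> 0)) //.
  rewrite big1 => [|k _]; last by rewrite scale0r.
  have [Wy|nWy] := pselect (W y); last by rewrite tnW.
  by rewrite tW // chi0 // (semb0 locK) scale0r.
by exists (mkGamma st).
Qed.

Lemma section_extend (s : dsec E) e W x : frames e -> open W -> W x -> W `<=` fdom e ->
  (forall i, ssmooth W (fun y => fcoef e (s y) i)) ->
  exists t, \forall y \near x, Gamma_at t y = s y.
Proof.
move=> Fe oW Wx We ss; have [chi bchi chi1] := bump_exists oW Wx.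
have [t [tW _]] := section_cutoff Fe oW We ss bchi; exists t.
have nW : \forall y \near x, W y by exact: open_nbhs_nbhs.
by apply: filterS2 chi1 nW => y c1 Wy; rewrite tW // c1 (semb1 locK) scale1r.
Qed.

Lemma frame_extend e x : frames e -> fdom e x ->
  exists sigma : 'I_r -> Gamma E, \forall y \near x, forall i, Gamma_at (sigma i) y = fvec e i y.
Proof.
move=> Fe ex.
have /choice[sigma sP] : forall i, exists t, \forall y \near x, Gamma_at t y = fvec e i y.
  move=> i; apply: (@section_extend (fvec e i) e (fdom e)) => //; first exact: frame_open.
  move=> j; apply: (ssmooth_ext locK (f := fun=> (j == i)%:R)); first exact: frame_open.
    by move=> y ey; rewrite fcoef_fvec.
  exact: ssmooth_cst.
by exists sigma; exact: filter_forall.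
Qed.

Lemma section_through x (v : E x) : exists t, Gamma_at t x = v.
Proof.
have [e Fe ex] := frame_cover E x; have [sigma sP] := frame_extend Fe ex.
exists (\sum_i fcoef e v i *: sigma i); rewrite Gamma_at_sum.
rewrite [RHS](fcoefP v Fe ex); apply: eq_bigr => i _.
by rewrite Gamma_atZ (nbhs_singleton sP).
Qed.

End bundle_sections.

Section smooth_matrices.
Context {R : realType} {n : nat} {M : manifold R n} {m : nat}.
Variables (U : set M) (A : M -> 'M[R]_m).
Hypothesis sA : forall i j, smooth_on U (fun x => A x i j).

Lemma smooth_det : smooth_on U (fun x => \det (A x)).
Proof.
apply: smooth_on_sum => s _; apply: smoothM; first exact: smooth_cst.
by apply: smooth_on_prod => i _; exact: sA.
Qed.

End smooth_matrices.

Lemma smooth_invmx {R : realType} {n : nat} {M : manifold R n} {m : nat} (U : set M)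
    (A : M -> 'M[R]_m) : open U -> (forall i j, smooth_on U (fun x => A x i j)) ->
  (forall x, U x -> A x \in unitmx) -> forall i j, smooth_on U (fun x => invmx (A x) i j).
Proof.
move=> oU sA uA i j.
apply: (@smooth_on_ext _ _ _ _ (fun x => (\det (A x))^-1 * cofactor (A x) j i)) => //.
  by move=> x Ux; rewrite /invmx uA // !mxE.
apply: smoothM.
  apply: smooth_on_inv; last exact: smooth_det.
  by move=> x /uA; rewrite unitmxE unitfE.
rewrite /cofactor; apply: smoothM; first exact: smooth_cst.
apply: (@smooth_det _ _ _ _ U (fun x => row' j (col' i (A x)))) => k l.
rewrite (_ : (fun x => _) = fun x => A x (lift j k) (lift i l)) //.
by apply/funext => x; rewrite !mxE.
Qed.

Section integer_cutoffs.
Context {R : realType} {n : nat} {M : manifold R n} (sigma : Cinf M).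
Hypothesis sigma_ge0 : forall x, 0 <= sigma x.

(** The factor 36/5 is the inverse of 1/4 - 1/9. It makes the argument of [step] at least 1 when |σ
    - k| <= 1/3 and at most 0 when |σ - k| >= 1/2, so near a point with σ close to k only the cutoff
    of index k survives. *)
Let cut (k : nat) (x : M) : R := step ((4^-1 - (sigma x - k%:R) * (sigma x - k%:R)) * (36 / 5)).

Let cut_smooth k : smooth_on setT (cut k).
Proof.
have s1 : smooth_on setT (fun x => sigma x - k%:R).
  by apply: smooth_onB; [exact: CinfP | exact: smooth_cst].
apply/smooth_on_step/smoothM; last exact: smooth_cst.
by apply: smooth_onB; [exact: smooth_cst | exact: smoothM].
Qed.

Definition cutoff k : Cinf M := mkCinf (cut_smooth k).
Arguments cutoff : simpl never.

Lemma cutoff_eq1 k x : `|sigma x - k%:R| <= 1 / 3 -> cutoff k x = 1.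
Proof.
rewrite ler_norml => /andP[h1 h2]; rewrite /cutoff /= /cut; set u := sigma x - k%:R in h1 h2 *.
apply: step_eq1; suff : u * u <= 1 / 9 by lra.
by nra.
Qed.

Lemma cutoff_eq0 k x : 1 / 2 <= `|sigma x - k%:R| -> cutoff k x = 0.
Proof.
move=> h; rewrite /cutoff /= /cut; set u := sigma x - k%:R in h *.
apply: step_eq0; suff : 1 / 4 <= u * u by lra.
by move: h; rewrite ler_normr => /orP[] h; nra.
Qed.

Definition cut_bound (x : M) : nat := (Num.truncn (sigma x)).+2.

Lemma cutoff_bound k x : (cut_bound x <= k)%N -> cutoff k x = 0.
Proof.
move=> xk; apply: cutoff_eq0; have /andP[_ h] := truncn_itv (sigma_ge0 x).
have : (Num.truncn (sigma x)).+2%:R <= k%:R :> R by rewrite ler_nat.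
rewrite -[_.+2%:R]natr1 => h2; rewrite ler_normr; apply/orP; right; lra.
Qed.

Lemma cut_bound_near x : \forall y \near x, (cut_bound y <= (cut_bound x).+1)%N.
Proof.
have := @Cinf_continuous _ _ _ sigma x => /cvgrPdist_lt/(_ 1 ltr01).
apply: filterS => y; rewrite ltr_norml => /andP[h1 _].
rewrite /cut_bound !ltnS -ltnS -(ltr_nat R).
have /andP[h2 _] := truncn_itv (sigma_ge0 y).
have /andP[_ h3] := truncn_itv (sigma_ge0 x).
rewrite -[_.+2%:R]natr1; lra.
Qed.

Lemma cutoff_near k x : `|sigma x - k%:R| <= 1 / 4 ->
  \forall y \near x, (k < cut_bound y)%N /\ forall j, cutoff j y = (j == k)%:R.
Proof.
move=> h; have c : \forall y \near x, `|sigma x - sigma y| < 1 / 12.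
  by have := @Cinf_continuous _ _ _ sigma x => /cvgrPdist_lt; apply.
apply: filterS c => y c; have h3 : `|sigma y - k%:R| <= 1 / 3.
  move: c h; rewrite ltr_norml !ler_norml => /andP[c1 c2] /andP[h1 h2].
  by apply/andP; split; lra.
split.
  have /andP[_ h2] := truncn_itv (sigma_ge0 y).
  move: h3; rewrite ler_norml => /andP[h4 h5].
  rewrite /cut_bound -(ltr_nat R) -[_.+2%:R]natr1; lra.
move=> j; have [->|jk] := eqVneq j k; first by rewrite cutoff_eq1.
apply: cutoff_eq0; move: h3; rewrite ler_norml => /andP[h4 h5].
rewrite ler_normr; move: jk; rewrite neq_ltn => /orP[jk|jk].
  have : j.+1%:R <= k%:R :> R by rewrite ler_nat.
  by rewrite -[_.+1%:R]natr1 => ?; apply/orP; left; lra.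
have : k.+1%:R <= j%:R :> R by rewrite ler_nat.
by rewrite -[_.+1%:R]natr1 => ?; apply/orP; right; lra.
Qed.

Lemma cutoff_sum_eq (F : lmodType R) (u : nat -> F) x m : (cut_bound x <= m)%N ->
  \sum_(k < cut_bound x) cutoff k x *: u k = \sum_(k < m) cutoff k x *: u k.
Proof.
move=> /subnK<-; rewrite -!(big_mkord xpredT (fun k => cutoff k x *: u k)).
elim: (m - _)%N => // j IH; rewrite addSn [RHS]big_nat_recr // -IH.
rewrite cutoff_bound ?leq_addl // scale0r; exact/esym/addr0.
Qed.

Lemma cutoff_sum_pick (F : lmodType R) (u : nat -> F) x k : (k < cut_bound x)%N ->
  (forall j, cutoff j x = (j == k)%:R) -> \sum_(j < cut_bound x) cutoff j x *: u j = u k.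
Proof.
move=> kx ck; rewrite (bigD1 (Ordinal kx)) // ck eqxx scale1r big1 => [|j jk]; first exact: addr0.
rewrite ck; case: eqP => [jk'|]; last by rewrite scale0r.
by case/eqP: jk; exact/val_inj.
Qed.

End integer_cutoffs.

Section glueing.
Context {R : realType} {n : nat} {M : manifold R n} {r : nat} (E : vbundle (real_scalars M) r).

(** Around a point with |σ - k| <= 1/4 the locally finite sum Σ χ_j u_j reduces to u_k on a whole
    neighbourhood, so every derivation at the point sees u_k. *)
Lemma glue_functions (sigma : Cinf M) (u : nat -> Cinf M) : (forall x, 0 <= sigma x) ->
  exists S : Cinf M, forall (k : nat) x (l : Cinf M -> R), l \in TM_pred x ->
    `|sigma x - k%:R| <= 1 / 4 -> l S = l (u k).
Proof.
move=> s0; pose S x := \sum_(k < cut_bound sigma x) cutoff sigma k x *: (u k x : R^o).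
have sS : smooth_on setT S.
  apply: smooth_on_local => x _; have := cut_bound_near s0 x => nx.
  have : nbhs x [set y | (cut_bound sigma y <= (cut_bound sigma x).+1)%N] := nx.
  rewrite nbhsE => -[W [oW Wx] WP]; exists W; split => //.
  apply: (@smooth_on_ext _ _ _ _
    (fun y => \sum_(k < (cut_bound sigma x).+1) cutoff sigma k y * u k y)) => //.
    by move=> y /WP h; exact/esym/(@cutoff_sum_eq _ _ _ sigma s0 R^o (fun k => u k y) y _ h).
  apply: smooth_on_sum => k _; apply: smoothM; apply: smooth_on_sub (CinfP _); exact: subsetT.
exists (mkCinf sS) => k x l lP h; apply: (TM_near lP).
apply: filterS (cutoff_near s0 h) => y [ky cy].
exact: (@cutoff_sum_pick _ _ _ sigma R^o (fun j => u j y)).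
Qed.

Lemma glue_sections (sigma : Cinf M) (u : nat -> Gamma E) : (forall x, 0 <= sigma x) ->
  exists S : Gamma E, forall (k : nat) x, `|sigma x - k%:R| <= 1 / 4 ->
    Gamma_at S x = Gamma_at (u k) x.
Proof.
move=> s0; pose S x : E x := \sum_(k < cut_bound sigma x) cutoff sigma k x *: Gamma_at (u k) x.
have sS : smooth_section S.
  apply: (smooth_section_local (local_real_scalars M)) => x.
  exists (\sum_(k < (cut_bound sigma x).+1) fsmul (cutoff sigma k) (u k)).
  apply: filterS (cut_bound_near s0 x) => y h.
  by rewrite /S (@cutoff_sum_eq _ _ _ sigma s0 (E y) (fun k => Gamma_at (u k) y) y _ h) Gamma_at_sum.
exists (mkGamma sS) => k x h; have [kx cx] := nbhs_singleton (cutoff_near s0 h).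
exact: (@cutoff_sum_pick _ _ _ sigma (E x) (fun j => Gamma_at (u j) x)).
Qed.

End glueing.

(** * Finite global frames of TM and of E *)

Section tangent_frame.
Context {R : realType} {n : nat} (M : manifold R n).
Implicit Types (x : M) (c : chart R n M).

Let Lam x (l : Cinf M -> R) : Prop := l \in TM_pred x.

Lemma TM_pred_sum x (I : Type) (q : seq I) (F : I -> Cinf M -> R) (a : I -> R) :
  (forall i, F i \in TM_pred x) -> (fun f => \sum_(i <- q) a i * F i f) \in TM_pred x.
Proof.
move=> FP; elim: q => [|i q IH].
  have -> : (fun f => \sum_(i <- [::]) a i * F i f) = (0 : Cinf M -> R).
    by apply/funext => f; rewrite big_nil.
  by have [] := TM_submod x.
have -> : (fun f => \sum_(j <- i :: q) a j * F j f) =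
    a i *: (F i : Cinf M -> R) + (fun f => \sum_(j <- q) a j * F j f).
  by apply/funext => f; rewrite big_cons.
by have [_] := TM_submod x; apply.
Qed.

Lemma tangent_spanning : exists N (h : 'I_N -> Cinf M), forall x (v : Cinf M -> R),
  v \in TM_pred x -> (forall i, v (h i) = 0) -> forall f, v f = 0.
Proof.
have [|||||N [h hP]] := @finite_spanning R n M (Cinf M) Lam n; last by exists N, h.
- by move=> x l lP a s t; exact: (TM_linear lP).
- move=> x l a lP; have := @TM_pred_sum x 'I_1 (index_enum 'I_1) (fun=> l) (fun=> a) (fun=> lP).
  by rewrite (_ : (fun f => \sum_(i <- _) _) = fun f => a * l f) //; apply/funext => f; rewrite big_ord1.
- move=> x; have [c Ac cx] := atlas_cover x.
  exists (cmap c), (fun k y => pd c k y).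
  have cn : \forall y \near x, cdom c y by apply: open_nbhs_nbhs; split => //; exact: cdom_open.
  split.
  + exact: cmap_continuous.
  + by apply: filterS cn => y cy l lP; exact: TM_basis.
  + by move=> v; apply: TM_pred_sum => k; exact: pd_TM.
  + move=> v v0; have [y yx pdy] := coord_extend Ac cx.
    apply/rowP => k; rewrite !mxE -[RHS](v0 (y k)) (bigD1 k) //= big1 => [|i ik].
      by rewrite (nbhs_singleton pdy) eqxx mulr1 addr0.
    by rewrite (nbhs_singleton pdy) eq_sym (negPf ik) mulr0.
  + move=> f k; have C2 := @Ck_chart _ _ _ c f 2 Ac.
    have [_ /(_ (unit_vec k))[_ C1]] := (CkSP 1 _ (@cimg_open _ _ _ c)).1 C2.
    have [|L L0 [e e0 LP]] := C1_lipschitz (x := cmap c x) (@cimg_open _ _ _ c) _ C1; first by exists x.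
    exists L => //; exists [set y | `|cmap c y - cmap c x| < e]; last by move=> y z; exact: LP.
    have := cmap_continuous cx => /cvgrPdist_lt/(_ e e0).
    by apply: filterS => y; rewrite distrC.
- move=> x; have [c Ac cx] := atlas_cover x; have [y yx pdy] := coord_extend Ac cx.
  have cn : \forall y \near x, cdom c y by apply: open_nbhs_nbhs; split => //; exact: cdom_open.
  exists y; apply: filterS2 cn pdy => z cz pdz l lP l0 f.
  have [a aP] := TM_basis Ac cz lP.
  rewrite aP big1 // => k _; suff -> : a 0 k = 0 by rewrite mul0r.
  rewrite -[RHS](l0 k) aP (bigD1 k) //= big1 => [|i ik]; first by rewrite pdz eqxx mulr1 addr0.
  by rewrite pdz eq_sym (negPf ik) mulr0.
- move=> sigma u s0; have [S SP] := glue_functions u s0.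
  by exists S => k x l lP h; exact: (SP k x l lP h).
Qed.

Lemma TM_ext x (v w : TM x) : (forall f, v f = w f) -> v = w.
Proof. by move=> vw; apply/val_inj/funext. Qed.

Lemma TM_funP x (v : TM x) : (v : Cinf M -> R) \in TM_pred x.
Proof. by case: v. Qed.

Lemma TM_funD x (v w : TM x) f : (v + w) f = v f + w f. Proof. by []. Qed.
Lemma TM_funZ x a (v : TM x) f : (a *: v) f = a * v f. Proof. by []. Qed.
Lemma TM_fun_sum x (I : Type) (q : seq I) (F : I -> TM x) f :
  (\sum_(i <- q) F i) f = \sum_(i <- q) F i f.
Proof. by elim: q => [|i q IH]; rewrite ?big_nil // !big_cons TM_funD IH. Qed.

Lemma pd_smooth c k f : atlas c -> smooth_on (cdom c) (fun y => pd c k y f).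
Proof.
move=> Ac; apply: (smooth_on_chart Ac); [exact: cdom_open | by [] |] => j.
have [_ /(_ (unit_vec k))[_ C1]] := (CkSP j _ (@cimg_open _ _ _ c)).1 (@Ck_chart _ _ _ c f j.+1 Ac).
apply: Ck_ext C1; first exact: cimg_open.
by move=> _ [y cy <-]; rewrite /pd /= chartK.
Qed.

(* [X j] at [x] is the vector whose image under [dh] is the orthogonal         *)
(* projection of the [j]th basis vector to the range of [dh].                  *)
Lemma tangent_frame : exists N (h : 'I_N -> Cinf M) (X : 'I_N -> vfield M),
  forall x (v : TM x), v = \sum_j v (h j) *: vfield_at (X j) x.
Proof.
have [N [h hP]] := tangent_spanning; exists N, h.
pose Q j x (w : TM x) := forall u : TM x, \sum_i w (h i) * u (h i) = u (h j).
pose mkpd c k x (Ac : atlas c) (cx : cdom c x) : TM x := MkTM (pd_TM k Ac cx).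
pose H c (x : M) : 'M[R]_(N, n) := \matrix_(i, k) pd c k x (h i).
pose G c (x : M) : 'M[R]_n := (H c x)^T *m H c x.
(* The solution of the normal equations in a chart, G being the Gram matrix of the columns of dh.
   Cramer's rule makes it smooth, while the characterization [Q] shows that it does not depend on
   the chart. *)
pose a c x j : 'rV[R]_n := row j (H c x) *m invmx (G c x).
have Gunit c x : atlas c -> cdom c x -> G c x \in unitmx.
  move=> Ac cx; rewrite -row_free_unit -kermx_eq0; apply/rowV0P => v.
  rewrite sub_kermx => /eqP vG; pose y := v *m (H c x)^T.
  have yy : \sum_i y 0 i * y 0 i = 0.
    have : (v *m G c x *m v^T) 0 0 = 0 by rewrite vG mul0mx mxE.
    rewrite /G mulmxA -/y -mulmxA.
    rewrite mxE => E0; rewrite -[RHS]E0; apply: eq_bigr => i _; congr (_ * _).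
    by rewrite -[H c x]trmxK -trmx_mul -/y !mxE.
  have y0 i : y 0 i = 0.
    apply/eqP; rewrite -sqrf_eq0 expr2; have := yy => /eqP.
    rewrite psumr_eq0 => [/allP/(_ i)|k _]; last by rewrite -expr2 sqr_ge0.
    by rewrite mem_index_enum; apply.
  have [z zx pdz] := coord_extend Ac cx.
  have lP : (fun f => \sum_k v 0 k * pd c k x f) \in TM_pred x.
    by apply: TM_pred_sum => k; exact: pd_TM.
  have l0 := hP x _ lP; apply/rowP => k; rewrite !mxE -[RHS](l0 _ (z k)).
    rewrite (bigD1 k) //= big1 => [|i ik]; first by rewrite (nbhs_singleton pdz) eqxx mulr1 addr0.
    by rewrite (nbhs_singleton pdz) eq_sym (negPf ik) mulr0.
  move=> i; rewrite -[RHS](y0 i) !mxE; apply: eq_bigr => k' _; by rewrite !mxE.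
have loc c x (Ac : atlas c) (cx : cdom c x) j : Q j x (\sum_k a c x j 0 k *: mkpd c k x Ac cx).
  move=> u; have [b bP] := TM_basis Ac cx (TM_funP u).
  have uh i : u (h i) = (b *m (H c x)^T) 0 i.
    by rewrite bP mxE; apply: eq_bigr => k _; rewrite !mxE.
  have wh i : (\sum_k a c x j 0 k *: mkpd c k x Ac cx) (h i) = (a c x j *m (H c x)^T) 0 i.
    rewrite TM_fun_sum mxE; apply: eq_bigr => k _; by rewrite TM_funZ !mxE.
  have -> : \sum_i (\sum_k a c x j 0 k *: mkpd c k x Ac cx) (h i) * u (h i) =
      (a c x j *m (H c x)^T *m (b *m (H c x)^T)^T) 0 0.
    by rewrite mxE; apply: eq_bigr => i _; rewrite wh uh [(b *m _)^T i 0]mxE.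
  rewrite trmx_mul trmxK mulmxA -[a c x j *m _ *m _]mulmxA -/(G c x) /a.
  rewrite mulmxKV ?Gunit // uh !mxE; apply: eq_bigr => k _; by rewrite !mxE mulrC.
have pos x (d : TM x) : \sum_i d (h i) * d (h i) = 0 -> d = 0.
  move=> d0; apply: TM_ext => f; apply: (hP x _ (TM_funP d)) => i.
  apply/eqP; rewrite -sqrf_eq0 expr2; move/eqP: d0.
  rewrite psumr_eq0 => [/allP/(_ i)|k _]; last by rewrite -expr2 sqr_ge0.
  by rewrite mem_index_enum; apply.
have Quniq j x w w' : Q j x w -> Q j x w' -> w = w'.
  move=> Qw Qw'; apply/eqP; rewrite -subr_eq0; apply/eqP/pos.
  have dE f : (w - w') f = w f - w' f by [].
  under eq_bigr => k _ do rewrite {1}dE mulrBl.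
  by rewrite sumrB Qw Qw' subrr.
have exW j x : exists w, Q j x w.
  have [c Ac cx] := atlas_cover x.
  by exists (\sum_k a c x j 0 k *: mkpd c k x Ac cx); exact: loc.
pose W j x := sval (cid (exW j x)).
have WQ j x : Q j x (W j x) by exact: svalP (cid (exW j x)).
have WE c x (Ac : atlas c) (cx : cdom c x) j f : W j x f = \sum_k a c x j 0 k * pd c k x f.
  rewrite (Quniq _ _ _ _ (WQ j x) (loc c x Ac cx j)) TM_fun_sum.
  by apply: eq_bigr => k _; rewrite TM_funZ.
have sW j f : smooth_on setT (fun x => W j x f).
  apply: smooth_on_local => x _; have [c Ac cx] := atlas_cover x.
  exists (cdom c); split => //; first exact: cdom_open.
  have sH i k : smooth_on (cdom c) (fun y => H c y i k).
    rewrite (_ : (fun y => _) = fun y => pd c k y (h i)); first exact: pd_smooth.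
    by apply/funext => y; rewrite mxE.
  apply: (@smooth_on_ext _ _ _ _ (fun y => \sum_k a c y j 0 k * pd c k y f)).
  - exact: cdom_open.
  - by move=> y cy; rewrite (WE c).
  apply: smooth_on_sum => k _; apply: smoothM; last exact: pd_smooth.
  rewrite (_ : (fun y => _) = fun y => \sum_l H c y j l * invmx (G c y) l k); last first.
    by apply/funext => y; rewrite mxE; apply: eq_bigr => l _; rewrite mxE.
  apply: smooth_on_sum => l _; apply: smoothM => //.
  apply: smooth_invmx => [|i k'|y cy]; [exact: cdom_open| |exact: Gunit].
  rewrite (_ : (fun y => _) = fun y => \sum_m H c y m i * H c y m k'); last first.
    by apply/funext => y; rewrite mxE; apply: eq_bigr => m _; rewrite mxE.
  by apply: smooth_on_sum => m _; apply: smoothM.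
pose X0 j f : Cinf M := mkCinf (sW j f).
have dX j : derivation (X0 j).
  split=> [a0 f g|f g]; apply: Cinf_ext => x.
    exact: (TM_linear (TM_funP (W j x))).
  exact: (TM_leibniz (TM_funP (W j x))).
exists (fun j => MkVfield (dX j)) => x v.
have XW j : vfield_at (MkVfield (dX j)) x = W j x by apply: TM_ext.
under eq_bigr => j _ do rewrite XW.
pose u := \sum_j v (h j) *: W j x.
have uE t : \sum_i u (h i) * (t : TM x) (h i) = \sum_i v (h i) * t (h i).
  have uh i : u (h i) = \sum_j v (h j) * W j x (h i).
    by rewrite /u TM_fun_sum; apply: eq_bigr => j _; rewrite TM_funZ.
  under eq_bigr => i _ do rewrite uh mulr_suml.
  rewrite exchange_big /=; apply: eq_bigr => j _.
  by rewrite -(WQ j x t) mulr_sumr; apply: eq_bigr => i _; rewrite mulrA.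
change (v = u); apply/eqP; rewrite -subr_eq0; apply/eqP/pos.
have dE f : (v - u) f = v f - u f by [].
under eq_bigr => k _ do rewrite {1}dE mulrBl.
by rewrite sumrB uE subrr.
Qed.

End tangent_frame.

Section metric_frame.
Context {R : realType} {n : nat} {M : manifold R n} {r : nat}.
Variable E : vbundle (real_scalars M) r.
Implicit Types (x : M) (c : chart R n M) (e : frame r E).

Let lK := local_real_scalars M.

Let Lam x (l : Gamma E -> R) : Prop :=
  (forall a s t, l (a *: s + t) = a * l s + l t) /\ forall s, Gamma_at s x = 0 -> l s = 0.

(** The case of [finite_spanning] in which the functionals are those on Γ(E) that factor through the
    fibre at x. The coefficients in a local frame form the local basis. *)
Lemma bundle_spanning : exists N (e : 'I_N -> Gamma E), forall x (l : E x -> R),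
  (forall a u v, l (a *: u + v) = a * l u + l v) -> (forall i, l (Gamma_at (e i) x) = 0) ->
  forall u, l u = 0.
Proof.
have Lam_expand x e l : frames e -> fdom e x -> Lam x l -> exists v : 'rV[R]_r,
    forall s, l s = \sum_k v 0 k * fcoef e (Gamma_at s x) k.
  move=> Fe ex [lL l0]; have [sg sgx] := frame_extend lK Fe ex.
  have lD s t : l (s + t) = l s + l t by have := lL 1 s t; rewrite scale1r mul1r.
  have l00 : l 0 = 0 by exact: l0.
  have lZ a s : l (a *: s) = a * l s by have := lL a s 0; rewrite !addr0 l00 addr0.
  exists (\row_k l (sg k)) => s.
  have lS (q : seq 'I_r) : l (\sum_(k <- q) fcoef e (Gamma_at s x) k *: sg k) =
      \sum_(k <- q) l (sg k) * fcoef e (Gamma_at s x) k.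
    elim: q => [|k q IH]; first by rewrite !big_nil.
    by rewrite !big_cons lD lZ IH mulrC.
  under eq_bigr => k _ do rewrite mxE; rewrite -lS.
  apply/eqP; rewrite -subr_eq0 -[X in X == _]/(l s - _) -mulN1r -lZ -lD; apply/eqP/l0.
  rewrite Gamma_atD Gamma_atZ scaleN1r Gamma_at_sum.
  rewrite [X in X - _](fcoefP _ Fe ex); apply/eqP; rewrite subr_eq0; apply/eqP.
  by apply: eq_bigr => k _; rewrite Gamma_atZ (nbhs_singleton sgx).
have [|||||N [e eP]] := @finite_spanning R n M (Defs_Gamma__canonical__GRing_Lmodule E) Lam r.
- by move=> x l [].
- move=> x l a [lL l0]; split=> [b s t|s s0]; last by rewrite l0 // mulr0.
  by rewrite lL; ring.
- move=> x; have [c Ac cx] := atlas_cover x; have [e Fe ex] := frame_cover E x.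
  exists (cmap c), (fun k y s => fcoef e (Gamma_at s y) k); split.
  + exact: cmap_continuous.
  + have en : \forall y \near x, fdom e y by apply: open_nbhs_nbhs; split => //; exact: frame_open.
    by apply: filterS en => y ey l; exact: Lam_expand.
  + move=> v; split=> [a s t|s s0].
      rewrite mulr_sumr -big_split /=; apply: eq_bigr => k _.
      rewrite [X in v 0 k * X](_ : _ = a * fcoef e (Gamma_at s x) k + fcoef e (Gamma_at t x) k).
        by ring.
      exact: (fcoef_linear _ _ _ _ Fe ex).
    rewrite big1 // => k _; rewrite s0 (@fcoef_uniq _ _ _ _ _ _ e x 0 (fun=> 0)) ?mulr0 //.
    by rewrite big1 // => i _; rewrite scale0r.
  + move=> v v0; have [sg sgx] := frame_extend lK Fe ex.
    apply/rowP => k; rewrite !mxE -[RHS](v0 (sg k)) (nbhs_singleton sgx).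
    rewrite (bigD1 k) //= fcoef_fvec // eqxx mulr1 big1 ?addr0 // => i ik.
    by rewrite fcoef_fvec // (negPf ik) mulr0.
  + move=> s k; have sm := fcoef_smooth lK s k Fe.
    pose U := cmap c @` (cdom c `&` fdom e).
    have oU : open U by apply: open_chart_image; exact: frame_open.
    have [|L L0 [d d0 LP]] := C1_lipschitz (x := cmap c x) oU _ (sm c Ac 1%N); first by exists x.
    exists L => //; exists [set y | cdom c y /\ `|cmap c y - cmap c x| < d].
      apply: filterI; first by apply: open_nbhs_nbhs; split => //; exact: cdom_open.
      have := cmap_continuous cx => /cvgrPdist_lt/(_ d d0).
      by apply: filterS => y; rewrite distrC.
    by move=> y z [cy yd] [cz zd]; have := LP _ _ yd zd; rewrite /= !chartK.
- move=> x; have [e Fe ex] := frame_cover E x; have [sg sgx] := frame_extend lK Fe ex.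
  have en : \forall y \near x, fdom e y by apply: open_nbhs_nbhs; split => //; exact: frame_open.
  exists sg; apply: filterS2 en sgx => y ey sgy l Ll l0 s.
  have [v vP] := Lam_expand y e l Fe ey Ll.
  rewrite vP big1 // => k _; suff -> : v 0 k = 0 by rewrite mul0r.
  rewrite -[RHS](l0 k) vP (bigD1 k) //= sgy fcoef_fvec // eqxx mulr1 big1 ?addr0 // => i ik.
  by rewrite fcoef_fvec // (negPf ik) mulr0.
- move=> sigma u s0; have [S SP] := glue_sections u s0; exists S => k x l [lL l0] h.
  have lD s t : l (s + t) = l s + l t by have := lL 1 s t; rewrite scale1r mul1r.
  have l00 : l 0 = 0 by exact: l0.
  have lZ a s : l (a *: s) = a * l s by have := lL a s 0; rewrite !addr0 l00 addr0.
  apply/eqP; rewrite -subr_eq0 -[X in X == _]/(l S - _) -mulN1r -lZ -lD; apply/eqP/l0.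
  by rewrite Gamma_atD Gamma_atZ scaleN1r (SP k x h) subrr.
exists N, e => x l lL l0 u.
have [t <-] := section_through lK u.
apply: (eP x (fun s => l (Gamma_at s x))) => //; split=> [a s t'|s s0].
  by rewrite Gamma_atD Gamma_atZ lL.
rewrite s0; have := lL 1 0 0; rewrite scale1r mul1r addr0 => /eqP.
by rewrite -subr_eq subrr eq_sym => /eqP.
Qed.

Variable g : metric E.

Lemma metricD x (u v w : E x) : g x (u + v) w = g x u w + g x v w.
Proof. by have := metric_linear g 1 u v w; rewrite scale1r mul1r. Qed.
Lemma metric0 x (w : E x) : g x 0 w = 0.
Proof. by have := metricD 0 0 w; rewrite addr0 => /eqP; rewrite -subr_eq subrr eq_sym => /eqP. Qed.
Lemma metricZ x a (u w : E x) : g x (a *: u) w = a * g x u w.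
Proof. by have := metric_linear g a u 0 w; rewrite !addr0 metric0 addr0. Qed.
Lemma metricDr x (u v w : E x) : g x w (u + v) = g x w u + g x w v.
Proof. by rewrite ![g x w _]metric_sym metricD. Qed.
Lemma metricZr x a (u w : E x) : g x w (a *: u) = a * g x w u.
Proof. by rewrite ![g x w _]metric_sym metricZ. Qed.
Lemma metric_suml x (I : Type) (q : seq I) (F : I -> E x) w :
  g x (\sum_(i <- q) F i) w = \sum_(i <- q) g x (F i) w.
Proof. by elim: q => [|i q IH]; rewrite ?big_nil ?metric0 // !big_cons metricD IH. Qed.
Lemma metric_sumr x (I : Type) (q : seq I) (F : I -> E x) w :
  g x w (\sum_(i <- q) F i) = \sum_(i <- q) g x w (F i).
Proof. by rewrite metric_sym metric_suml; apply: eq_bigr => i _; rewrite metric_sym. Qed.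

(* The sections [e' i] are the images of the [e i] by the inverse of           *)
(* [v |-> \sum_i g(v, e i) e i], which is injective as                         *)
(* [g(\sum_i g(v, e i) e i, v) = \sum_i g(v, e i) ^ 2].                        *)
Lemma metric_frame : exists N (e e' : 'I_N -> Gamma E), forall x (v : E x),
  v = \sum_i g x v (Gamma_at (e' i) x) *: Gamma_at (e i) x /\
  v = \sum_i g x v (Gamma_at (e i) x) *: Gamma_at (e' i) x.
Proof.
have [N [e eP]] := bundle_spanning; exists N, e.
pose P x (v : E x) : E x := \sum_i g x v (Gamma_at (e i) x) *: Gamma_at (e i) x.
have PL x a (u v : E x) : P x (a *: u + v) = a *: P x u + P x v.
  rewrite /P scaler_sumr -big_split /=; apply: eq_bigr => i _.
  by rewrite metric_linear scalerDl scalerA.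
have Pinj x (v : E x) : P x v = 0 -> v = 0.
  move=> Pv; apply: (metric_nondegenerate (m := g)) => w; apply: (eP x (g x v)).
    by move=> a u1 u2; rewrite metricDr metricZr.
  move=> i; apply/eqP; rewrite -sqrf_eq0 expr2.
  have : \sum_i g x v (Gamma_at (e i) x) * g x v (Gamma_at (e i) x) == 0.
    have : g x (P x v) v = 0 by rewrite Pv metric0.
    rewrite /P metric_suml => E0; apply/eqP; rewrite -[RHS]E0; apply: eq_bigr => k _.
    by rewrite metricZ [g x _ v]metric_sym.
  rewrite psumr_eq0 => [/allP/(_ i)|k _]; last by rewrite -expr2 sqr_ge0.
  by rewrite mem_index_enum; apply.
(* The matrix of the endomorphism [P] in the frame f. Its inverse exhibits the preimages of the e_i
   as smooth sections. *)
pose Q f x : 'M[R]_r := \matrix_(a, b) fcoef f (P x (fvec f a x)) b.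
have PQ f x (u : E x) b : frames f -> fdom f x ->
    fcoef f (P x u) b = ((\row_a fcoef f u a) *m Q f x) 0 b.
  move=> Ff fx; rewrite {1}(fcoefP u Ff fx) mxE.
  have P0 : P x 0 = 0.
    have := PL x 1 0 0; rewrite !scale1r addr0 => /eqP.
    by rewrite -subr_eq subrr eq_sym => /eqP.
  have fc0 : fcoef f (0 : E x) b = 0.
    rewrite (@fcoef_uniq _ _ _ _ _ _ f x 0 (fun=> 0)) //.
    by rewrite big1 // => i _; rewrite scale0r.
  have H (q : seq 'I_r) : fcoef f (P x (\sum_(i <- q) fcoef f u i *: fvec f i x)) b =
      \sum_(i <- q) (\row_a fcoef f u a) 0 i * Q f x i b.
    elim: q => [|i q IH]; first by rewrite !big_nil P0.
    by rewrite !big_cons PL (fcoef_linear _ _ _ _ Ff fx) IH !mxE.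
  exact: H.
have Qunit f x : frames f -> fdom f x -> Q f x \in unitmx.
  move=> Ff fx; rewrite -row_free_unit -kermx_eq0; apply/rowV0P => v.
  rewrite sub_kermx => /eqP vQ; pose u := \sum_a v 0 a *: fvec f a x.
  have uv : fcoef f u = fun a => v 0 a by exact: fcoef_uniq.
  have rv : \row_a fcoef f u a = v by apply/rowP => a; rewrite mxE uv.
  have Pu : P x u = 0.
    rewrite (fcoefP (P x u) Ff fx) big1 // => b _.
    by rewrite PQ // rv vQ mxE scale0r.
  apply/rowP => a; have -> : v 0 a = fcoef f u a by rewrite uv.
  rewrite (Pinj x u Pu) mxE.
  rewrite (@fcoef_uniq _ _ _ _ _ _ f x 0 (fun=> 0)) //.
  by rewrite big1 // => i _; rewrite scale0r.
pose sol f x (w : E x) : E x :=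
  \sum_a ((\row_b fcoef f w b) *m invmx (Q f x)) 0 a *: fvec f a x.
have solP f x (w : E x) : frames f -> fdom f x -> P x (sol f x w) = w.
  move=> Ff fx; rewrite (fcoefP (P x _) Ff fx) [RHS](fcoefP w Ff fx).
  apply: eq_bigr => b _; congr (_ *: _); rewrite PQ //.
  have -> : \row_a fcoef f (sol f x w) a = (\row_b fcoef f w b) *m invmx (Q f x).
    by apply/rowP => a; rewrite mxE (@fcoef_uniq _ _ _ _ _ _ f x _ _ Ff fx (erefl (sol f x w))).
  by rewrite mulmxKV ?Qunit // mxE.
have PU x u v : P x u = P x v -> u = v.
  move=> Puv; apply/eqP; rewrite -subr_eq0; apply/eqP/Pinj.
  by rewrite addrC -scaleN1r PL Puv scaleN1r addNr.
have exI x (w : E x) : exists u, P x u = w.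
  by have [f Ff fx] := frame_cover E x; exists (sol f x w); exact: solP.
pose I x w := sval (cid (exI x w)).
have IP x w : P x (I x w) = w by exact: svalP (cid (exI x w)).
have sI i : smooth_section (fun x => I x (Gamma_at (e i) x)).
  apply: (smooth_section_coef lK) => x; have [f Ff fx] := frame_cover E x.
  have of_ : open (fdom f) by exact: frame_open.
  exists f, (fdom f); split => // a.
  apply: (@smooth_on_ext _ _ _ _ (fun y =>
      ((\row_b fcoef f (Gamma_at (e i) y) b) *m invmx (Q f y)) 0 a)) => //.
    move=> y fy; rewrite -(@fcoef_uniq _ _ _ _ _ _ f y _ _ Ff fy (erefl (sol f y _))).
    by congr (fcoef f _ a); apply: PU; rewrite solP // IP.
  rewrite (_ : (fun y => _) = fun y => \sum_b fcoef f (Gamma_at (e i) y) b * invmx (Q f y) b a); last first.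
    by apply/funext => y; rewrite mxE; apply: eq_bigr => b _; rewrite mxE.
  apply: smooth_on_sum => b _; apply: smoothM; first exact: (fcoef_smooth lK).
  apply: smooth_invmx => [//|k l|y fy]; last exact: Qunit.
  apply: smooth_on_local => y fy; have [sg sgy] := frame_extend lK Ff fy.
  have : nbhs y ([set z | forall i, Gamma_at (sg i) z = fvec f i z] `&` fdom f).
    by apply: filterI => //; exact: open_nbhs_nbhs.
  rewrite nbhsE => -[W [oW Wy] WP]; exists W; split => //.
  apply: (@smooth_on_ext _ _ _ _ (fun z => \sum_j
      g z (Gamma_at (sg k) z) (Gamma_at (e j) z) * fcoef f (Gamma_at (e j) z) l)) => //.
    move=> z /WP[sgz fz]; rewrite mxE /P -sgz.
    have fc0 : fcoef f (0 : E z) l = 0.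
      rewrite (@fcoef_uniq _ _ _ _ _ _ f z 0 (fun=> 0)) //.
      by rewrite big1 // => j _; rewrite scale0r.
    have H (q : seq 'I_N) : \sum_(j <- q) g z (Gamma_at (sg k) z) (Gamma_at (e j) z) *
        fcoef f (Gamma_at (e j) z) l = fcoef f (\sum_(j <- q)
        g z (Gamma_at (sg k) z) (Gamma_at (e j) z) *: Gamma_at (e j) z) l.
      elim: q => [|j q IH]; first by rewrite !big_nil.
      by rewrite !big_cons (fcoef_linear _ _ _ _ Ff fz) IH.
    exact: H.
  apply: smooth_on_sum => j _; apply: smoothM.
    exact: smooth_on_sub (metric_smooth g (sg k) (e j)).
  by apply: smooth_on_sub (fcoef_smooth lK (e j) l Ff) => z /WP[].
exists (fun i => mkGamma (sI i)) => x v.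
have IE i : Gamma_at (mkGamma (sI i)) x = I x (Gamma_at (e i) x) by [].
have IL a u w : I x (a *: u + w) = a *: I x u + I x w by apply: PU; rewrite PL !IP.
have I0 : I x 0 = 0.
  have := IL 1 0 0; rewrite !scale1r addr0 => /eqP.
  by rewrite -subr_eq subrr eq_sym => /eqP.
have Psym u w : g x (P x u) w = g x u (P x w).
  rewrite /P metric_suml metric_sumr; apply: eq_bigr => i _.
  by rewrite metricZ metricZr mulrC [g x _ w]metric_sym.
split.
  under eq_bigr => i _ do rewrite IE -{1}[v](IP x v) Psym IP.
  exact/esym/IP.
rewrite -[LHS](IP x v).
have H (q : seq 'I_N) : I x (\sum_(i <- q) g x v (Gamma_at (e i) x) *: Gamma_at (e i) x) =
    \sum_(i <- q) g x v (Gamma_at (e i) x) *: Gamma_at (mkGamma (sI i)) x.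
  elim: q => [|i q IH]; first by rewrite !big_nil.
  by rewrite !big_cons IL IH.
rewrite -H; apply: PU; rewrite IP; exact/esym/IP.
Qed.

End metric_frame.

(** * Decision procedures for noncommutative rings and abelian groups *)

(* Reflexive decision procedure for identities of noncommutative rings [ncring] *)
(* and of abelian groups [ncgroup]: both sides are expanded into lists of      *)
(* signed words, which are then cancelled pairwise.                            *)
Inductive nexpr := NV of nat | NA of nexpr & nexpr | NM of nexpr & nexpr
  | NO of nexpr | N0 | N1.

Section signed_words.
Context {V : zmodType} (w : seq nat -> V).
Implicit Types (l : seq (bool * seq nat)) (m : bool * seq nat).

Definition mono_val m : V := if m.1 then - w m.2 else w m.2.
Definition words_val l : V := foldr (fun m s => mono_val m + s) 0 l.

Definition neg_mono m := (~~ m.1, m.2).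

Fixpoint cancel_words k l :=
  match k, l with
  | k'.+1, m :: l' => if neg_mono m \in l' then cancel_words k' (rem (neg_mono m) l')
                      else m :: cancel_words k' l'
  | _, _ => l
  end.

Lemma words_val_cat l l' : words_val (l ++ l') = words_val l + words_val l'.
Proof. by elim: l => [|m l IH] /=; rewrite ?add0r // IH addrA. Qed.

Lemma words_val_neg l : words_val (map neg_mono l) = - words_val l.
Proof.
elim: l => [|[b m] l IH] /=; first by rewrite oppr0.
by rewrite IH opprD /mono_val /=; case: b; rewrite //= opprK.
Qed.

Lemma words_val_rem m l : m \in l -> words_val l = mono_val m + words_val (rem m l).
Proof.
elim: l => //= m' l IH; rewrite inE eq_sym; case: eqP => [->|_] //= ml.
by rewrite (IH ml) addrCA.
Qed.

Lemma cancel_words_val k l : words_val (cancel_words k l) = words_val l.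
Proof.
elim: k l => [|k IH] [|[b m] l] //=; case: ifP => [ml|_]; last by rewrite /= IH.
rewrite IH (words_val_rem ml) addrA /mono_val /=.
by case: b {ml} => /=; rewrite ?addNr ?subrr add0r.
Qed.

End signed_words.

Definition nc_mul (l l' : seq (bool * seq nat)) :=
  flatten [seq [seq (m.1 (+) m'.1, m.2 ++ m'.2) | m' <- l'] | m <- l].

Fixpoint nc_norm e : seq (bool * seq nat) :=
  match e with
  | NV i => [:: (false, [:: i])]
  | NA a b => nc_norm a ++ nc_norm b
  | NM a b => nc_mul (nc_norm a) (nc_norm b)
  | NO a => map neg_mono (nc_norm a)
  | N0 => [::]
  | N1 => [:: (false, [::])]
  end.

Definition nc_check e e' : bool :=
  let l := nc_norm e ++ map neg_mono (nc_norm e') in nilp (cancel_words (size l) l).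

Lemma nc_checkP (V : zmodType) (w : seq nat -> V) e e' : nc_check e e' ->
  words_val w (nc_norm e) = words_val w (nc_norm e').
Proof.
move=> /nilP H; apply/eqP; rewrite -subr_eq0 -words_val_neg -words_val_cat.
by rewrite -(cancel_words_val w (size (nc_norm e ++ map neg_mono (nc_norm e')))) H.
Qed.

Fixpoint ring_val (A : pzRingType) (env : seq A) e : A :=
  match e with
  | NV i => nth 0 env i
  | NA a b => ring_val env a + ring_val env b
  | NM a b => ring_val env a * ring_val env b
  | NO a => - ring_val env a
  | N0 => 0
  | N1 => 1
  end.

Lemma ring_valE (A : pzRingType) (env : seq A) e :
  ring_val env e = words_val (foldr (fun i p => nth 0 env i * p) 1) (nc_norm e).
Proof.
set w := foldr _ _.
have wM m m' : w (m ++ m') = w m * w m'.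
  by elim: m => [|i m IH] /=; rewrite ?mul1r // IH mulrA.
elim: e => [i|a IHa b IHb|a IHa b IHb|a IHa||] /=.
- by rewrite /mono_val /= mulr1 addr0.
- by rewrite words_val_cat IHa IHb.
- rewrite IHa IHb /nc_mul; elim: (nc_norm a) => [|m l IH] /=; first by rewrite mul0r.
  rewrite words_val_cat mulrDl IH; congr (_ + _).
  elim: (nc_norm b) => [|m' l' IH'] /=; first by rewrite mulr0.
  rewrite mulrDr IH'; congr (_ + _); rewrite /mono_val /= wM.
  by case: m.1 m'.1 => [] [] /=; rewrite ?mulrNN ?mulNr ?mulrN.
- by rewrite words_val_neg IHa.
- by [].
- by rewrite /mono_val /= addr0.
Qed.

Lemma ncringP (A : pzRingType) (env : seq A) e e' : nc_check e e' ->
  ring_val env e = ring_val env e'.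
Proof. by move=> H; rewrite !ring_valE; exact: nc_checkP. Qed.

Fixpoint group_val (V : zmodType) (env : seq V) e : V :=
  match e with
  | NV i => nth 0 env i
  | NA a b => group_val env a + group_val env b
  | NO a => - group_val env a
  | _ => 0
  end.

Fixpoint group_expr e :=
  match e with
  | NV _ | N0 => true
  | NA a b => group_expr a && group_expr b
  | NO a => group_expr a
  | _ => false
  end.

Lemma group_valE (V : zmodType) (env : seq V) e : group_expr e ->
  group_val env e = words_val (fun m => nth 0 env (head 0%N m)) (nc_norm e).
Proof.
elim: e => [i|a IHa b IHb|a IHa b IHb|a IHa||] //=.
- by move=> _; rewrite /mono_val /= addr0.
- by move=> /andP[/IHa -> /IHb ->]; rewrite words_val_cat.
- by move=> /IHa ->; rewrite words_val_neg.
Qed.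

Lemma ncgroupP (V : zmodType) (env : seq V) e e' :
  [&& group_expr e, group_expr e' & nc_check e e'] -> group_val env e = group_val env e'.
Proof. by move=> /and3P[h h' H]; rewrite !group_valE //; exact: nc_checkP. Qed.

(* Atoms are compared up to conversion only when they have the same head. *)
Ltac nc_head t := lazymatch t with ?f _ => nc_head f | _ => t end.
Ltac nc_same x y :=
  first [ constr_eq x y
        | let a := nc_head x in let b := nc_head y in constr_eq a b; unify x y ].
Ltac nc_index x l :=
  lazymatch l with
  | cons ?y ?l' => match tt with
                   | _ => let _ := match tt with _ => nc_same x y end in constr:(0%N)
                   | _ => let i := nc_index x l' in constr:(S i)
                   end
  end.
Ltac nc_mem x l :=
  lazymatch l with
  | cons ?y ?l' => match tt with
                   | _ => let _ := match tt with _ => nc_same x y end in constr:(true)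
                   | _ => nc_mem x l'
                   end
  | _ => constr:(false)
  end.
Ltac nc_insert x l :=
  lazymatch nc_mem x l with true => l | _ => constr:(cons x l) end.
Ltac ring_atoms t l :=
  lazymatch t with
  | @GRing.add _ ?a ?b => let l' := ring_atoms b l in ring_atoms a l'
  | @GRing.mul _ ?a ?b => let l' := ring_atoms b l in ring_atoms a l'
  | @GRing.opp _ ?a => ring_atoms a l
  | @GRing.zero _ => l
  | @GRing.one _ => l
  | _ => nc_insert t l
  end.
Ltac ring_expr t l :=
  lazymatch t with
  | @GRing.add _ ?a ?b => let x := ring_expr a l in let y := ring_expr b l in constr:(NA x y)
  | @GRing.mul _ ?a ?b => let x := ring_expr a l in let y := ring_expr b l in constr:(NM x y)
  | @GRing.opp _ ?a => let x := ring_expr a l in constr:(NO x)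
  | @GRing.zero _ => constr:(N0)
  | @GRing.one _ => constr:(N1)
  | _ => let i := nc_index t l in constr:(NV i)
  end.
Ltac group_atoms t l :=
  lazymatch t with
  | @GRing.add _ ?a ?b => let l' := group_atoms b l in group_atoms a l'
  | @GRing.opp _ ?a => group_atoms a l
  | @GRing.zero _ => l
  | _ => nc_insert t l
  end.
Ltac group_expr t l :=
  lazymatch t with
  | @GRing.add _ ?a ?b => let x := group_expr a l in let y := group_expr b l in constr:(NA x y)
  | @GRing.opp _ ?a => let x := group_expr a l in constr:(NO x)
  | @GRing.zero _ => constr:(N0)
  | _ => let i := nc_index t l in constr:(NV i)
  end.
Ltac ncring :=
  lazymatch goal with
  | |- @eq ?T ?a ?b =>
    let l0 := ring_atoms b (@nil T) in let l := ring_atoms a l0 in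
    let x := ring_expr a l in let y := ring_expr b l in
    exact: (@ncringP _ l x y (erefl true))
  end.
Ltac ncgroup :=
  lazymatch goal with
  | |- @eq ?T ?a ?b =>
    let l0 := group_atoms b (@nil T) in let l := group_atoms a l0 in
    let x := group_expr a l in let y := group_expr b l in
    exact: (@ncgroupP _ l x y (erefl true))
  end.

(** * Actions, automorphisms and derivations of presented algebras *)

Section presented_algebra_theory.
Local Open Scope quotient_scope.
Context {K : comPzRingType} {G : Type} {prel : pterm K G -> pterm K G -> Prop}.
Local Notation A := (palg prel).
Implicit Types (a b p q : A) (c : K) (u : G).

Lemma pclass_scal c : pclass prel (pscal c) = c *: (1 : A).
Proof. exact: (esym (mulr1 (pclass prel (pscal c) : A))). Qed.

Lemma pclass_add s t : pclass prel (padd s t) = pclass prel s + pclass prel t.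
Proof. by rewrite -aaddE. Qed.

Lemma pclass_mul s t : pclass prel (pmul s t) = pclass prel s * pclass prel t.
Proof. by rewrite -amulE. Qed.

Lemma palg_ind (P : A -> Prop) :
  (forall c, P (c *: (1 : A))) -> (forall u, P (agen u)) ->
  (forall a b, P a -> P b -> P (a + b)) -> (forall a b, P a -> P b -> P (a * b)) ->
  forall a, P a.
Proof.
move=> Ps Pg Pa Pm a; rewrite -(prepK a).
elim: (repr _) => [c|u|s IHs t IHt|s IHs t IHt].
- by rewrite pclass_scal.
- exact: Pg.
- by rewrite pclass_add; exact: Pa.
- by rewrite pclass_mul; exact: Pm.
Qed.

Lemma palg_scaleAl c a b : c *: (a * b) = (c *: a) * b.
Proof. by rewrite palg_scaleE [in RHS]palg_scaleE mulrA. Qed.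

Lemma palg_scaleAr c a b : c *: (a * b) = a * (c *: b).
Proof.
have H t : pclass prel (pscal c) * pclass prel t = pclass prel t * pclass prel (pscal c).
  by rewrite -!pclass_mul; apply/pclassP; exact: pc_scalC.
rewrite palg_scaleE [c *: b]palg_scaleE !mulrA -pclass_scal; congr (_ * _).
by have := H (repr (a : {eq_quot (pcong_equiv prel)})); rewrite (prepK a) mulr1.
Qed.

Section action.
Variables (V : lmodType K) (rho : G -> V -> V).

(** The universal property is used in the form of modules: operators on V that satisfy the relations
    make V a module over the presented algebra. Maps out of the algebra are then obtained by acting
    on a fixed vector. *)
Fixpoint pint (t : pterm K G) : V -> V :=
  match t with
  | pscal c => fun v => c *: v
  | pgen u => rho u
  | padd s t => fun v => pint s v + pint t v
  | pmul s t => fun v => pint s (pint t v)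
  end.

Hypothesis rho_linear : forall u c v w, rho u (c *: v + w) = c *: rho u v + rho u w.
Hypothesis rho_rel : forall s t, prel s t -> pint s =1 pint t.

Lemma pint_linear t c v w : pint t (c *: v + w) = c *: pint t v + pint t w.
Proof.
elim: t v w => [d|u|s IHs t IHt|s IHs t IHt] v w /=.
- by rewrite scalerDr !scalerA mulrC.
- exact: rho_linear.
- by rewrite IHs IHt scalerDr addrACA.
- by rewrite IHt IHs.
Qed.

Lemma pintD t v w : pint t (v + w) = pint t v + pint t w.
Proof. by have := pint_linear t 1 v w; rewrite !scale1r. Qed.

Lemma pint0 t : pint t 0 = 0.
Proof. by apply: (addrI (pint t 0)); rewrite -pintD !addr0. Qed.

Lemma pintZ t c v : pint t (c *: v) = c *: pint t v.
Proof. by have := pint_linear t c v 0; rewrite !addr0 pint0 addr0. Qed.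

Lemma pcong_pint s t : pcong prel s t -> pint s =1 pint t.
Proof.
elim=> {s t}.
- exact: rho_rel.
- by [].
- by move=> s t _ H v; rewrite H.
- by move=> s t u _ H1 _ H2 v; rewrite H1.
- by move=> s s' t t' _ H1 _ H2 v /=; rewrite H1 H2.
- by move=> s s' t t' _ H1 _ H2 v /=; rewrite H2 H1.
- by move=> s t u v /=; rewrite addrA.
- by move=> s t v /=; rewrite addrC.
- by move=> t v /=; rewrite scale0r add0r.
- by move=> t v /=; rewrite scaleN1r scale0r addNr.
- by [].
- by move=> t v /=; rewrite scale1r.
- by [].
- by move=> s t u v /=; rewrite pintD.
- by move=> a b v /=; rewrite scalerDl.
- by move=> a b v /=; rewrite scalerA.
- by move=> a t v /=; rewrite pintZ.
Qed.

Definition pact (a : A) : V -> V := pint (repr (a : {eq_quot (pcong_equiv prel)})).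

Lemma pactE t v : pact (pclass prel t) v = pint t v.
Proof. by apply: pcong_pint; exact: prep_cong. Qed.

Lemma pact_scal c v : pact (c *: (1 : A)) v = c *: v.
Proof. by rewrite -pclass_scal pactE. Qed.

Lemma pact_gen u v : pact (agen u) v = rho u v.
Proof. exact: pactE. Qed.

Lemma pactD a b v : pact (a + b) v = pact a v + pact b v.
Proof. by rewrite -(prepK a) -(prepK b) -pclass_add !pactE. Qed.

Lemma pactM a b v : pact (a * b) v = pact a (pact b v).
Proof. by rewrite -(prepK a) -(prepK b) -pclass_mul !pactE. Qed.

Lemma pact_linear a c v w : pact a (c *: v + w) = c *: pact a v + pact a w.
Proof. by rewrite -(prepK a) !pactE pint_linear. Qed.

End action.

Section sign_automorphism.
Variable eps : G -> K.
Let rho u p : A := eps u *: (agen u * p).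
Hypothesis rel_ok : forall s t, prel s t -> pint rho s =1 pint rho t.

Let rho_linear u c p q : rho u (c *: p + q) = c *: rho u p + rho u q.
Proof. by rewrite /rho mulrDr scalerDr -palg_scaleAr !scalerA mulrC. Qed.

(** The automorphism multiplying each generator u by [eps u]. The algebra acts on itself with u
    acting as left multiplication by [eps u] times u, and the automorphism is the image of 1. *)
Definition paut (a : A) : A := pact rho a 1.

Let pact_paut a p : pact rho a p = paut a * p.
Proof.
move: a p; apply: palg_ind => [c|u|a b IHa IHb|a b IHa IHb] p.
- by rewrite /paut !(pact_scal rho_linear rel_ok) -palg_scaleAl mul1r.
- by rewrite /paut !(pact_gen rho_linear rel_ok) /rho mulr1 palg_scaleAl.
- have -> : paut (a + b) = paut a + paut b by rewrite {1}/paut (pactD rho_linear rel_ok).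
  by rewrite (pactD rho_linear rel_ok) IHa IHb -mulrDl.
- have -> : paut (a * b) = paut a * paut b by rewrite {1}/paut (pactM rho_linear rel_ok) IHa.
  by rewrite (pactM rho_linear rel_ok) IHb IHa mulrA.
Qed.

Lemma paut_scal c : paut (c *: (1 : A)) = c *: (1 : A).
Proof. by rewrite /paut (pact_scal rho_linear rel_ok). Qed.

Lemma paut_gen u : paut (agen u) = eps u *: agen u.
Proof. by rewrite /paut (pact_gen rho_linear rel_ok) /rho mulr1. Qed.

Lemma pautD a b : paut (a + b) = paut a + paut b.
Proof. by rewrite /paut (pactD rho_linear rel_ok). Qed.

Lemma pautM a b : paut (a * b) = paut a * paut b.
Proof. by rewrite {1}/paut (pactM rho_linear rel_ok) pact_paut. Qed.

Lemma paut1 : paut 1 = 1.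
Proof. by have := paut_scal 1; rewrite scale1r. Qed.

Lemma pautZ c a : paut (c *: a) = c *: paut a.
Proof. by rewrite palg_scaleE pautM paut_scal -palg_scaleE. Qed.

End sign_automorphism.

Section twisted_derivation.
Variables (tau : A -> A) (delta : G -> A).
Hypothesis tauD : forall a b, tau (a + b) = tau a + tau b.
Hypothesis tauM : forall a b, tau (a * b) = tau a * tau b.
Hypothesis tauZ : forall c a, tau (c *: a) = c *: tau a.
Hypothesis tau1 : tau 1 = 1.

Definition tder_act u (pq : A * A) : A * A :=
  (agen u * pq.1, agen u * pq.2 + delta u * tau pq.1).

Hypothesis rel_ok : forall s t, prel s t -> pint tder_act s =1 pint tder_act t.

Let act_linear u c v w : tder_act u (c *: v + w) = c *: tder_act u v + tder_act u w.
Proof.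
case: v w => p q [p' q']; rewrite /tder_act /=; congr (_, _) => /=.
  by rewrite mulrDr -palg_scaleAr.
by rewrite tauD tauZ !mulrDr -!palg_scaleAr scalerDr addrACA.
Qed.

(* The action on pairs encodes the right twisted Leibniz rule                  *)
(* [d (a b) = a (d b) + (d a) (tau b)].                                        *)
Definition tder (a : A) : A := (pact tder_act a (1, 0)).2.

Let pact_tder a pq : pact tder_act a pq = (a * pq.1, a * pq.2 + tder a * tau pq.1).
Proof.
move: a pq; apply: palg_ind => [c|u|a b IHa IHb|a b IHa IHb] [p q].
- rewrite /tder !(pact_scal act_linear rel_ok) /= scaler0 mul0r addr0.
  by rewrite -!palg_scaleAl !mul1r.
- by rewrite /tder !(pact_gen act_linear rel_ok) /tder_act /= tau1 mulr0 add0r mulr1.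
- have -> : tder (a + b) = tder a + tder b by rewrite {1}/tder (pactD act_linear rel_ok).
  rewrite (pactD act_linear rel_ok) IHa IHb /=.
  by congr (_, _); rewrite /= !mulrDl // addrACA.
- have -> : tder (a * b) = a * tder b + tder a * tau b.
    by rewrite {1}/tder (pactM act_linear rel_ok) IHb IHa /= mulr0 add0r tau1 !mulr1.
  rewrite (pactM act_linear rel_ok) IHb IHa /=; congr (_, _); first by rewrite mulrA.
  by rewrite tauM mulrDr mulrDl !mulrA addrA.
Qed.

Lemma tder_scal c : tder (c *: (1 : A)) = 0.
Proof. by rewrite /tder (pact_scal act_linear rel_ok) /= scaler0. Qed.

Lemma tder_gen u : tder (agen u) = delta u.
Proof. by rewrite /tder (pact_gen act_linear rel_ok) /= tau1 mulr0 add0r mulr1. Qed.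

Lemma tderD a b : tder (a + b) = tder a + tder b.
Proof. by rewrite /tder (pactD act_linear rel_ok). Qed.

Lemma tderM a b : tder (a * b) = a * tder b + tder a * tau b.
Proof.
rewrite {1}/tder (pactM act_linear rel_ok) [pact _ b _]pact_tder pact_tder /=.
by rewrite mulr0 add0r tau1 !mulr1.
Qed.

Lemma tderZ c a : tder (c *: a) = c *: tder a.
Proof. by rewrite palg_scaleE tderM tder_scal mul0r addr0 -palg_scaleE. Qed.

End twisted_derivation.

(* Twisted derivations are determined by their values on the generators.       *)
Lemma tder_unique (tau : A -> A) (d : A -> A) : tau 1 = 1 ->
  (forall a b, d (a + b) = d a + d b) -> (forall c a, d (c *: a) = c *: d a) ->
  (forall a b, d (a * b) = a * d b + d a * tau b) -> (forall u, d (agen u) = 0) ->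
  forall a, d a = 0.
Proof.
move=> t1 dD dZ dM dg.
have d1 : d 1 = 0.
  by apply: (addrI (d 1)); have := dM 1 1; rewrite t1 mulr1 !mul1r mulr1 addr0 => <-.
apply: palg_ind => [c|u|a b IHa IHb|a b IHa IHb].
- by rewrite dZ d1 scaler0.
- exact: dg.
- by rewrite dD IHa IHb addr0.
- by rewrite dM IHa IHb mulr0 mul0r addr0.
Qed.

End presented_algebra_theory.

(** * The fibres of Sym(TM) ⊗ ∧E: sign rules and bracket derivations *)

Section symext_algebra.
Context {R : realType} {n : nat} {M : manifold R n} {r : nat}.
Context {E : vbundle (real_scalars M) r} (g : metric E) (x : M).
Local Notation generator := (TM x + E x)%type.
Local Notation A := (palg (@symext_rel R n M r E x)).
Implicit Types (a b p q : A) (v w : TM x) (u t : E x) (k l : nat).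

Definition tT v : A := agen (inl v).
Definition tE u : A := agen (inr u).

Lemma symext_relE (s s2 : pterm R[i] generator) : symext_rel s s2 ->
  pclass (@symext_rel R n M r E x) s = pclass (@symext_rel R n M r E x) s2.
Proof. by move=> st; apply/pclassP; exact: pc_rel. Qed.

Lemma tT_linear (c : R) v w : tT (c *: v + w) = c%:C%C *: tT v + tT w.
Proof.
rewrite /tT /agen (symext_relE (symext_linearT c v w)) pclass_add pclass_mul pclass_scal.
by rewrite -palg_scaleE.
Qed.

Lemma tE_linear (c : R) u t : tE (c *: u + t) = c%:C%C *: tE u + tE t.
Proof.
rewrite /tE /agen (symext_relE (symext_linearE c u t)) pclass_add pclass_mul pclass_scal.
by rewrite -palg_scaleE.
Qed.

Lemma tTC v w : tT v * tT w = tT w * tT v.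
Proof. by rewrite /tT /agen -!pclass_mul (symext_relE (symext_TT v w)). Qed.

Lemma tTEC v u : tT v * tE u = tE u * tT v.
Proof. by rewrite /tT /tE /agen -!pclass_mul (symext_relE (symext_TE v u)). Qed.

Lemma tEE u : tE u * tE u = 0.
Proof.
by rewrite /tE /agen -pclass_mul (symext_relE (symext_EE u)) pclass_scal scale0r.
Qed.

Lemma realC1 : (1 : R)%:C%C = 1. Proof. by []. Qed.

Lemma tED u t : tE (u + t) = tE u + tE t.
Proof. by have := tE_linear 1 u t; rewrite scale1r realC1 scale1r. Qed.
Lemma tE0 : tE 0 = 0.
Proof. by apply: (addrI (tE 0)); rewrite -tED !addr0. Qed.
Lemma tEZ (c : R) u : tE (c *: u) = c%:C%C *: tE u.
Proof. by have := tE_linear c u 0; rewrite !addr0 tE0 addr0. Qed.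
Lemma tE_sum (I : Type) (s : seq I) (F : I -> E x) :
  tE (\sum_(i <- s) F i) = \sum_(i <- s) tE (F i).
Proof. by elim: s => [|i s IH]; rewrite ?big_nil ?tE0 // !big_cons tED IH. Qed.
Lemma tTD v w : tT (v + w) = tT v + tT w.
Proof. by have := tT_linear 1 v w; rewrite scale1r realC1 scale1r. Qed.
Lemma tT0 : tT 0 = 0.
Proof. by apply: (addrI (tT 0)); rewrite -tTD !addr0. Qed.
Lemma tTZ (c : R) v : tT (c *: v) = c%:C%C *: tT v.
Proof. by have := tT_linear c v 0; rewrite !addr0 tT0 addr0. Qed.
Lemma tT_sum (I : Type) (s : seq I) (F : I -> TM x) :
  tT (\sum_(i <- s) F i) = \sum_(i <- s) tT (F i).
Proof. by elim: s => [|i s IH]; rewrite ?big_nil ?tT0 // !big_cons tTD IH. Qed.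

Lemma tE_anti u t : tE u * tE t = - (tE t * tE u).
Proof.
have := tEE (u + t); rewrite tED mulrDl !mulrDr !tEE add0r addr0 => /eqP.
by rewrite addr_eq0 => /eqP.
Qed.

Definition gen_sign (y : generator) : R[i] := if y is inl _ then 1 else -1.
(** The parity automorphism, equal to (-1)^k in degree k. It carries the signs of all graded
    commutation and Leibniz rules below. *)
Definition theta : A -> A := paut gen_sign.

Let theta_ok (s t : pterm R[i] generator) : symext_rel s t ->
  pint (V := A) (fun y p => gen_sign y *: (agen y * p)) s =1
  pint (V := A) (fun y p => gen_sign y *: (agen y * p)) t.
Proof.
case=> {s t} [c v w|c u w|v w|v u|u] p /=.
- by rewrite !scale1r -/(tT _) tT_linear mulrDl -palg_scaleAl.
- rewrite -/(tE _) tE_linear mulrDl scalerDr; congr (_ + _).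
  by rewrite -palg_scaleAl !scalerA mulrC.
- by rewrite !scale1r !mulrA -/(tT v) -/(tT w) tTC.
- by rewrite !scale1r -palg_scaleAr !mulrA -/(tT v) -/(tE u) tTEC.
- by rewrite -palg_scaleAr scalerA mulrA -/(tE u) tEE mul0r scaler0 scale0r.
Qed.

Lemma theta_scal c : theta (c *: (1 : A)) = c *: (1 : A).
Proof. exact: paut_scal theta_ok c. Qed.
Lemma theta1 : theta 1 = 1. Proof. exact: paut1 theta_ok. Qed.
Lemma thetaT v : theta (tT v) = tT v.
Proof. by rewrite [LHS](paut_gen theta_ok) scale1r. Qed.
Lemma thetaE u : theta (tE u) = - tE u.
Proof. by rewrite [LHS](paut_gen theta_ok) scaleN1r. Qed.
Lemma thetaD a b : theta (a + b) = theta a + theta b. Proof. exact: pautD theta_ok a b. Qed.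
Lemma thetaM a b : theta (a * b) = theta a * theta b. Proof. exact: pautM theta_ok a b. Qed.
Lemma thetaZ c a : theta (c *: a) = c *: theta a. Proof. exact: pautZ theta_ok c a. Qed.

Lemma symext_ind (P : A -> Prop) :
  (forall c, P (c *: (1 : A))) -> (forall v, P (tT v)) -> (forall u, P (tE u)) ->
  (forall a b, P a -> P b -> P (a + b)) -> (forall a b, P a -> P b -> P (a * b)) ->
  forall a, P a.
Proof. by move=> Ps PT PE Pa Pm; apply: palg_ind => // -[]. Qed.

Lemma theta0 : theta 0 = 0.
Proof. by rewrite -(scale0r (1 : A)) theta_scal. Qed.
Lemma thetaN a : theta (- a) = - theta a. Proof. by rewrite -scaleN1r thetaZ scaleN1r. Qed.

Lemma thetaK a : theta (theta a) = a.
Proof.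
apply: (symext_ind (P := fun a => theta (theta a) = a)) a => [c|v|u|a b IHa IHb|a b IHa IHb].
- by rewrite !theta_scal.
- by rewrite !thetaT.
- by rewrite thetaE thetaN thetaE opprK.
- by rewrite !thetaD IHa IHb.
- by rewrite !thetaM IHa IHb.
Qed.

Lemma tT_comm v b : tT v * b = b * tT v.
Proof.
apply: (symext_ind (P := fun b => tT v * b = b * tT v)) b => [c|w|u|a b IHa IHb|a b IHa IHb].
- by rewrite -palg_scaleAr -palg_scaleAl mulr1 mul1r.
- exact: tTC.
- exact: tTEC.
- by rewrite mulrDr mulrDl IHa IHb.
- by rewrite mulrA IHa -mulrA IHb mulrA.
Qed.

Lemma tE_comm u b : tE u * b = theta b * tE u.
Proof.
apply: (symext_ind (P := fun b => tE u * b = theta b * tE u)) b => [c|w|t|a b IHa IHb|a b IHa IHb].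
- by rewrite theta_scal -palg_scaleAr -palg_scaleAl mulr1 mul1r.
- by rewrite thetaT tTEC.
- by rewrite thetaE mulNr tE_anti.
- by rewrite mulrDr thetaD mulrDl IHa IHb.
- by rewrite mulrA IHa -mulrA IHb mulrA thetaM.
Qed.

Local Notation homog := (homog (@total_degree R n M r E x)).

Lemma symext_homog_ind (P : nat -> A -> Prop) :
  (forall c, P 0%N (c *: (1 : A))) -> (forall v, P 2%N (tT v)) -> (forall u, P 1%N (tE u)) ->
  (forall k a b, homog k a -> homog k b -> P k a -> P k b -> P k (a + b)) ->
  (forall k l a b, homog k a -> homog l b -> P k a -> P l b -> P (k + l)%N (a * b)) ->
  (forall k, P k 0) -> forall k a, homog k a -> P k a.
Proof.
move=> Ps PT PE Pa Pm P0 k a; elim=> {k a} //.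
- by case.
- by move=> k a b ha IHa hb IHb; exact: Pa.
- by move=> k l a b ha IHa hb IHb; exact: Pm.
Qed.

Lemma homogT v : homog 2 (tT v). Proof. exact: (homog_gen _ (@total_degree R n M r E x) (inl v)). Qed.
Lemma homogE u : homog 1 (tE u). Proof. exact: (homog_gen _ (@total_degree R n M r E x) (inr u)). Qed.
Lemma homogZ k c a : homog k a -> homog k (c *: a).
Proof.
move=> ha; rewrite palg_scaleE -[k]/(0 + k)%N.
exact: (@homog_mul _ _ _ nat _ 0%N) (homog_scal _ _ c) ha.
Qed.
Lemma homogM k l a b : homog k a -> homog l b -> homog (k + l)%N (a * b).
Proof. exact: homog_mul. Qed.

Lemma theta_homog k a : homog k a -> theta a = (-1) ^+ k *: a.
Proof.
apply: (symext_homog_ind (P := fun k a => theta a = (-1) ^+ k *: a)) => {k a}.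
- by move=> c; rewrite theta_scal scale1r.
- by move=> v; rewrite thetaT sqrrN expr1n scale1r.
- by move=> u; rewrite thetaE scaleN1r.
- by move=> k a b _ _ IHa IHb; rewrite thetaD IHa IHb scalerDr.
- move=> k l a b _ _ IHa IHb; rewrite thetaM IHa IHb -palg_scaleAl -palg_scaleAr scalerA.
  by rewrite exprD.
- by move=> k; rewrite theta0 scaler0.
Qed.

Lemma symext_comm k l a b : homog k a -> homog l b -> a * b = (-1) ^+ (k * l) *: (b * a).
Proof.
move=> ha hb; have : a * b = (if odd k then theta b else b) * a.
  move: k a ha b hb => k a ha b _; move: k a ha b.
  apply: (symext_homog_ind (P := fun k a => forall b, a * b = (if odd k then theta b else b) * a)).
  - by move=> c b; rewrite -palg_scaleAr -palg_scaleAl mulr1 mul1r.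
  - by move=> v b; exact: tT_comm.
  - by move=> u b; exact: tE_comm.
  - by move=> k a a' _ _ IHa IHa' b; rewrite mulrDl mulrDr IHa IHa'.
  - move=> k k' a a' _ _ IHa IHa' b; rewrite -mulrA IHa' mulrA IHa -mulrA oddD.
    by case: (odd k) (odd k') => [] [] //=; rewrite thetaK.
  - by move=> k b; rewrite mul0r mulr0.
move=> ->; case ok : (odd k).
  by rewrite (theta_homog hb) palg_scaleAl -[in RHS]signr_odd oddM ok /= signr_odd.
by rewrite -signr_odd oddM ok scale1r.
Qed.

End symext_algebra.

Section symext_derivations.
Context {R : realType} {n : nat} {M : manifold R n} {r : nat}.
Context {E : vbundle (real_scalars M) r}.

Section twisted.
Variable (x : M).
Local Notation generator := (TM x + E x)%type.
Local Notation A := (palg (@symext_rel R n M r E x)).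
Variables (tau : A -> A) (delta : generator -> A).
Hypothesis tauM : forall a b, tau (a * b) = tau a * tau b.
Hypothesis tauT : forall v : TM x, tau (tT v) = tT v.
Hypothesis deltaT_linear : forall (c : R) (v w : TM x),
  delta (inl (c *: v + w)) = c%:C%C *: delta (inl v) + delta (inl w).
Hypothesis deltaE_linear : forall (c : R) (u t : E x),
  delta (inr (c *: u + t)) = c%:C%C *: delta (inr u) + delta (inr t).
Hypothesis deltaTT : forall v w : TM x, tT v * delta (inl w) + delta (inl v) * tT w =
  tT w * delta (inl v) + delta (inl w) * tT v.
Hypothesis deltaTE : forall (v : TM x) (u : E x),
  tT v * delta (inr u) + delta (inl v) * tau (tE u) = tE u * delta (inl v) + delta (inr u) * tT v.
Hypothesis deltaEE : forall u : E x, tE u * delta (inr u) + delta (inr u) * tau (tE u) = 0.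

(** By [prodE], a product of two generators acts on pairs with the twisted Leibniz expression in the
    second component. The hypotheses say exactly that this expression respects each defining
    relation. *)
Lemma symext_tder_ok (s s2 : pterm R[i] generator) : symext_rel s s2 ->
  pint (V := (A * A)%type) (tder_act tau delta) s =1 pint (V := (A * A)%type) (tder_act tau delta) s2.
Proof.
have prodE (y1 y2 : generator) (p q : A) :
    tder_act tau delta y1 (tder_act tau delta y2 (p, q)) =
    (agen y1 * agen y2 * p, agen y1 * agen y2 * q +
      (agen y1 * delta y2 + delta y1 * tau (agen y2)) * tau p).
  by rewrite /tder_act /= tauM; congr (_, _) => /=; ncring.
case=> {s s2} [c v w|c u w|v w|v u|u] [p q]; rewrite [LHS]/= [RHS]/=.
- rewrite /tder_act /= deltaT_linear -/(tT _) tT_linear.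
  by congr (_, _); rewrite /= !mulrDl -!palg_scaleAl // scalerDr addrACA.
- rewrite /tder_act /= deltaE_linear -/(tE _) tE_linear.
  by congr (_, _); rewrite /= !mulrDl -!palg_scaleAl // scalerDr addrACA.
- rewrite !prodE -/(tT v) -/(tT w) !tauT deltaTT; congr (_, _) => /=; first by rewrite tTC.
  by rewrite [tT v * tT w]tTC.
- rewrite !prodE -/(tT v) -/(tE u) !tauT deltaTE; congr (_, _) => /=; first by rewrite tTEC.
  by rewrite tTEC.
- rewrite !prodE -/(tE u) deltaEE tEE !mul0r addr0.
  by congr (_, _) => /=; rewrite scale0r.
Qed.

End twisted.

Section derivation_along_function.
Variable (x : M).
Local Notation A := (palg (@symext_rel R n M r E x)).
Variable f : Cinf M.

(** The generator values of {-, f}, which sends X to X(f) and kills sections of E. *)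
Definition dF_gen (y : (TM x + E x)%type) : A :=
  if y is inl v then (v f)%:C%C *: (1 : A) else 0.
Definition dF : A -> A := tder id dF_gen.

Let ok : forall s s2 : pterm R[i] (TM x + E x)%type, symext_rel s s2 ->
  pint (V := (A * A)%type) (tder_act id dF_gen) s =1 pint (V := (A * A)%type) (tder_act id dF_gen) s2.
Proof.
apply: symext_tder_ok => //=.
- move=> c v w; change ((c * v f + w f)%:C%C *: (1 : A) = c%:C%C *: ((v f)%:C%C *: (1 : A)) + (w f)%:C%C *: (1 : A)).
  by rewrite rmorphD rmorphM /= scalerDl scalerA.
- by move=> c u t; rewrite scaler0 addr0.
- move=> v w; rewrite -!palg_scaleAr -!palg_scaleAl !mulr1 !mul1r; exact: addrC.
- by move=> v u; rewrite mulr0 add0r mul0r addr0 -palg_scaleAr -palg_scaleAl mulr1 mul1r.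
- by move=> u; rewrite mulr0 mul0r addr0.
Qed.

Lemma dF_scal c : dF (c *: (1 : A)) = 0.
Proof. exact: (tder_scal (tau := id) (fun _ _ => erefl) (fun _ _ => erefl) ok). Qed.
Lemma dFT v : dF (tT v) = (v f)%:C%C *: (1 : A).
Proof. exact: (tder_gen (tau := id) (fun _ _ => erefl) (fun _ _ => erefl) erefl ok). Qed.
Lemma dFE u : dF (tE u) = 0.
Proof. exact: (tder_gen (tau := id) (fun _ _ => erefl) (fun _ _ => erefl) erefl ok). Qed.
Lemma dFD a b : dF (a + b) = dF a + dF b.
Proof. exact: (tderD (tau := id) (fun _ _ => erefl) (fun _ _ => erefl) ok). Qed.
Lemma dFM a b : dF (a * b) = a * dF b + dF a * b.
Proof. exact: (tderM (tau := id) (fun _ _ => erefl) (fun _ _ => erefl) (fun _ _ => erefl) erefl ok). Qed.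
Lemma dFZ c a : dF (c *: a) = c *: dF a.
Proof. exact: (tderZ (tau := id) (fun _ _ => erefl) (fun _ _ => erefl) (fun _ _ => erefl) erefl ok). Qed.

End derivation_along_function.

Section derivation_along_section.
Variables (g : metric E) (x : M).
Local Notation A := (palg (@symext_rel R n M r E x)).
Variables (D : TM x -> E x) (w : E x).

(** The generator values of {-, ξ} at x, where w stands for ξ(x) and [D v] for ∇_v ξ. This is a
    right derivation with the sign carried by [theta]. *)
Definition dX_gen (y : (TM x + E x)%type) : A :=
  match y with inl v => tE (D v) | inr u => (g x u w)%:C%C *: (1 : A) end.
Definition dX : A -> A := tder (@theta R n M r E x) dX_gen.

Hypothesis D_linear : forall (c : R) v v', D (c *: v + v') = c *: D v + D v'.

Let ok : forall s s2 : pterm R[i] (TM x + E x)%type, symext_rel s s2 ->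
  pint (V := (A * A)%type) (tder_act (@theta R n M r E x) dX_gen) s =1
  pint (V := (A * A)%type) (tder_act (@theta R n M r E x) dX_gen) s2.
Proof.
apply: symext_tder_ok => /=.
- exact: thetaM.
- exact: thetaT.
- by move=> c v v'; rewrite D_linear tE_linear.
- by move=> c u t; rewrite metricD metricZ rmorphD rmorphM /= scalerDl scalerA.
- by move=> v v'; rewrite !tT_comm addrC.
- move=> v u; rewrite thetaE mulrN -tE_anti addrC; congr (_ + _).
  by rewrite -palg_scaleAr -palg_scaleAl mulr1 mul1r.
- by move=> u; rewrite thetaE mulrN -palg_scaleAr -palg_scaleAl mulr1 mul1r subrr.
Qed.

Lemma dX_scal c : dX (c *: (1 : A)) = 0.
Proof. exact: (tder_scal (@thetaD _ _ _ _ _ x) (@thetaZ _ _ _ _ _ x) ok). Qed.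
Lemma dXT v : dX (tT v) = tE (D v).
Proof. exact: (tder_gen (@thetaD _ _ _ _ _ x) (@thetaZ _ _ _ _ _ x) (@theta1 _ _ _ _ _ x) ok). Qed.
Lemma dXE u : dX (tE u) = (g x u w)%:C%C *: (1 : A).
Proof. exact: (tder_gen (@thetaD _ _ _ _ _ x) (@thetaZ _ _ _ _ _ x) (@theta1 _ _ _ _ _ x) ok). Qed.
Lemma dXD a b : dX (a + b) = dX a + dX b.
Proof. exact: (tderD (@thetaD _ _ _ _ _ x) (@thetaZ _ _ _ _ _ x) ok). Qed.
Lemma dXM a b : dX (a * b) = a * dX b + dX a * theta b.
Proof. exact: (tderM (@thetaD _ _ _ _ _ x) (@thetaM _ _ _ _ _ x) (@thetaZ _ _ _ _ _ x) (@theta1 _ _ _ _ _ x) ok). Qed.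
Lemma dXZ c a : dX (c *: a) = c *: dX a.
Proof. exact: (tderZ (@thetaD _ _ _ _ _ x) (@thetaM _ _ _ _ _ x) (@thetaZ _ _ _ _ _ x) (@theta1 _ _ _ _ _ x) ok). Qed.

End derivation_along_section.

Section degrees.
Variables (g : metric E) (x : M).
Local Notation A := (palg (@symext_rel R n M r E x)).
Local Notation homog := (homog (@total_degree R n M r E x)).
Implicit Types (a b : A) (k l : nat).

Lemma dF0 f : dF f (0 : A) = 0.
Proof. by have := dF_scal x f (0 : R[i]); rewrite scale0r. Qed.

(** The vanishing for k < 2 is carried along because k - 2 is truncated there. Without it the
    degrees in the Leibniz rule would not add up. *)
Lemma dF_homog f k a : homog k a -> homog (k - 2)%N (dF f a) /\ ((k < 2)%N -> dF f a = 0).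
Proof.
apply: (symext_homog_ind (P := fun k a => homog (k - 2)%N (dF f a) /\ ((k < 2)%N -> dF f a = 0)))
  => {k a}.
- by move=> c; rewrite dF_scal; split=> //; exact: homog_0.
- by move=> v; rewrite dFT; split=> //; exact: homog_scal.
- by move=> u; rewrite dFE; split=> //; exact: homog_0.
- move=> k a b _ _ [IHa za] [IHb zb]; rewrite dFD; split; first exact: homog_add.
  by move=> k2; rewrite za ?zb ?addr0.
- move=> k l a b ha hb [IHa za] [IHb zb]; rewrite dFM; split.
    apply: homog_add.
      have [l2|l2] := ltnP l 2; first by rewrite zb // mulr0; exact: homog_0.
      by rewrite -addnBA //; exact: homogM.
    have [k2|k2] := ltnP k 2; first by rewrite za // mul0r; exact: homog_0.
    by rewrite -addnBAC //; exact: homogM.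
  move=> kl; rewrite za ?zb ?mulr0 ?mul0r ?addr0 //; apply: leq_ltn_trans kl.
    exact: leq_addl.
  exact: leq_addr.
- by move=> k; rewrite dF0; split=> //; exact: homog_0.
Qed.

Variables (D : TM x -> E x) (w : E x).
Hypothesis D_linear : forall (c : R) v v', D (c *: v + v') = c *: D v + D v'.

Lemma dX0 : dX g D w 0 = 0.
Proof. by have := dX_scal g w D_linear (0 : R[i]); rewrite scale0r. Qed.

Lemma dX_homog k a : homog k a -> homog (k - 1)%N (dX g D w a) /\ (k = 0%N -> dX g D w a = 0).
Proof.
apply: (symext_homog_ind (P := fun k a => homog (k - 1)%N (dX g D w a) /\ (k = 0%N -> dX g D w a = 0)))
  => {k a}.
- by move=> c; rewrite dX_scal //; split=> //; exact: homog_0.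
- by move=> v; rewrite dXT //; split=> //; exact: homogE.
- by move=> u; rewrite dXE //; split=> //; exact: homog_scal.
- move=> k a b _ _ [IHa za] [IHb zb]; rewrite dXD //; split; first exact: homog_add.
  by move=> k2; rewrite za ?zb ?addr0.
- move=> k l a b ha hb [IHa za] [IHb zb]; rewrite dXM //; split.
    apply: homog_add.
      have [l0|l0] := posnP l; first by rewrite zb // mulr0; exact: homog_0.
      by rewrite -addnBA //; exact: homogM.
    have [k0|k0] := posnP k; first by rewrite za // mul0r; exact: homog_0.
    rewrite -addnBAC //; apply: homogM => //; rewrite (theta_homog hb); exact: homogZ.
  move=> /eqP; rewrite addn_eq0 => /andP[/eqP k0 /eqP l0].
  by rewrite za // zb // mulr0 mul0r addr0.
- by move=> k; rewrite dX0; split=> //; exact: homog_0.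
Qed.

(* The two kinds of derivations commute, as [{f, xi} = 0].                     *)
Lemma dF_dX f a : dF f (dX g D w a) = dX g D w (dF f a).
Proof.
apply/eqP; rewrite -subr_eq0; apply/eqP.
have dFN b : dF f (- b) = - dF f b by rewrite -scaleN1r dFZ scaleN1r.
have dFtheta b : dF f (theta b) = theta (dF f b).
  apply: (symext_ind (P := fun b => dF f (theta b) = theta (dF f b))) b.
  - by move=> c; rewrite theta_scal dF_scal theta0.
  - by move=> v; rewrite thetaT dFT theta_scal.
  - by move=> u; rewrite thetaE dFN dFE oppr0 theta0.
  - by move=> b b' IH IH'; rewrite !(thetaD, dFD) IH IH'.
  - by move=> b b' IH IH'; rewrite !(thetaM, dFM, thetaD) IH IH'.
have dXD' := dXD g w D_linear; have dXM' := dXM g w D_linear; have dXZ' := dXZ g w D_linear.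
apply: (@tder_unique _ _ _ (@theta R n M r E x) (fun a => dF f (dX g D w a) - dX g D w (dF f a))).
- exact: theta1.
- by move=> b b'; rewrite !(dXD', dFD) opprD addrACA.
- by move=> c b; rewrite !(dXZ', dFZ) scalerBr.
- move=> b b'; rewrite dFM dXM' !(dXD', dFD) !(dXM', dFM) dFtheta !opprD.
  rewrite mulrBr mulrBl.
  set A1 := b * dF f (dX g D w b'); set A2 := dF f b * dX g D w b'.
  set A3 := dX g D w b * theta (dF f b'); set A4 := dF f (dX g D w b) * theta b'.
  set B1 := b * dX g D w (dF f b'); set B4 := dX g D w (dF f b) * theta b'.
  ncgroup.
- by case=> [v|u]; rewrite -/(tT _) -/(tE _) ?dXT ?dFT ?dXE ?dFE ?dF_scal ?dX_scal ?dX0 ?subrr.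
Qed.

End degrees.

End symext_derivations.

Lemma scale_natr_eq0 (K : numFieldType) (V : lmodType K) k (a : V) :
  (0 < k)%N -> k%:R *: a = 0 -> a = 0.
Proof.
move=> k0 H; have : k%:R^-1 *: (k%:R *: a) = 0 by rewrite H scaler0.
by rewrite scalerA mulVf ?scale1r // pnatr_eq0 -lt0n.
Qed.

(** * Degree zero part, Euler identity and contractions *)

Section symext_structure.
Context {R : realType} {n : nat} {M : manifold R n} {r : nat}.
Context {E : vbundle (real_scalars M) r} (g : metric E) (x : M).
Local Notation generator := (TM x + E x)%type.
Local Notation A := (palg (@symext_rel R n M r E x)).
Local Notation homog := (homog (@total_degree R n M r E x)).
Implicit Types (a b : A) (v : TM x) (u w : E x).

Let rho0 (y : generator) (c : R[i]^o) : R[i]^o := 0.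

Let rho0_linear y (c : R[i]) (p q : R[i]^o) : rho0 y (c *: p + q) = c *: rho0 y p + rho0 y q.
Proof. by rewrite /rho0 scaler0 addr0. Qed.

Let rho0_ok (s s2 : pterm R[i] generator) : symext_rel s s2 ->
  pint rho0 s =1 pint rho0 s2.
Proof.
by case=> {s s2} [c v w|c u w|v w|v u|u] p; rewrite /= /rho0 ?scaler0 ?addr0 ?scale0r.
Qed.

(* The projection onto the degree 0 part.                                      *)
Definition aug a : R[i] := pact rho0 a (1 : R[i]^o).

Lemma aug_scal c : aug (c *: (1 : A)) = c.
Proof. by rewrite /aug (pact_scal rho0_linear rho0_ok); exact: mulr1. Qed.
Lemma aug_gen y : aug (agen y) = 0.
Proof. by rewrite /aug (pact_gen rho0_linear rho0_ok). Qed.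
Lemma augD a b : aug (a + b) = aug a + aug b.
Proof. by rewrite /aug (pactD rho0_linear rho0_ok). Qed.
Lemma augM a b : aug (a * b) = aug a * aug b.
Proof.
rewrite /aug (pactM rho0_linear rho0_ok).
have H (c : R[i]) (p : R[i]^o) : pact rho0 a (c *: p) = c *: pact rho0 a p.
  have L := pact_linear rho0_linear rho0_ok a; have := L c p 0.
  have -> : pact rho0 a 0 = 0.
    by have := L (-1) 0 0; rewrite scaler0 addr0 scaleN1r addNr.
  by rewrite !addr0.
have := H (pact rho0 b 1) 1; rewrite [_ *: 1]mulr1 => ->; exact: mulrC.
Qed.

Lemma symext_scal_inj (c c' : R[i]) : c *: (1 : A) = c' *: (1 : A) -> c = c'.
Proof. by move=> H; rewrite -(aug_scal c) H aug_scal. Qed.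

Lemma homog0_scal a : homog 0%N a -> a = aug a *: (1 : A).
Proof.
suff H k b : homog k b -> k = 0%N -> b = aug b *: (1 : A) by move=> /H; apply.
apply: (symext_homog_ind (P := fun k a => k = 0%N -> a = aug a *: (1 : A))) => // {k b}.
- by move=> c _; rewrite aug_scal.
- by move=> k a' b _ _ IH IH' k0; rewrite augD scalerDl -IH // -IH'.
- move=> k l a' b _ _ IH IH' /eqP; rewrite addn_eq0 => /andP[/eqP/IH E1 /eqP/IH' E2].
  by rewrite augM {1}E1 {1}E2 -palg_scaleAl mul1r scalerA.
- move=> k _; have := aug_scal 0; rewrite scale0r => ->; by rewrite scale0r.
Qed.

Section frames.
Variables (N P : nat) (h : 'I_N -> Cinf M) (X : 'I_N -> TM x) (e e' : 'I_P -> E x).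
Hypothesis hX : forall v, v = \sum_j v (h j) *: X j.
Hypothesis ee' : forall u, u = \sum_i g x u (e i) *: e' i.
Variable D : 'I_P -> TM x -> E x.
Hypothesis D_linear : forall i (c : R) v v', D i (c *: v + v') = c *: D i v + D i v'.

(** The factor 2 is the degree of a vector field. The quadratic term compensates for {X, e_i} = ∇_X
    e_i, which makes the sum over the e_i contribute on vector fields too. *)
Definition euler_T j : A := 2%:R *: tT (X j) - \sum_i tE (D i (X j)) * tE (e' i).

(* The identity [deg a * a = {a, h_j} (2 X_j - Omega_j) + {a, e_i} e'_i].      *)
Lemma symext_euler k a : homog k a ->
  k%:R *: a = \sum_j dF (h j) a * euler_T j + \sum_i dX g (D i) (e i) a * tE (e' i).
Proof.
have DD i v v' : D i (v + v') = D i v + D i v'.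
  by have := D_linear i 1 v v'; rewrite !scale1r.
have D0 i : D i 0 = 0 by apply: (addrI (D i 0)); rewrite -DD !addr0.
have DZ i c v : D i (c *: v) = c *: D i v by have := D_linear i c v 0; rewrite D0 !addr0.
have Dsum i (I : Type) (s : seq I) (F : I -> TM x) : D i (\sum_(j <- s) F j) = \sum_(j <- s) D i (F j).
  by elim: s => [|j s IH]; rewrite ?big_nil ?D0 // !big_cons DD IH.
have sc (c : R[i]) b : c *: (1 : A) * b = c *: b by rewrite -palg_scaleAl mul1r.
apply: (symext_homog_ind (P := fun k a => k%:R *: a =
  \sum_j dF (h j) a * euler_T j + \sum_i dX g (D i) (e i) a * tE (e' i))) => {k a}.
- move=> c; rewrite scale0r !big1 ?addr0 // => [i _|j _].
    by rewrite dX_scal // mul0r.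
  by rewrite dF_scal mul0r.
- move=> v; rewrite [X in _ + X](eq_bigr (fun i => \sum_j (v (h j))%:C%C *: (tE (D i (X j)) * tE (e' i)))).
    rewrite exchange_big -big_split /=.
    rewrite (eq_bigr (fun j => 2%:R *: ((v (h j))%:C%C *: tT (X j)))).
      rewrite -scaler_sumr {1}[v]hX tT_sum; congr (_ *: _).
      by apply: eq_bigr => j _; rewrite tTZ.
    move=> j _; rewrite dFT sc /euler_T scalerBr -scaler_sumr subrK !scalerA mulrC //.
  move=> i _; rewrite dXT // {1}[v]hX Dsum tE_sum mulr_suml; apply: eq_bigr => j _.
  by rewrite DZ tEZ -palg_scaleAl.
- move=> u; rewrite scale1r big1 ?add0r => [|j _]; last by rewrite dFE mul0r.
  rewrite {1}[u]ee' tE_sum; apply: eq_bigr => i _.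
  by rewrite dXE // sc tEZ.
- move=> k a b _ _ IHa IHb; rewrite scalerDr IHa IHb addrACA -!big_split /=.
  by congr (_ + _); apply: eq_bigr => i _; rewrite ?dFD ?(dXD g _ (D_linear i)) mulrDl.
- move=> k l a b ha hb IHa IHb.
  have -> : (k + l)%:R *: (a * b) = k%:R *: a * b + a * (l%:R *: b).
    by rewrite -palg_scaleAl -palg_scaleAr natrD scalerDl.
  have Tc j p : euler_T j * p = p * euler_T j.
    rewrite /euler_T mulrBl mulrBr -palg_scaleAl -palg_scaleAr tT_comm; congr (_ - _).
    rewrite mulr_suml mulr_sumr; apply: eq_bigr => i _.
    by rewrite -mulrA (tE_comm (e' i) p) mulrA (tE_comm (D i (X j)) (theta p)) thetaK -mulrA.
  rewrite IHa IHb mulrDl mulrDr !mulr_suml !mulr_sumr addrACA -!big_split /=.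
  congr (_ + _); apply: eq_bigr => i _.
    by rewrite dFM mulrDl -!mulrA Tc addrC.
  by rewrite (dXM g _ (D_linear i)) mulrDl -!mulrA tE_comm addrC.
- move=> k; rewrite scaler0 !big1 ?addr0 // => [i _|j _]; rewrite ?dF0 ?mul0r //.
  by rewrite (dX0 g _ (D_linear i)) mul0r.
Qed.

End frames.

Lemma dX_uniq (D D' : TM x -> E x) (w w' : E x) : D =1 D' -> w = w' -> dX g D w =1 dX g D' w'.
Proof. by move=> /funext -> ->. Qed.

Let zero_field (v : TM x) : E x := 0.
Let zero_linear (c : R) (v v' : TM x) : zero_field (c *: v + v') = c *: zero_field v + zero_field v'.
Proof. by rewrite /zero_field scaler0 addr0. Qed.

(** Interior multiplication by u on the exterior factor, as the bracket derivation with vanishing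
    covariant derivative. It anticommutes with itself, as the Clifford action below requires. *)
Definition contraction u : A -> A := dX g zero_field u.

Lemma contraction_scal u c : contraction u (c *: (1 : A)) = 0.
Proof. exact: (dX_scal g _ zero_linear). Qed.
Lemma contractionT u v : contraction u (tT v) = 0.
Proof. by rewrite [LHS](dXT g _ zero_linear) /zero_field tE0. Qed.
Lemma contractionE u w : contraction u (tE w) = (g x w u)%:C%C *: (1 : A).
Proof. exact: (dXE g _ zero_linear). Qed.
Lemma contractionD u a b : contraction u (a + b) = contraction u a + contraction u b.
Proof. exact: (dXD g _ zero_linear). Qed.
Lemma contractionM u a b :
  contraction u (a * b) = a * contraction u b + contraction u a * theta b.
Proof. exact: (dXM g _ zero_linear). Qed.
Lemma contractionZ u c a : contraction u (c *: a) = c *: contraction u a.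
Proof. exact: (dXZ g _ zero_linear). Qed.
Lemma contractionN u a : contraction u (- a) = - contraction u a.
Proof. by rewrite -scaleN1r contractionZ scaleN1r. Qed.
Lemma contraction0 u : contraction u 0 = 0.
Proof. by have := contraction_scal u 0; rewrite scale0r. Qed.

Lemma contraction_theta u a : contraction u (theta a) = - theta (contraction u a).
Proof.
apply: (symext_ind (P := fun b => contraction u (theta b) = - theta (contraction u b))) a.
- by move=> c; rewrite theta_scal contraction_scal theta0 oppr0.
- by move=> v; rewrite thetaT contractionT theta0 oppr0.
- by move=> t; rewrite thetaE contractionN contractionE theta_scal.
- by move=> b b' IH IH'; rewrite !(thetaD, contractionD) IH IH' opprD.
- by move=> b b' IH IH'; rewrite !(thetaM, contractionM, thetaD) IH IH'; ncring.
Qed.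

Lemma contraction_anti u w a :
  contraction u (contraction w a) = - contraction w (contraction u a).
Proof.
apply/eqP; rewrite -subr_eq0 opprK; apply/eqP.
apply: (@tder_unique _ _ _ id (fun a => contraction u (contraction w a) +
  contraction w (contraction u a))) => //.
- by move=> b b'; rewrite !contractionD; ncgroup.
- by move=> c b; rewrite !contractionZ scalerDr.
- move=> b b'; rewrite !contractionM !contractionD !contractionM !contraction_theta !thetaK; ncring.
- case=> [v|t]; rewrite -/(tT _) -/(tE _) ?contractionT ?contraction0 ?addr0 //.
  by rewrite !contractionE !contraction_scal addr0.
Qed.

End symext_structure.

(** * The Clifford algebra of a fibre: words, parity and its Euler identity *)

Section clifford_fibre.
Context {R : realType} {n : nat} {M : manifold R n} {r : nat}.
Context {E : vbundle (real_scalars M) r} (g : metric E) (x : M).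
Local Notation A := (palg (@symext_rel R n M r E x)).
Local Notation C := (palg (@clifford_rel R n M r E g x)).
Implicit Types (a c : C) (b : bool) (u v : E x).

Definition cE u : C := agen u.

Lemma clifford_relE (s s2 : pterm R[i] (E x)) : clifford_rel g s s2 ->
  pclass (@clifford_rel R n M r E g x) s = pclass (@clifford_rel R n M r E g x) s2.
Proof. by move=> st; apply/pclassP; exact: pc_rel. Qed.

Lemma cE_linear (k : R) u v : cE (k *: u + v) = k%:C%C *: cE u + cE v.
Proof.
rewrite /cE /agen (clifford_relE (clifford_linear g k u v)) pclass_add pclass_mul pclass_scal.
by rewrite -palg_scaleE.
Qed.
Lemma cED u v : cE (u + v) = cE u + cE v.
Proof. by have := cE_linear 1 u v; rewrite scale1r realC1 scale1r. Qed.
Lemma cE0 : cE 0 = 0.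
Proof. by apply: (addrI (cE 0)); rewrite -cED !addr0. Qed.
Lemma cEZ (k : R) u : cE (k *: u) = k%:C%C *: cE u.
Proof. by have := cE_linear k u 0; rewrite !addr0 cE0 addr0. Qed.
Lemma cE_sum (I : Type) (s : seq I) (F : I -> E x) :
  cE (\sum_(i <- s) F i) = \sum_(i <- s) cE (F i).
Proof. by elim: s => [|i s IH]; rewrite ?big_nil ?cE0 // !big_cons cED IH. Qed.

Lemma cEE u v : cE u * cE v + cE v * cE u = (g x u v)%:C%C *: (1 : C).
Proof.
rewrite /cE /agen -!pclass_mul -pclass_add (clifford_relE (clifford_metric g u v)).
exact: pclass_scal.
Qed.

Lemma clif_sc (k : R[i]) a : k *: (1 : C) * a = k *: a.
Proof. by rewrite -palg_scaleAl mul1r. Qed.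

(** The Clifford action on the exterior side: multiplication by u on the right plus half the
    contraction with u. The mixed terms of u v + v u add up to g(u, v), the normalization of the
    relation here. As 1 is nonzero in the module, 1 is nonzero in the Clifford algebra. *)
Let half_u u (p : A) : A := p * tE u + 2%:R^-1 *: contraction g u p.

Let half_linear u (k : R[i]) (p q : A) : half_u u (k *: p + q) = k *: half_u u p + half_u u q.
Proof.
rewrite /half_u contractionD contractionZ mulrDl -palg_scaleAl !scalerDr !scalerA.
by rewrite [_^-1 * k]mulrC addrACA.
Qed.

Lemma contraction_linear (k : R) u v p :
  contraction g (k *: u + v) p = k%:C%C *: contraction g u p + contraction g v p.
Proof.
apply: (symext_ind (P := fun p => contraction g (k *: u + v) p =
  k%:C%C *: contraction g u p + contraction g v p)) p.
- by move=> c; rewrite !contraction_scal scaler0 addr0.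
- by move=> w; rewrite !contractionT scaler0 addr0.
- by move=> w; rewrite !contractionE metricDr metricZr rmorphD rmorphM /= scalerDl scalerA.
- by move=> a b IHa IHb; rewrite !contractionD IHa IHb scalerDr addrACA.
- move=> a b IHa IHb; rewrite !contractionM IHa IHb scalerDr mulrDr mulrDl.
  by rewrite -palg_scaleAl -palg_scaleAr addrACA.
Qed.

Let half_ok (s s2 : pterm R[i] (E x)) : clifford_rel g s s2 -> pint half_u s =1 pint half_u s2.
Proof.
case=> {s s2} [k u v|u v] p /=.
  rewrite /half_u tE_linear contraction_linear mulrDr -palg_scaleAr !scalerDr !scalerA.
  by rewrite [_^-1 * _]mulrC addrACA.
rewrite /half_u !contractionD !contractionZ !contractionM !contractionE !thetaE !mulrN.
rewrite (contraction_anti g u v) (metric_sym g v u) scalerN.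
set k := (g x u v)%:C%C; set h := 2%:R^-1 : R[i].
set q := contraction g v p; set q' := contraction g u p.
have -> : p * (k *: (1 : A)) = k *: p by rewrite -palg_scaleAr mulr1.
have Ek : k *: p = h *: (k *: p) + h *: (k *: p).
  by rewrite -scalerDl -[h]mul1r -mulrDl divff ?scale1r // pnatr_eq0.
have Ev : p * tE v * tE u = p * (tE v * tE u) by rewrite mulrA.
have Eu : p * tE u * tE v = - (p * (tE v * tE u)) by rewrite -mulrA tE_anti mulrN.
have Eh (t : A) w : (h *: t) * tE w = h *: (t * tE w) by rewrite palg_scaleAl.
rewrite [RHS]Ek !mulrDl Ev Eu !Eh !scalerDr !scalerN; ncgroup.
Qed.

Lemma clifford_neq0 : (1 : C) <> 0.
Proof.
move=> C10; have := pact_scal half_linear half_ok 1 (1 : A).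
rewrite C10 scaler0 -(scale0r (1 : C)) (pact_scal half_linear half_ok) scale0r scale1r => A10.
have := @symext_scal_inj R n M r E x 1 0; rewrite scale0r scale1r -A10 => /(_ erefl) /eqP.
by rewrite oner_eq0.
Qed.

Let thC_ok (s s2 : pterm R[i] (E x)) : clifford_rel g s s2 ->
  pint (V := C) (fun y p => (-1) *: (agen y * p)) s =1
  pint (V := C) (fun y p => (-1) *: (agen y * p)) s2.
Proof.
case=> {s s2} [k u v|u v] p /=.
  rewrite -/(cE _) cE_linear mulrDl scalerDr; congr (_ + _).
  by rewrite -palg_scaleAl !scalerA mulrC.
rewrite -!palg_scaleAr !scalerA mulrNN mulr1 !scale1r !mulrA -mulrDl -/(cE u) -/(cE v) cEE.
exact: clif_sc.
Qed.

Definition thetaC : C -> C := paut (fun=> -1).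

Lemma thetaC_parity (b : bool) a : Cl_parity b a -> thetaC a = (-1) ^+ b *: a.
Proof.
elim=> {b a} [k|u|d a b _ IHa _ IHb|d d' a b _ IHa _ IHb|d].
- by rewrite [LHS](paut_scal thC_ok) scale1r.
- by rewrite [LHS](paut_gen thC_ok).
- by rewrite [LHS](pautD thC_ok) -!/(thetaC _) IHa IHb scalerDr.
- rewrite [LHS](pautM thC_ok) -!/(thetaC _) IHa IHb -palg_scaleAl -palg_scaleAr scalerA.
  by rewrite -signr_addb.
- by rewrite scaler0; have := paut_scal thC_ok 0; rewrite scale0r.
Qed.

Lemma Cl_parity_disjoint a : Cl_parity false a -> Cl_parity true a -> a = 0.
Proof.
move=> /thetaC_parity E0 /thetaC_parity; rewrite E0 scale1r scaleN1r => H.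
apply: (@scale_natr_eq0 _ _ 2) => //.
by rewrite scaler_nat mulr2n {1}H addNr.
Qed.

Section words.
Variables (P : nat) (e e' : 'I_P -> E x).
Hypothesis ee : forall u, u = \sum_i g x u (e' i) *: e i.
Hypothesis ee' : forall u, u = \sum_i g x u (e i) *: e' i.

Definition word (s : seq 'I_P) : C := \prod_(i <- s) cE (e i).

(** The bound on the length of the words is strict, so that d = 0 leaves only 0 and d = 1 only
    scalars. *)
Inductive clw (d : nat) (b : bool) : C -> Prop :=
  | clw0 : clw d b 0
  | clw_word k s a : (size s < d)%N -> odd (size s) = b -> clw d b a ->
      clw d b (k *: word s + a).

Lemma word_cons i s : word (i :: s) = cE (e i) * word s.
Proof. by rewrite /word big_cons. Qed.
Lemma word_cat s t : word (s ++ t) = word s * word t.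
Proof. by rewrite /word big_cat. Qed.
Lemma word_nil : word [::] = 1.
Proof. by rewrite /word big_nil. Qed.

Lemma clw_leq d d' b a : (d <= d')%N -> clw d b a -> clw d' b a.
Proof.
move=> dd; elim=> [|k s c sd sb _ IH]; first exact: clw0.
by apply: clw_word => //; exact: leq_trans dd.
Qed.

Lemma clwD d b a c : clw d b a -> clw d b c -> clw d b (a + c).
Proof.
elim=> [|k s a' sd sb _ IH] hc; first by rewrite add0r.
by rewrite -addrA; apply: clw_word => //; exact: IH.
Qed.

Lemma clwZ d b (k : R[i]) a : clw d b a -> clw d b (k *: a).
Proof.
elim=> [|k' s a' sd sb _ IH]; first by rewrite scaler0; exact: clw0.
by rewrite scalerDr scalerA; exact: clw_word.
Qed.

Lemma clwN d b a : clw d b a -> clw d b (- a).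
Proof. by rewrite -scaleN1r; exact: clwZ. Qed.

Lemma clw_sum d b (I : Type) (q : seq I) (F : I -> C) :
  (forall i, clw d b (F i)) -> clw d b (\sum_(i <- q) F i).
Proof.
by move=> H; elim: q => [|i q IH]; rewrite ?big_nil ?big_cons; [exact: clw0|exact: clwD].
Qed.

Lemma clw1 d b s : (size s < d)%N -> odd (size s) = b -> clw d b (word s).
Proof.
by move=> sd sb; rewrite -[word s]scale1r -[_ *: _]addr0; apply: clw_word => //; exact: clw0.
Qed.

Lemma clw_words d b s t a : clw d b a ->
  clw (size s + d + size t) (odd (size s) (+) b (+) odd (size t)) (word s * a * word t).
Proof.
elim=> [|k w c wd wb _ IH]; first by rewrite mulr0 mul0r; exact: clw0.
rewrite mulrDr mulrDl; apply: clwD => //.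
rewrite -palg_scaleAr -palg_scaleAl -!word_cat; apply/clwZ/clw1.
  by rewrite !size_cat -!addnA ltn_add2l ltn_add2r.
by rewrite !size_cat !oddD wb.
Qed.

Lemma clw_gen d b u a : clw d b a -> clw d.+1 (~~ b) (cE u * a).
Proof.
move=> ha; rewrite [u]ee cE_sum mulr_suml; apply: clw_sum => i.
rewrite cEZ -palg_scaleAl; apply: clwZ.
by have := clw_words [:: i] [::] ha; rewrite word_cons word_nil !mulr1 /= addn0 addbF.
Qed.

Lemma clw_genr d b u a : clw d b a -> clw d.+1 (~~ b) (a * cE u).
Proof.
move=> ha; rewrite [u]ee cE_sum mulr_sumr; apply: clw_sum => i.
rewrite cEZ -palg_scaleAr; apply: clwZ.
have := clw_words [::] [:: i] ha; rewrite word_cons word_nil mulr1 mul1r /= addn1.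
by rewrite addbC.
Qed.

(* Graded commutator of an element of parity b with a generator.               *)
Definition gcomm1 (b : bool) a u : C := a * cE u - (-1) ^+ b *: (cE u * a).

Lemma gcomm1_linear b k a c u :
  gcomm1 b (k *: a + c) u = k *: gcomm1 b a u + gcomm1 b c u.
Proof.
rewrite /gcomm1 mulrDl mulrDr -palg_scaleAl -palg_scaleAr scalerDr opprD scalerDr.
by rewrite scalerN !scalerA [(-1) ^+ b * k]mulrC addrACA.
Qed.

Lemma gcomm1_0 b u : gcomm1 b 0 u = 0.
Proof. by rewrite /gcomm1 mulr0 mul0r scaler0 subrr. Qed.

Lemma gcomm1_mul (b : bool) v a u : gcomm1 (~~ b) (cE v * a) u =
  cE v * gcomm1 b a u + ((-1) ^+ b * (g x v u)%:C%C) *: a.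
Proof.
rewrite /gcomm1 -scalerA -[_ *: a]clif_sc -cEE mulrDl scalerDr mulrBr.
have -> : (-1) ^+ (~~ b) = - (-1) ^+ b :> R[i] by rewrite signrN.
rewrite scaleNr opprK -palg_scaleAr !mulrA; ncgroup.
Qed.

(** By the Clifford relation a graded commutator with a generator removes one letter at a time from
    the word, so it shortens words and changes the parity. *)
Lemma gcomm1_word s u : clw (size s) (~~ odd (size s)) (gcomm1 (odd (size s)) (word s) u).
Proof.
elim: s => [|i s IH]; first by rewrite /gcomm1 word_nil mulr1 mul1r scale1r subrr; exact: clw0.
rewrite word_cons /= gcomm1_mul; apply: clwD; first exact: clw_gen.
by apply/clwZ/clw1 => //=; rewrite negbK.
Qed.

Lemma gcomm1_clw d b a u : clw d.+1 b a -> clw d (~~ b) (gcomm1 b a u).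
Proof.
elim=> [|k s c sd <- _ IH]; first by rewrite gcomm1_0; exact: clw0.
rewrite gcomm1_linear; apply: clwD => //; apply/clwZ/clw_leq; last exact: gcomm1_word.
exact: sd.
Qed.

Definition cl_euler (b : bool) a : C := \sum_i gcomm1 b a (e i) * cE (e' i).

Lemma cl_euler_linear b k a c : cl_euler b (k *: a + c) = k *: cl_euler b a + cl_euler b c.
Proof.
rewrite /cl_euler scaler_sumr -big_split; apply: eq_bigr => i _.
by rewrite gcomm1_linear mulrDl palg_scaleAl.
Qed.

(** The Euler identity in the Clifford algebra, exact up to shorter words. When a letter e_i is put
    in front, its commutators with the frame reassemble to word times e_i by duality, and moving e_i
    back to the front costs a commutator, which is shorter. *)
Lemma cl_euler_word s :
  clw (size s) (odd (size s)) (cl_euler (odd (size s)) (word s) - (size s)%:R *: word s).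
Proof.
elim: s => [|i s IH].
  rewrite scale0r subr0 /cl_euler big1 => [|i _]; first exact: clw0.
  by rewrite /gcomm1 word_nil mulr1 mul1r scale1r subrr mul0r.
set b := odd (size s) in IH *.
have -> : cl_euler (odd (size (i :: s))) (word (i :: s)) - (size (i :: s))%:R *: word (i :: s) =
    cE (e i) * (cl_euler b (word s) - (size s)%:R *: word s) +
    (-1) ^+ b *: gcomm1 b (word s) (e i).
  rewrite word_cons /= -/b /cl_euler.
  under eq_bigr => j _ do rewrite gcomm1_mul mulrDl.
  rewrite big_split /=.
  have -> : \sum_j ((-1) ^+ b * (g x (e i) (e j))%:C%C) *: word s * cE (e' j) =
      (-1) ^+ b *: (word s * cE (e i)).
    rewrite {2}[e i]ee' cE_sum mulr_sumr scaler_sumr; apply: eq_bigr => j _.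
    by rewrite cEZ -palg_scaleAl -palg_scaleAr scalerA.
  rewrite mulrBr mulr_sumr /gcomm1 scalerBr scalerA -signr_addb addbb scale1r.
  rewrite -palg_scaleAr -[(size s).+1%:R]natr1 scalerDl scale1r.
  under eq_bigr => j _ do rewrite -mulrA.
  ncgroup.
apply: clwD; first exact: clw_gen.
by apply: clwZ; have := gcomm1_word s (e i); apply: clw_leq.
Qed.

Lemma cl_euler_clw d b a : clw d.+1 b a -> clw d b (cl_euler b a - d%:R *: a).
Proof.
elim=> [|k s c sd sb _ IH].
  rewrite scaler0 subr0 /cl_euler big1 => [|i _]; [exact: clw0|by rewrite gcomm1_0 mul0r].
have -> : cl_euler b (k *: word s + c) - d%:R *: (k *: word s + c) =
    k *: (cl_euler b (word s) - d%:R *: word s) + (cl_euler b c - d%:R *: c).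
  rewrite cl_euler_linear scalerBr !scalerDr !scalerA [d%:R * k]mulrC; ncgroup.
apply: clwD => //; apply: clwZ.
have := cl_euler_word s; rewrite sb => hs.
have [sdE|sdN] := eqVneq (size s) d; first by rewrite -sdE.
have lt : (size s < d)%N by rewrite ltn_neqAle sdN -ltnS.
rewrite -[cl_euler _ _](subrK ((size s)%:R *: word s)) -addrA -scalerBl.
apply: clwD; first by apply: clw_leq hs; exact: ltnW.
exact/clwZ/clw1.
Qed.

Lemma nuniq_split (T : eqType) (s : seq T) : ~~ uniq s ->
  exists i s1 s2 s3, s = s1 ++ i :: s2 ++ i :: s3.
Proof.
elim: s => //= i s IH; rewrite negb_and negbK; case: (boolP (i \in s)) => [/splitPr[s2 s3] _|_ /= /IH].
  by exists i, [::], s2, s3.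
by move=> [j [s1 [s2 [s3 ->]]]]; exists j, (i :: s1), s2, s3.
Qed.

(* Moving one of two equal letters next to the other shortens the word, as     *)
(* [e_i e_i] is a scalar.                                                      *)
Lemma clw_nuniq s : ~~ uniq s -> clw (size s) (odd (size s)) (word s).
Proof.
move=> /nuniq_split[i [s1 [s2 [s3 ->]]]].
have -> : word (s1 ++ i :: s2 ++ i :: s3) =
    word s1 * (cE (e i) * word s2 * cE (e i)) * word s3.
  by rewrite !(word_cat, word_cons) !mulrA.
set m := size s2; have H : clw m.+1 (odd m) (cE (e i) * word s2 * cE (e i)).
  have -> : cE (e i) * word s2 * cE (e i) = (-1) ^+ odd m *:
      ((2%:R^-1 * (g x (e i) (e i))%:C%C) *: word s2 -
       gcomm1 (odd m) (word s2) (e i) * cE (e i)).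
    have sq : cE (e i) * cE (e i) = (2%:R^-1 * (g x (e i) (e i))%:C%C) *: (1 : C).
      rewrite -scalerA -cEE -[X in _ *: X]mulr2n -[X in _ *: X]scaler_nat scalerA mulVf ?scale1r //.
    have sqw : (2%:R^-1 * (g x (e i) (e i))%:C%C) *: word s2 = word s2 * cE (e i) * cE (e i).
      by rewrite -mulrA sq -palg_scaleAr mulr1.
    rewrite sqw /gcomm1 mulrBl opprB addrCA subrr addr0 -palg_scaleAl scalerA.
    by rewrite -signr_addb addbb scale1r.
  apply: clwZ; apply: clwD; first exact/clwZ/clw1.
  apply: clwN; have := clw_genr (e i) (gcomm1_word s2 (e i)); rewrite negbK; exact.
have := clw_words s1 s3 H; rewrite !size_cat /= size_cat /= -/m.
have -> : odd (size s1 + (m + (size s3).+1).+1) = odd (size s1) (+) odd m (+) odd (size s3).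
  by rewrite !(oddD, addnS) /= oddD; case: (odd _) (odd m) (odd _) => [] [] [].
by apply: clw_leq; rewrite !addnS !addSn !addnA.
Qed.

(** A word with more than P letters repeats a letter and is a combination of shorter ones. This
    bounds the length uniformly over M, although the expansion of a Clifford section is chosen
    separately at each point. *)
Lemma clw_bound d b a : clw d b a -> clw P.+1 b a.
Proof.
elim: d a => [|d IH] a; first exact: clw_leq.
have [dP|Pd] := leqP d P; first exact: clw_leq.
move=> H; apply: IH; elim: H => [|k s c sd sb _ IH]; first exact: clw0.
apply: clwD => //; apply: clwZ.
move: sd; rewrite ltnS leq_eqVlt => /orP[/eqP sd|sd]; last exact: clw1.
rewrite -sd -sb; apply: clw_nuniq; apply/negP => us.
by have := max_card (mem s); rewrite (card_uniqP us) card_ord sd leqNgt Pd.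
Qed.

Lemma clwM d d' b b' a c : clw d b a -> clw d' b' c -> clw (d + d') (b (+) b') (a * c).
Proof.
move=> ha hc; elim: ha => [|k s a' sd <- _ IH]; first by rewrite mul0r; exact: clw0.
rewrite mulrDl -palg_scaleAl; apply: clwD => //; apply: clwZ.
have := clw_words s [::] hc; rewrite word_nil mulr1 addbF; apply: clw_leq.
by rewrite addn0 leq_add2r ltnW.
Qed.

Lemma Cl_parity_clw (b : bool) a : Cl_parity b a -> clw P.+1 b a.
Proof.
move=> H; suff [d hd] : exists d, clw d b a by exact: clw_bound hd.
elim: H => {b a} [k|u|b a c _ [d hd] _ [d' hd']|b b' a c _ [d hd] _ [d' hd']|b].
- by exists 1%N; apply: clwZ; rewrite -word_nil; exact: clw1.
- have := @clw_gen 1 false u 1; rewrite mulr1 -word_nil => H; exists 2; apply: H; exact: clw1.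
- by exists (maxn d d'); apply: clwD; [apply: clw_leq hd|apply: clw_leq hd'];
    rewrite ?leq_maxl ?leq_maxr.
- by exists (d + d')%N; exact: clwM.
- by exists 0%N; exact: clw0.
Qed.

Lemma clw_parity d (b : bool) a : clw d b a -> Cl_parity b a.
Proof.
elim=> [|k s c _ <- _ IH]; first exact: homog_0.
apply: homog_add => //; rewrite -clif_sc.
suff H : Cl_parity (odd (size s)) (word s).
  by have := homog_mul (homog_scal _ (fun=> true) k) H; rewrite add0r.
elim: (s) => [|i t IHs]; first by rewrite word_nil -[1]scale1r; exact: homog_scal.
by rewrite word_cons; exact: (homog_mul (homog_gen _ (fun=> true) _) IHs).
Qed.

Lemma clw_scalar b a : clw 1 b a -> exists k, a = k *: (1 : C).
Proof.
elim=> [|k s c sd _ _ [k' ->]]; first by exists 0; rewrite scale0r.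
by exists (k + k'); case: s sd => // _; rewrite word_nil scalerDl.
Qed.

End words.

End clifford_fibre.

(** * Fixed global frames and symbols over M *)

Section frames.
Context {R : realType} {n : nat} {M : manifold R n} {r : nat}.
Context {E : vbundle (real_scalars M) r} (g : metric E).

Let tf := cid (tangent_frame M).
Definition tnum : nat := sval tf.
Definition tfun : 'I_(tnum) -> Cinf M := sval (cid (svalP tf)).
Definition tvec : 'I_(tnum) -> vfield M := sval (cid (svalP (cid (svalP tf)))).
Lemma tframeP x (v : TM x) : v = \sum_j v (tfun j) *: vfield_at (tvec j) x.
Proof. exact: (svalP (cid (svalP (cid (svalP tf))))). Qed.

Let mf := cid (metric_frame g).
Definition mnum : nat := sval mf.
Definition mvec : 'I_mnum -> Gamma E := sval (cid (svalP mf)).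
Definition mdual : 'I_mnum -> Gamma E := sval (cid (svalP (cid (svalP mf)))).
Let mfP := svalP (cid (svalP (cid (svalP mf)))).
Lemma mframeP x (u : E x) : u = \sum_i g x u (Gamma_at (mdual i) x) *: Gamma_at (mvec i) x.
Proof. exact: (mfP u).1. Qed.
Lemma mdualP x (u : E x) : u = \sum_i g x u (Gamma_at (mvec i) x) *: Gamma_at (mdual i) x.
Proof. exact: (mfP u).2. Qed.

End frames.
Arguments tnum {R n} M.
Arguments mvec {R n M r E} g _.
Arguments mdual {R n M r E} g _.
Arguments tfun {R n} M _.
Arguments tvec {R n} M _.

Section vector_field_expansion.
Context {R : realType} {n : nat} {M : manifold R n}.
Local Notation h := (tfun M).
Local Notation X := (tvec M).

Lemma vfield_ext (Y Z : vfield M) : (forall f, Y f = Z f) -> Y = Z.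
Proof.
case: Y Z => Y HY [Z HZ] /= YZ; have {}YZ : Y = Z by apply/funext.
by move: HY; rewrite YZ => HY; congr MkVfield; exact: Prop_irrelevance.
Qed.

Let zeroP : derivation (fun _ : Cinf M => (0 : Cinf M)).
Proof. by split=> [c f f'|f f']; rewrite ?scaler0 ?addr0 ?mul0r ?mulr0 ?addr0. Qed.

Lemma vfield_expand (Y : vfield M) : Y =
  foldr (fun j Z => vadd (vscale (Y (h j)) (X j)) Z) (MkVfield zeroP) (enum 'I_(tnum M)).
Proof.
apply: vfield_ext => f; apply: Cinf_ext => y.
have := congr1 (fun v : TM y => v f) (tframeP (vfield_at Y y)).
rewrite TM_fun_sum => Ef; rewrite [LHS]Ef -(big_enum _ _ (fun=> true)) /=.
by elim: (enum _) => [|j s IH]; rewrite ?big_nil // big_cons IH.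
Qed.

Lemma nabla_expand (K : scalars M) (locK : local_scalars K) r (F : vbundle K r)
    (nF : connection F) Y s : nF Y s = \sum_j fsmul (Y (h j)) (nF (X j) s).
Proof.
rewrite [in LHS](vfield_expand Y) -(big_enum _ _ (fun=> true)) /=.
elim: (enum _) => [|j q IH]; last by rewrite big_cons /= nabla_vadd nabla_vscale IH.
rewrite big_nil /=; have -> : MkVfield zeroP = vscale 0 (MkVfield zeroP).
  by apply: vfield_ext => f; rewrite /= mul0r.
rewrite nabla_vscale; apply: Gamma_ext => x; rewrite Gamma_at_fsmul.
have -> : (0 : Cinf M) x = 0 by [].
by rewrite (semb0 locK) scale0r.
Qed.

End vector_field_expansion.

Section global_symbols.
Context {R : realType} {n : nat} {M : manifold R n} {r : nat}.
Context {E : vbundle (real_scalars M) r} (g : metric E) (nE : connection E).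
Local Notation h := (tfun M).
Local Notation X := (tvec M).
Local Notation Om x := (palg (@symext_rel R n M r E x)).

Definition osymbol : Type := forall x, Om x.
Implicit Types (a b : osymbol) (f : Cinf M) (xi eta : Gamma E).
Local Notation smooth := (smooth_alg (@smooth_generators R n M r E)).

Lemma osym_ext a b : (forall x, a x = b x) -> a = b.
Proof. exact: functional_extensionality_dep. Qed.

(** The covariant derivative along a single tangent vector, defined through the global frame. It
    agrees with [nE Y xi] at x for vectors coming from a field Y, because Y expands in the same
    frame. *)
Definition nabla_at xi x (v : TM x) : E x :=
  \sum_j v (h j) *: Gamma_at (nE (X j) xi) x.

Lemma nabla_at_linear xi x (c : R) (v w : TM x) :
  nabla_at xi (c *: v + w) = c *: nabla_at xi v + nabla_at xi w.
Proof.
rewrite /nabla_at scaler_sumr -big_split /=; apply: eq_bigr => j _.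
by rewrite scalerA -scalerDl.
Qed.

Lemma nabla_at_vfield xi x (Y : vfield M) : nabla_at xi (vfield_at Y x) = Gamma_at (nE Y xi) x.
Proof. by rewrite (nabla_expand (local_real_scalars M) nE Y) Gamma_at_sum. Qed.

Definition fO f a : osymbol := fun x => dF f (a x).
Definition dO xi a : osymbol := fun x => dX g (@nabla_at xi x) (Gamma_at xi x) (a x).

Lemma dX_fsmul f xi x (p : Om x) :
  dX g (@nabla_at (fsmul f xi) x) (Gamma_at (fsmul f xi) x) p =
  (f x)%:C%C *: dX g (@nabla_at xi x) (Gamma_at xi x) p + dF f p * tE (Gamma_at xi x).
Proof.
have L y := nabla_at_linear y (x := x).
have Nf (v : TM x) : nabla_at (fsmul f xi) v = v f *: Gamma_at xi x + f x *: nabla_at xi v.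
  rewrite {2}[v]tframeP TM_fun_sum scaler_suml scaler_sumr -big_split /=.
  apply: eq_bigr => j _.
  by rewrite nabla_leibniz Gamma_atD !Gamma_at_fsmul scalerDr !scalerA [f x * _]mulrC.
apply: (symext_ind (P := fun p => dX g (@nabla_at (fsmul f xi) x) (Gamma_at (fsmul f xi) x) p =
  (f x)%:C%C *: dX g (@nabla_at xi x) (Gamma_at xi x) p + dF f p * tE (Gamma_at xi x))) p.
- by move=> c; rewrite !(dX_scal g _ (L _)) dF_scal scaler0 mul0r addr0.
- by move=> v; rewrite !(dXT g _ (L _)) dFT Nf tED !tEZ addrC -palg_scaleAl mul1r.
- move=> u; rewrite !(dXE g _ (L _)) dFE mul0r addr0 Gamma_at_fsmul metricZr.
  by rewrite rmorphM /= scalerA.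
- by move=> a b IHa IHb; rewrite !(dXD g _ (L _)) dFD IHa IHb scalerDr mulrDl addrACA.
- move=> a b IHa IHb; rewrite !(dXM g _ (L _)) dFM IHa IHb scalerDr !mulrDr !mulrDl.
  rewrite -palg_scaleAl -palg_scaleAr.
  have -> : dF f a * tE (Gamma_at xi x) * theta b = dF f a * b * tE (Gamma_at xi x).
    by rewrite -mulrA tE_comm thetaK mulrA.
  rewrite !mulrA; ncgroup.
Qed.

Definition euler_X j : osymbol := fun x =>
  2%:R *: tT (vfield_at (X j) x) -
  \sum_i tE (Gamma_at (nE (X j) (mvec g i)) x) * tE (Gamma_at (mdual g i) x).

Lemma osym_euler k a x : homog (@total_degree R n M r E x) k (a x) ->
  k%:R *: a x = \sum_j fO (h j) a x * euler_X j x +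
    \sum_i dO (mvec g i) a x * tE (Gamma_at (mdual g i) x).
Proof.
move=> ha.
rewrite (symext_euler (@tframeP _ _ _ x) (@mdualP _ _ _ _ _ g x)
  (fun i => @nabla_at_linear (mvec g i) x) ha); congr (_ + _).
apply: eq_bigr => j _; congr (_ * _); congr (_ - _); apply: eq_bigr => i _.
by rewrite nabla_at_vfield.
Qed.

(** Comparing {a, fξ} = f {a, ξ} + {a, f} ξ with the hypothesis gives {a, f} ξ = 0. Bracketing with
    η yields g(ξ, η) {a, f} = 0, and positive rank provides ξ and η with g(ξ, η) nonzero at x. So
    all brackets of a with functions and sections vanish, and the Euler identity gives k a = 0. *)
Lemma osym_nondegenerate k a x : (0 < r)%N -> (0 < k)%N ->
  homog (@total_degree R n M r E x) k (a x) -> (forall xi, dO xi a x = 0) -> a x = 0.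
Proof.
move=> r0 k0 ha da.
have fa f : dF f (a x) = 0.
  have [u u0] : exists u : E x, u != 0.
    have [e Fe ex] := frame_cover E x; exists (fvec e (Ordinal r0) x); apply/eqP => e0.
    have := fcoef_fvec (Ordinal r0) (Ordinal r0) Fe ex; rewrite e0 eqxx.
    have := fcoef_uniq (v := 0) (c := fun=> 0) Fe ex.
    rewrite big1 => [-> // /eqP|i _]; last by rewrite scale0r.
    by rewrite eq_sym oner_eq0.
  have [w /eqP uw] : exists w, g x u w <> 0.
    apply: contrapT => H; move/eqP: u0; apply; apply: (metric_nondegenerate (m := g)) => w.
    by apply: contrapT => uw; apply: H; exists w.
  have [xi xiu] := section_through (local_real_scalars M) u.
  have [eta etaw] := section_through (local_real_scalars M) w.
  have H : dF f (a x) * tE (Gamma_at xi x) = 0.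
    by have := dX_fsmul f xi (a x); rewrite -!/(dO _ a x) !da scaler0 add0r => <-.
  have := congr1 (dX g (@nabla_at eta x) (Gamma_at eta x)) H.
  have L := nabla_at_linear eta (x := x).
  rewrite (dXM g _ L) (dX0 g _ L) (dXE g _ L) -(dF_dX g _ L) -/(dO eta a x) da dF0 mul0r addr0.
  rewrite -palg_scaleAr mulr1 xiu etaw => /(congr1 (fun p => ((g x u w)%:C%C)^-1 *: p)).
  rewrite scaler0 scalerA mulVf ?scale1r // ; apply: contra uw => /eqP /(congr1 (@complex.Re R)).
  by move=> /= ->.
apply: (scale_natr_eq0 k0); rewrite (osym_euler ha) !big1 ?addr0 // => [i _|j _].
  by rewrite da mul0r.
by rewrite /fO fa mul0r.
Qed.

Lemma smooth_alg_ext a b : (forall x, a x = b x) -> smooth b -> smooth a.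
Proof. by move=> /osym_ext ->. Qed.

Lemma smooth_alg_scal (c : M -> R[i]) a : csmooth_on setT c -> smooth a ->
  smooth ((fun x => c x *: a x) : osymbol).
Proof.
move=> sc sa; have := smooth_alg_mul (smooth_alg_fun _ sc) sa.
by apply: smooth_alg_ext => x; rewrite -palg_scaleAl mul1r.
Qed.

Lemma smooth_alg0 : smooth ((fun x => 0) : osymbol).
Proof.
have := smooth_alg_fun (rel := @symext_rel R n M r E) (@smooth_generators R n M r E) (csmooth_cst setT (0 : R[i])).
by apply: smooth_alg_ext => x; rewrite scale0r.
Qed.

Lemma fO_smooth f a : smooth a -> smooth (fO f a).
Proof.
elim=> {a} [c sc|u gu|a b sa IHa sb IHb|a b sa IHa sb IHb|a b sb IHb ab].
- by apply: smooth_alg_ext smooth_alg0 => x; rewrite /fO dF_scal.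
- case: gu => [[Y ->]|[xi ->]].
    have := smooth_alg_fun (rel := @symext_rel R n M r E) (@smooth_generators R n M r E) (csmooth_real (CinfP (Y f))).
    by apply: smooth_alg_ext => x; rewrite /fO dFT.
  by apply: smooth_alg_ext smooth_alg0 => x; rewrite /fO dFE.
- by apply: smooth_alg_ext (smooth_alg_add IHa IHb) => x; rewrite /fO dFD.
- by apply: smooth_alg_ext (smooth_alg_add (smooth_alg_mul sa IHb) (smooth_alg_mul IHa sb)) => x;
    rewrite /fO dFM.
- apply: (smooth_alg_local (b := fun x => fO f (b x))) => // x.
  by apply: filterS (ab x) => y; rewrite /fO => ->.
Qed.

Lemma theta_smooth a : smooth a -> smooth (fun x => theta (a x)).
Proof.
elim=> {a} [c sc|u gu|a b sa IHa sb IHb|a b sa IHa sb IHb|a b sb IHb ab].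
- by apply: smooth_alg_ext (smooth_alg_fun _ sc) => x; rewrite theta_scal.
- case: gu => [[Y ->]|[xi ->]].
    apply: smooth_alg_ext (smooth_alg_gen (or_introl (ex_intro _ Y erefl))) => x; exact: thetaT.
  have := smooth_alg_scal (csmooth_cst setT (-1 : R[i])) (smooth_alg_gen
    (gens := @smooth_generators R n M r E) (or_intror (ex_intro _ xi erefl))).
  by apply: smooth_alg_ext => x; rewrite scaleN1r [LHS]thetaE.
- by apply: smooth_alg_ext (smooth_alg_add IHa IHb) => x; rewrite thetaD.
- by apply: smooth_alg_ext (smooth_alg_mul IHa IHb) => x; rewrite thetaM.
- apply: (smooth_alg_local (b := fun x y => theta (b x y))) => // x.
  by apply: filterS (ab x) => y ->.
Qed.

Lemma dO_smooth xi a : smooth a -> smooth (dO xi a).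
Proof.
have L x := @nabla_at_linear xi x.
elim=> {a} [c sc|u gu|a b sa IHa sb IHb|a b sa IHa sb IHb|a b sb IHb ab].
- by apply: smooth_alg_ext smooth_alg0 => x; rewrite /dO (dX_scal g _ (L x)).
- case: gu => [[Y ->]|[eta ->]].
    apply: smooth_alg_ext (smooth_alg_gen (or_intror (ex_intro _ (nE Y xi) erefl))) => x.
    by rewrite /dO [LHS](dXT g _ (L x)) nabla_at_vfield.
  have := smooth_alg_fun (rel := @symext_rel R n M r E) (@smooth_generators R n M r E) (csmooth_real (metric_smooth g eta xi)).
  by apply: smooth_alg_ext => x; rewrite /dO [LHS](dXE g _ (L x)).
- by apply: smooth_alg_ext (smooth_alg_add IHa IHb) => x; rewrite /dO (dXD g _ (L x)).
- apply: smooth_alg_ext (smooth_alg_add (smooth_alg_mul sa IHb)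
    (smooth_alg_mul IHa (theta_smooth sb))) => x.
  by rewrite /dO (dXM g _ (L x)).
- apply: (smooth_alg_local (b := fun x => dO xi (b x))) => // x.
  by apply: filterS (ab x) => y; rewrite /dO => ->.
Qed.

Lemma aug_smooth a : smooth a -> csmooth_on setT (fun x => aug (a x)).
Proof.
elim=> {a} [c sc|u gu|a b sa IHa sb IHb|a b sa IHa sb IHb|a b sb IHb ab].
- by have -> : (fun x => aug (c x *: (1 : Om x))) = c by apply/funext => x; rewrite aug_scal.
- have -> : (fun x => aug (agen (u x) : Om x)) = fun=> 0 by apply/funext => x; rewrite aug_gen.
  exact: csmooth_cst.
- have -> : (fun x => aug (a x + b x)) = (fun x => aug (a x) + aug (b x)).
    by apply/funext => x; rewrite augD.
  exact: csmoothD.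
- have -> : (fun x => aug (a x * b x)) = (fun x => aug (a x) * aug (b x)).
    by apply/funext => x; rewrite augM.
  exact: csmoothM.
- apply: (ssmooth_local (local_complex_scalars M)) => x _.
  have : nbhs x [set y | a y = b x y] := ab x.
  rewrite nbhsE => -[W [oW Wx] Wab]; exists W; split => //.
  apply: (ssmooth_ext (local_complex_scalars M) (f := fun y => aug (b x y))) => //.
    by move=> y /Wab /= ->.
  exact: (ssmooth_sub (local_complex_scalars M) (@subsetT _ W)) (IHb x).
Qed.

End global_symbols.

(** * The ring of linear operators on Γ(S) *)

Section linear_operators.
Context {R : realType} {n : nat} {M : manifold R n} {r : nat}.
Context {E : vbundle (real_scalars M) r} {g : metric E} (S : spinor_bundle g).
Local Notation K := (complex_scalars M).

Definition lop_pred : {pred operator S} := fun D => `[< linear_op D >].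
(** For linear operators composition distributes over addition on both sides, so they form a ring in
    which commutator identities can be settled by [ncring]. *)
Record lop := MkLop { lop_op : operator S; _ : lop_op \in lop_pred }.
Definition lop_fun (D : lop) : Gamma S -> Gamma S := lop_op D.
Coercion lop_fun : lop >-> Funclass.
HB.instance Definition _ := [isSub for lop_op].
HB.instance Definition _ := [Choice of lop by <:].

Lemma lop_submod : @GRing.submod_closed K (operator S) lop_pred.
Proof.
split=> [|c A B /asboolP lA /asboolP lB]; apply/asboolP => d s t.
  by change (0 = d *: 0 + 0 :> Gamma S); rewrite scaler0 addr0.
change (c *: A (d *: s + t) + B (d *: s + t) = d *: (c *: A s + B s) + (c *: A t + B t)).
by rewrite lA lB !scalerDr !scalerA (mulrC c d); ncgroup.
Qed.
HB.instance Definition _ := GRing.isSubmodClosed.Build K (operator S) lop_pred lop_submod.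
HB.instance Definition _ := [SubChoice_isSubZmodule of lop by <:].
HB.instance Definition _ := [SubZmodule_isSubLmodule of lop by <:].

Lemma lopP (D : lop) (c : K) s t : D (c *: s + t) = c *: D s + D t.
Proof. by case: D => D DP; move/asboolP: (DP); apply. Qed.
Definition mklop (D : operator S) (lD : linear_op D) : lop := MkLop (asboolT lD : D \in lop_pred).

Lemma lop_ext (A B : lop) : (forall s x, Gamma_at (A s) x = Gamma_at (B s) x) -> A = B.
Proof. by move=> AB; apply/val_inj/funext => s; apply: Gamma_ext => x; exact: AB. Qed.

Lemma lopD (A : lop) s t : A (s + t) = A s + A t.
Proof. by have := lopP A 1 s t; rewrite !scale1r. Qed.
Lemma lop0 (A : lop) : A 0 = 0.
Proof. by apply: (addrI (A 0)); rewrite -lopD !addr0. Qed.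
Lemma lopZ (A : lop) (c : K) s : A (c *: s) = c *: A s.
Proof. by have := lopP A c s 0; rewrite lop0 !addr0. Qed.

Let lmul_subproof (A B : lop) : linear_op (A \o B).
Proof. by move=> c s t; rewrite /= !lopP. Qed.
Definition lcomp A B : lop := mklop (lmul_subproof A B).
Let lone_subproof : linear_op (idfun : operator S). Proof. by []. Qed.
Definition lone : lop := mklop lone_subproof.

Let lcompA : associative lcomp. Proof. by move=> A B C; apply: lop_ext. Qed.
Let lcomp1 : left_id lone lcomp. Proof. by move=> A; apply: lop_ext. Qed.
Let lcomp1r : right_id lone lcomp. Proof. by move=> A; apply: lop_ext. Qed.
Let lcompDl : left_distributive lcomp +%R. Proof. by move=> A B C; apply: lop_ext. Qed.
Let lcompDr : right_distributive lcomp +%R.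
Proof. by move=> A B C; apply: lop_ext => s x; rewrite [in LHS]/= lopD. Qed.
HB.instance Definition _ :=
  GRing.Zmodule_isPzRing.Build lop lcompA lcomp1 lcomp1r lcompDl lcompDr.

Lemma lop_scalel (c : R[i]) (A B : lop) : (c : K) *: (A * B) = ((c : K) *: A) * B.
Proof. by apply: lop_ext. Qed.
Lemma lop_scaler (c : R[i]) (A B : lop) : (c : K) *: (A * B) = A * ((c : K) *: B).
Proof. by apply: lop_ext => s x; rewrite [in RHS]/= lopZ. Qed.

Lemma lop_atM (A B : lop) s : (A * B) s = A (B s). Proof. by []. Qed.
Lemma lop_atD (A B : lop) s : (A + B) s = A s + B s. Proof. by []. Qed.
Lemma lop_atN (A : lop) s : (- A) s = - A s. Proof. by []. Qed.
Lemma lop_atZ (c : K) (A : lop) s : (c *: A) s = c *: A s. Proof. by []. Qed.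
Lemma lop_at0 s : (0 : lop) s = 0. Proof. by []. Qed.
Lemma lop_sum (I : Type) (q : seq I) (F : I -> lop) s :
  (\sum_(i <- q) F i) s = \sum_(i <- q) F i s.
Proof. by elim: q => [|i q IH]; rewrite ?big_nil // !big_cons lop_atD IH. Qed.

Let lmulf_subproof (f : Cinf M) : linear_op (mul_op S f).
Proof.
move=> c s t; apply: Gamma_ext => x.
rewrite !(Gamma_at_fsmul, Gamma_atD, Gamma_atZ) scalerDr !scalerA; congr (_ *: _ + _).
exact: mulrC.
Qed.
Definition lmulf f : lop := mklop (lmulf_subproof f).
Lemma lmulf_at f s x : Gamma_at (lmulf f s) x = (f x)%:C%C *: Gamma_at s x. Proof. by []. Qed.

Let lgam_subproof xi : linear_op (gamma S xi).
Proof. by move=> c s t; apply: Gamma_ext => x; exact: cliff_linear. Qed.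
Definition lgam xi : lop := mklop (lgam_subproof xi).
Lemma lgam_at xi s x : Gamma_at (lgam xi s) x = cliff S (cE g (Gamma_at xi x)) (Gamma_at s x).
Proof. by []. Qed.

Definition lnab (nS : connection S) (Y : vfield M) : lop := mklop (nabla_linear nS Y).

Lemma cliff_scale x (c : R[i]) (a : Cl g x) s : cliff S (c *: a) s = c *: cliff S a s.
Proof. by have := @cliffD _ _ _ _ _ _ S x c a 0 s; rewrite cliff0 !addr0. Qed.
Lemma cliff_add x (a b : Cl g x) s : cliff S (a + b) s = cliff S a s + cliff S b s.
Proof. by have := @cliffD _ _ _ _ _ _ S x 1 a b s; rewrite !scale1r. Qed.
Lemma cliff_sum (I : Type) (q : seq I) x (F : I -> Cl g x) s :
  cliff S (\sum_(i <- q) F i) s = \sum_(i <- q) cliff S (F i) s.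
Proof. by elim: q => [|i q IH]; rewrite ?big_nil ?cliff0 // !big_cons cliff_add IH. Qed.
Lemma cliffZr x (c : R[i]) (a : Cl g x) s : cliff S a (c *: s) = c *: cliff S a s.
Proof.
have := @cliff_linear _ _ _ _ _ _ S x a c s 0; have -> : cliff S a 0 = 0.
  by apply: (addrI (cliff S a 0)); have := @cliff_linear _ _ _ _ _ _ S x a 1 0 0; rewrite !scale1r !addr0 => <-.
by rewrite !addr0.
Qed.

Lemma lmulfM f f' : lmulf (f * f') = lmulf f * lmulf f'.
Proof.
apply: lop_ext => s x; rewrite lop_atM !lmulf_at scalerA; congr (_ *: _).
by rewrite -rmorphM.
Qed.
Lemma lmulfC f f' : lmulf f * lmulf f' = lmulf f' * lmulf f.
Proof. by rewrite -!lmulfM mulrC. Qed.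
Lemma lgam_lmulf xi f : lgam xi * lmulf f = lmulf f * lgam xi.
Proof. by apply: lop_ext => s x; rewrite !lop_atM lgam_at !lmulf_at cliffZr. Qed.
Lemma lgamD xi eta : lgam (xi + eta) = lgam xi + lgam eta.
Proof. by apply: lop_ext => s x; rewrite lop_atD Gamma_atD !lgam_at Gamma_atD cED cliff_add. Qed.
Lemma lgam0 : lgam 0 = 0.
Proof. by apply: (addrI (lgam 0)); rewrite -lgamD !addr0. Qed.
Lemma lgamZ (c : R) xi : lgam ((c : real_scalars M) *: xi) = (c%:C%C : K) *: lgam xi.
Proof. by apply: lop_ext => s x; rewrite lop_atZ Gamma_atZ !lgam_at Gamma_atZ cEZ cliff_scale. Qed.
Lemma lgam_sum (I : Type) (q : seq I) (F : I -> Gamma E) :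
  lgam (\sum_(i <- q) F i) = \sum_(i <- q) lgam (F i).
Proof. by elim: q => [|i q IH]; rewrite ?big_nil ?lgam0 // !big_cons lgamD IH. Qed.
Lemma lgam_fsmul f xi : lgam (fsmul f xi) = lmulf f * lgam xi.
Proof.
apply: lop_ext => s x.
by rewrite lop_atM lmulf_at !lgam_at Gamma_at_fsmul cEZ cliff_scale.
Qed.
Lemma lgam_anti xi eta : lgam xi * lgam eta + lgam eta * lgam xi = lmulf (metric_fun g xi eta).
Proof.
apply: lop_ext => s x; rewrite lop_atD Gamma_atD !lop_atM lmulf_at !lgam_at -!cliffM -cliff_add.
by rewrite cEE cliff_scale cliff1.
Qed.
Lemma lnab_lmulf nS Y f : lnab nS Y * lmulf f - lmulf f * lnab nS Y = lmulf (Y f).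
Proof.
apply: lop_ext => s x; rewrite lop_atD lop_atN !lop_atM.
have -> : lnab nS Y (lmulf f s) = lmulf (Y f) s + lmulf f (lnab nS Y s).
  exact: nabla_leibniz.
by rewrite addrK.
Qed.
Lemma lnab_lgam nE nS Y xi : compatible nE nS ->
  lnab nS Y * lgam xi - lgam xi * lnab nS Y = lgam (nE Y xi).
Proof.
move=> [_ /(_ Y 1%N (fun=> xi))].
have W (F : 'I_1 -> Gamma E) : gamma_wedge S F = gamma S (F ord0).
  rewrite /gamma_wedge invr1 scale1r (big_pred1 (1%g : 'S_1)) => [|w]; last first.
    rewrite /=; apply/esym/eqP/permP => i; rewrite perm1; by rewrite !ord1.
  by rewrite odd_perm1 scale1r big_ord_recl big_ord0 perm1; apply/funext.
rewrite big_ord_recl big_ord0 addr0 !W eqxx => H.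
by apply/val_inj; exact: H.
Qed.
Lemma lnab_vadd nS Y Z : lnab nS (vadd Y Z) = lnab nS Y + lnab nS Z.
Proof. by apply: lop_ext => s x; rewrite lop_atD [lnab _ _ _]nabla_vadd. Qed.
Lemma lnab_vscale nS f Y : lnab nS (vscale f Y) = lmulf f * lnab nS Y.
Proof. by apply: lop_ext => s x; rewrite lop_atM [lnab _ _ _]nabla_vscale. Qed.

(* The graded commutator of operators of parities b and c.                     *)
Definition gcom (b c : bool) (A B : lop) : lop :=
  if b && c then A * B + B * A else A * B - B * A.

End linear_operators.

(** * Operators with symbols and their commutators with generators *)

Section span.
Context {R : realType} {n : nat} {M : manifold R n} {r : nat}.
Context {E : vbundle (real_scalars M) r} {g : metric E} (S : spinor_bundle g).
Variables (nE : connection E) (nS : connection S).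
Local Notation K := (complex_scalars M).
Local Notation lop := (lop S).
Local Notation osym := (@osymbol R n M r E).
Local Notation Om x := (palg (@symext_rel R n M r E x)).
Implicit Types (A B D : lop) (a : osym) (b c : bool) (k l m : nat).

(* [Span m b D a]: D is a combination of products of degree at most m and of   *)
(* parity b of functions, Clifford generators and covariant derivatives, and   *)
(* a is the sum of the corresponding products of degree m.                     *)
Inductive Span : nat -> bool -> lop -> osym -> Prop :=
  | Span_f f : Span 0 false (lmulf S f) (fun x => (f x)%:C%C *: (1 : Om x))
  | Span_g xi : Span 1 true (lgam S xi) (fun x => tE (Gamma_at xi x))
  | Span_n Y : Span 2 false (lnab nS Y) (fun x => tT (vfield_at Y x))
  | Span_0 m b : Span m b 0 (fun x => 0)
  | Span_scale m b (z : R[i]) D a : Span m b D a -> Span m b ((z : K) *: D) (fun x => z *: a x)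
  | Span_add m b A B a a' : Span m b A a -> Span m b B a' -> Span m b (A + B) (fun x => a x + a' x)
  | Span_mul m l b c A B a a' : Span m b A a -> Span l c B a' ->
      Span (m + l) (b (+) c) (A * B) (fun x => a x * a' x)
  | Span_low m l b D a : (m < l)%N -> Span m b D a -> Span l b D (fun x => 0).

Lemma Span_eq m b D D' a a' : Span m b D a -> D = D' -> (forall x, a x = a' x) -> Span m b D' a'.
Proof. by move=> H <- /osym_ext <-. Qed.

Lemma Span_theta m b D a : Span m b D a -> forall x, theta (a x) = (-1) ^+ b *: a x.
Proof.
elim=> {m b D a} [f|xi|Y|m b|m b z D a _ IH|m b A B a a' _ IH _ IH'|m l b c A B a a' _ IH _ IH'|m l b D a _ _ IH] x /=.
- by rewrite theta_scal scale1r.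
- by rewrite thetaE scaleN1r.
- by rewrite thetaT scale1r.
- by rewrite theta0 scaler0.
- by rewrite thetaZ IH !scalerA mulrC.
- by rewrite thetaD IH IH' scalerDr.
- by rewrite thetaM IH IH' -palg_scaleAl -palg_scaleAr scalerA signr_addb.
- by rewrite theta0 scaler0.
Qed.

Lemma Span_homog m b D a : Span m b D a -> forall x, homog (@total_degree R n M r E x) m (a x).
Proof.
elim=> {m b D a} [f|xi|Y|m b|m b z D a _ IH|m b A B a a' _ IH _ IH'|m l b c A B a a' _ IH _ IH'|m l b D a _ _ IH] x.
- exact: homog_scal.
- exact: homogE.
- exact: homogT.
- exact: homog_0.
- exact: homogZ.
- exact: homog_add.
- exact: homogM.
- exact: homog_0.
Qed.

Lemma Span_smooth m b D a : Span m b D a -> smooth_alg (@smooth_generators R n M r E) a.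
Proof.
elim=> {m b D a} [f|xi|Y|m b|m b z D a _ IH|m b A B a a' _ IH _ IH'|m l b c A B a a' _ IH _ IH'|m l b D a _ _ IH].
- exact: (smooth_alg_fun _ (csmooth_real (CinfP f))).
- exact: (smooth_alg_gen (or_intror (ex_intro _ xi erefl))).
- exact: (smooth_alg_gen (or_introl (ex_intro _ Y erefl))).
- exact: smooth_alg0.
- exact: (smooth_alg_scal (csmooth_cst setT z)).
- exact: smooth_alg_add.
- exact: smooth_alg_mul.
- exact: smooth_alg0.
Qed.

(* [Sp k m b D a]: the same in degree m - k, everything being 0 if m < k.      *)
Definition Sp k m b D a : Prop :=
  if (k <= m)%N then Span (m - k) b D a else D = 0 /\ forall x, a x = 0.

Lemma Sp0E m b D a : Sp 0 m b D a <-> Span m b D a.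
Proof. by rewrite /Sp leq0n subn0. Qed.

Lemma Sp_eq k m b D D' a a' : Sp k m b D a -> D = D' -> (forall x, a x = a' x) -> Sp k m b D' a'.
Proof. by move=> H <- /osym_ext <-. Qed.

Lemma Sp_0 k m b : Sp k m b 0 (fun x => 0).
Proof. by rewrite /Sp; case: ifP => _ //; exact: Span_0. Qed.

Lemma Sp_scale k m b (z : R[i]) D a : Sp k m b D a -> Sp k m b ((z : K) *: D) (fun x => z *: a x).
Proof.
rewrite /Sp; case: ifP => _; first exact: Span_scale.
by move=> [-> a0]; split=> [|x]; rewrite ?a0 scaler0.
Qed.

Lemma Sp_add k m b A B a a' : Sp k m b A a -> Sp k m b B a' -> Sp k m b (A + B) (fun x => a x + a' x).
Proof.
rewrite /Sp; case: ifP => _; first exact: Span_add.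
by move=> [-> a0] [-> b0]; split=> [|x]; rewrite ?a0 ?b0 addr0.
Qed.

Lemma Sp_opp k m b D a : Sp k m b D a -> Sp k m b (- D) (fun x => - a x).
Proof.
move=> /(Sp_scale (-1)) H; apply: Sp_eq H _ _ => [|x]; last exact: scaleN1r.
by apply: lop_ext => s x; rewrite lop_atZ lop_atN [LHS]scaleN1r.
Qed.

Lemma Sp_sub k m b A B a a' : Sp k m b A a -> Sp k m b B a' -> Sp k m b (A - B) (fun x => a x - a' x).
Proof. by move=> HA HB; apply: Sp_add => //; exact: Sp_opp. Qed.

Lemma Sp_sum k m b (I : Type) (q : seq I) (F : I -> lop) (G : I -> osym) :
  (forall i, Sp k m b (F i) (G i)) -> Sp k m b (\sum_(i <- q) F i) (fun x => \sum_(i <- q) G i x).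
Proof.
move=> H; elim: q => [|i q IH].
  by apply: Sp_eq (Sp_0 k m b) _ _ => [|x]; rewrite big_nil.
by apply: Sp_eq (Sp_add (H i) IH) _ _ => [|x]; rewrite big_cons.
Qed.

Lemma Sp_mul k k' m l b c A B a a' : Sp k m b A a -> Sp k' l c B a' ->
  Sp (k + k') (m + l) (b (+) c) (A * B) (fun x => a x * a' x).
Proof.
rewrite {1 2}/Sp; case: (leqP k m) => [km|mk]; case: (leqP k' l) => [kl|lk].
- move=> HA HB; rewrite /Sp leq_add //; have := Span_mul HA HB.
  by have -> : (m - k + (l - k') = m + l - (k + k'))%N by rewrite subnDA addnBA // addnBAC // subnBA.
- by move=> _ [-> b0]; apply: Sp_eq (Sp_0 _ _ _) _ _ => [|x]; rewrite ?b0 mulr0.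
- by move=> [-> b0] _; apply: Sp_eq (Sp_0 _ _ _) _ _ => [|x]; rewrite ?b0 mul0r.
- by move=> _ [-> b0]; apply: Sp_eq (Sp_0 _ _ _) _ _ => [|x]; rewrite ?b0 mulr0.
Qed.

Lemma Sp_low k m k' m' b D a : (k' + m < k + m')%N -> Sp k m b D a -> Sp k' m' b D (fun x => 0).
Proof.
move=> lt; rewrite {1}/Sp; case: leqP => [km|mk]; last by move=> [-> _]; exact: Sp_0.
move=> H; rewrite /Sp; have k'm' : (k' <= m')%N.
  by rewrite -(leq_add2l k) (leq_trans _ (ltnW lt)) // addnC leq_add2l.
rewrite k'm'; apply: Span_low H; rewrite ltn_subLR // addnBA // ltn_subRL //.
Qed.

Lemma Sp_shift k m k' m' b D a : (k' + m = k + m')%N -> Sp k m b D a -> Sp k' m' b D a.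
Proof.
move=> eq; rewrite /Sp; have -> : (k' <= m')%N = (k <= m)%N.
  by rewrite -(leq_add2l k) -eq addnC leq_add2l.
by case: leqP => // km; have -> : (m' - k' = m - k)%N by rewrite -(subnDl k) -eq [(k + k')%N]addnC subnDl.
Qed.

End span.

Section commutators.
Context {R : realType} {n : nat} {M : manifold R n} {r : nat}.
Context {E : vbundle (real_scalars M) r} {g : metric E} {S : spinor_bundle g}.
Context {nE : connection E} {nS : connection S}.
Hypothesis nES : compatible nE nS.
Local Notation K := (complex_scalars M).
Local Notation lop := (lop S).
Local Notation osym := (@osymbol R n M r E).
Local Notation Om x := (palg (@symext_rel R n M r E x)).
Local Notation Span := (@Span R n M r E g S nS).
Local Notation Sp := (@Sp R n M r E g S nS).
Local Notation dO := (dO g nE).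
Implicit Types (A B D : lop) (a : osym) (b c : bool) (k l m : nat).

Lemma Span_Sp m b D a : Span m b D a -> Sp 0 m b D a.
Proof. by rewrite Sp0E. Qed.

(** Among the generators only ∇_Y fails to commute with f, with [∇_Y, f] = Y(f) = {Y, f}. The
    Leibniz rule of commutators then matches the one of the derivation {-, f}. *)
Lemma Span_comm_f f m b D a : Span m b D a ->
  Sp 2 m b (D * lmulf S f - lmulf S f * D) (fO f a).
Proof.
elim=> {m b D a} [f'|xi|Y|m b|m b z D a _ IH|m b A B a a' _ IH _ IH'|m l b c A B a a' hA IH hB IH'|m l b D a ml _ IH].
- by apply: Sp_eq (Sp_0 _ _ _ _) _ _ => [|x]; rewrite ?[lmulf S f' * _]lmulfC ?subrr // /fO dF_scal.
- by apply: Sp_eq (Sp_0 _ _ _ _) _ _ => [|x]; rewrite ?lgam_lmulf ?subrr // /fO dFE.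
- apply: Sp_eq (Sp_shift (erefl : (2 + 0 = 0 + 2)%N) (Span_Sp (Span_f nS (Y f)))) _ _ => [|x].
    by rewrite lnab_lmulf.
  by rewrite /fO dFT.
- by apply: Sp_eq (Sp_0 _ _ _ _) _ _ => [|x]; rewrite ?mul0r ?mulr0 ?subrr // /fO dF0.
- apply: Sp_eq (Sp_scale z IH) _ _ => [|x]; last by rewrite /fO dFZ.
  by rewrite -lop_scalel -lop_scaler scalerBr.
- apply: Sp_eq (Sp_add IH IH') _ _ => [|x]; last by rewrite /fO dFD.
  ncring.
- apply: Sp_eq (Sp_add (Sp_mul (Span_Sp hA) IH') (Sp_mul IH (Span_Sp hB))) _ _ => [|x].
    ncring.
  by rewrite /fO dFM.
- apply: Sp_eq (Sp_low _ IH) _ _ => [||x] //; last by rewrite /fO dF0.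
Qed.

(** On generators the graded commutators are g(η, ξ) and ∇_Y ξ, by the Clifford relation and
    compatibility. For products, the sign of the graded Leibniz rule is the action of [theta] on the
    symbol of the second factor, whose operator has parity c. *)
Lemma Span_comm_g xi m b D a : Span m b D a ->
  Sp 1 m (~~ b) (gcom b true D (lgam S xi)) (dO xi a).
Proof.
have L x := @nabla_at_linear _ _ _ _ _ nE xi x.
elim=> {m b D a} [f|eta|Y|m b|m b z D a _ IH|m b A B a a' _ IH _ IH'|m l b c A B a a' hA IH hB IH'|m l b D a ml _ IH].
- by apply: Sp_eq (Sp_0 _ _ _ _) _ _ => [|x]; rewrite ?/gcom /= ?lgam_lmulf ?subrr // /dO (dX_scal g _ (L x)).
- apply: Sp_eq (Sp_shift (erefl : (1 + 0 = 0 + 1)%N) (Span_Sp (Span_f nS (metric_fun g eta xi)))) _ _ => [|x].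
    by rewrite /gcom lgam_anti.
  by rewrite /dO (dXE g _ (L x)).
- apply: Sp_eq (Sp_shift (erefl : (1 + 1 = 0 + 2)%N) (Span_Sp (Span_g nS (nE Y xi)))) _ _ => [|x].
    by rewrite /gcom (lnab_lgam _ _ nES).
  by rewrite /dO (dXT g _ (L x)) nabla_at_vfield.
- apply: Sp_eq (Sp_0 _ _ _ _) _ _ => [|x]; last by rewrite /dO (dX0 g _ (L x)).
  by rewrite /gcom !mul0r !mulr0 addr0 subr0; case: ifP.
- apply: Sp_eq (Sp_scale z IH) _ _ => [|x]; last by rewrite /dO (dXZ g _ (L x)).
  by rewrite /gcom; case: ifP => _; rewrite -lop_scalel -lop_scaler ?scalerBr ?scalerDr.
- apply: Sp_eq (Sp_add IH IH') _ _ => [|x]; last by rewrite /dO (dXD g _ (L x)).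
  by rewrite /gcom; case: ifP => _; ncring.
- have H1 := Sp_mul (Span_Sp hA) IH'; have H2 := Sp_mul IH (Span_Sp hB).
  have -> : ~~ (b (+) c) = b (+) ~~ c by case: (b) (c) => [] [].
  have bc : ~~ b (+) c = b (+) ~~ c by case: (b) (c) => [] [].
  rewrite bc in H2; have th x := Span_theta hB x.
  case: c hB {IH'} H1 H2 bc th => hB H1 H2 bc th.
    apply: Sp_eq (Sp_sub H1 H2) _ _ => [|x].
      by rewrite /gcom; case: (b) => /=; ncring.
    by rewrite /dO (dXM g _ (L x)) th scaleN1r mulrN.
  apply: Sp_eq (Sp_add H1 H2) _ _ => [|x].
    by rewrite /gcom; case: (b) => /=; ncring.
  by rewrite /dO (dXM g _ (L x)) th scale1r.
- apply: Sp_eq (Sp_low _ IH) _ _ => [||x] //; last by rewrite /dO (dX0 g _ (L x)).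
Qed.

End commutators.

(** * Tensorial operators as Clifford elements; central operators *)

Section pointwise_operators.
Context {R : realType} {n : nat} {M : manifold R n} {r : nat}.
Context {E : vbundle (real_scalars M) r} {g : metric E} {S : spinor_bundle g}.
Local Notation K := (complex_scalars M).
Local Notation lop := (lop S).
Implicit Types (A B D : lop) (s t : Gamma S) (x y : M).
Let locK := local_complex_scalars M.

Definition tensorial D : Prop := forall f, D * lmulf S f = lmulf S f * D.

Lemma tensorialD A B : tensorial A -> tensorial B -> tensorial (A + B).
Proof. by move=> cA cB f; rewrite mulrDl mulrDr cA cB. Qed.
Lemma tensorialZ (c : R[i]) A : tensorial A -> tensorial ((c : K) *: A).
Proof. by move=> cA f; rewrite -lop_scalel -lop_scaler cA. Qed.
Lemma tensorialN A : tensorial A -> tensorial (- A).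
Proof. by move=> cA f; rewrite mulNr mulrN cA. Qed.
Lemma tensorialM A B : tensorial A -> tensorial B -> tensorial (A * B).
Proof. by move=> cA cB f; rewrite -mulrA cB mulrA cA mulrA. Qed.
Lemma tensorial_sum (I : Type) (q : seq I) (F : I -> lop) :
  (forall i, tensorial (F i)) -> tensorial (\sum_(i <- q) F i).
Proof.
move=> H; elim: q => [|i q IH]; first by move=> f; rewrite big_nil mul0r mulr0.
by rewrite big_cons; exact: tensorialD.
Qed.
Lemma tensorial_lmulf f : tensorial (lmulf S f).
Proof. by move=> f'; exact: lmulfC. Qed.
Lemma tensorial_lgam xi : tensorial (lgam S xi).
Proof. exact: lgam_lmulf. Qed.

Section expansion.
Variable D : lop.
Hypothesis Dt : tensorial D.

Let D_fsmul f s x : Gamma_at (D (fsmul f s)) x = (f x)%:C%C *: Gamma_at (D s) x.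
Proof.
have -> : D (fsmul f s) = (D * lmulf S f) s by [].
by rewrite Dt.
Qed.

Let D_local s x : (\forall y \near x, Gamma_at s y = 0) -> Gamma_at (D s) x = 0.
Proof.
move=> s0; have : nbhs x [set y | Gamma_at s y = 0] := s0.
rewrite nbhsE => -[W [oW Wx] Ws].
have [chi [_ [C [_ CW] chi0]] chi1] := bump_exists oW Wx.
have cs : fsmul chi s = 0.
  apply: Gamma_ext => y; rewrite Gamma_at_fsmul Gamma_at0.
  have [Cy|nCy] := pselect (C y); first by rewrite (Ws y (CW y Cy)) scaler0.
  by rewrite chi0 // scale0r.
have := D_fsmul chi s x; rewrite cs lop0 Gamma_at0 (nbhs_singleton chi1) scale1r.
by move=> <-.
Qed.

(** An operator commuting with functions is local, so s may be replaced near x by its expansion in a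
    frame, and the coefficients then come out of the operator. *)
Lemma tensorial_expand s x e (sigma : 'I_(spinor_rank S) -> Gamma S) :
  frames e -> fdom e x ->
  (\forall y \near x, forall i, Gamma_at (sigma i) y = fvec e i y) ->
  Gamma_at (D s) x = \sum_i fcoef e (Gamma_at s x) i *: Gamma_at (D (sigma i)) x.
Proof.
move=> Fe ex sg; have oe := frame_open Fe.
have ext (F : R[i] -> R) : (forall i, smooth_on (fdom e) (fun y => F (fcoef e (Gamma_at s y) i))) ->
    exists G : 'I_(spinor_rank S) -> Cinf M,
      \forall y \near x, forall i, G i y = F (fcoef e (Gamma_at s y) i).
  move=> sF; have /choice[G GP] : forall i, exists G : Cinf M,
      \forall y \near x, G y = F (fcoef e (Gamma_at s y) i).
    by move=> i; have [G GP _] := smooth_extend oe ex (sF i); exists G.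
  by exists G; exact: filter_forall.
have [|F FP] := ext (@complex.Re R); first by move=> i; exact: (fcoef_smooth locK s i Fe).1.
have [|G GP] := ext (@complex.Im R); first by move=> i; exact: (fcoef_smooth locK s i Fe).2.
(* Only multiplication by real functions is assumed to commute with D, so the complex coefficients
   are split into real and imaginary parts. *)
pose s' : Gamma S := \sum_i (fsmul (F i) (sigma i) + ('i%C : K) *: fsmul (G i) (sigma i)).
have ss' : Gamma_at (D (s - s')) x = 0.
  apply: D_local; have ne : \forall y \near x, fdom e y by exact: open_nbhs_nbhs.
  near=> y; have Fy : forall i, F i y = complex.Re (fcoef e (Gamma_at s y) i) by near: y.
  have Gy : forall i, G i y = complex.Im (fcoef e (Gamma_at s y) i) by near: y.
  have sy : forall i, Gamma_at (sigma i) y = fvec e i y by near: y.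
  rewrite Gamma_atB /s' Gamma_at_sum {1}(fcoefP (e := e) (Gamma_at s y)) //; last by near: y.
  rewrite -sumrB big1 // => i _.
  have -> : Gamma_at (fsmul (F i) (sigma i) + ('i%C : K) *: fsmul (G i) (sigma i)) y =
    ((F i y)%:C%C + 'i%C * (G i y)%:C%C) *: Gamma_at (sigma i) y.
    by rewrite Gamma_atD Gamma_atZ !Gamma_at_fsmul scalerA -scalerDl.
  by rewrite Fy Gy sy -complexE subrr.
have -> : Gamma_at (D s) x = Gamma_at (D s') x.
  have {1}-> : s = (s - s') + s' by rewrite subrK.
  by rewrite lopD Gamma_atD ss' add0r.
have Dsum (q : seq 'I_(spinor_rank S)) F' : D (\sum_(i <- q) F' i) = \sum_(i <- q) D (F' i).
  by elim: q => [|i q IH]; rewrite ?big_nil ?lop0 // !big_cons lopD IH.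
rewrite /s' Dsum Gamma_at_sum; apply: eq_bigr => i _.
rewrite lopD lopZ Gamma_atD Gamma_atZ !D_fsmul scalerA -scalerDl.
by rewrite (nbhs_singleton FP) (nbhs_singleton GP) -complexE.
Unshelve. all: by end_near.
Qed.

Lemma tensorial_at s t x : Gamma_at s x = Gamma_at t x -> Gamma_at (D s) x = Gamma_at (D t) x.
Proof.
move=> st; have [e Fe ex] := frame_cover S x; have [sigma sP] := frame_extend locK Fe ex.
by rewrite !(tensorial_expand _ Fe ex sP) st.
Qed.

Lemma tensorial_cliff x : exists a : Cl g x, forall s, Gamma_at (D s) x = cliff S a (Gamma_at s x).
Proof.
have /choice[sec secP] : forall v : S x, exists t, Gamma_at t x = v.
  by move=> v; exact: section_through.
have [|a aP] := @cliff_surj _ _ _ _ _ _ S x (fun v => Gamma_at (D (sec v)) x).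
  move=> c s t; have H : Gamma_at (D (sec (c *: s + t))) x = Gamma_at (D ((c : K) *: sec s + sec t)) x.
    by apply: tensorial_at; rewrite Gamma_atD Gamma_atZ !secP.
  by rewrite H lopP Gamma_atD Gamma_atZ.
by exists a => s; rewrite aP; apply: tensorial_at; rewrite secP.
Qed.

End expansion.

Lemma spinor_neq0 x : exists v : S x, v != 0.
Proof.
apply: contrapT => H; have := clifford_neq0 (g := g) (x := x); apply.
apply: (@cliff_inj _ _ _ _ _ _ S x) => v; rewrite cliff1.
by apply: contrapT => v0; apply: H; exists v; apply/eqP.
Qed.

Lemma lmulf_inj f : lmulf S f = 0 -> f = 0.
Proof.
move=> f0; apply: Cinf_ext => x; have [v v0] := spinor_neq0 x.
have [s sv] := section_through locK v.
have := lmulf_at f s x; rewrite f0 lop_at0 Gamma_at0 sv => /esym/eqP.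
by rewrite scaler_eq0 (negPf v0) orbF => /eqP /(congr1 (@complex.Re R)).
Qed.

Lemma cliff_scalar_inj x (c c' : R[i]) :
  (forall s : Gamma S, c *: Gamma_at s x = c' *: Gamma_at s x) -> c = c'.
Proof.
move=> H; have [v v0] := spinor_neq0 x; have [s sv] := section_through locK v.
by have /eqP := H s; rewrite sv -subr_eq0 -scalerBl scaler_eq0 (negPf v0) orbF subr_eq0 => /eqP.
Qed.

Lemma scalar_smooth D (c : M -> R[i]) :
  (forall s x, Gamma_at (D s) x = c x *: Gamma_at s x) -> csmooth_on setT c.
Proof.
move=> Dc; apply: (ssmooth_local locK) => x _.
have [e Fe ex] := frame_cover S x; have [sigma sP] := frame_extend locK Fe ex.
have : nbhs x (fdom e `&` [set y | forall i, Gamma_at (sigma i) y = fvec e i y]).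
  by apply: filterI => //; apply: open_nbhs_nbhs; split => //; exact: frame_open.
rewrite nbhsE => -[W [oW Wx] Wsub]; exists W; split => //.
have [i0] : exists i : 'I_(spinor_rank S), True.
  apply: contrapT => H; have [v /eqP[]] := spinor_neq0 x.
  by rewrite [v](fcoefP (e := e)) // big1 // => i _; case: H; exists i.
move=> _; apply: (ssmooth_ext locK (f := fun y => fcoef e (Gamma_at (D (sigma i0)) y) i0)) => //.
  move=> y /Wsub[ey sy]; rewrite Dc sy -[_ *: _]addr0 fcoef_linear // fcoef_fvec // eqxx mulr1.
  by rewrite (@fcoef_uniq _ _ _ _ _ _ e y 0 (fun=> 0)) ?addr0 // big1 // => i _; rewrite scale0r.
apply: (@ssmooth_sub _ _ _ _ locK (fdom e)); first by move=> y /Wsub[].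
exact: (fcoef_smooth locK (D (sigma i0)) i0 Fe).
Qed.

(* As S is irreducible, an operator commuting with Cl(E) is a scalar.         *)
Lemma central_scalar D : tensorial D -> (forall xi, D * lgam S xi = lgam S xi * D) ->
  exists c : M -> R[i], forall s x, Gamma_at (D s) x = c x *: Gamma_at s x.
Proof.
move=> Dt Dg; suff /choice[c cP] : forall x, exists c : R[i],
    forall s, Gamma_at (D s) x = c *: Gamma_at s x by exists c.
move=> x; have [a aP] := tensorial_cliff Dt x.
have comm (b : Cl g x) : forall v, cliff S a (cliff S b v) = cliff S b (cliff S a v).
  apply: (palg_ind (P := fun b => forall v, cliff S a (cliff S b v) = cliff S b (cliff S a v))) b.
  - by move=> z v; rewrite !cliff_scale !cliff1 cliffZr.
  - move=> u v; have [xi xiu] := section_through (local_real_scalars M) u.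
    have [s sv] := section_through locK v.
    rewrite -xiu -/(cE g _) -sv -lgam_at -aP -aP -lgam_at.
    by have := congr1 (fun D' : lop => Gamma_at (D' s) x) (Dg xi).
  - by move=> b b' IH IH' v; rewrite !cliff_add -IH -IH';
      have := @cliff_linear _ _ _ _ _ _ S x a 1 (cliff S b v) (cliff S b' v); rewrite !scale1r.
  - by move=> b b' IH IH' v; rewrite !cliffM IH IH'.
have [e Fe ex] := frame_cover S x; have [v0 v0N] := spinor_neq0 x.
have [i0] : exists i : 'I_(spinor_rank S), True.
  apply: contrapT => H; move/eqP: v0N; apply.
  by rewrite [v0](fcoefP (e := e)) // big1 // => i _; case: H; exists i.
move=> _; exists (fcoef e (cliff S a (fvec e i0 x)) i0) => s; rewrite aP.
(* As all endomorphisms of S_x come from the Clifford algebra, a commutes in particular with the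
   rank one map sending the frame vector [i0] to the value of s. This forces a to act by the scalar
   read off on that frame vector. *)
have [|b bP] := @cliff_surj _ _ _ _ _ _ S x (fun w => fcoef e w i0 *: Gamma_at s x).
  by move=> c v w; rewrite fcoef_linear // scalerDl scalerA.
by have := comm b (fvec e i0 x); rewrite !bP fcoef_fvec // eqxx scale1r => ->.
Qed.

Lemma lscal_subproof (c : M -> R[i]) (sc : csmooth_on setT c) :
  smooth_on setT (fun x => complex.Re (c x)) /\ smooth_on setT (fun x => complex.Im (c x)).
Proof. exact: sc. Qed.
Definition lscal (c : M -> R[i]) (sc : csmooth_on setT c) : lop :=
  lmulf S (mkCinf sc.1) + ('i%C : K) *: lmulf S (mkCinf sc.2).

Lemma lscal_at c (sc : csmooth_on setT c) s x : Gamma_at (lscal sc s) x = c x *: Gamma_at s x.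
Proof.
rewrite /lscal lop_atD lop_atZ Gamma_atD Gamma_atZ !lmulf_at scalerA -scalerDl.
by rewrite /= -complexE.
Qed.

Lemma Span_lscal (nS : connection S) c (sc : csmooth_on setT c) :
  Span nS 0 false (lscal sc) (fun x => c x *: (1 : palg (@symext_rel R n M r E x))).
Proof.
apply: Span_eq (Span_add (Span_f nS _) (Span_scale 'i%C (Span_f nS _))) _ _ => // x.
by rewrite scalerA -scalerDl /= -complexE.
Qed.

End pointwise_operators.

(** * Quadratic Clifford elements and the curvature of a spinor connection *)

Section clifford_derivations.
Context {R : realType} {n : nat} {M : manifold R n} {r : nat}.
Context {E : vbundle (real_scalars M) r} {g : metric E} {S : spinor_bundle g}.
Local Notation K := (complex_scalars M).
Local Notation lop := (lop S).
Local Notation Om x := (palg (@symext_rel R n M r E x)).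
Local Notation e := (mvec g).
Local Notation e' := (mdual g).

Lemma lmulfB f f' : lmulf S (f - f') = lmulf S f - lmulf S f'.
Proof.
apply: lop_ext => s x; rewrite lop_atD lop_atN Gamma_atD !lmulf_at.
have -> : Gamma_at (- lmulf S f' s) x = - ((f' x)%:C%C *: Gamma_at s x) by [].
by rewrite -scalerBl -rmorphB.
Qed.
Lemma lmulfD f f' : lmulf S (f + f') = lmulf S f + lmulf S f'.
Proof.
apply: lop_ext => s x; rewrite lop_atD Gamma_atD !lmulf_at.
by rewrite -scalerDl -rmorphD.
Qed.

Section derivation.
Variables (D : lop) (A : Gamma E -> Gamma E).
Hypothesis Dt : tensorial D.
Hypothesis DA : forall xi, D * lgam S xi - lgam S xi * D = lgam S (A xi).

(** Commuting D with both sides of ξη + ηξ = g(ξ, η) gives 0 on the right because D is tensorial,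
    and g(Aξ, η) + g(ξ, Aη) on the left. *)
Lemma derivation_skew xi eta x : g x (Gamma_at (A xi) x) (Gamma_at eta x) =
  - g x (Gamma_at xi x) (Gamma_at (A eta) x).
Proof.
have DAr ze : D * lgam S ze = lgam S ze * D + lgam S (A ze) by rewrite -DA addrC subrK.
have H : metric_fun g (A xi) eta + metric_fun g xi (A eta) = 0.
  apply: (@lmulf_inj _ _ _ _ _ _ S); rewrite lmulfD -!lgam_anti.
  have := Dt (metric_fun g xi eta); rewrite -lgam_anti mulrDl mulrDr !mulrA !DAr => /eqP.
  rewrite -subr_eq0 => /eqP <-; rewrite !mulrDl -!mulrA !DAr !mulrDr; ncring.
have /eqP := congr1 (fun f : Cinf M => f x) H.
have -> : (metric_fun g (A xi) eta + metric_fun g xi (A eta)) x =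
  g x (Gamma_at (A xi) x) (Gamma_at eta x) + g x (Gamma_at xi x) (Gamma_at (A eta) x) by [].
by rewrite addr_eq0 => /eqP.
Qed.

(** A is given as a bare map on sections. Its linearity over functions follows from skewness by
    pairing with an arbitrary section. *)
Lemma derivation_expand xi x :
  \sum_i g x (Gamma_at xi x) (Gamma_at (e' i) x) *: Gamma_at (A (e i)) x = Gamma_at (A xi) x.
Proof.
apply/eqP; rewrite -subr_eq0; apply/eqP; apply: (metric_nondegenerate (m := g)) => w.
have [eta <-] := section_through (local_real_scalars M) w.
rewrite metricD -scaleN1r metricZ metric_suml mulN1r derivation_skew opprK.
rewrite [X in _ + g x X _](mframeP g) metric_suml; apply/eqP; rewrite addr_eq0 -sumrN; apply/eqP.
by apply: eq_bigr => i _; rewrite !metricZ derivation_skew mulrN.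
Qed.

(** The standard lift of a skew endomorphism A to a quadratic Clifford element, ½ Σ A(e_i) e'_i. The
    factor ½ makes its commutator with γ(ξ) equal to γ(Aξ). *)
Definition quad : lop :=
  (2%:R^-1 : K) *: \sum_i lgam S (A (e i)) * lgam S (e' i).
Definition quad_sym : @osymbol R n M r E := fun x =>
  (2%:R^-1 : R[i]) *: \sum_i (tE (Gamma_at (A (e i)) x) * tE (Gamma_at (e' i) x) : Om x).

Lemma quad_Span nS : Span nS 2 false quad quad_sym.
Proof.
have H : Sp nS 0 2 false (\sum_i lgam S (A (e i)) * lgam S (e' i))
    (fun x => \sum_i (tE (Gamma_at (A (e i)) x) * tE (Gamma_at (e' i) x) : Om x)).
  apply: Sp_sum => i; apply/Sp0E; exact: (Span_mul (Span_g nS _) (Span_g nS _)).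
by apply: Span_scale; apply/Sp0E.
Qed.

Lemma quad_lgam xi : quad * lgam S xi - lgam S xi * quad = lgam S (A xi).
Proof.
rewrite /quad -lop_scalel -lop_scaler -scalerBr mulr_suml mulr_sumr -sumrB.
have -> : \sum_i (lgam S (A (e i)) * lgam S (e' i) * lgam S xi -
    lgam S xi * (lgam S (A (e i)) * lgam S (e' i))) =
  \sum_i lgam S (fsmul (metric_fun g xi (e' i)) (A (e i)) -
                 fsmul (metric_fun g (A (e i)) xi) (e' i)).
  apply: eq_bigr => i _.
  have -> : lgam S (fsmul (metric_fun g xi (e' i)) (A (e i)) -
                 fsmul (metric_fun g (A (e i)) xi) (e' i)) =
    lgam S (A (e i)) * lmulf S (metric_fun g xi (e' i)) -
    lmulf S (metric_fun g (A (e i)) xi) * lgam S (e' i).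
    rewrite lgamD -scaleN1r (lgamZ S (-1)) !lgam_fsmul lgam_lmulf.
    by rewrite rmorphN1 scaleN1r.
  rewrite -!lgam_anti; ncring.
rewrite -lgam_sum; have -> : \sum_i (fsmul (metric_fun g xi (e' i)) (A (e i)) -
    fsmul (metric_fun g (A (e i)) xi) (e' i)) = A xi + A xi.
  apply: Gamma_ext => x; rewrite Gamma_at_sum Gamma_atD -{1}derivation_expand.
  rewrite [X in _ = _ + X](mdualP g) -big_split; apply: eq_bigr => i _.
  rewrite Gamma_atB !Gamma_at_fsmul; congr (_ + _).
  rewrite -scaleNr; congr (_ *: _).
  by rewrite /= derivation_skew opprK metric_sym.
rewrite lgamD scalerDr -scalerDl; have -> : (2%:R^-1 + 2%:R^-1 : K) = 1.
  by rewrite -[2%:R^-1]mul1r -mulrDl divff // pnatr_eq0.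
by rewrite scale1r.
Qed.

(* A derivation of Cl(E) given by A in so(E) is inner, up to scalars.         *)
Lemma derivation_quad : exists (c : M -> R[i]) (sc : csmooth_on setT c), D = quad + lscal (S := S) sc.
Proof.
have qt : tensorial quad.
  by apply: tensorialZ; apply: tensorial_sum => i; apply: tensorialM; exact: tensorial_lgam.
have [||c cP] := @central_scalar _ _ _ _ _ _ S (D - quad).
- by apply: tensorialD => //; exact: tensorialN.
- move=> xi; apply/eqP; rewrite -subr_eq0; apply/eqP.
  transitivity ((D * lgam S xi - lgam S xi * D) - (quad * lgam S xi - lgam S xi * quad)).
    ncring.
  by rewrite DA quad_lgam subrr.
exists c, (scalar_smooth cP); transitivity (quad + (D - quad)); first by ncgroup.
by congr (_ + _); apply: lop_ext => s x; rewrite lscal_at cP.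
Qed.

End derivation.

End clifford_derivations.

Section span_theory.
Context {R : realType} {n : nat} {M : manifold R n} {r : nat}.
Context {E : vbundle (real_scalars M) r} {g : metric E} {S : spinor_bundle g}.
Context {nE : connection E} {nS : connection S}.
Hypothesis nES : compatible nE nS.
Local Notation K := (complex_scalars M).
Local Notation lop := (lop S).
Local Notation osym := (@osymbol R n M r E).
Local Notation Om x := (palg (@symext_rel R n M r E x)).
Local Notation Span := (@Span R n M r E g S nS).
Local Notation Sp := (@Sp R n M r E g S nS).
Local Notation dO := (dO g nE).
Local Notation e := (mvec g).
Local Notation e' := (mdual g).
Implicit Types (A B D : lop) (a : osym) (b c : bool) (k l m : nat).

Definition curv (Y Z : vfield M) xi : Gamma E :=
  nE Y (nE Z xi) - nE Z (nE Y xi) - nE (vlie Y Z) xi.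

Lemma lgamB xi eta : lgam S (xi - eta) = lgam S xi - lgam S eta.
Proof. by apply/eqP; rewrite eq_sym subr_eq -lgamD subrK. Qed.

Lemma curvature_derivation Y Z (D := lnab nS Y * lnab nS Z - lnab nS Z * lnab nS Y - lnab nS (vlie Y Z)) :
  tensorial D /\ forall xi, D * lgam S xi - lgam S xi * D = lgam S (curv Y Z xi).
Proof.
rewrite /D => {D}.
have nf V f : lnab nS V * lmulf S f = lmulf S f * lnab nS V + lmulf S (V f).
  by rewrite -(lnab_lmulf nS) addrC subrK.
have ng V xi : lnab nS V * lgam S xi = lgam S xi * lnab nS V + lgam S (nE V xi).
  by rewrite -(lnab_lgam _ _ nES) addrC subrK.
have nnf V W f : lnab nS V * lnab nS W * lmulf S f = lmulf S f * (lnab nS V * lnab nS W) +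
    lmulf S (W f) * lnab nS V + lmulf S (V (W f)) + lmulf S (V f) * lnab nS W.
  by rewrite -mulrA nf mulrDr mulrA !nf; ncring.
have nng V W xi : lnab nS V * lnab nS W * lgam S xi = lgam S xi * (lnab nS V * lnab nS W) +
    lgam S (nE W xi) * lnab nS V + lgam S (nE V (nE W xi)) + lgam S (nE V xi) * lnab nS W.
  by rewrite -mulrA ng mulrDr mulrA !ng; ncring.
split.
- move=> f; rewrite !mulrBl !nnf nf.
  have -> : lmulf S (vlie Y Z f) = lmulf S (Y (Z f)) - lmulf S (Z (Y f)) by rewrite -lmulfB.
  ncring.
- by move=> xi; rewrite /curv !lgamB !mulrBl !nng ng; ncring.
Qed.

(** The curvature operator of ∇^S is tensorial and commutes with γ(ξ) into γ(R(Y, Z) ξ), so it is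
    the quadratic lift of R(Y, Z) up to a scalar. The scalar has degree 0 and does not affect the
    symbol in degree 2. *)
Lemma curvature_op Y Z : exists (c : M -> R[i]) (sc : csmooth_on setT c),
  lnab nS Y * lnab nS Z - lnab nS Z * lnab nS Y =
  lnab nS (vlie Y Z) + quad (curv Y Z) + lscal (S := S) sc.
Proof.
have [H1 H2] := curvature_derivation Y Z; have [c [sc H]] := derivation_quad H1 H2.
by exists c, sc; rewrite -addrA -H; ncgroup.
Qed.

Lemma curvature_lgam Y Z xi :
  quad (curv Y Z) * lgam S xi - lgam S xi * quad (curv Y Z) = lgam S (curv Y Z xi).
Proof. by have [H1 H2] := curvature_derivation Y Z; exact: (quad_lgam H1 H2). Qed.

End span_theory.

(** * Graded commutators of general operators and the operator Euler identity *)

Section span_structure.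
Context {R : realType} {n : nat} {M : manifold R n} {r : nat}.
Context {E : vbundle (real_scalars M) r} {g : metric E} {S : spinor_bundle g}.
Context {nE : connection E} {nS : connection S}.
Hypothesis nES : compatible nE nS.
Local Notation K := (complex_scalars M).
Local Notation lop := (lop S).
Local Notation osym := (@osymbol R n M r E).
Local Notation Om x := (palg (@symext_rel R n M r E x)).
Local Notation Span := (@Span R n M r E g S nS).
Local Notation Sp := (@Sp R n M r E g S nS).
Local Notation dO := (dO g nE).
Local Notation e := (mvec g).
Local Notation e' := (mdual g).
Local Notation h := (tfun M).
Local Notation X := (tvec M).
Implicit Types (A B D : lop) (a : osym) (b c : bool) (k l m : nat).

(** The degree bound of [Sp] with the symbol forgotten, for estimates in which only the order of an
    error term matters. *)
Definition SpE k m b D : Prop := exists a, Sp k m b D a.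

Lemma SpE_D k m b A B : SpE k m b A -> SpE k m b B -> SpE k m b (A + B).
Proof. by move=> [a ha] [a' hb]; exists (fun x => a x + a' x); exact: Sp_add. Qed.
Lemma SpE_N k m b A : SpE k m b A -> SpE k m b (- A).
Proof. by move=> [a ha]; exists (fun x => - a x); exact: Sp_opp. Qed.
Lemma SpE_Z k m b (z : R[i]) A : SpE k m b A -> SpE k m b ((z : K) *: A).
Proof. by move=> [a ha]; exists (fun x => z *: a x); exact: Sp_scale. Qed.
Lemma SpE_M k k' m l b c A B : SpE k m b A -> SpE k' l c B ->
  SpE (k + k') (m + l) (b (+) c) (A * B).
Proof. by move=> [a ha] [a' hb]; exists (fun x => a x * a' x); exact: Sp_mul. Qed.
Lemma SpE_le k m k' m' b D : (k' + m <= k + m')%N -> SpE k m b D -> SpE k' m' b D.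
Proof.
rewrite leq_eqVlt => /orP[/eqP eq|lt] [a ha]; first by exists a; exact: Sp_shift ha.
by exists (fun x => 0); exact: Sp_low ha.
Qed.
Lemma SpE_0 k m b : SpE k m b 0.
Proof. by exists (fun x => 0); exact: Sp_0. Qed.
Lemma SpE_sum k m b (I : Type) (q : seq I) (F : I -> lop) :
  (forall i, SpE k m b (F i)) -> SpE k m b (\sum_(i <- q) F i).
Proof.
by move=> H; elim: q => [|i q IH]; rewrite ?big_nil ?big_cons; [exact: SpE_0|exact: SpE_D].
Qed.
Lemma Span_SpE m b D a : Span m b D a -> SpE 0 m b D.
Proof. by exists a; apply/Sp0E. Qed.

Lemma gcom_sym b c A B : gcom b c A B = if b && c then gcom c b B A else - gcom c b B A.
Proof. by rewrite /gcom andbC; case: (c && b); rewrite ?opprB // addrC. Qed.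

Lemma gcom_mulr b c d A B C :
  gcom b (c (+) d) A (B * C) = gcom b c A B * C + (if b && c then - (B * gcom b d A C) else B * gcom b d A C).
Proof. by rewrite /gcom; case: b c d => [] [] [] /=; ncring. Qed.

Lemma gcom_mull b c d A B C :
  gcom (b (+) c) d (A * B) C = A * gcom c d B C + (if c && d then - (gcom b d A C * B) else gcom b d A C * B).
Proof. by rewrite /gcom; case: b c d => [] [] [] /=; ncring. Qed.

Lemma gcomDr b c A B B' : gcom b c A (B + B') = gcom b c A B + gcom b c A B'.
Proof. by rewrite /gcom; case: ifP => _; ncring. Qed.
Lemma gcomDl b c A A' B : gcom b c (A + A') B = gcom b c A B + gcom b c A' B.
Proof. by rewrite /gcom; case: ifP => _; ncring. Qed.
Lemma gcomZr b c (z : R[i]) A B : gcom b c A ((z : K) *: B) = (z : K) *: gcom b c A B.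
Proof. by rewrite /gcom -lop_scalel -lop_scaler; case: ifP => _; rewrite ?scalerBr ?scalerDr. Qed.
Lemma gcomZl b c (z : R[i]) A B : gcom b c ((z : K) *: A) B = (z : K) *: gcom b c A B.
Proof. by rewrite /gcom -lop_scalel -lop_scaler; case: ifP => _; rewrite ?scalerBr ?scalerDr. Qed.
Lemma gcom0r b c A : gcom b c A 0 = 0.
Proof. by rewrite /gcom mulr0 mul0r addr0 subr0; case: ifP. Qed.
Lemma gcom0l b c A : gcom b c 0 A = 0.
Proof. by rewrite /gcom mulr0 mul0r addr0 subr0; case: ifP. Qed.

Lemma SpE_if k m b (t : bool) D : SpE k m b D -> SpE k m b (if t then - D else D).
Proof. by move=> H; case: t => //; exact: SpE_N. Qed.
Lemma SpE_if' k m b (t : bool) D : SpE k m b D -> SpE k m b (if t then D else - D).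
Proof. by move=> H; case: t => //; exact: SpE_N. Qed.

Lemma Span_commE f m b D a : Span m b D a -> SpE 2 m b (gcom b false D (lmulf S f)).
Proof. by move=> /(Span_comm_f f) H; exists (fO f a); rewrite /gcom andbF. Qed.
Lemma Span_commgE xi m b D a : Span m b D a -> SpE 1 m (~~ b) (gcom b true D (lgam S xi)).
Proof. by move=> /(Span_comm_g nES xi) H; exists (dO xi a). Qed.

Lemma lnab_comm Y l c B a' : Span l c B a' -> SpE 2 (2 + l) c (gcom false c (lnab nS Y) B).
Proof.
elim=> {l c B a'} [f|xi|Z|m b|m b z D a _ IH|m b A B a a' _ IH _ IH'|m l b c A B a a' hA IH hB IH'|m l b D a ml _ IH].
- exact: Span_commE (Span_n nS Y).
- by apply: SpE_le (Span_commgE xi (Span_n nS Y)).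
- have [c [sc H]] := curvature_op nES Y Z; rewrite /gcom H.
  apply: SpE_D; first apply: SpE_D.
  + by apply: SpE_le (Span_SpE (Span_n nS _)).
  + by apply: SpE_le (Span_SpE (quad_Span (S := S) (curv (nE := nE) Y Z) nS)).
  + by apply: SpE_le (Span_SpE (Span_lscal nS sc)).
- by rewrite gcom0r; exact: SpE_0.
- by rewrite gcomZr; exact: SpE_Z.
- by rewrite gcomDr; exact: SpE_D.
- rewrite gcom_mulr /=; apply: SpE_D.
    by apply: SpE_le (SpE_M IH (Span_SpE hB)); lia.
  by apply: SpE_le (SpE_M (Span_SpE hA) IH'); lia.
- by apply: SpE_le IH; lia.
Qed.

(** A graded commutator lowers the total degree by 2. By the Leibniz rules in both arguments this
    reduces to generators, where the only involved case, two covariant derivatives, is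
    [curvature_op]. *)
Lemma Span_comm k b A a l c B a' : Span k b A a -> Span l c B a' ->
  SpE 2 (k + l) (b (+) c) (gcom b c A B).
Proof.
move=> hA; elim: hA l c B a' => {k b A a} [f|xi|Y|m b|m b z D a _ IH|m b A B a a' _ IH _ IH'|m m' b b' A B a a' hA IH hB IH'|m m' b D a mm _ IH] l c C u hC.
- by rewrite gcom_sym /=; apply: SpE_N; exact: Span_commE hC.
- rewrite gcom_sym /=; apply: SpE_if'; have := Span_commgE xi hC.
  by apply: SpE_le.
- exact: lnab_comm hC.
- by rewrite gcom0l; exact: SpE_0.
- by rewrite gcomZl; apply: SpE_Z; exact: IH hC.
- by rewrite gcomDl; apply: SpE_D; [exact: IH hC|exact: IH' hC].
- rewrite gcom_mull; apply: SpE_D.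
    by rewrite -addbA; apply: SpE_le (SpE_M (Span_SpE hA) (IH' _ _ _ _ hC)); lia.
  apply: SpE_if; rewrite -addbA [b' (+) c]addbC addbA.
  by apply: SpE_le (SpE_M (IH _ _ _ _ hC) (Span_SpE hB)); lia.
- by apply: SpE_le (IH _ _ _ _ hC); lia.
Qed.

Definition opT j : lop :=
  (2%:R : K) *: lnab nS (X j) - \sum_i lgam S (nE (X j) (e i)) * lgam S (e' i).

Lemma opT_Span j : Span 2 false (opT j) (euler_X g nE j).
Proof.
apply/Sp0E; apply: Sp_sub; first by apply/Sp0E; exact: (Span_scale 2%:R (Span_n nS (X j))).
apply: Sp_sum => i; apply/Sp0E; exact: (Span_mul (Span_g nS _) (Span_g nS _)).
Qed.

Definition op_euler b D : lop :=
  \sum_j (D * lmulf S (h j) - lmulf S (h j) * D) * opT j +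
  \sum_i gcom b true D (lgam S (e i)) * lgam S (e' i).

(** The Euler operator is a derivation up to the last two sums. Each of their terms multiplies two
    commutators, so they lie in lower degree. *)
Lemma op_euler_mul b c A B : op_euler (b (+) c) (A * B) =
  A * op_euler c B + op_euler b A * B +
  \sum_j (A * lmulf S (h j) - lmulf S (h j) * A) * gcom c false B (opT j) +
  \sum_i (if c then - (gcom b true A (lgam S (e i)) * gcom c true B (lgam S (e' i)))
          else gcom b true A (lgam S (e i)) * gcom c true B (lgam S (e' i))).
Proof.
have EJ : \sum_j (A * B * lmulf S (h j) - lmulf S (h j) * (A * B)) * opT j =
    \sum_j A * ((B * lmulf S (h j) - lmulf S (h j) * B) * opT j) +
    \sum_j (A * lmulf S (h j) - lmulf S (h j) * A) * opT j * B +
    \sum_j (A * lmulf S (h j) - lmulf S (h j) * A) * gcom c false B (opT j).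
  by rewrite -!big_split /=; apply: eq_bigr => j _; rewrite /gcom andbF; ncring.
have EI : \sum_i gcom (b (+) c) true (A * B) (lgam S (e i)) * lgam S (e' i) =
    \sum_i A * (gcom c true B (lgam S (e i)) * lgam S (e' i)) +
    \sum_i gcom b true A (lgam S (e i)) * lgam S (e' i) * B +
    \sum_i (if c then - (gcom b true A (lgam S (e i)) * gcom c true B (lgam S (e' i)))
          else gcom b true A (lgam S (e i)) * gcom c true B (lgam S (e' i))).
  by rewrite -!big_split /=; apply: eq_bigr => i _; rewrite /gcom; case: (b) (c) => [] [] /=; ncring.
by rewrite /op_euler mulrDr mulrDl !mulr_sumr !mulr_suml EJ EI; ncgroup.
Qed.

Lemma op_eulerD b A B : op_euler b (A + B) = op_euler b A + op_euler b B.
Proof.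
rewrite /op_euler addrACA -!big_split /=; congr (_ + _); apply: eq_bigr => i _.
  by ncring.
by rewrite gcomDl mulrDl.
Qed.
Lemma op_eulerZ b (z : R[i]) A : op_euler b ((z : K) *: A) = (z : K) *: op_euler b A.
Proof.
rewrite /op_euler scalerDr !scaler_sumr; congr (_ + _); apply: eq_bigr => i _.
  by rewrite -lop_scalel -lop_scaler -scalerBr lop_scalel.
by rewrite gcomZl lop_scalel.
Qed.

(** The operator version of [symext_euler]. The identity is exact on functions, Clifford generators
    and covariant derivatives, and for products the error terms of [op_euler_mul] have degree lower
    than m. *)
Lemma op_euler_Span m b D a : Span m b D a -> SpE 1 m b (op_euler b D - (m%:R : K) *: D).
Proof.
elim=> {m b D a} [f|xi|Y|m b|m b z D a _ IH|m b A B a a' _ IH _ IH'|m l b c A B a a' hA IH hB IH'|m l b D a ml hD IH].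
- have -> : op_euler false (lmulf S f) - (0%:R : K) *: lmulf S f = 0; last exact: SpE_0.
  rewrite scale0r subr0 /op_euler !big1 ?addr0 // => i _.
    by rewrite /gcom /= lgam_lmulf subrr mul0r.
  by rewrite lmulfC subrr mul0r.
- have -> : op_euler true (lgam S xi) - (1%:R : K) *: lgam S xi = 0; last exact: SpE_0.
  rewrite scale1r /op_euler big1 ?add0r => [|j _]; last by rewrite lgam_lmulf subrr mul0r.
  apply/eqP; rewrite subr_eq0; apply/eqP.
  transitivity (lgam S (\sum_i fsmul (metric_fun g xi (e i)) (e' i))).
    by rewrite lgam_sum; apply: eq_bigr => i _; rewrite /gcom lgam_anti lgam_fsmul.
  congr lgam; apply: Gamma_ext => x; rewrite Gamma_at_sum [RHS](mdualP g).
  by apply: eq_bigr => i _; rewrite Gamma_at_fsmul.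
- have -> : op_euler false (lnab nS Y) - (2%:R : K) *: lnab nS Y = 0; last exact: SpE_0.
  apply/eqP; rewrite subr_eq0; apply/eqP.
  have EY xi : nE Y xi = \sum_j fsmul (Y (h j)) (nE (X j) xi).
    exact: (nabla_expand (local_real_scalars M) nE Y xi).
  have ES : lnab nS Y = \sum_j lmulf S (Y (h j)) * lnab nS (X j).
    apply: lop_ext => s x; rewrite lop_sum Gamma_at_sum.
    by rewrite [lnab nS Y s](nabla_expand (local_complex_scalars M) nS Y) Gamma_at_sum.
  rewrite /op_euler; under eq_bigr => j _ do rewrite lnab_lmulf /opT mulrBr.
  (* The quadratic part of [opT] cancels the sum over the e_i, because [∇_Y, γ(e_i)] = γ(∇_Y e_i)
     and Y expands in the X_j. *)
  rewrite sumrB -addrA; have -> : - (\sum_j lmulf S (Y (h j)) *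
      (\sum_i lgam S (nE (X j) (e i)) * lgam S (e' i))) +
      \sum_i gcom false true (lnab nS Y) (lgam S (e i)) * lgam S (e' i) = 0.
    apply/eqP; rewrite addrC subr_eq0; apply/eqP.
    under [RHS]eq_bigr => j _ do rewrite mulr_sumr.
    rewrite [RHS]exchange_big; apply: eq_bigr => i _.
    rewrite /gcom (lnab_lgam _ _ nES) EY lgam_sum mulr_suml; apply: eq_bigr => j _.
    by rewrite lgam_fsmul mulrA.
  rewrite addr0 [in RHS]ES scaler_sumr; apply: eq_bigr => j _.
  by rewrite lop_scaler.
- have -> : op_euler b 0 - (m%:R : K) *: 0 = 0; last exact: SpE_0.
  by have := op_eulerZ b 0 0; rewrite !scale0r => ->; rewrite scaler0 subr0.
- rewrite op_eulerZ scalerA mulrC -scalerA -scalerBr; exact: SpE_Z.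
- rewrite op_eulerD scalerDr opprD addrACA; exact: SpE_D.
- rewrite op_euler_mul.
  have -> (P Q : lop) : A * op_euler c B + op_euler b A * B + P + Q - ((m + l)%:R : K) *: (A * B) =
     A * (op_euler c B - (l%:R : K) *: B) + (op_euler b A - (m%:R : K) *: A) * B + (P + Q).
    rewrite natrD scalerDl mulrBr mulrBl -lop_scaler -lop_scalel; ncgroup.
  apply: SpE_D; first apply: SpE_D.
  + by apply: SpE_le (SpE_M (Span_SpE hA) IH'); lia.
  + by apply: SpE_le (SpE_M IH (Span_SpE hB)); lia.
  apply: SpE_D; apply: SpE_sum => j.
    have := SpE_M (ex_intro _ _ (Span_comm_f (h j) hA)) (Span_comm hB (opT_Span j)).
    by rewrite addbF; apply: SpE_le; lia.
  apply: SpE_if; have := SpE_M (Span_commgE (e j) hA) (Span_commgE (e' j) hB).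
  by rewrite addNb addbN negbK; apply: SpE_le; lia.
- have -> : op_euler b D - (l%:R : K) *: D = (op_euler b D - (m%:R : K) *: D) +
      ((m%:R - l%:R : R[i]) : K) *: D by rewrite scalerBl addrA subrK.
  apply: SpE_D; first by apply: SpE_le IH; lia.
  by apply: SpE_Z; apply: SpE_le (Span_SpE hD); lia.
Qed.

End span_structure.

(** * Symbols are well defined, detect the degree and can be lifted *)

Section span_symbols.
Context {R : realType} {n : nat} {M : manifold R n} {r : nat}.
Context {E : vbundle (real_scalars M) r} {g : metric E} {S : spinor_bundle g}.
Context {nE : connection E} {nS : connection S}.
Hypothesis nES : compatible nE nS.
Local Notation K := (complex_scalars M).
Local Notation lop := (lop S).
Local Notation osym := (@osymbol R n M r E).
Local Notation Om x := (palg (@symext_rel R n M r E x)).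
Local Notation Span := (@Span R n M r E g S nS).
Local Notation Sp := (@Sp R n M r E g S nS).
Local Notation SpE := (@SpE R n M r E g S nS).
Local Notation dO := (dO g nE).
Local Notation e := (mvec g).
Local Notation e' := (mdual g).
Local Notation h := (tfun M).
Local Notation op_euler := (@op_euler R n M r E g S nE nS).
Local Notation opT := (@opT R n M r E g S nE nS).
Local Notation homog x := (homog (@total_degree R n M r E x)).
Implicit Types (A B D : lop) (a : osym) (b c : bool) (k l m : nat).

Lemma Span0_scalar b D a : Span 0 b D a -> exists z : M -> R[i],
  [/\ forall s x, Gamma_at (D s) x = z x *: Gamma_at s x, forall x, a x = z x *: (1 : Om x) &
      b -> forall x, z x = 0].
Proof.
suff main m : Span m b D a -> m = 0%N -> exists z : M -> R[i],
  [/\ forall s x, Gamma_at (D s) x = z x *: Gamma_at s x, forall x, a x = z x *: (1 : Om x) &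
      b -> forall x, z x = 0] by move=> /main; apply.
elim=> {m b D a} [f|xi|Y|m b|m b z D a _ IH|m b A B a a' _ IH _ IH'|m l b c A B a a' _ IH _ IH'|m l b D a ml _ _] //.
- by move=> _; exists (fun x => (f x)%:C%C); split => // s x; rewrite lmulf_at.
- by move=> _; exists (fun=> 0); split => // [s x|x]; rewrite scale0r.
- move=> /IH[w [w1 w2 w3]]; exists (fun x => z * w x); split=> [s x|x|/w3 w0 x].
  + by rewrite lop_atZ Gamma_atZ w1 scalerA.
  + by rewrite w2 scalerA.
  + by rewrite w0 mulr0.
- move=> m0; have [w [w1 w2 w3]] := IH m0; have [w' [w1' w2' w3']] := IH' m0.
  exists (fun x => w x + w' x); split=> [s x|x|bt x].
  + by rewrite lop_atD Gamma_atD w1 w1' scalerDl.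
  + by rewrite w2 w2' scalerDl.
  + by rewrite w3 // w3' // addr0.
- move=> /eqP; rewrite addn_eq0 => /andP[/eqP m0 /eqP l0].
  have [w [w1 w2 w3]] := IH m0; have [w' [w1' w2' w3']] := IH' l0.
  exists (fun x => w x * w' x); split=> [s x|x|bc x].
  + by rewrite lop_atM w1 w1' scalerA.
  + by rewrite w2 w2' -palg_scaleAl mul1r scalerA.
  + by case: (b) bc w3 => [_ /(_ erefl) ->|/= /w3' ->]; rewrite ?mul0r ?mulr0.
- by move=> l0; rewrite l0 in ml.
Qed.

Lemma Span_uniq m b a : Span m b 0 a -> forall x, a x = 0.
Proof.
elim/ltn_ind: m b a => m IH b a ha x.
have [m0|m0] := posnP m.
  rewrite m0 in ha; have [z [z1 -> _]] := Span0_scalar ha.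
  suff -> : z x = 0 by rewrite scale0r.
  apply: (cliff_scalar_inj (S := S) (x := x)) => s.
  by rewrite -z1 lop_at0 Gamma_at0 scale0r.
apply: (scale_natr_eq0 m0); rewrite (osym_euler g nE (Span_homog ha x)) !big1 ?addr0 //.
- move=> i _; have := Span_comm_g nES (e i) ha; rewrite gcom0l /Sp m0 => H.
  by rewrite (IH _ _ _ _ H) ?mul0r // subn1 prednK.
- move=> j _; have := Span_comm_f (h j) ha; rewrite mul0r mulr0 subr0 /Sp.
  case: ifP => [m2 H|_ [_ ->]]; last by rewrite mul0r.
  by rewrite (IH _ _ _ _ H) ?mul0r // ltn_subrL m0.
Qed.

Lemma Span_inj m b D a a' : Span m b D a -> Span m b D a' -> forall x, a x = a' x.
Proof.
move=> /Sp0E ha /Sp0E hb x; have := Sp_sub ha hb; rewrite subrr => /Sp0E /Span_uniq /(_ x) /eqP.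
by rewrite subr_eq0 => /eqP.
Qed.

(** The mirror image of [Span_uniq]. As a = 0, the commutators of D have zero symbol, hence lower
    degree by induction. So the Euler operator of D has degree below m, and it differs from m D by
    lower degree. *)
Lemma Span_lower m b D a : Span m b D a -> (forall x, a x = 0) -> SpE 1 m b D.
Proof.
elim/ltn_ind: m b D a => m IH b D a ha a0.
have [m0|m0] := posnP m.
  rewrite m0 in ha; have [z [z1 z2 _]] := Span0_scalar ha.
  have -> : D = 0; last exact: SpE_0.
  apply: lop_ext => s x; rewrite z1 lop_at0 Gamma_at0.
  suff -> : z x = 0 by rewrite scale0r.
  by apply: (@symext_scal_inj R n M r E x); rewrite -z2 a0 scale0r.
have lower k c B u : (0 < k)%N -> Sp k m c B u -> (forall x, u x = 0) -> SpE k.+1 m c B.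
  move=> k0; rewrite /Sp; case: leqP => km; last by move=> [-> _] _; exact: SpE_0.
  move=> H u0; apply: SpE_le (IH _ _ _ _ _ H u0); lia.
have eD : SpE 1 m b (op_euler b D).
  apply: SpE_D; apply: SpE_sum => j.
    have := SpE_M (lower 2 _ _ _ isT (Span_comm_f (h j) ha) _) (Span_SpE (opT_Span (nE := nE) (nS := nS) j)).
    rewrite addbF; move=> H; apply: SpE_le (H _); first by lia.
    by move=> x; rewrite /fO a0 dF0.
  have H := SpE_M (lower 1%N _ _ _ isT (Span_comm_g nES (e j) ha) _) (Span_SpE (Span_g nS (e' j))).
  rewrite addbT negbK in H; apply: SpE_le (H _); first by lia.
  by move=> x; rewrite /dO a0 dX0 //; exact: nabla_at_linear.
have eL := SpE_N (op_euler_Span nES ha).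
have := SpE_Z (m%:R^-1) (SpE_D eD eL).
have -> : op_euler b D - (op_euler b D - (m%:R : K) *: D) = (m%:R : K) *: D by ncgroup.
by rewrite scalerA mulVf ?scale1r // pnatr_eq0 -lt0n.
Qed.

(** The Euler identity writes m a through symbols of smaller degree times fixed generators. Lifting
    these by induction and multiplying by the corresponding operators gives a lift of a. *)
Lemma Span_surj m a : smooth_alg (@smooth_generators R n M r E) a ->
  (forall x, homog x m (a x)) -> exists D, Span m (odd m) D a.
Proof.
elim/ltn_ind: m a => m IH a sa ha.
have [m0|m0] := posnP m.
  rewrite m0; have sc := aug_smooth sa; exists (lscal (S := S) sc).
  apply: Span_eq (Span_lscal nS sc) _ _ => // x.
  by apply/esym/homog0_scal; rewrite -m0.
have HF j : exists D, Sp 2 m (odd m) D (fO (h j) a).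
  have hF x := dF_homog (h j) (ha x).
  have [m2|m2] := ltnP m 2.
    by exists 0; rewrite /Sp leqNgt m2; split=> // x; exact: (hF x).2.
  have lt : (m - 2 < m)%N by lia.
  have [||D hD] := IH (m - 2)%N lt (fO (h j) a).
  - exact: fO_smooth.
  - by move=> x; exact: (hF x).1.
  by exists D; rewrite /Sp m2 -[odd m](_ : odd (m - 2) = _) // oddB // addbF.
have HX i : exists D, Sp 1 m (~~ odd m) D (dO (e i) a).
  have hX x := dX_homog g (Gamma_at (e i) x) (nabla_at_linear nE (e i) (x := x)) (ha x).
  have lt : (m - 1 < m)%N by lia.
  have [||D hD] := IH (m - 1)%N lt (dO (e i) a).
  - exact: dO_smooth.
  - by move=> x; exact: (hX x).1.
  by exists D; rewrite /Sp m0 -[~~ odd m](_ : odd (m - 1) = _) // oddB // addbT.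
have {HF} /choice[F FP] := HF; have {HX} /choice[G GP] := HX.
have H1 : Sp 0 m (odd m) (\sum_j F j * opT j) (fun x => \sum_j fO (h j) a x * euler_X g nE j x).
  apply: Sp_sum => j; have := Sp_mul (FP j) (Span_Sp (opT_Span (nE := nE) (nS := nS) j)).
  by rewrite addbF; apply: Sp_shift; lia.
have H2 : Sp 0 m (odd m) (\sum_i G i * lgam S (e' i))
    (fun x => \sum_i dO (e i) a x * tE (Gamma_at (e' i) x)).
  apply: Sp_sum => j; have := Sp_mul (GP j) (Span_Sp (Span_g nS (e' j))).
  by rewrite addbT negbK; apply: Sp_shift; lia.
have /Sp0E H := Sp_scale (m%:R^-1) (Sp_add H1 H2); eexists; apply: Span_eq H erefl _ => x.
rewrite -(osym_euler g nE (ha x)) scalerA mulVf ?scale1r // pnatr_eq0 -lt0n //.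
Qed.

Definition cl_valued b D : Prop :=
  forall x, exists2 u : Cl g x, Cl_parity b u & forall s, Gamma_at (D s) x = cliff S u (Gamma_at s x).

Lemma cl_valuedD b A B : cl_valued b A -> cl_valued b B -> cl_valued b (A + B).
Proof.
move=> cA cB x; have [u hu uA] := cA x; have [v hv vB] := cB x.
by exists (u + v) => [|s]; [exact: homog_add|rewrite lop_atD Gamma_atD uA vB cliff_add].
Qed.
Lemma cl_valuedZ b (z : R[i]) A : cl_valued b A -> cl_valued b ((z : K) *: A).
Proof.
move=> cA x; have [u hu uA] := cA x; exists (z *: u) => [|s].
  rewrite -clif_sc; have := homog_mul (homog_scal _ (fun=> true) z) hu; by rewrite add0r.
by rewrite lop_atZ Gamma_atZ uA cliff_scale.
Qed.
Lemma cl_valued_gam b xi A : cl_valued b A -> cl_valued (~~ b) (A * lgam S xi).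
Proof.
move=> cA x; have [u hu uA] := cA x; exists (u * cE g (Gamma_at xi x)) => [|s].
  by have := homog_mul hu (homog_gen _ (fun=> true) (Gamma_at xi x)); rewrite -addbT.
by rewrite lop_atM uA lgam_at cliffM.
Qed.
Lemma cl_valued0 b : cl_valued b 0.
Proof. by move=> x; exists 0 => [|s]; [exact: homog_0|rewrite lop_at0 Gamma_at0 cliff0]. Qed.
Lemma cl_valued_sum b (I : Type) (q : seq I) (F : I -> lop) :
  (forall i, cl_valued b (F i)) -> cl_valued b (\sum_(i <- q) F i).
Proof.
by move=> H; elim: q => [|i q IH]; rewrite ?big_nil ?big_cons; [exact: cl_valued0|exact: cl_valuedD].
Qed.

Lemma tensorial_gcom b xi D : tensorial D -> tensorial (gcom b true D (lgam S xi)).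
Proof.
move=> Dt; have gt := @tensorial_lgam _ _ _ _ _ _ S xi.
by rewrite /gcom; case: ifP => _; apply: tensorialD; rewrite ?(tensorialM, tensorialN) //;
  [exact: tensorialM|exact: tensorialM|exact: tensorialM|apply: tensorialN; exact: tensorialM].
Qed.

(* The symbol-free form of the Euler identity expresses a tensorial operator   *)
(* through its commutators with Cl(E).                                         *)
Lemma Span_cl_valued m b D a : tensorial D -> Span m b D a -> cl_valued b D.
Proof.
elim/ltn_ind: m b D a => m IH b D a Dt ha.
have [m0|m0] := posnP m.
  rewrite m0 in ha; have [z [z1 _ z3]] := Span0_scalar ha => x.
  case: b z3 {ha} => z3.
    by exists 0 => [|s]; [exact: homog_0|rewrite z1 z3 // cliff0 scale0r].
  by exists (z x *: (1 : Cl g x)) => [|s]; [exact: homog_scal|rewrite z1 cliff_scale cliff1].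
have ht j : D * lmulf S (h j) - lmulf S (h j) * D = 0 by rewrite Dt subrr.
have cl_Sp c B : tensorial B -> SpE 1 m c B -> cl_valued c B.
  move=> Bt [u]; rewrite /Sp m0; apply: IH => //; lia.
have gt i : tensorial (gcom b true D (lgam S (e i)) * lgam S (e' i)).
  by apply: tensorialM; [exact: tensorial_gcom|exact: tensorial_lgam].
have eE : op_euler b D = \sum_i gcom b true D (lgam S (e i)) * lgam S (e' i).
  by rewrite /op_euler big1 ?add0r // => j _; rewrite ht mul0r.
have et : tensorial (op_euler b D) by rewrite eE; exact: tensorial_sum.
have c1 : cl_valued b (op_euler b D).
  rewrite eE; apply: cl_valued_sum => i; rewrite -[X in cl_valued X]negbK.
  apply: cl_valued_gam; apply: cl_Sp; first exact: tensorial_gcom.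
  exact: (Span_commgE nES (e i) ha).
have c2 : cl_valued b (op_euler b D - (m%:R : K) *: D).
  apply: cl_Sp (op_euler_Span nES ha).
  by apply: tensorialD => //; apply: tensorialN; exact: tensorialZ.
have := cl_valuedZ (m%:R^-1) (cl_valuedD c1 (cl_valuedZ (-1) c2)).
have -> : op_euler b D + (-1 : K) *: (op_euler b D - (m%:R : K) *: D) = (m%:R : K) *: D.
  by rewrite scaleN1r; ncgroup.
by rewrite scalerA mulVf ?scale1r // pnatr_eq0 -lt0n.
Qed.

(** The commutators of D with functions again have both parities and smaller degree, so they vanish
    by induction and D is tensorial. Then D is given at each point by a Clifford element that is
    both even and odd, hence 0. *)
Lemma Span_even_odd m m' D a a' : Span m false D a -> Span m' true D a' -> D = 0.
Proof.
elim/ltn_ind: m m' D a a' => m IH m' D a a' ha hb.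
have Dt : tensorial D.
  move=> f; apply/eqP; rewrite -subr_eq0; apply/eqP.
  have := Span_comm_f f ha; have := Span_comm_f f hb; rewrite /Sp.
  case: ifP => [m2|_ [-> _]] //; case: ifP => [l2|_ _ [-> _]] // H1 H2.
  by apply: (IH _ _ _ _ _ _ H2 H1); lia.
have ev := Span_cl_valued Dt ha; have od := Span_cl_valued Dt hb.
apply: lop_ext => s x; have [u hu uD] := ev x; have [v hv vD] := od x.
have uv : u = v.
  apply/eqP; rewrite -subr_eq0; apply/eqP; apply: (@cliff_inj _ _ _ _ _ _ S x) => w.
  have [t <-] := section_through (local_complex_scalars M) w.
  by rewrite cliff_add -scaleN1r cliff_scale -uD -vD scaleN1r subrr.
by rewrite uD (@Cl_parity_disjoint _ _ _ _ _ g x u) // ?cliff0 // uv.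
Qed.

End span_symbols.

(** * Every operator with a parity is an operator with a symbol *)

Section parity.
Context {R : realType} {n : nat} {M : manifold R n} {r : nat}.
Context {E : vbundle (real_scalars M) r} {g : metric E} {S : spinor_bundle g}.
Context {nE : connection E} {nS : connection S}.
Hypothesis nES : compatible nE nS.
Local Notation K := (complex_scalars M).
Local Notation lop := (lop S).
Local Notation Span := (@Span R n M r E g S nS).
Local Notation SpE := (@SpE R n M r E g S nS).
Local Notation e := (mvec g).
Local Notation e' := (mdual g).
Local Notation cfam := (forall x, palg (@clifford_rel R n M r E g x)).
Implicit Types (A B D : lop) (b c : bool) (k l m : nat) (u v : cfam).

Lemma smooth_Cl_ext u v : (forall x, u x = v x) -> smooth_Cl (g := g) v -> smooth_Cl (g := g) u.
Proof. by move=> uv; have -> : u = v by apply: functional_extensionality_dep. Qed.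

Lemma smooth_ClZ (z : R[i]) u : smooth_Cl (g := g) u -> smooth_Cl (g := g) (fun x => z *: u x).
Proof.
move=> su; have := smooth_alg_mul (smooth_alg_fun _ (csmooth_cst setT z)) su.
by apply: smooth_Cl_ext => x; rewrite clif_sc.
Qed.

Lemma smooth_Cl0 : smooth_Cl (g := g) ((fun=> 0) : cfam).
Proof.
have := smooth_alg_fun (rel := @clifford_rel R n M r E g) [set w | smooth_section w]
  (csmooth_cst setT (0 : R[i])).
by apply: smooth_Cl_ext => x; rewrite scale0r.
Qed.

Lemma smooth_Cl_sum (I : Type) (q : seq I) (F : I -> cfam) :
  (forall i, smooth_Cl (g := g) (F i)) -> smooth_Cl (g := g) (fun x => \sum_(i <- q) F i x).
Proof.
move=> sF; elim: q => [|i q IH].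
  by apply: smooth_Cl_ext smooth_Cl0 => x; rewrite big_nil.
by apply: smooth_Cl_ext (smooth_alg_add (sF i) IH) => x; rewrite big_cons.
Qed.

Lemma smooth_gen xi : smooth_Cl (g := g) (fun x => cE g (Gamma_at xi x)).
Proof. exact: (smooth_alg_gen (gens := [set w | smooth_section w]) (GammaP xi)). Qed.

Definition cl_rep D u : Prop :=
  smooth_Cl (g := g) u /\ forall s x, Gamma_at (D s) x = cliff S (u x) (Gamma_at s x).

Lemma cl_repD A B u v : cl_rep A u -> cl_rep B v -> cl_rep (A + B) (fun x => u x + v x).
Proof.
move=> [su Au] [sv Bv]; split; first exact: smooth_alg_add.
by move=> s x; rewrite lop_atD Gamma_atD Au Bv cliff_add.
Qed.
Lemma cl_repM A B u v : cl_rep A u -> cl_rep B v -> cl_rep (A * B) (fun x => u x * v x).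
Proof.
move=> [su Au] [sv Bv]; split; first exact: smooth_alg_mul.
by move=> s x; rewrite lop_atM Au Bv cliffM.
Qed.
Lemma cl_repZ (z : R[i]) A u : cl_rep A u -> cl_rep ((z : K) *: A) (fun x => z *: u x).
Proof.
move=> [su Au]; split; first exact: smooth_ClZ.
by move=> s x; rewrite lop_atZ Gamma_atZ Au cliff_scale.
Qed.
Lemma cl_rep_ext A u v : (forall x, u x = v x) -> cl_rep A u -> cl_rep A v.
Proof. by move=> uv; have -> : u = v by apply: functional_extensionality_dep. Qed.
Lemma cl_rep_sum (I : Type) (q : seq I) (F : I -> lop) (G : I -> cfam) :
  (forall i, cl_rep (F i) (G i)) -> cl_rep (\sum_(i <- q) F i) (fun x => \sum_(i <- q) G i x).
Proof.
move=> FG; split; first by apply: smooth_Cl_sum => i; case: (FG i).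
move=> s x; rewrite lop_sum Gamma_at_sum cliff_sum; apply: eq_bigr => i _.
by case: (FG i).
Qed.
Lemma cl_rep_gam xi : cl_rep (lgam S xi) (fun x => cE g (Gamma_at xi x)).
Proof. by split; [exact: smooth_gen|move=> s x; rewrite lgam_at]. Qed.

Lemma cl_rep_gcom b xi D u : cl_rep D u ->
  cl_rep (gcom b true D (lgam S xi)) (fun x => gcomm1 b (u x) (Gamma_at xi x)).
Proof.
move=> Du; have H1 := cl_repM Du (cl_rep_gam xi); have H2 := cl_repM (cl_rep_gam xi) Du.
have -> : gcom b true D (lgam S xi) = D * lgam S xi + ((- (-1) ^+ b : R[i]) : K) *: (lgam S xi * D).
  by rewrite /gcom; case: b => /=; rewrite ?opprK ?scale1r ?scaleN1r.
apply: cl_rep_ext (cl_repD H1 (cl_repZ (- (-1) ^+ b) H2)) => x.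
by rewrite /gcomm1 scaleNr.
Qed.

Lemma clw1_odd x P (f : 'I_P -> E x) (w : palg (@clifford_rel R n M r E g x)) :
  clw f 1 true w -> w = 0.
Proof. by elim=> // z s a; case: s. Qed.

(** An expansion into words at each point need not have smooth coefficients. The Clifford Euler
    identity instead expresses D by its commutators with the global sections γ(e_i) and a remainder,
    all of smaller length, so the induction stays among smooth sections. *)
Lemma clifford_SpE d b D u : cl_rep D u ->
  (forall x, clw (fun i => Gamma_at (e i) x) d.+1 b (u x)) -> SpE 0 d b D.
Proof.
elim: d b D u => [|d IH] b D u Du hu.
  case: b hu => hu.
    have -> : D = 0; last exact: SpE_0.
    by apply: lop_ext => s x; rewrite Du.2 (clw1_odd (hu x)) cliff0 lop_at0.
  have /choice[z zP] : forall x, exists z : R[i], u x = z *: (1 : Cl g x).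
    by move=> x; exact: clw_scalar (hu x).
  have Dz s x : Gamma_at (D s) x = z x *: Gamma_at s x by rewrite Du.2 zP cliff_scale cliff1.
  have -> : D = lscal (S := S) (scalar_smooth Dz).
    by apply: lop_ext => s x; rewrite lscal_at Dz.
  exact: Span_SpE (Span_lscal nS _).
have ee x := @mframeP _ _ _ _ _ g x; have ee' x := @mdualP _ _ _ _ _ g x.
have hG i : SpE 0 d (~~ b) (gcom b true D (lgam S (e i))).
  apply: IH (cl_rep_gcom b (e i) Du) _ => x.
  exact: (gcomm1_clw (ee x) _ (hu x)).
have hE : cl_rep (\sum_i gcom b true D (lgam S (e i)) * lgam S (e' i))
    (fun x => cl_euler (fun i => Gamma_at (e i) x) (fun i => Gamma_at (e' i) x) b (u x)).
  by apply: cl_rep_sum => i; exact: cl_repM (cl_rep_gcom b (e i) Du) (cl_rep_gam _).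
have hL : SpE 0 d b ((\sum_i gcom b true D (lgam S (e i)) * lgam S (e' i)) +
    ((- d.+1%:R : R[i]) : K) *: D).
  apply: IH (cl_repD hE (cl_repZ (- d.+1%:R) Du)) _ => x.
  by rewrite scaleNr; exact: (cl_euler_clw (ee x) (ee' x) (hu x)).
have hS : SpE 0 d.+1 b (\sum_i gcom b true D (lgam S (e i)) * lgam S (e' i)).
  apply: SpE_sum => i; have := SpE_M (hG i) (Span_SpE (Span_g nS (e' i))).
  by rewrite addbT negbK addn1.
have hL' : SpE 0 d.+1 b ((\sum_i gcom b true D (lgam S (e i)) * lgam S (e' i)) +
    ((- d.+1%:R : R[i]) : K) *: D) by apply: SpE_le hL.
have := SpE_Z (d.+1%:R^-1) (SpE_D hS (SpE_N hL')).
set P := \sum_i _; have -> : P - (P + ((- d.+1%:R : R[i]) : K) *: D) = (d.+1%:R : K) *: D.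
  rewrite scaleNr; ncgroup.
by rewrite scalerA mulVf ?scale1r // pnatr_eq0.
Qed.

Lemma SpE_up k k' b D : (k <= k')%N -> SpE 0 k b D -> SpE 0 k' b D.
Proof. by move=> kk; apply: SpE_le. Qed.

Lemma cl_op_SpE b u (su : smooth_Cl u) : (forall x, Cl_parity b (u x)) ->
  exists2 D : lop, lop_op D = cl_op S su & exists m, SpE 0 m b D.
Proof.
move=> hu; have lin : linear_op (cl_op S su).
  by move=> c s t; apply: Gamma_ext => x; exact: cliff_linear.
exists (mklop lin) => //; exists (mnum g); apply: (clifford_SpE (u := u)) => [|x].
  by split.
exact: (Cl_parity_clw (@mframeP _ _ _ _ _ g x) (hu x)).
Qed.

(** The parity of operators is defined with all compatible pairs of connections. The difference of
    two such covariant derivatives is tensorial and induces a skew endomorphism, hence is quadratic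
    plus scalar by [derivation_quad]. *)
Lemma nabla_SpE nE' nS' Y : compatible nE' nS' -> SpE 0 2 false (lnab (S := S) nS' Y).
Proof.
move=> nES'.
have [||c [sc H]] := @derivation_quad _ _ _ _ _ _ S (lnab nS' Y - lnab nS Y)
  (fun xi => nE' Y xi - nE Y xi).
- move=> f; apply/eqP; rewrite -subr_eq0; apply/eqP.
  transitivity ((lnab nS' Y * lmulf S f - lmulf S f * lnab nS' Y) -
    (lnab nS Y * lmulf S f - lmulf S f * lnab nS Y)); first by ncring.
  by rewrite !lnab_lmulf subrr.
- move=> xi; rewrite lgamB -(lnab_lgam _ _ nES) -(lnab_lgam _ _ nES'); ncring.
have -> : lnab nS' Y = lnab nS Y + (lnab nS' Y - lnab nS Y) by ncgroup.
rewrite H; apply: SpE_D; first exact: Span_SpE (Span_n nS Y).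
apply: SpE_D; first exact: Span_SpE (quad_Span (S := S) _ nS).
exact: SpE_up (Span_SpE (Span_lscal nS sc)).
Qed.

Lemma parity_Span b (D : operator S) : diffop_parity b D ->
  exists2 L : lop, lop_op L = D & exists m, SpE 0 m b L.
Proof.
elim=> {b D} [nE' nS' Y nES'|b u su hu|b A B _ [A' <- [m hA]] _ [B' <- [l hB]]|b c A B _ [A' <- [m hA]] _ [B' <- [l hB]]].
- by exists (lnab nS' Y) => //; exists 2; exact: nabla_SpE nES'.
- exact: cl_op_SpE.
- exists (A' + B') => //; exists (maxn m l); apply: SpE_D.
    by apply: SpE_up hA; exact: leq_maxl.
  by apply: SpE_up hB; exact: leq_maxr.
- by exists (A' * B') => //; exists (m + l)%N; exact: SpE_M hA hB.
Qed.

Lemma Span_parity m b D a : Span m b D a -> diffop_parity b (lop_op D).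
Proof.
elim=> {m b D a} [f|xi|Y|m b|m b z D a _ IH|m b A B a a' _ IH _ IH'|m l b c A B a a' _ IH _ IH'|m l b D a _ _ IH] //.
- have sf : smooth_Cl (g := g) (fun x => (f x)%:C%C *: (1 : Cl g x)).
    exact: (smooth_alg_fun _ (csmooth_real (CinfP f))).
  have -> : lop_op (lmulf S f) = cl_op S sf.
    apply/funext => s; apply: Gamma_ext => x.
    by rewrite [RHS]cliff_scale cliff1.
  by apply: parity_cl => x; exact: homog_scal.
- by apply: parity_cl => x; exact: (homog_gen _ (fun=> true)).
- exact: parity_nabla nES.
- exact: diffop_parity0.
- exact: diffop_parity_scale.
- exact: parity_add.
- exact: parity_mul.
Qed.

Lemma Span_diffop m b D a : Span m b D a -> diffop (lop_op D).
Proof.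
move=> H; exists m.+1; elim/ltn_ind: m D a H => m IH D a ha.
split=> [c s t|f]; first exact: lopP.
have := Span_comm_f f ha; rewrite /Sp; case: ifP => [m2 H|_ [D0 _]].
  apply: (@diffop_lt_leq _ _ _ _ _ _ _ (m - 2).+1); first by lia.
  by apply: (IH (m - 2)%N _ (D * lmulf S f - lmulf S f * D) _ H); lia.
have -> : (lop_op D \o mul_op S f) - (mul_op S f \o lop_op D) =
    lop_op (D * lmulf S f - lmulf S f * D) by [].
by rewrite D0; apply: (@diffop_lt_leq _ _ _ _ _ _ _ 0).
Qed.

End parity.

(** * The filtration D_k in terms of symbols *)

Section filtration_symbols.
Context {R : realType} {n : nat} {M : manifold R n} {r : nat}.
Hypothesis r_gt0 : (0 < r)%N.
Context {E : vbundle (real_scalars M) r} {g : metric E} {S : spinor_bundle g}.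
Context {nE : connection E} {nS : connection S}.
Hypothesis nES : compatible nE nS.
Local Notation K := (complex_scalars M).
Local Notation lop := (lop S).
Local Notation osym := (@osymbol R n M r E).
Local Notation Span := (@Span R n M r E g S nS).
Local Notation Sp := (@Sp R n M r E g S nS).
Local Notation SpE := (@SpE R n M r E g S nS).
Local Notation dO := (dO g nE).
Local Notation homog x := (homog (@total_degree R n M r E x)).
Implicit Types (A B : lop) (D : operator S) (a : osym) (b c : bool) (k l m : nat).

Lemma SpE_even_odd k m k' m' A : SpE k m false A -> SpE k' m' true A -> A = 0.
Proof.
move=> [a ha] [a' hb]; move: ha hb; rewrite /Sp.
case: ifP => [_ ha|_ [-> _] //]; case: ifP => [_ hb|_ [-> _] //].
exact: (Span_even_odd nES ha hb).
Qed.

Lemma gcomm_gamma A B xi :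
  gcomm (lop_op A, lop_op B) (0, gamma S xi) =
  lop_op (gcom false true A (lgam S xi) + gcom true true B (lgam S xi)).
Proof.
apply/funext => s; apply: Gamma_ext => x.
change (Gamma_at (A 0 - 0 + (A (lgam S xi s) - lgam S xi (A s)) + (B 0 - 0) +
  (B (lgam S xi s) + lgam S xi (B s))) x =
  Gamma_at (A (lgam S xi s) - lgam S xi (A s) + (B (lgam S xi s) + lgam S xi (B s))) x).
by rewrite !lop0 !subrr add0r addr0.
Qed.

(** Graded commutators with γ(ξ) lower the degree by 1 and exchange the parities, as the definition
    of the filtration demands. The shift in [SpE 1 j] reflects that [diffop_filt j] is D_{j-1}. *)
Lemma SpE_filt j A B : SpE 1 j false A -> SpE 1 j true B -> diffop_filt j (lop_op (A + B)).
Proof.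
elim: j A B => [|j IH] A B; first by move=> [a [-> _]] [b' [-> _]]; rewrite addr0.
move=> [a ha] [a' hb]; rewrite /Sp subn1 /= in ha hb; split.
  have -> : lop_op (A + B) = 1 *: lop_op A + lop_op B by rewrite scale1r.
  by apply: diffop_linear; [exact: (Span_diffop ha)|exact: (Span_diffop hb)].
exists (lop_op A, lop_op B).
  by split=> //=; [exact: (Span_parity nES ha)|exact: (Span_parity nES hb)].
move=> xi; rewrite gcomm_gamma addrC; apply: IH.
  exact: (Span_commgE nES xi hb).
exact: (Span_commgE nES xi ha).
Qed.

(* An operator whose commutators with Cl(E) have low degree has low degree.    *)
Lemma SpE_descend m j b A : SpE 0 m b A ->
  (forall xi, SpE 1 j (~~ b) (gcom b true A (lgam S xi))) -> SpE 0 j b A.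
Proof.
elim: m => [|m IH] hA hxi; first by apply: SpE_up hA.
have [mj|jm] := leqP m.+1 j; first exact: SpE_up hA.
apply: IH => //; case: hA => a /Sp0E ha.
suff a0 x : a x = 0 by case: (Span_lower nES ha a0) => a' ha'; exists a'; move: ha'; rewrite /Sp subn1 subn0.
apply: (osym_nondegenerate r_gt0 (ltn0Sn m) (Span_homog ha x)) => xi.
have [u hu] := hxi xi; have := Span_comm_g nES xi ha.
have : Sp 1 m.+1 (~~ b) (gcom b true A (lgam S xi)) (fun x => 0) by apply: Sp_low hu; lia.
rewrite /Sp => h1 h2; exact: (Span_inj nES h2 h1 x).
Qed.

(** By [parity_Span] the components of D have expansions of some degree. Their commutators with γ(ξ)
    have degree bounded by induction, and [SpE_descend] transfers this bound to the components. *)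
Lemma filt_SpE j D : diffop_filt j D ->
  exists A B, [/\ D = lop_op (A + B), SpE 1 j false A & SpE 1 j true B].
Proof.
elim: j D => [|j IH] D.
  by move=> ->; exists 0, 0; split; [rewrite addr0|exact: SpE_0|exact: SpE_0].
move=> [_ [[P1 P2] [/= pA pB ->] fP]].
have [A AE [m hA]] := parity_Span nES pA; have [B BE [l hB]] := parity_Span nES pB.
rewrite -{}AE -{}BE in fP *; exists A, B.
(* The induction hypothesis only bounds the sum of the two commutators. They have opposite parities,
   so the bound passes to each of them because even and odd operators meet only in 0. *)
have key xi : SpE 1 j true (gcom false true A (lgam S xi)) /\
    SpE 1 j false (gcom true true B (lgam S xi)).
  have := IH _ (fP xi); rewrite gcomm_gamma => -[C [C' [/val_inj CE hC hC']]].
  case: hA => a /Sp0E ha; case: hB => a' /Sp0E hb.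
  have HA := Span_commgE nES xi ha; have HB := Span_commgE nES xi hb.
  have EQ : gcom true true B (lgam S xi) - C = C' - gcom false true A (lgam S xi).
    transitivity (gcom false true A (lgam S xi) + gcom true true B (lgam S xi) - C -
      gcom false true A (lgam S xi)); first by ncgroup.
    by rewrite CE; ncgroup.
  have z : gcom true true B (lgam S xi) - C = 0.
    apply: (@SpE_even_odd 1 (maxn l j) 1 (maxn m j)).
      apply: SpE_D; first by apply: SpE_le HB; rewrite leq_add2l leq_maxl.
      by apply: SpE_N; apply: SpE_le hC; rewrite leq_add2l leq_maxr.
    rewrite EQ; apply: SpE_D; first by apply: SpE_le hC'; rewrite leq_add2l leq_maxr.
    by apply: SpE_N; apply: SpE_le HA; rewrite leq_add2l leq_maxl.
  split; last by move/eqP: z; rewrite subr_eq0 => /eqP ->.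
  by move: z; rewrite EQ => /eqP; rewrite subr_eq0 => /eqP <-.
split=> //.
  by apply: (@SpE_le _ _ _ _ _ _ _ _ 0 j); rewrite //; apply: SpE_descend hA _ => xi; case: (key xi).
by apply: (@SpE_le _ _ _ _ _ _ _ _ 0 j); rewrite //; apply: SpE_descend hB _ => xi; case: (key xi).
Qed.

(** Operators of D_k have no fixed parity. The symbol is the sum of the symbols of the even and the
    odd component, of which only the one with the parity of k can be nonzero. *)
Definition Symb k D a : Prop := exists A B a0 a1,
  [/\ D = lop_op (A + B), Span k false A a0, Span k true B a1 & forall x, a x = a0 x + a1 x].

Lemma Symb_filt k D a : Symb k D a -> diffop_filt k.+1 D.
Proof.
move=> [A [B [a0 [a1 [-> hA hB _]]]]]; apply: SpE_filt.
  by exists a0; rewrite /Sp subn1.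
by exists a1; rewrite /Sp subn1.
Qed.

Lemma filt_Symb k D : diffop_filt k.+1 D -> exists a, Symb k D a.
Proof.
move=> /filt_SpE[A [B [-> [a0 hA] [a1 hB]]]]; exists (fun x => a0 x + a1 x).
by exists A, B, a0, a1; split => //; [move: hA|move: hB]; rewrite /Sp subn1.
Qed.

Lemma parity_components_eq A B A' B' m m' : A + B = A' + B' ->
  SpE 0 m false A -> SpE 0 m true B -> SpE 0 m' false A' -> SpE 0 m' true B' -> A = A' /\ B = B'.
Proof.
move=> eq hA hB hA' hB'; have EQ : A - A' = B' - B.
  transitivity (A + B - A' - B); first by ncgroup.
  by rewrite eq; ncgroup.
have z : A - A' = 0.
  apply: (@SpE_even_odd 0 (maxn m m') 0 (maxn m m')).
    apply: SpE_D; first exact: SpE_up (leq_maxl _ _) hA.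
    by apply: SpE_N; exact: SpE_up (leq_maxr _ _) hA'.
  rewrite EQ; apply: SpE_D; first exact: SpE_up (leq_maxr _ _) hB'.
  by apply: SpE_N; exact: SpE_up (leq_maxl _ _) hB.
split; first by apply/eqP; rewrite -subr_eq0 z.
by apply/esym/eqP; rewrite -subr_eq0 -EQ z.
Qed.

Lemma Symb_uniq k D a a' : Symb k D a -> Symb k D a' -> forall x, a x = a' x.
Proof.
move=> [A [B [a0 [a1 [-> hA hB aE]]]]] [A' [B' [b0 [b1 [/val_inj EQ hA' hB' bE]]]]] x.
have [EA EB] := parity_components_eq EQ (Span_SpE hA) (Span_SpE hB) (Span_SpE hA') (Span_SpE hB').
rewrite -EA in hA'; rewrite -EB in hB'.
by rewrite aE bE (Span_inj nES hA hA') (Span_inj nES hB hB').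
Qed.

Lemma Symb_even k A a : Span k false A a -> Symb k (lop_op A) a.
Proof.
move=> hA; exists A, 0, a, (fun=> 0); split => //; first by rewrite addr0.
  exact: Span_0.
by move=> x; rewrite addr0.
Qed.
Lemma Symb_odd k A a : Span k true A a -> Symb k (lop_op A) a.
Proof.
move=> hA; exists 0, A, (fun=> 0), a; split => //; first by rewrite add0r.
  exact: Span_0.
by move=> x; rewrite add0r.
Qed.
Lemma Symb_Span b k A a : Span k b A a -> Symb k (lop_op A) a.
Proof. by case: b; [exact: Symb_odd|exact: Symb_even]. Qed.

Lemma Symb_linear k (z : R[i]) D D' a a' : Symb k D a -> Symb k D' a' ->
  Symb k ((z : K) *: D + D') (fun x => z *: a x + a' x).
Proof.
move=> [A [B [a0 [a1 [-> hA hB aE]]]]] [A' [B' [b0 [b1 [-> hA' hB' bE]]]]].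
exists ((z : K) *: A + A'), ((z : K) *: B + B'), (fun x => z *: a0 x + b0 x), (fun x => z *: a1 x + b1 x).
split; [|exact: Span_add (Span_scale z hA) hA'|exact: Span_add (Span_scale z hB) hB'|].
  have -> : (z : K) *: A + A' + ((z : K) *: B + B') = (z : K) *: (A + B) + (A' + B').
    by rewrite scalerDr; ncgroup.
  by [].
by move=> x; rewrite aE bE scalerDr; ncgroup.
Qed.

Lemma Symb_mul k l D D' a a' : Symb k D a -> Symb l D' a' ->
  Symb (k + l) (D \o D') (fun x => a x * a' x).
Proof.
move=> [A [B [a0 [a1 [-> hA hB aE]]]]] [A' [B' [b0 [b1 [-> hA' hB' bE]]]]].
exists (A * A' + B * B'), (A * B' + B * A'), (fun x => a0 x * b0 x + a1 x * b1 x),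
  (fun x => a0 x * b1 x + a1 x * b0 x).
split; [|exact: Span_add (Span_mul hA hA') (Span_mul hB hB')|
  exact: Span_add (Span_mul hA hB') (Span_mul hB hA')|].
  have -> : A * A' + B * B' + (A * B' + B * A') = (A + B) * (A' + B') by ncring.
  by [].
by move=> x; rewrite aE bE; ncring.
Qed.

Lemma Symb_low k D a : Symb k D a -> (forall x, a x = 0) <-> diffop_filt k D.
Proof.
move=> [A [B [a0 [a1 [-> hA hB aE]]]]]; split=> [a_0|].
  (* The two parts are eigenvectors of [theta] for 1 and -1, so their sum vanishes only if both
     do. *)
  have z x : a0 x = 0 /\ a1 x = 0.
    have t0 := Span_theta hA x; have t1 := Span_theta hB x.
    have s0 : a0 x = - a1 x by apply/eqP; rewrite -addr_eq0 -aE a_0.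
    have : a0 x = a1 x.
      move: t0; rewrite scale1r {1}s0 thetaN t1 scaleN1r opprK => ->; by [].
    move=> e01; have : a1 x = 0.
      apply: (@scale_natr_eq0 _ _ 2) => //; rewrite scaler_nat mulr2n.
      by rewrite -{1}e01 s0 addNr.
    by move=> a10; rewrite e01 a10.
  apply: SpE_filt; first by apply: (Span_lower nES hA) => x; case: (z x).
  by apply: (Span_lower nES hB) => x; case: (z x).
move=> /filt_SpE[A' [B' [/val_inj EQ hA' hB']]] x.
have [EA EB] : A = A' /\ B = B'.
  apply: (parity_components_eq EQ (Span_SpE hA) (Span_SpE hB) (m' := k)).
    by apply: SpE_le hA'; lia.
  by apply: SpE_le hB'; lia.
have low b C u : Span k b C u -> SpE 1 k b C -> u x = 0.
  move=> hC [w hw]; have /Sp0E hC' : Sp 0 k b C (fun=> 0) by apply: Sp_low hw; lia.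
  by rewrite (Span_inj nES hC hC').
by rewrite aE (low _ _ _ hA) ?EA // (low _ _ _ hB) ?EB // addr0.
Qed.

Lemma Symb_smooth k D a : Symb k D a ->
  smooth_alg (@smooth_generators R n M r E) a /\ forall x, homog x k (a x).
Proof.
move=> [A [B [a0 [a1 [_ hA hB aE]]]]]; split.
  by apply: smooth_alg_ext (smooth_alg_add (Span_smooth hA) (Span_smooth hB)).
by move=> x; rewrite aE; apply: homog_add; [exact: (Span_homog hA)|exact: (Span_homog hB)].
Qed.

End filtration_symbols.

(** * The Poisson bracket as the symbol of the graded commutator *)

Section poisson_bracket.
Context {R : realType} {n : nat} {M : manifold R n} {r : nat}.
Context {E : vbundle (real_scalars M) r} {g : metric E} {S : spinor_bundle g}.
Context {nE : connection E} {nS : connection S}.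
Hypothesis nES : compatible nE nS.
Local Notation K := (complex_scalars M).
Local Notation lop := (lop S).
Local Notation osym := (@osymbol R n M r E).
Local Notation Span := (@Span R n M r E g S nS).
Local Notation Sp := (@Sp R n M r E g S nS).
Local Notation SpE := (@SpE R n M r E g S nS).
Local Notation dO := (dO g nE).
Local Notation OC := (@OC R n M r E).
Implicit Types (A B D : lop) (k l m : nat).

Lemma OC_ext k (a b : OC k) : (forall x, O_at a x = O_at b x) -> a = b.
Proof. by move=> ab; apply/val_inj/functional_extensionality_dep. Qed.

Lemma O_at_linear k (z : R[i]) (a b : OC k) x : O_at (z *: a + b) x = z *: O_at a x + O_at b x.
Proof. by []. Qed.
Lemma O_at0 k x : O_at (0 : OC k) x = 0. Proof. by []. Qed.
Lemma O_atM k l (a : OC k) (b : OC l) x : O_at (O_mul a b) x = O_at a x * O_at b x.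
Proof. by []. Qed.

(** Functions, sections and vector fields generate all symbols. Each symbol lifts to an operator by
    [Span_surj], and the induction runs over the expansion of that lift. *)
Lemma OC_ind (P : forall k, OC k -> Prop) :
  (forall f, P 0%N (O_fun f)) -> (forall xi, P 1%N (O_E xi)) -> (forall Y, P 2 (O_TM Y)) ->
  (forall k (z : R[i]) (a b : OC k), P k a -> P k b -> P k (z *: a + b)) -> (forall k, P k 0) ->
  (forall k l (a : OC k) (b : OC l), P k a -> P l b -> P (k + l)%N (O_mul a b)) ->
  forall k (a : OC k), P k a.
Proof.
move=> Pf PE PT Pl P0 Pm k a.
suff H b D u : Span k b D u -> forall c : OC k, (forall x, O_at c x = u x) -> P k c.
  by have [D /H] := @Span_surj _ _ _ _ _ _ S nE nS _ _ (OP a).1 (OP a).2; apply.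
move=> {a} hD; elim: hD => {k b D u} [f|xi|Y|m b|m b z D u hD IH|m b A B u u' hA IH hB IH'|m l b c A B u u' hA IH hB IH'|m l b D u _ _ _] a au.
- by rewrite (OC_ext (b := O_fun f) au).
- by rewrite (OC_ext (b := O_E xi) au).
- by rewrite (OC_ext (b := O_TM Y) au).
- by rewrite (OC_ext (b := 0) au).
- have -> : a = z *: mkO (Span_smooth hD) (Span_homog hD) + 0.
    by apply: OC_ext => x; rewrite O_at_linear au addr0.
  by apply: Pl => //; exact: IH.
- have -> : a = 1 *: mkO (Span_smooth hA) (Span_homog hA) + mkO (Span_smooth hB) (Span_homog hB).
    by apply: OC_ext => x; rewrite O_at_linear au scale1r.
  by apply: Pl; [exact: IH|exact: IH'].
- have -> : a = O_mul (mkO (Span_smooth hA) (Span_homog hA)) (mkO (Span_smooth hB) (Span_homog hB)).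
    by apply: OC_ext => x; rewrite O_atM au.
  by apply: Pm; [exact: IH|exact: IH'].
- by rewrite (OC_ext (b := 0) au).
Qed.

Lemma Span_OC k (a : OC k) : exists D, Span k (odd k) D (O_at a).
Proof. exact: (@Span_surj _ _ _ _ _ _ S nE nS _ _ (OP a).1 (OP a).2). Qed.
Definition oplop k (a : OC k) : lop := sval (cid (Span_OC a)).
Lemma oplopP k (a : OC k) : Span k (odd k) (oplop a) (O_at a).
Proof. exact: (svalP (cid (Span_OC a))). Qed.

Lemma Sp_inj k m b D a a' : Sp k m b D a -> Sp k m b D a' -> forall x, a x = a' x.
Proof.
rewrite /Sp; case: ifP => _; first exact: (Span_inj nES).
by move=> [_ a0] [_ a'0] x; rewrite a0 a'0.
Qed.

Lemma Sp_OC k m b D s : Sp k m b D s -> exists c : OC (m - k), forall x, O_at c x = s x.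
Proof.
rewrite /Sp; case: ifP => _; last by move=> [_ s0]; exists 0 => x; rewrite s0.
by move=> H; exists (mkO (Span_smooth H) (Span_homog H)).
Qed.

Lemma Span_comm_low k l b c A B u : SpE 1 k b A -> Span l c B u ->
  Sp 2 (k + l) (b (+) c) (gcom b c A B) (fun=> 0).
Proof.
move=> [a]; rewrite {1}/Sp; case: ifP => [k1|_ [-> _] _]; last first.
  by apply: Sp_eq (Sp_0 _ _ _ _) _ _ => [|x] //; rewrite gcom0l.
by move=> hA hB; have [s hs] := Span_comm nES hA hB; apply: Sp_low hs; lia.
Qed.

Lemma br_ex k l (a : OC k) (b : OC l) : exists c : OC (k + l - 2),
  Sp 2 (k + l) (odd k (+) odd l) (gcom (odd k) (odd l) (oplop a) (oplop b)) (O_at c).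
Proof.
have [s hs] := Span_comm nES (oplopP a) (oplopP b); have [c cs] := Sp_OC hs.
by exists c; apply: Sp_eq hs _ _.
Qed.
Definition br k l (a : OC k) (b : OC l) : OC (k + l - 2) := sval (cid (br_ex a b)).

(** Two lifts of the same symbol differ by an operator of lower degree, whose commutators fall below
    degree k + l - 2. So the bracket does not depend on the lifts. *)
Lemma brP k l (a : OC k) (b : OC l) A B : Span k (odd k) A (O_at a) ->
  Span l (odd l) B (O_at b) ->
  Sp 2 (k + l) (odd k (+) odd l) (gcom (odd k) (odd l) A B) (O_at (br a b)).
Proof.
move=> hA hB; have H := svalP (cid (br_ex a b)); rewrite -/(br a b) in H.
have lowsub j (c : OC j) C : Span j (odd j) C (O_at c) -> SpE 1 j (odd j) (C - oplop c).
  move=> hC; have /Sp0E := Sp_sub (Span_Sp hC) (Span_Sp (oplopP c)).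
  by move=> /(Span_lower nES); apply => x; rewrite subrr.
have H1 := Span_comm_low (lowsub _ _ _ hA) hB.
have H2 : Sp 2 (k + l) (odd k (+) odd l) (gcom (odd k) (odd l) (oplop a) (B - oplop b)) (fun=> 0).
  have := Span_comm_low (lowsub _ _ _ hB) (oplopP a); rewrite gcom_sym addnC addbC => H2.
  move: H2; case: ifP => _ H2; last first.
    by apply: Sp_eq (Sp_opp H2) _ _ => [|x]; rewrite ?opprK // oppr0.
  exact: H2.
apply: Sp_eq (Sp_add (Sp_add H1 H2) H) _ _ => [|x]; last by rewrite !add0r.
by rewrite -addrA -gcomDr subrK -gcomDl subrK.
Qed.

Lemma br_val k l (a : OC k) (b : OC l) A B s : Span k (odd k) A (O_at a) ->
  Span l (odd l) B (O_at b) -> Sp 2 (k + l) (odd k (+) odd l) (gcom (odd k) (odd l) A B) s ->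
  forall x, O_at (br a b) x = s x.
Proof. by move=> hA hB; exact: (Sp_inj (brP hA hB)). Qed.

Let Pf f : Span 0 (odd 0) (lmulf S f) (O_at (O_fun f : OC 0)) := Span_f nS f.
Let Pg xi : Span 1 (odd 1) (lgam S xi) (O_at (O_E xi)) := Span_g nS xi.
Let Pn Y : Span 2 (odd 2) (lnab nS Y) (O_at (O_TM Y : OC 2)) := Span_n nS Y.

Lemma br_gamma k (a : OC k) xi x : O_at (br a (O_E xi)) x = dO xi (O_at a) x.
Proof.
apply: (br_val (s := dO xi (O_at a)) (oplopP a) (Pg xi)).
have := Span_comm_g nES xi (oplopP a); rewrite addbT; apply: Sp_shift; lia.
Qed.

Lemma quad_sym_OC (A : Gamma E -> Gamma E) : exists2 rho : OC 2,
  forall x, O_at rho x = quad_sym (g := g) A x &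
  forall x, homog (@sym_degree R n M r E x) 0%N (O_at rho x).
Proof.
have H := quad_Span (S := S) A nS; exists (mkO (Span_smooth H) (Span_homog H)) => // x.
change (homog (@sym_degree R n M r E x) 0%N (quad_sym (g := g) A x)).
rewrite /quad_sym palg_scaleE.
apply: (@homog_mul _ _ _ nat _ 0%N 0%N); first exact: homog_scal.
elim: (index_enum _) => [|i q IH]; first by rewrite big_nil; exact: homog_0.
rewrite big_cons; apply: homog_add => //.
apply: (@homog_mul _ _ _ nat _ 0%N 0%N); exact: (homog_gen _ (@sym_degree R n M r E x) (inr _)).
Qed.

(** Each axiom is the symbol of an identity of operators: skew symmetry and the Leibniz rule of
    graded commutators, the commutators of the generators, and for two vector fields
    [curvature_op]. *)
Lemma br_poisson : is_poisson_bracket g nE br.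
Proof.
split.
- move=> k l a z b b'; apply: OC_ext => x.
  have hB := Span_add (Span_scale z (oplopP b)) (oplopP b').
  rewrite O_at_linear; apply: (br_val (b := z *: b + b')
    (s := fun x => z *: O_at (br a b) x + O_at (br a b') x) (oplopP a) hB).
  apply: Sp_eq (Sp_add (Sp_scale z (brP (oplopP a) (oplopP b))) (brP (oplopP a) (oplopP b'))) _ _ => //.
  by rewrite gcomDr gcomZr.
- move=> k l a b x; apply: (br_val (s := fun x => - ((-1) ^+ (k * l) *: O_at (br b a) x))
    (oplopP a) (oplopP b)).
  move: (brP (oplopP b) (oplopP a)); move: (O_at (br b a)) => u.
  rewrite [(l + k)%N]addnC [odd l (+) _]addbC => H.
  rewrite gcom_sym -signr_odd oddM; case: (odd k && odd l).
    by apply: Sp_eq H _ _ => // y; rewrite scaleN1r opprK.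
  by apply: Sp_eq (Sp_opp H) _ _ => // y; rewrite scale1r.
- move=> k l m a b c x.
  have hBC := Span_mul (oplopP b) (oplopP c); rewrite -oddD in hBC.
  apply: (br_val (b := O_mul b c) (s := fun x => O_at (br a b) x * O_at c x +
    (-1) ^+ (k * l) *: (O_at b x * O_at (br a c) x)) (oplopP a) hBC).
  have H1 := Sp_mul (brP (oplopP a) (oplopP b)) (Span_Sp (oplopP c)).
  have H2 := Sp_mul (Span_Sp (oplopP b)) (brP (oplopP a) (oplopP c)).
  rewrite oddD gcom_mulr.
  have H1' : Sp 2 (k + (l + m)) (odd k (+) (odd l (+) odd m))
      (gcom (odd k) (odd l) (oplop a) (oplop b) * oplop c) (fun x => O_at (br a b) x * O_at c x).
    by rewrite addbA; apply: Sp_shift H1; lia.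
  have H2' : Sp 2 (k + (l + m)) (odd k (+) (odd l (+) odd m))
      (oplop b * gcom (odd k) (odd m) (oplop a) (oplop c)) (fun x => O_at b x * O_at (br a c) x).
    by rewrite addbCA; apply: Sp_shift H2; lia.
  rewrite -signr_odd oddM; case: (odd k && odd l).
    by apply: Sp_eq (Sp_add H1' (Sp_opp H2')) _ _ => // y; rewrite scaleN1r.
  by apply: Sp_eq (Sp_add H1' H2') _ _ => // y; rewrite scale1r.
- split.
  + move=> h f; apply: OC_ext; apply: (br_val (Pf h) (Pf f)).
    by apply: Sp_eq (Sp_0 _ _ _ _) _ _ => // ; rewrite /gcom /= lmulfC subrr.
  + move=> f xi; apply: OC_ext; apply: (br_val (Pf f) (Pg xi)).
    by apply: Sp_eq (Sp_0 _ _ _ _) _ _ => // ; rewrite /gcom /= lgam_lmulf subrr.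
  + move=> Y f; apply: OC_ext; apply: (br_val (Pn Y) (Pf f)).
    have := Span_Sp (Pf (Y f)) => /(Sp_shift (erefl : (2 + 0 = 0 + 2)%N)) H.
    by apply: Sp_eq H _ _ => //; rewrite /gcom /= lnab_lmulf.
  + move=> Y xi; apply: OC_ext; apply: (br_val (Pn Y) (Pg xi)).
    have := Span_Sp (Pg (nE Y xi)) => /(Sp_shift (erefl : (2 + 1 = 0 + 3)%N)) H.
    by apply: Sp_eq H _ _ => //; rewrite /gcom /= (lnab_lgam _ _ nES).
  + split=> [xi eta|Y Z].
      apply: OC_ext; apply: (br_val (Pg xi) (Pg eta)).
      have := Span_Sp (Pf (metric_fun g xi eta)) => /(Sp_shift (erefl : (2 + 0 = 0 + 2)%N)) H.
      by apply: Sp_eq H _ _ => //; rewrite /gcom /= lgam_anti.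
    have [rho rhoE rho0] := quad_sym_OC (curv (nE := nE) Y Z).
    have hq : Span 2 (odd 2) (quad (S := S) (curv (nE := nE) Y Z)) (O_at rho).
      by apply: Span_eq (quad_Span (S := S) _ nS) _ _.
    exists rho; split => // [xi|].
      apply: OC_ext; apply: (br_val hq (Pg xi)).
      have := Span_Sp (Pg (curv (nE := nE) Y Z xi)) => /(Sp_shift (erefl : (2 + 1 = 0 + 3)%N)) H.
      by apply: Sp_eq H _ _ => //; rewrite /gcom /= (curvature_lgam nES).
    apply: OC_ext; apply: (br_val (Pn Y) (Pn Z)).
    have [c [sc H]] := curvature_op nES Y Z; rewrite /gcom H.
    (* The scalar in the curvature has degree 0, so in degree 2 its symbol is 0. *)
    have H0 : Sp 2 4 false (lscal (S := S) sc) (fun=> 0).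
      by apply: Sp_low (Span_Sp (Span_lscal nS sc)).
    have H1 : Sp 2 4 false (lnab nS (vlie Y Z)) (O_at (O_TM (vlie Y Z) : OC 2)).
      exact: (Sp_shift (erefl : (2 + 2 = 0 + 4)%N) (Span_Sp (Pn (vlie Y Z)))).
    have H2 := Sp_shift (erefl : (2 + 2 = 0 + 4)%N) (Span_Sp hq).
    apply: Sp_eq (Sp_add (Sp_add H1 H2) H0) _ _ => // y; by rewrite addr0.
Qed.

Hypothesis r_gt0 : (0 < r)%N.

Section uniqueness.
Variable B : @bracket_type R n M r E.
Hypothesis BP : is_poisson_bracket g nE B.

Let agree k (a : OC k) l (b : OC l) := forall x, O_at (B a b) x = O_at (br a b) x.

Let agree_sym k (a : OC k) l (b : OC l) : agree a b -> agree b a.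
Proof.
have [_ sB _ _] := BP; have [_ sb _ _] := br_poisson.
by move=> ab x; rewrite sB sb ab.
Qed.

Let agree_linear k (a : OC k) l (z : R[i]) (b b' : OC l) :
  agree a b -> agree a b' -> agree a (z *: b + b').
Proof.
have [lB _ _ _] := BP; have [lb _ _ _] := br_poisson.
by move=> h h' x; rewrite lB lb !O_at_linear h h'.
Qed.

Let agree0 k (a : OC k) l : agree a (0 : OC l).
Proof.
have [lB _ _ _] := BP; have [lb _ _ _] := br_poisson.
have z0 (F : OC l -> OC (k + l - 2)) : (forall z b b', F (z *: b + b') = z *: F b + F b') -> F 0 = 0.
  by move=> FL; have := FL (-1) 0 0; rewrite scaler0 addr0 scaleN1r addNr.
by move=> x; rewrite (z0 (fun b => B a b)) // (z0 (fun b => br a b)).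
Qed.

Let agree_mul k (a : OC k) l m (b : OC l) (c : OC m) : agree a b -> agree a c -> agree a (O_mul b c).
Proof.
have [_ _ mB _] := BP; have [_ _ mb _] := br_poisson.
by move=> h h' x; rewrite mB mb h h'.
Qed.

Let agree_gens l (b : OC l) : (forall f, agree b (O_fun f)) -> (forall xi, agree b (O_E xi)) ->
  (forall Y, agree b (O_TM Y)) -> forall k (a : OC k), agree b a.
Proof.
move=> bf bE bT; apply: (OC_ind (P := fun k a => agree b a)) => //.
- by move=> k z a a'; exact: agree_linear.
- by move=> k k' a a'; exact: agree_mul.
Qed.

Let agree_f f k (a : OC k) : agree (O_fun f) a.
Proof.
have [_ _ _ [Bff BfE BTf _ _]] := BP; have [_ _ _ [bff bfE bTf _ _]] := br_poisson.
apply: agree_gens => [f'|xi|Y].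
- by move=> x; rewrite Bff bff.
- by move=> x; rewrite BfE bfE.
- by apply: agree_sym => x; rewrite BTf bTf.
Qed.

Let agree_E xi k (a : OC k) : agree (O_E xi) a.
Proof.
have [_ _ _ [_ _ _ BTE [BEE _]]] := BP; have [_ _ _ [_ _ _ bTE [bEE _]]] := br_poisson.
apply: agree_gens => [f|eta|Y].
- by apply: agree_sym; exact: agree_f.
- by move=> x; rewrite BEE bEE.
- by apply: agree_sym => x; rewrite BTE bTE.
Qed.

Let agree_T Y k (a : OC k) : agree (O_TM Y) a.
Proof.
have [_ _ _ [_ _ _ _ [_ BTT]]] := BP; have [_ _ _ [_ _ _ _ [_ bTT]]] := br_poisson.
apply: agree_gens => [f|eta|Z].
- by apply: agree_sym; exact: agree_f.
- by apply: agree_sym; exact: agree_E.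
have [rho [_ rhoE EB]] := BTT Y Z; have [rho' [_ rhoE' Eb]] := bTT Y Z.
(* Both curvature elements have the same brackets with all sections of E, so they agree by
   nondegeneracy in degree 2. *)
suff rr : rho = rho' by move=> x; rewrite EB Eb rr.
apply: OC_ext => x; apply/eqP; rewrite -subr_eq0; apply/eqP.
have -> : O_at rho x - O_at rho' x = O_at (- 1 *: rho' + rho) x.
  by rewrite O_at_linear scaleN1r addrC.
apply: (osym_nondegenerate (nE := nE) (g := g) r_gt0 (isT : (0 < 2)%N) ((OP _).2 x)) => xi.
have [lb sb _ _] := br_poisson.
rewrite -br_gamma sb lb O_at_linear.
have e1 : O_at (br (O_E xi) rho) x = O_at (br (O_E xi) rho') x.
  have [_ sB _ _] := BP; by rewrite -(agree_E xi rho x) sB sb rhoE rhoE'.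
by rewrite e1 scaleN1r addNr scaler0 oppr0.
Qed.

(** By the Leibniz rule and skew symmetry a bracket is determined on generators. The one value not
    prescribed outright, on two vector fields, involves an element that is fixed by its brackets
    with sections of E. *)
Lemma poisson_bracket_uniq k l (a : OC k) (b : OC l) : B a b = br a b.
Proof.
apply: OC_ext; apply: agree_gens => [f|xi|Y]; apply: agree_sym.
- exact: agree_f.
- exact: agree_E.
- exact: agree_T.
Qed.

End uniqueness.

Lemma O_bracketE k l (a : OC k) (b : OC l) : O_bracket g nE a b = br a b.
Proof.
apply: poisson_bracket_uniq; rewrite /O_bracket; case: pselect => [h|[]]; first exact: svalP.
by exists br; exact: br_poisson.
Qed.

End poisson_bracket.

(** * Representatives of classes in gr D *)

Section quotient_classes.
Context {R : realType} {n : nat} {M : manifold R n} {r : nat}.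
Context {E : vbundle (real_scalars M) r} {g : metric E} (S : spinor_bundle g).
Local Notation K := (complex_scalars M).
Implicit Types (D : operator S) (k l : nat).

Lemma filtP k (D : filt S k) : diffop_filt k.+1 (filt_op D).
Proof. by case: D => D DP; apply/asboolP. Qed.

Lemma gr_reprP k (al : gr S k) : diffop_filt k.+1 (gr_repr al).
Proof. exact: filtP. Qed.

Lemma filt_insubd k D : diffop_filt k.+1 D -> filt_op (insubd (0 : filt S k) D) = D.
Proof. by move=> fD; rewrite [LHS](insubdK (0 : filt S k)) //; apply/asboolP. Qed.

Lemma symbol_repr k (al : gr S k) : symbol k (gr_repr al) = al.
Proof.
rewrite -[RHS]qreprK /symbol; congr qclass; apply/val_inj.
exact: (filt_insubd (gr_reprP al)).
Qed.

Lemma symbol_eq k D D' : diffop_filt k.+1 D -> diffop_filt k.+1 D' ->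
  diffop_filt k (D - D') -> symbol k D = symbol k D'.
Proof.
move=> fD fD' low; apply/qclassP/asboolP.
change (diffop_filt k (filt_op (insubd (0 : filt S k) D) - filt_op (insubd (0 : filt S k) D'))).
by rewrite !filt_insubd.
Qed.

Lemma gr_repr_symbol k D : diffop_filt k.+1 D -> diffop_filt k (gr_repr (symbol k D) - D).
Proof.
move=> fD; have /asboolP := qrepr_class (@filt_low_submod R n M r E g S k) (insubd (0 : filt S k) D).
change (diffop_filt k (gr_repr (symbol k D) - filt_op (insubd (0 : filt S k) D)) -> 
  diffop_filt k (gr_repr (symbol k D) - D)).
by rewrite filt_insubd.
Qed.

Lemma symbol_linear k (z : K) D D' : diffop_filt k.+1 D -> diffop_filt k.+1 D' ->
  symbol k (z *: D + D') = z *: symbol k D + symbol k D'.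
Proof.
move=> fD fD'; have fL := diffop_filt_linear z fD fD'.
have -> : symbol k (z *: D + D') =
    qclass (@filt_low_submod R n M r E g S k)
      (z *: insubd (0 : filt S k) D + insubd (0 : filt S k) D').
  rewrite /symbol; congr qclass; apply/val_inj; rewrite [LHS](filt_insubd fL).
  change (z *: D + D' = z *: filt_op (insubd (0 : filt S k) D) + filt_op (insubd (0 : filt S k) D')).
  by rewrite !filt_insubd.
rewrite -(qaddE (@filt_low_submod R n M r E g S k)) -(qscaleE (@filt_low_submod R n M r E g S k)).
by [].
Qed.

End quotient_classes.

(** * The isomorphism, its uniqueness and its dependence on the connections *)

Section main.
Context {R : realType} {n : nat} {M : manifold R n} {r : nat}.
Hypothesis r_gt0 : (0 < r)%N.
Context {E : vbundle (real_scalars M) r} {g : metric E} {S : spinor_bundle g}.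
Context {nE : connection E} {nS : connection S}.
Hypothesis nES : compatible nE nS.
Local Notation K := (complex_scalars M).
Local Notation lop := (lop S).
Local Notation Span := (@Span R n M r E g S nS).
Local Notation Sp := (@Sp R n M r E g S nS).
Local Notation SpE := (@SpE R n M r E g S nS).
Local Notation Symb := (@Symb R n M r E g S nS).
Local Notation OC := (@OC R n M r E).
Implicit Types (A B : lop) (D : operator S) (k l m : nat).

Lemma Symb_OC k D : diffop_filt k.+1 D -> exists a : OC k, Symb k D (O_at a).
Proof.
move=> /(filt_Symb r_gt0 nES)[a ha]; have [sa ka] := Symb_smooth ha.
by exists (mkO sa ka).
Qed.

Definition phi k (al : gr S k) : OC k := sval (cid (Symb_OC (gr_reprP al))).
Lemma phiP k (al : gr S k) : Symb k (gr_repr al) (O_at (phi al)).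
Proof. exact: (svalP (cid (Symb_OC (gr_reprP al)))). Qed.

Lemma filt_Symb0 k D : diffop_filt k D -> Symb k D (fun=> 0).
Proof.
move=> /(filt_SpE r_gt0 nES)[A [B [-> [a0 hA] [a1 hB]]]].
exists A, B, (fun=> 0), (fun=> 0); split => //; [| |by move=> x; rewrite addr0].
  by apply/Sp0E; apply: Sp_low hA; lia.
by apply/Sp0E; apply: Sp_low hB; lia.
Qed.

Lemma Symb_eq k D a a' : Symb k D a -> (forall x, a x = a' x) -> Symb k D a'.
Proof. by move=> H /osym_ext <-. Qed.

Lemma Symb_symbol k D a : Symb k D a -> Symb k (gr_repr (symbol k D)) a.
Proof.
move=> H; have low := filt_Symb0 (gr_repr_symbol (Symb_filt nES H)).
have := Symb_linear 1 low H; rewrite scale1r subrK => H'.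
by apply: Symb_eq H' _ => x; rewrite scaler0 add0r.
Qed.

Lemma symbol_eqS k D D' a : Symb k D a -> Symb k D' a -> symbol k D = symbol k D'.
Proof.
move=> H H'; apply: symbol_eq; [exact: (Symb_filt nES H)|exact: (Symb_filt nES H')|].
have := Symb_linear (-1) H' H; rewrite scaleN1r addrC => L.
by apply/(Symb_low r_gt0 nES L) => x; rewrite scaleN1r addNr.
Qed.

(** The chosen representative of the class of D differs from D by an element of the lower filtration
    step, which has symbol 0 in degree k. Hence [phi] may be computed on any representative. *)
Lemma phi_symbol k D (a : OC k) : Symb k D (O_at a) -> phi (symbol k D) = a.
Proof. by move=> /Symb_symbol H; apply: OC_ext; exact: (Symb_uniq nES (phiP _) H). Qed.

Lemma phi_linear k (z : R[i]) (al be : gr S k) : phi (z *: al + be) = z *: phi al + phi be.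
Proof.
have := symbol_linear z (gr_reprP al) (gr_reprP be); rewrite !symbol_repr => <-.
by apply: phi_symbol; exact: (Symb_linear z (phiP al) (phiP be)).
Qed.

Lemma phi_bijective k : bijective (@phi k).
Proof.
exists (fun a : OC k => symbol k (lop_op (oplop (S := S) (nE := nE) (nS := nS) a))) => [al|a].
  rewrite -[RHS]symbol_repr; apply: symbol_eqS (phiP al).
  exact: Symb_Span (oplopP _).
by apply: phi_symbol; exact: Symb_Span (oplopP _).
Qed.

Lemma phi_mul k l (al : gr S k) (be : gr S l) :
  phi (gmul (gr S) al be : gr S (k + l)%N) = O_mul (phi al) (phi be).
Proof. by apply: phi_symbol; exact: (Symb_mul (phiP al) (phiP be)). Qed.

(** A symbol of degree k has sign (-1)^k under [theta], while its operator forces the sign of its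
    parity. If these differ, twice the symbol is 0. *)
Lemma Span_sign0 k b A a : Span k b A a -> b != odd k -> forall x, a x = 0.
Proof.
move=> hA bk x; have := Span_theta hA x; rewrite (theta_homog (Span_homog hA x)).
rewrite -signr_odd; have -> : odd k = ~~ b by case: (b) (odd k) bk => [] [].
case: b {hA bk}; rewrite scaleN1r scale1r => H.
  apply: (@scale_natr_eq0 _ _ 2) => //; rewrite scaler_nat mulr2n; by rewrite {1}H addNr.
apply: (@scale_natr_eq0 _ _ 2) => //; rewrite scaler_nat mulr2n; by rewrite -{1}H addNr.
Qed.

Definition fam (A B : lop) (b : bool) : lop := if b then B else A.

Lemma Symb_family k D (a : OC k) : Symb k D (O_at a) -> exists A B,
  [/\ D = lop_op (A + B), forall b, SpE 0 k b (fam A B b),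
      Span k (odd k) (fam A B (odd k)) (O_at a) & SpE 1 k (~~ odd k) (fam A B (~~ odd k))].
Proof.
move=> [A [B [a0 [a1 [-> hA hB aE]]]]]; exists A, B.
split => // [[]| |]; [exact: Span_SpE hB|exact: Span_SpE hA| |].
  case ok : (odd k).
    apply: Span_eq hB _ _ => // x; by rewrite aE (Span_sign0 hA) ?ok // add0r.
  apply: Span_eq hA _ _ => // x; by rewrite aE (Span_sign0 hB) ?ok // addr0.
case ok : (odd k) => /=.
  by apply: (Span_lower nES hA); apply: Span_sign0 hA _; rewrite ok.
by apply: (Span_lower nES hB); apply: Span_sign0 hB _; rewrite ok.
Qed.

Lemma parity_splitE k A B : SpE 0 k false A -> SpE 0 k true B ->
  parity_split (lop_op (A + B)) = (lop_op A, lop_op B).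
Proof.
move=> hA hB.
have pc : parity_components (lop_op (A + B)) (lop_op A, lop_op B).
  case: hA hB => a /Sp0E hA [b /Sp0E hB].
  by split => //=; [exact: (Span_parity nES hA)|exact: (Span_parity nES hB)].
rewrite /parity_split; case: xgetP => [P _ [p1 p2 PE]|/(_ _ pc)[]].
have [A' AE [m hA']] := parity_Span nES p1; have [B' BE [m' hB']] := parity_Span nES p2.
case: P p1 p2 PE AE BE => P1 P2 /= _ _ PE AE BE; rewrite -AE -BE in PE *.
have EQ : A + B = A' + B' by apply/val_inj.
by have [-> ->] := parity_components_eq nES EQ hA hB
  (SpE_up (leq_maxl m m') hA') (SpE_up (leq_maxr m m') hB').
Qed.

Lemma Sp_Symb m b A a : Sp 2 m b A a -> Symb (m - 2)%N (lop_op A) a.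
Proof.
rewrite /Sp; case: ifP => _; first exact: Symb_Span.
by move=> [-> a0]; apply: Symb_eq (Symb_Span (Span_0 nS _ false)) _.
Qed.

Lemma Symb_sum4 k (A1 A2 A3 A4 : lop) a1 a2 a3 a4 a : Symb k (lop_op A1) a1 -> Symb k (lop_op A2) a2 ->
  Symb k (lop_op A3) a3 -> Symb k (lop_op A4) a4 -> (forall x, a x = a1 x + a2 x + a3 x + a4 x) ->
  Symb k (lop_op (A1 + A2 + A3 + A4)) a.
Proof.
have add B1 B2 b1 b2 : Symb k (lop_op B1) b1 -> Symb k (lop_op B2) b2 ->
    Symb k (lop_op (B1 + B2)) (fun x => b1 x + b2 x).
  move=> h1 h2; have := Symb_linear 1 h1 h2.
  have -> : 1 *: lop_op B1 + lop_op B2 = lop_op (B1 + B2) by rewrite scale1r.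
  by move=> H; apply: Symb_eq H _ => x; rewrite scale1r.
move=> h1 h2 h3 h4 aE; apply: Symb_eq (add _ _ _ _ (add _ _ _ _ (add _ _ _ _ h1 h2) h3) h4) _.
by move=> x; rewrite aE.
Qed.

Lemma phi_bracket k l (al : gr S k) (be : gr S l) :
  phi (gbracket (gr S) al be : gr S (k + l - 2)%N) = O_bracket g nE (phi al) (phi be).
Proof.
rewrite (O_bracketE nES r_gt0); apply: phi_symbol.
have [A [B [-> sF hF lF]]] := Symb_family (phiP al).
have [A' [B' [-> sG hG lG]]] := Symb_family (phiP be).
rewrite (parity_splitE (sF false) (sF true)) (parity_splitE (sG false) (sG true)).
have -> : gcomm (lop_op A, lop_op B) (lop_op A', lop_op B') =
    lop_op (gcom false false A A' + gcom false true A B' + gcom true false B A' + gcom true true B B').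
  by [].
(* Of the four commutators between components only the one with both parities matching the degrees k
   and l contributes to the symbol. In the others one factor has lower degree. *)
pose s b c : osymbol := if (b == odd k) && (c == odd l) then O_at (br nES (phi al) (phi be)) else fun=> 0.
have H b c : Symb (k + l - 2)%N (lop_op (gcom b c (fam A B b) (fam A' B' c))) (s b c).
  apply: (@Sp_Symb _ (b (+) c)); rewrite /s; have [bk|bk] := eqVneq b (odd k).
    rewrite bk; have [cl|cl] := eqVneq c (odd l); first by rewrite cl; exact: (brP nES hF hG).
    have -> : c = ~~ odd l by case: (c) (odd l) cl => [] [].
    have := Span_comm_low nES lG hF; rewrite gcom_sym addnC addbC.
    case: ifP => _ L; first exact: L.
    by apply: Sp_eq (Sp_opp L) _ _ => [|x]; rewrite ?opprK // oppr0.
  have -> : b = ~~ odd k by case: (b) (odd k) bk => [] [].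
  by case: (sG c) => u /Sp0E hu; exact: (Span_comm_low nES lF hu).
apply: Symb_sum4 (H false false) (H false true) (H true false) (H true true) _ => x.
by rewrite /s; case: (odd k) (odd l) => [] [] /=; rewrite ?addr0 ?add0r.
Qed.

Lemma lmulf1 : lmulf S 1 = 1.
Proof. by apply: lop_ext => s x; rewrite lmulf_at; exact: scale1r. Qed.

Lemma phi_iso : symbol_iso nE nS (phi : forall k, gr S k -> O_poisson g nE k).
Proof.
split.
- split.
  + by split=> k; [exact: phi_linear|exact: phi_bijective].
  + have := phi_symbol (a := (O_fun 1 : OC 0)) (Symb_Span (Span_f nS 1)).
    by rewrite lmulf1.
  + exact: phi_mul.
  + exact: phi_bracket.
- by move=> f; exact: (phi_symbol (a := (O_fun f : OC 0)) (Symb_Span (Span_f nS f))).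
- by move=> xi; exact: (phi_symbol (a := O_E xi) (Symb_Span (Span_g nS xi))).
- by move=> Y; exact: (phi_symbol (a := (O_TM Y : OC 2)) (Symb_Span (Span_n nS Y))).
Qed.

(** Along the expansion of an operator the value of [psi] is forced by the three normalizations,
    linearity and multiplicativity. Terms of lower degree have class 0. *)
Lemma symbol_iso_uniq (psi : forall k, gr S k -> O_poisson g nE k) :
  symbol_iso nE nS psi -> forall k (al : gr S k), psi k al = phi al.
Proof.
move=> [[[psiL _] psi1 psiM _] psif psig psin].
have psi0 k : psi k 0 = 0.
  by have := psiL k (-1) 0 0; rewrite scaler0 addr0 scaleN1r addNr.
have main k b A u : Span k b A u -> forall x, O_at (psi k (symbol k (lop_op A)) : OC k) x = u x.
  elim=> {k b A u} [f|xi|Y|m b|m b z D a hD IH|m b A B a a' hA IH hB IH'|m l b c A B a a' hA IH hB IH'|m l b D a ml hD _] x.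
  + by rewrite [symbol 0 _](_ : _ = symbol 0 (mul_op S f)) // psif.
  + by rewrite [symbol 1 _](_ : _ = symbol 1 (gamma S xi)) // psig.
  + by rewrite [symbol 2 _](_ : _ = symbol 2 (nS Y)) // psin.
  + have -> : symbol m (lop_op (0 : lop)) = 0 :> gr S m.
      have := symbol_linear (-1) (diffop_filt0 S m.+1) (diffop_filt0 S m.+1).
      by rewrite scaler0 addr0 scaleN1r addNr.
    by rewrite psi0.
  + have fD := Symb_filt nES (Symb_Span hD).
    have := symbol_linear z fD (diffop_filt0 S m.+1).
    rewrite addr0 => L; rewrite [symbol m _]L psiL O_at_linear IH.
    have -> : symbol m (0 : operator S) = 0 :> gr S m.
      have := symbol_linear (-1) (diffop_filt0 S m.+1) (diffop_filt0 S m.+1).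
      by rewrite scaler0 addr0 scaleN1r addNr.
    by rewrite psi0 O_at0 addr0.
  + have := symbol_linear 1 (Symb_filt nES (Symb_Span hA)) (Symb_filt nES (Symb_Span hB)).
    rewrite scale1r => L; rewrite [symbol m _]L psiL O_at_linear IH IH'.
    by rewrite scale1r.
  + have -> : symbol (m + l) (lop_op (A * B)) =
        gmul (gr S) (symbol m (lop_op A) : gr S m) (symbol l (lop_op B) : gr S l).
      apply: symbol_eqS (Symb_Span (Span_mul hA hB)) _.
      exact: (Symb_mul (Symb_symbol (Symb_Span hA)) (Symb_symbol (Symb_Span hB))).
    by rewrite psiM; rewrite -IH -IH'.
  + have -> : symbol l (lop_op D) = 0 :> gr S l.
      transitivity (symbol l (0 : operator S)).
        exact: symbol_eqS (Symb_Span (Span_low ml hD)) (Symb_Span (Span_0 nS l b)).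
      have := symbol_linear (-1) (diffop_filt0 S l.+1) (diffop_filt0 S l.+1).
      by rewrite scaler0 addr0 scaleN1r addNr.
    by rewrite psi0.
move=> k al; apply: OC_ext => x.
have [A [B [a0 [a1 [DE hA hB aE]]]]] := phiP al.
rewrite -{1}(symbol_repr al) DE.
have := symbol_linear 1 (Symb_filt nES (Symb_Span hA)) (Symb_filt nES (Symb_Span hB)).
rewrite scale1r => L; rewrite [symbol k _]L.
have -> : O_at (psi k (1 *: symbol k (lop_op A) + symbol k (lop_op B)) : OC k) x = a0 x + a1 x.
  by rewrite psiL O_at_linear (main _ _ _ _ hA) (main _ _ _ _ hB) scale1r.
by rewrite aE.
Qed.

(** The difference of the two covariant derivatives commutes with functions and with all γ(ξ), since
    ∇^E is the same for both. So it is a scalar, of degree 0, and its class in degree 2 is 0. *)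
Lemma symbol_nabla nS' Y : compatible nE nS' -> symbol 2 (nS' Y) = symbol 2 (nS Y) :> gr S 2.
Proof.
move=> nES'; have [||c cP] := @central_scalar _ _ _ _ _ _ S (lnab nS' Y - lnab nS Y).
- move=> f; apply/eqP; rewrite -subr_eq0; apply/eqP.
  transitivity ((lnab nS' Y * lmulf S f - lmulf S f * lnab nS' Y) -
    (lnab nS Y * lmulf S f - lmulf S f * lnab nS Y)); first by ncring.
  by rewrite !lnab_lmulf subrr.
- move=> xi; apply/eqP; rewrite -subr_eq0; apply/eqP.
  transitivity ((lnab nS' Y * lgam S xi - lgam S xi * lnab nS' Y) -
    (lnab nS Y * lgam S xi - lgam S xi * lnab nS Y)); first by ncring.
  by rewrite (lnab_lgam _ _ nES) (lnab_lgam _ _ nES') subrr.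
have EQ : lnab nS' Y = lnab nS Y + lscal (S := S) (scalar_smooth cP).
  transitivity (lnab nS Y + (lnab nS' Y - lnab nS Y)); first by ncgroup.
  by congr (_ + _); apply: lop_ext => s x; rewrite lscal_at cP.
have H : Span 2 false (lnab nS' Y) (fun x => tT (vfield_at Y x)).
  apply: Span_eq (Span_add (Span_n nS Y) (Span_low _ (Span_lscal nS (scalar_smooth cP)))) _ _ => //.
  by move=> x; rewrite addr0.
exact: symbol_eqS (Symb_Span H) (Symb_Span (Span_n nS Y)).
Qed.

End main.

Theorem theorem3p9 (R : realType) (n : nat) (M : manifold R n)
    (r : nat) (r_gt0 : (0 < r)%N) (r_even : ~~ odd r)
    (E : vbundle (real_scalars M) r) (g : metric E) (S : spinor_bundle g)
    (nE : connection E) (nS : connection S) (nES : compatible nE nS) :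
  (exists! phi : forall k, gr S k -> O_poisson g nE k, symbol_iso nE nS phi) /\
  (forall nS' : connection S, compatible nE nS' ->
    forall phi phi' : forall k, gr S k -> O_poisson g nE k,
      symbol_iso nE nS phi -> symbol_iso nE nS' phi' -> phi = phi').
Proof.
have uniq (psi psi' : forall k, gr S k -> O_poisson g nE k) :
    symbol_iso nE nS psi -> symbol_iso nE nS psi' -> psi = psi'.
  move=> h h'; apply: functional_extensionality_dep => k; apply/funext => al.
  by rewrite (symbol_iso_uniq r_gt0 nES h) (symbol_iso_uniq r_gt0 nES h').
split.
  exists (phi r_gt0 nES); split; first exact: phi_iso.
  by move=> psi; apply: uniq; exact: phi_iso.
(* The bracket on the target involves only ∇^E, and ∇^S and the other spinor connection have the
   same symbols. So [psi'] satisfies the normalization for [nS] as well, and uniqueness applies. *)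
move=> nS' nES' psi psi' h [iso' f' g' n']; apply: uniq => //; split => // Y.
by rewrite -(symbol_nabla r_gt0 nES Y nES') n'.
Qed.
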